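(* Fix any $t_0\in\mathbb C_t^*$ and select a branch of $\hat q(t,\hbar)$ near $t_0$. Then the formal power series $\hat q(t_0,\hbar)\in\mathbb C[[\hbar]]$ is stably Borel summable in every regular direction $\alpha$ at $t_0$. Thus, the Borel resummation $q_\alpha(t_0,\hbar):=s_\alpha[\hat q](t_0,\hbar)$ in the direction $\alpha$ defines a holomorphic function on a sectorial neighbourhood $S\subset\mathbb C_\hbar$ of the origin with opening $\mathrm{Arc}_\pi(\alpha)$ which is asymptotic to $\hat q(t_0,\hbar)$ of uniform factorial type: $$q_\alpha(t_0,\hbar)\simeq\hat q(t_0,\hbar)\quad\text{as }\hbar\to0\text{ uniformly along }\mathrm{Arc}_\pi(\alpha).$$ In fact, $q_\alpha(t_0,\hbar)$ is the unique holomorphic function on $S$ with this property. Furthermore, $S$ can be chosen to be the straight sector $\mathrm{Sect}_\pi(\alpha;r)$ of some radius $r>0$ that can be taken arbitrarily large provided that $t_0$ is sufficiently large.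
   Context: Formal solution. $\hat q(t,\hbar)=\sum_{n\ge0}q_n(t)\hbar^n$ is the formal solution of $\hbar^2\partial_t^2q=6q^2+t$ with locally holomorphic coefficients on $\mathbb C_t^*=\mathbb C\smallsetminus\{0\}$; a branch is determined by a root $q_0(t)$ of $6q_0^2+t=0$, after which all $q_n$ are determined recursively ($q_{2n-1}=0$, $q_{2n}=\frac1{12q_0}(\ddot q_{2n-2}-6\sum_{i+j=n,\,i,j\ne0}q_{2i}q_{2j})$). Stokes directions. Let $\theta_0$ be an argument of $t_0$ compatible with the chosen branch, i.e. $q_0(t_0)=|t_0/6|^{1/2}e^{i(\theta_0+\pi)/2}$. The Stokes directions at $t_0$ are $\alpha_+=\frac54(\theta_0+\pi)$ and $\alpha_-=\alpha_++\pi$ in $\mathbb R/2\pi\mathbb Z$; all other directions are regular. Borel summation. The Borel transform is $\hat\omega(t,\xi)=\sum_{n\ge0}\frac1{n!}q_{n+1}(t)\xi^n$. $\hat q(t_0,\hbar)$ is Borel summable in the direction $\alpha$ if $\hat\omega(t_0,\xi)$ converges near $\xi=0$, continues analytically to a function $\omega(t_0,\xi)$ on a neighbourhood of the ray $e^{i\alpha}\mathbb R_+$, and is bounded there by $Ce^{K|\xi|}$; then $s_\alpha[\hat q](t_0,\hbar)=q_0(t_0)+\int_{e^{i\alpha}\mathbb R_+}e^{-\xi/\hbar}\omega(t_0,\xi)\,d\xi$. Stably Borel summable in the direction $\alpha$ means Borel summable in all directions in some open arc containing $\alpha$. Arcs, sectors, asymptotics. $\mathrm{Arc}_\pi(\alpha)=(\alpha-\frac\pi2,\alpha+\frac\pi2)$;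 $\mathrm{Sect}_\pi(\alpha;r)=\{\hbar\in\mathbb C^*:\arg\hbar\in\mathrm{Arc}_\pi(\alpha),|\hbar|<r\}$. A sectorial neighbourhood of the origin with opening $A$ is a simply connected domain $S\subset\mathbb C_\hbar^*$ such that some simply connected open subset of the real-oriented blowup $\mathbb C_\hbar^*\sqcup\mathbb S^1$ of $\mathbb C_\hbar$ at $0$ has intersection $S$ with $\mathbb C_\hbar^*$ and $A$ with the boundary circle. For $\hat f=\sum a_n\hbar^n$, ''$f\simeq\hat f$ as $\hbar\to0$ uniformly along $A$'' (asymptotic of uniform factorial type) means there are $C,M>0$ such that $|f(\hbar)-\sum_{k<n}a_k\hbar^k|\le CM^nn!\,|\hbar|^n$ for all $n\ge0$ and all sufficiently small $\hbar\in S$. The last sentence of the claim means: for every $r>0$ there is a point $t_0$ of the given argument $\theta_0$ (it suffices that $|t_0|$ be sufficiently large) for which $S=\mathrm{Sect}_\pi(\alpha;r)$ is allowed. *)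

(* Defs.v *)
From Stdlib Require Import Reals Factorial.
From Coquelicot Require Export Coquelicot.
Open Scope R_scope.

Definition Cexp (z : C) : C :=
  (exp (Re z) * cos (Im z), exp (Re z) * sin (Im z)).

Definition cis (theta : R) : C := (cos theta, sin theta).

Definition holomorphic_on (U : C -> Prop) (f : C -> C) : Prop :=
  forall z : C, U z -> ex_derive (K := C_AbsRing) (V := C_NormedModule) f z.

(* A formal power series in hbar whose coefficients are functions of t is a map
   [q : nat -> C -> C], where [q n] is the coefficient of hbar^n. *)

Definition fps_mul (p q : nat -> C -> C) (n : nat) (t : C) : C :=
  sum_n (fun i => p i t * q (n - i)%nat t)%C n.

Definition fps_const (c : C -> C) (n : nat) (t : C) : C :=
  match n with O => c t | S _ => RtoC 0 end.

Definition fps_hbar2_dt2 (q : nat -> C -> C) (n : nat) (t : C) : C :=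
  match n with
  | S (S m) => C_derive (C_derive (q m)) t
  | _ => RtoC 0
  end.

(* hbar^2 q'' = 6 q^2 + t, coefficient by coefficient, on a neighbourhood of t0
   in C \ {0}; the coefficient of hbar^0 reads 0 = 6 q_0^2 + t. *)
Definition formal_solution_near (t0 : C) (q : nat -> C -> C) : Prop :=
  exists U : C -> Prop,
    open U /\ U t0 /\ (forall t, U t -> t <> RtoC 0) /\
    (forall n, holomorphic_on U (q n)) /\
    (forall n t, U t ->
       fps_hbar2_dt2 q n t
       = (RtoC 6 * fps_mul q q n t + fps_const (fun s => s) n t)%C).

(* Given t0, the branch determines theta0 modulo 4 pi only. *)
Definition compatible_argument (t0 : C) (q : nat -> C -> C) (theta0 : R) : Prop :=
  t0 = (RtoC (Cmod t0) * cis theta0)%C /\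
  q O t0 = (RtoC (sqrt (Cmod (t0 / RtoC 6))) * cis ((theta0 + PI) / 2))%C.

Definition stokes_plus (theta0 : R) : R := 5 / 4 * (theta0 + PI).
Definition stokes_minus (theta0 : R) : R := stokes_plus theta0 + PI.

(* Directions are real numbers, understood modulo 2 pi. *)
Definition regular_direction (theta0 alpha : R) : Prop :=
  forall k : Z,
    alpha <> stokes_plus theta0 + 2 * PI * IZR k /\
    alpha <> stokes_minus theta0 + 2 * PI * IZR k.

Definition borel_coef (a : nat -> C) (n : nat) : C :=
  (a (S n) / RtoC (INR (fact n)))%C.

(* Since the ray is connected and contains 0, the values of [omega] on it are
   determined by [a]; possible other components of [Omega] play no role. *)
Definition Borel_continuation (a : nat -> C) (alpha : R) (omega : C -> C) : Prop :=
  exists Omega : C -> Prop,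
    open Omega /\
    (forall rho : R, 0 <= rho -> Omega (RtoC rho * cis alpha)%C) /\
    holomorphic_on Omega omega /\
    locally (RtoC 0) (fun xi : C =>
      is_pseries (K := C_AbsRing) (V := C_NormedModule)
        (borel_coef a) xi (omega xi)) /\
    (exists A K : R, forall xi : C,
        Omega xi -> Cmod (omega xi) <= A * exp (K * Cmod xi)).

Definition Borel_summable (a : nat -> C) (alpha : R) : Prop :=
  exists omega : C -> C, Borel_continuation a alpha omega.

Definition stably_Borel_summable (a : nat -> C) (alpha : R) : Prop :=
  exists eps : R, 0 < eps /\
    forall beta : R, Rabs (beta - alpha) < eps -> Borel_summable a beta.

(* [l] is the integral of exp (- xi / h) omega (xi) dxi along the ray
   xi = rho e^(i alpha), 0 <= rho < infinity. *)
Definition is_Laplace (omega : C -> C) (alpha : R) (h l : C) : Prop :=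
  is_RInt_gen (V := C_R_NormedModule)
    (fun rho : R =>
       Cexp (- (RtoC rho * cis alpha / h)) * omega (RtoC rho * cis alpha)
       * cis alpha)%C
    (at_point 0) (Rbar_locally p_infty) l.

(* The Laplace integral converges at [h] and s_alpha[a](h) = v. *)
Definition is_Borel_sum (a : nat -> C) (alpha : R) (h v : C) : Prop :=
  exists (omega : C -> C) (l : C),
    Borel_continuation a alpha omega /\ is_Laplace omega alpha h l /\
    v = (a O + l)%C.

(* Borel summability makes the Laplace integral converge on a disc
   Re (e^(i alpha) / h) > K, which contains no straight sector of opening pi.
   On a general [S] the Borel resummation is the analytic continuation from
   that disc. *)
Definition continues_Borel_sum
    (a : nat -> C) (alpha : R) (S : C -> Prop) (f : C -> C) : Prop :=
  holomorphic_on S f /\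
  exists K : R, forall h : C,
    S h -> K < Re (cis alpha / h)%C -> is_Borel_sum a alpha h (f h).

Definition path_connected {T : UniformSpace} (X : T -> Prop) : Prop :=
  (exists x, X x) /\
  forall x y, X x -> X y ->
    exists gamma : R -> T,
      (forall s, continuous gamma s) /\ gamma 0 = x /\ gamma 1 = y /\
      (forall s, 0 <= s <= 1 -> X (gamma s)).

(* Paths and homotopies are parametrised by [0,1] and [0,1]^2.  Requiring
   continuity on R and R^2 is no restriction: precompose with the retraction. *)
Definition simply_connected {T : UniformSpace} (X : T -> Prop) : Prop :=
  path_connected X /\
  forall gamma : R -> T,
    (forall s, continuous gamma s) -> gamma 0 = gamma 1 ->
    (forall s, 0 <= s <= 1 -> X (gamma s)) ->
    exists H : R * R -> T,
      (forall p, continuous H p) /\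
      (forall s u, 0 <= s <= 1 -> 0 <= u <= 1 -> X (H (s, u))) /\
      (forall s, 0 <= s <= 1 -> H (s, 0) = gamma s /\ H (s, 1) = gamma 0) /\
      (forall u, 0 <= u <= 1 -> H (0, u) = gamma 0 /\ H (1, u) = gamma 0).

(* The real-oriented blowup of C at 0, as the closed subset
   {(z, u) : |u| = 1, z = |z| u} of C x C: the point z <> 0 is (z, z / |z|),
   and u on the boundary circle is (0, u). *)
Definition blowup (p : C * C) : Prop :=
  Cmod (snd p) = 1 /\ fst p = (RtoC (Cmod (fst p)) * snd p)%C.

Definition sectorial_neighbourhood (A S : C -> Prop) : Prop :=
  open S /\ simply_connected (T := C_UniformSpace) S /\
  (forall z, S z -> z <> RtoC 0) /\
  exists X : C * C -> Prop,
    simply_connected (T := prod_UniformSpace C_UniformSpace C_UniformSpace) X /\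
    (exists O : C * C -> Prop,
       open (T := prod_UniformSpace C_UniformSpace C_UniformSpace) O /\
       forall p, X p <-> blowup p /\ O p) /\
    (forall z : C, z <> RtoC 0 -> (X (z, z / RtoC (Cmod z))%C <-> S z)) /\
    (forall u : C, Cmod u = 1 -> (X (RtoC 0, u) <-> A u)).

Definition Arc_pi (alpha : R) (u : C) : Prop :=
  exists theta : R, alpha - PI / 2 < theta < alpha + PI / 2 /\ u = cis theta.

Definition Sect_pi (alpha r : R) (h : C) : Prop :=
  h <> RtoC 0 /\ Arc_pi alpha (h / RtoC (Cmod h))%C /\ Cmod h < r.

Definition partial_sum (a : nat -> C) (h : C) (n : nat) : C :=
  match n with
  | O => RtoC 0
  | S m => sum_n (fun k => a k * h ^ k)%C m
  end.

Definition factorially_asymptotic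
    (S : C -> Prop) (f : C -> C) (a : nat -> C) : Prop :=
  exists A M delta : R, 0 < A /\ 0 < M /\ 0 < delta /\
    forall (n : nat) (h : C), S h -> Cmod h < delta ->
      Cmod (f h - partial_sum a h n)
      <= A * M ^ n * INR (fact n) * Cmod h ^ n.

Definition unique_factorially_asymptotic
    (S : C -> Prop) (f : C -> C) (a : nat -> C) : Prop :=
  holomorphic_on S f /\ factorially_asymptotic S f a /\
  forall g : C -> C,
    holomorphic_on S g -> factorially_asymptotic S g a ->
    forall h, S h -> g h = f h.

Definition resummed_on_straight_sector (a : nat -> C) (alpha r : R) : Prop :=
  sectorial_neighbourhood (Arc_pi alpha) (Sect_pi alpha r) /\
  exists f : C -> C,
    continues_Borel_sum a alpha (Sect_pi alpha r) f /\
    unique_factorially_asymptotic (Sect_pi alpha r) f a.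

(* Main.v *)
Require Import Defs.
From Stdlib Require Import Reals Lra Lia Arith.
From Stdlib Require Import FunctionalExtensionality PropExtensionality ClassicalEpsilon.
From Coquelicot Require Import Coquelicot.
Open Scope R_scope.

(* By homogeneity [q_n = b_n q_0 kappa^n] with constants [b_n] and [kappa^2 = q_0^(-5)], so a single
   power series governs all times and branches. Up to the scale [kappa] its Borel transform [w] solves
     (25 z^2 - 6912) w = 4 z + 25 int_0^z s w(s) ds + 4 int_0^z (z - s) w(s) ds + 3456 w * w,
   whose symbol vanishes only on the two real rays, i.e. in the Stokes directions. On the union of
   the unit disc and a double sector around the imaginary axis, which is star-shaped, it is solved by
   a contraction in the norm [sup |w(z)| exp (- nu |z|)]. Holomorphy passes to limits and to
   integrals by means of a second-order Cauchy estimate in which no derivative occurs.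
   The Laplace integrals in the directions [alpha + eta] and [alpha - eta] agree where both converge,
   by rotation of the contour, and together they cover the straight sector of opening [PI].
   Uniqueness is Watson's lemma: the difference of two solutions is [O(exp (- c / |h|))], and it is
   killed by the maximum principle on circles nearly touching 0, with the multipliers
   [exp (lambda sum_k 1 / (z + delta_k))] at dyadic scales [delta_k].
   Finally [|kappa|] is of order [|t|^(-5/4)], so the radius grows with [|t|]. *)

(** The second-order term of the recursion turns into 25 z^2 w plus integrals in the Borel plane, so
    after division by the symbol every term other than the source is an integral: the equation is of
    Volterra type. A large [nu] makes the linear integrals small, but it cannot help with w * w,
    because exp (nu |s|) exp (nu |z - s|) = exp (nu |z|) for s on the segment from 0 to z. Hence the
    contraction takes place on a ball of small radius [A]. Uniqueness is delicate because [PI] is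
    the critical opening: a bound exp (- c / |h|) on a narrower sector would kill nothing. On a disc
    touching 0 the majorant - c / |z| of log |D| has a logarithmically divergent boundary integral,
    so its mean is - infinity. Each dyadic scale contributes the same amount to the divergence; the
    multipliers count these contributions with the maximum principle alone, without log |D| or
    Poisson integrals. *)

(** * Unit complex numbers and moduli *)

Lemma cis_add (a b : R) : cis (a + b) = (cis a * cis b)%C.
Proof.
  unfold cis, Cmult; simpl. rewrite cos_plus, sin_plus. f_equal; ring.
Qed.

Lemma Cmod_cis (a : R) : Cmod (cis a) = 1.
Proof.
  unfold Cmod, cis; simpl.
  replace (cos a * (cos a * 1) + sin a * (sin a * 1)) with 1.
  - apply sqrt_1.
  - generalize (sin2_cos2 a). unfold Rsqr. lra.
Qed.

Lemma cis_0 : cis 0 = RtoC 1.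
Proof. unfold cis. now rewrite cos_0, sin_0. Qed.

Lemma cis_neq_0 (a : R) : cis a <> RtoC 0.
Proof. apply Cmod_gt_0. rewrite Cmod_cis. lra. Qed.

Lemma cis_opp_l (a : R) : (cis (- a) * cis a)%C = RtoC 1.
Proof. rewrite <- cis_add. rewrite Rplus_opp_l. apply cis_0. Qed.

Lemma cis_opp_r (a : R) : (cis a * cis (- a))%C = RtoC 1.
Proof. rewrite Cmult_comm. apply cis_opp_l. Qed.

Lemma Cmod_scal_cis (r a : R) : 0 <= r -> Cmod (RtoC r * cis a) = r.
Proof.
  intros Hr. rewrite Cmod_mult, Cmod_cis, Cmod_R, Rabs_pos_eq by assumption. ring.
Qed.

Lemma Cmod_sub_sym (x y : C) : Cmod (x - y) = Cmod (y - x).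
Proof. rewrite <- (Cmod_opp (x - y)). f_equal. ring. Qed.

Lemma Cmod_sub_le (x y : C) : Cmod (x - y) <= Cmod x + Cmod y.
Proof. unfold Cminus. rewrite <- (Cmod_opp y). apply Cmod_triangle. Qed.

Lemma Cmod_sub_ge (x y : C) : Cmod x - Cmod y <= Cmod (x - y).
Proof.
  generalize (Cmod_triangle (x - y) y).
  replace (x - y + y)%C with x by ring. lra.
Qed.

Lemma Cmod_plus_ge (x y : C) : Cmod x - Cmod y <= Cmod (x + y).
Proof.
  generalize (Cmod_sub_le (x + y) y).
  replace (x + y - y)%C with x by ring. lra.
Qed.

Lemma Cmod_le_Re_Im (z : C) : Cmod z <= Rabs (Re z) + Rabs (Im z).
Proof.
  generalize (Rabs_pos (Re z)) (Rabs_pos (Im z)); intros H1 H2.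
  apply Rsqr_incr_0_var; [|lra].
  rewrite !Rsqr_pow2, Cmod2_alt.
  rewrite <- (pow2_abs (Re z)), <- (pow2_abs (Im z)). nra.
Qed.

Lemma im_le_Cmod (z : C) : Rabs (Im z) <= Cmod z.
Proof.
  generalize (Rmax_Cmod z). intros H. eapply Rle_trans; [|exact H]. apply Rmax_r.
Qed.

Lemma Re_le_Cmod (z : C) : Re z <= Cmod z.
Proof. generalize (re_le_Cmod z) (Rle_abs (Re z)). lra. Qed.

Lemma Cmod_RtoC_pos (x : R) : 0 <= x -> Cmod (RtoC x) = x.
Proof. intros. rewrite Cmod_R. apply Rabs_pos_eq; auto. Qed.

Lemma RtoC_neq (x : R) : x <> 0 -> RtoC x <> RtoC 0.
Proof. intros H E. apply H. now injection E. Qed.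

Lemma Re_RtoC_mult (x : R) (z : C) : Re (RtoC x * z)%C = x * Re z.
Proof. unfold Re, Cmult, RtoC; simpl. ring. Qed.

(** * Complex differentiability *)

(** Equivalent to [is_derive] by [is_derive_cdiff], but free of filters. The non-strict bound makes
    the increment 0 harmless. *)
Definition cdiff (f : C -> C) (z l : C) : Prop :=
  forall eps : R, 0 < eps -> exists d : R, 0 < d /\
    forall k : C, Cmod k < d -> Cmod (f (z + k) - f z - k * l)%C <= eps * Cmod k.

Definition ccont (f : C -> C) (z : C) : Prop :=
  forall eps : R, 0 < eps -> exists d : R, 0 < d /\
    forall k : C, Cmod k < d -> Cmod (f (z + k) - f z)%C <= eps.

(** Balls of [C_UniformSpace] are squares; [sqrt 2] is the factor that compares them with discs. *)
Lemma sqrt2_bounds : 1 < sqrt 2 < 2.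
Proof.
  split.
  - rewrite <- sqrt_1. apply sqrt_lt_1; lra.
  - replace 2 with (sqrt (2 * 2)) at 2. apply sqrt_lt_1; lra.
    apply sqrt_square; lra.
Qed.

Lemma is_derive_cdiff (f : C -> C) (z l : C) :
  is_derive (K := C_AbsRing) (V := C_NormedModule) f z l <-> cdiff f z l.
Proof.
  split.
  - intros [_ H] eps Heps.
    specialize (H z (fun P HP => HP)).
    destruct (H (mkposreal eps Heps)) as [d Hd].
    exists d. split. { apply cond_pos. }
    intros k Hk.
    specialize (Hd (z + k)%C).
    assert (Hb : ball (M := AbsRing_UniformSpace C_AbsRing) z d (z + k)%C).
    { red; simpl. unfold AbsRing_ball. simpl.
      change (Cmod (z + k - z)%C < d).
      replace (z + k - z)%C with k by ring. exact Hk. }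
    specialize (Hd Hb).
    change (Cmod (f (z + k) - f z - (z + k - z) * l)%C <= eps * Cmod (z + k - z)%C) in Hd.
    replace (z + k - z)%C with k in Hd by ring. exact Hd.
  - intros H. split.
    + apply (is_linear_scal_l (K := C_AbsRing) (V := C_NormedModule)).
    + intros x Hx eps.
      apply (is_filter_lim_locally_unique (V := AbsRing_NormedModule C_AbsRing)) in Hx. subst x.
      destruct (H eps (cond_pos eps)) as [d [Hd Hk]].
      assert (Hy : forall y : C, Cmod (y - z)%C < d ->
        Cmod (f y - f z - (y - z) * l)%C <= eps * Cmod (y - z)%C).
      { intros y Hy. specialize (Hk (y - z)%C Hy).
        replace (z + (y - z))%C with y in Hk by ring. exact Hk. }
      exists (mkposreal d Hd). exact Hy.
Qed.

Lemma ex_derive_cdiff (f : C -> C) (z : C) :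
  ex_derive (K := C_AbsRing) (V := C_NormedModule) f z <-> exists l, cdiff f z l.
Proof.
  split; intros [l H]; exists l; apply is_derive_cdiff; exact H.
Qed.

Lemma cdiff_ccont (f : C -> C) (z l : C) : cdiff f z l -> ccont f z.
Proof.
  intros H eps Heps.
  destruct (H 1 Rlt_0_1) as [d [Hd Hk]].
  assert (Hp : 0 < 1 + Cmod l) by (generalize (Cmod_ge_0 l); lra).
  exists (Rmin d (eps / (1 + Cmod l))). split.
  { apply Rmin_case; auto. apply Rdiv_lt_0_compat; auto. }
  intros k Hk1.
  destruct (Rmin_Rgt_l _ _ _ Hk1) as [Ha Hb].
  replace (f (z + k) - f z)%C with ((f (z + k) - f z - k * l) + k * l)%C by ring.
  eapply Rle_trans. { apply Cmod_triangle. }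
  specialize (Hk k Ha). rewrite Cmod_mult.
  apply (Rmult_lt_compat_r (1 + Cmod l)) in Hb; auto.
  replace (eps / (1 + Cmod l) * (1 + Cmod l)) with eps in Hb by (field; lra).
  lra.
Qed.

Lemma cdiff_ext_loc (f g : C -> C) (z l d : C) (r : R) :
  0 < r -> (forall k, Cmod k < r -> f (z + k)%C = g (z + k)%C) -> cdiff f z l -> cdiff g z l.
Proof.
  intros Hr He H eps Heps. destruct (H eps Heps) as [d' [Hd Hk]].
  assert (E0 : f z = g z).
  { replace z with (z + RtoC 0)%C by ring. apply He. rewrite Cmod_0. auto. }
  exists (Rmin d' r). split. { apply Rmin_case; auto. }
  intros k Hk1.
  rewrite <- E0, <- He.
  - apply Hk. eapply Rlt_le_trans; [exact Hk1| apply Rmin_l].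
  - eapply Rlt_le_trans; [exact Hk1| apply Rmin_r].
Qed.

Lemma cdiff_const (c z : C) : cdiff (fun _ => c) z (RtoC 0).
Proof.
  intros eps Heps. exists 1. split. lra. intros k _.
  replace (c - c - k * RtoC 0)%C with (RtoC 0) by ring. rewrite Cmod_0.
  generalize (Cmod_ge_0 k). nra.
Qed.

Lemma cdiff_id (z : C) : cdiff (fun x => x) z (RtoC 1).
Proof.
  intros eps Heps. exists 1. split. lra. intros k _.
  replace (z + k - z - k * RtoC 1)%C with (RtoC 0) by ring. rewrite Cmod_0.
  generalize (Cmod_ge_0 k). nra.
Qed.

Lemma cdiff_plus (f g : C -> C) (z l m : C) :
  cdiff f z l -> cdiff g z m -> cdiff (fun x => f x + g x)%C z (l + m)%C.
Proof.
  intros Hf Hg eps Heps.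
  destruct (Hf (eps / 2)) as [d1 [Hd1 H1]]. lra.
  destruct (Hg (eps / 2)) as [d2 [Hd2 H2]]. lra.
  exists (Rmin d1 d2). split. { apply Rmin_case; auto. }
  intros k Hk.
  replace (f (z + k) + g (z + k) - (f z + g z) - k * (l + m))%C
    with ((f (z + k) - f z - k * l) + (g (z + k) - g z - k * m))%C by ring.
  eapply Rle_trans. { apply Cmod_triangle. }
  specialize (H1 k). specialize (H2 k).
  assert (Cmod k < d1) by (eapply Rlt_le_trans; [exact Hk| apply Rmin_l]).
  assert (Cmod k < d2) by (eapply Rlt_le_trans; [exact Hk| apply Rmin_r]).
  specialize (H1 H). specialize (H2 H0). lra.
Qed.

(* Caratheodory's form of the derivative: it turns the product and chain rules into continuity. *)
Lemma cdiff_caratheodory (f : C -> C) (z l : C) :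
  cdiff f z l <->
  exists p : C -> C, (forall k, f (z + k)%C = (f z + k * p k)%C) /\ p (RtoC 0) = l /\ ccont p (RtoC 0).
Proof.
  split.
  - intros H.
    exists (fun k => if Ceq_dec k (RtoC 0) then l else ((f (z + k) - f z) / k)%C).
    split; [|split].
    + intros k. destruct (Ceq_dec k (RtoC 0)) as [->|Hk].
      * replace (z + RtoC 0)%C with z by ring. ring.
      * field. exact Hk.
    + destruct (Ceq_dec (RtoC 0) (RtoC 0)); congruence.
    + intros eps Heps. destruct (H eps Heps) as [d [Hd Hk]].
      exists d. split; auto. intros k Hkd.
      replace (RtoC 0 + k)%C with k by ring.
      destruct (Ceq_dec (RtoC 0) (RtoC 0)) as [_|]; [|congruence].
      destruct (Ceq_dec k (RtoC 0)) as [->|Hk0].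
      * replace (l - l)%C with (RtoC 0) by ring. rewrite Cmod_0. lra.
      * replace ((f (z + k) - f z) / k - l)%C with ((f (z + k) - f z - k * l) / k)%C
          by (field; exact Hk0).
        rewrite Cmod_div by exact Hk0.
        apply Cmod_gt_0 in Hk0. apply Rle_div_l; auto.
  - intros [p [Hp [Hl Hc]]] eps Heps.
    destruct (Hc eps Heps) as [d [Hd Hk]]. exists d. split; auto.
    intros k Hkd. rewrite Hp. specialize (Hk k Hkd).
    replace (RtoC 0 + k)%C with k in Hk by ring. rewrite Hl in Hk.
    replace (f z + k * p k - f z - k * l)%C with (k * (p k - l))%C by ring.
    rewrite Cmod_mult. generalize (Cmod_ge_0 k). nra.
Qed.

Lemma ccont_plus (f g : C -> C) (z : C) :
  ccont f z -> ccont g z -> ccont (fun x => f x + g x)%C z.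
Proof.
  intros Hf Hg eps Heps.
  destruct (Hf (eps / 2)) as [d1 [Hd1 H1]]. lra.
  destruct (Hg (eps / 2)) as [d2 [Hd2 H2]]. lra.
  exists (Rmin d1 d2). split. { apply Rmin_case; auto. }
  intros k Hk.
  replace (f (z + k) + g (z + k) - (f z + g z))%C
    with ((f (z + k) - f z) + (g (z + k) - g z))%C by ring.
  eapply Rle_trans. { apply Cmod_triangle. }
  assert (Cmod k < d1) by (eapply Rlt_le_trans; [exact Hk| apply Rmin_l]).
  assert (Cmod k < d2) by (eapply Rlt_le_trans; [exact Hk| apply Rmin_r]).
  specialize (H1 k H). specialize (H2 k H0). lra.
Qed.

Lemma ccont_mult (f g : C -> C) (z : C) :
  ccont f z -> ccont g z -> ccont (fun x => f x * g x)%C z.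
Proof.
  intros Hf Hg eps Heps.
  set (A := 1 + Cmod (f z)). set (B := 1 + Cmod (g z)).
  assert (HA : 1 <= A) by (unfold A; generalize (Cmod_ge_0 (f z)); lra).
  assert (HB : 1 <= B) by (unfold B; generalize (Cmod_ge_0 (g z)); lra).
  set (e := Rmin 1 (eps / (A + B))).
  assert (He : 0 < e).
  { unfold e. apply Rmin_case. lra. apply Rdiv_lt_0_compat; lra. }
  assert (He1 : e <= 1) by apply Rmin_l.
  assert (He2 : e * (A + B) <= eps).
  { apply Rle_div_r. lra. apply Rmin_r. }
  destruct (Hf e He) as [d1 [Hd1 H1]].
  destruct (Hg e He) as [d2 [Hd2 H2]].
  exists (Rmin d1 d2). split. { apply Rmin_case; auto. }
  intros k Hk.
  destruct (Rmin_Rgt_l _ _ _ Hk) as [K1 K2].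
  specialize (H1 k K1). specialize (H2 k K2).
  replace (f (z + k) * g (z + k) - f z * g z)%C
    with ((f (z + k) - f z) * (g (z + k) - g z) + (f z * (g (z + k) - g z)
      + g z * (f (z + k) - f z)))%C by ring.
  eapply Rle_trans. { apply Cmod_triangle. }
  eapply Rle_trans. { apply Rplus_le_compat_l. apply Cmod_triangle. }
  rewrite !Cmod_mult.
  generalize (Cmod_ge_0 (f z)) (Cmod_ge_0 (g z)) (Cmod_ge_0 (f (z + k) - f z)%C)
    (Cmod_ge_0 (g (z + k) - g z)%C). intros.
  unfold A, B in *. nra.
Qed.

Lemma ccont_const (c z : C) : ccont (fun _ => c) z.
Proof. eapply cdiff_ccont. apply cdiff_const. Qed.

Lemma ccont_id (z : C) : ccont (fun x => x) z.
Proof. eapply cdiff_ccont. apply cdiff_id. Qed.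

Lemma ccont_comp (f g : C -> C) (z : C) :
  ccont g z -> ccont f (g z) -> ccont (fun x => f (g x)) z.
Proof.
  intros Hg Hf eps Heps. destruct (Hf eps Heps) as [d [Hd Hk]].
  destruct (Hg (d / 2)) as [d' [Hd' Hk']]. lra.
  exists d'. split; auto. intros k H.
  replace (g (z + k)%C) with (g z + (g (z + k) - g z))%C by ring.
  apply Hk. specialize (Hk' k H). lra.
Qed.

Lemma cdiff_mult (f g : C -> C) (z l m : C) :
  cdiff f z l -> cdiff g z m -> cdiff (fun x => f x * g x)%C z (l * g z + f z * m)%C.
Proof.
  intros Hf Hg. apply cdiff_caratheodory in Hf. apply cdiff_caratheodory in Hg.
  destruct Hf as [p [Hp [Hp0 Hpc]]]. destruct Hg as [r [Hr [Hr0 Hrc]]].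
  apply cdiff_caratheodory.
  exists (fun k => p k * g z + (f z * r k + k * (p k * r k)))%C.
  split; [|split].
  - intros k. rewrite Hp, Hr. ring.
  - rewrite Hp0, Hr0. ring.
  - repeat first [apply ccont_plus | apply ccont_mult | apply ccont_const | apply ccont_id | assumption].
Qed.

Lemma cdiff_comp (f g : C -> C) (z l m : C) :
  cdiff f (g z) l -> cdiff g z m -> cdiff (fun x => f (g x)) z (l * m)%C.
Proof.
  intros Hf Hg. apply cdiff_caratheodory in Hf. apply cdiff_caratheodory in Hg.
  destruct Hf as [p [Hp [Hp0 Hpc]]]. destruct Hg as [r [Hr [Hr0 Hrc]]].
  apply cdiff_caratheodory.
  exists (fun k => p (k * r k) * r k)%C.
  split; [|split].
  - intros k. rewrite Hr, Hp. ring.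
  - replace (RtoC 0 * r (RtoC 0))%C with (RtoC 0) by ring. rewrite Hp0, Hr0. ring.
  - apply ccont_mult; auto.
    apply (ccont_comp p (fun k => k * r k)%C).
    + apply ccont_mult; auto. apply ccont_id.
    + replace (RtoC 0 * r (RtoC 0))%C with (RtoC 0) by ring. auto.
Qed.

Lemma ccont_inv (f : C -> C) (z : C) : ccont f z -> f z <> RtoC 0 -> ccont (fun x => / f x)%C z.
Proof.
  intros Hf Hn eps Heps.
  assert (Hm : 0 < Cmod (f z)) by (apply Cmod_gt_0; auto).
  set (m := Cmod (f z)) in *.
  destruct (Hf (Rmin (m / 2) (eps * (m * m / 2)))) as [d [Hd Hk]].
  { apply Rmin_case. lra. apply Rmult_lt_0_compat; nra. }
  exists d. split; auto. intros k H. specialize (Hk k H).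
  assert (H1 : Cmod (f (z + k) - f z)%C <= m / 2) by (eapply Rle_trans; [exact Hk| apply Rmin_l]).
  assert (H2 : Cmod (f (z + k) - f z)%C <= eps * (m * m / 2)) by (eapply Rle_trans; [exact Hk| apply Rmin_r]).
  assert (H3 : m / 2 <= Cmod (f (z + k)%C)).
  { generalize (Cmod_sub_ge (f z) (f z - f (z + k)%C)%C).
    replace (f z - (f z - f (z + k)))%C with (f (z + k)%C) by ring.
    rewrite (Cmod_sub_sym (f z)). fold m. lra. }
  assert (H4 : f (z + k)%C <> RtoC 0) by (apply Cmod_gt_0; lra).
  replace (/ f (z + k) - / f z)%C with (- (f (z + k) - f z) / (f (z + k) * f z))%C
    by (field; auto).
  rewrite Cmod_div by (apply Cmult_neq_0; auto).
  rewrite Cmod_opp, Cmod_mult. fold m.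
  apply Rle_div_l. nra.
  eapply Rle_trans; [exact H2|]. apply Rmult_le_compat_l. lra. nra.
Qed.

Lemma cdiff_inv (f : C -> C) (z l : C) :
  cdiff f z l -> f z <> RtoC 0 -> cdiff (fun x => / f x)%C z (- l / (f z * f z))%C.
Proof.
  intros H Hn.
  assert (Hc := cdiff_ccont _ _ _ H).
  apply cdiff_caratheodory in H. destruct H as [p [Hp [Hp0 Hpc]]].
  destruct (Hc (Cmod (f z) / 2)) as [d [Hd Hk]].
  { apply Cmod_gt_0 in Hn. lra. }
  assert (Hnz : forall k, Cmod k < d -> f (z + k)%C <> RtoC 0).
  { intros k Hkd E. specialize (Hk k Hkd). rewrite E in Hk.
    replace (RtoC 0 - f z)%C with (- f z)%C in Hk by ring.
    rewrite Cmod_opp in Hk. apply Cmod_gt_0 in Hn. lra. }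
  (* [cdiff_caratheodory] asks for a slope valid for all increments, but [f (z + k)] may vanish for
     large [k]. The slope [s] of the inverse is therefore used on the disc of radius [d] only. *)
  set (s := fun k : C => (- p k * / ((f z + k * p k) * f z))%C).
  assert (Hs : ccont s (RtoC 0)).
  { unfold s. apply ccont_mult.
    - apply (ccont_mult (fun _ => (- (1))%C) p (RtoC 0)) in Hpc; [|apply ccont_const].
      intros e He. destruct (Hpc e He) as [d1 [Hd1 H1]]. exists d1. split; auto.
      intros k Hk1. specialize (H1 k Hk1).
      replace (- p (RtoC 0 + k) - - p (RtoC 0))%C
        with (- (1) * p (RtoC 0 + k) - - (1) * p (RtoC 0))%C by ring. exact H1.
    - apply (ccont_inv (fun k => (f z + k * p k) * f z)%C).
      + repeat first [apply ccont_mult | apply ccont_plus | apply ccont_const | apply ccont_id | assumption].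
      + rewrite Cmult_0_l, Cplus_0_r. apply Cmult_neq_0; auto. }
  intros eps Heps. destruct (Hs eps Heps) as [d2 [Hd2 H2]].
  exists (Rmin d d2). split. { apply Rmin_case; auto. }
  intros k Hk0.
  destruct (Rmin_Rgt_l _ _ _ Hk0) as [K1 K2].
  specialize (H2 k K2). specialize (Hnz k K1). rewrite Cplus_0_l in H2.
  replace (/ f (z + k) - / f z - k * (- l / (f z * f z)))%C with (k * (s k - s (RtoC 0)))%C.
  - rewrite Cmod_mult. generalize (Cmod_ge_0 k). nra.
  - unfold s. rewrite Hp in Hnz |- *. rewrite Hp0. field. repeat split; auto.
Qed.

Lemma cdiff_unique (f : C -> C) (z l m : C) : cdiff f z l -> cdiff f z m -> l = m.
Proof.
  intros H1 H2. apply is_derive_cdiff in H1. apply is_derive_cdiff in H2.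
  rewrite <- (is_C_derive_unique _ _ _ H1). apply is_C_derive_unique. exact H2.
Qed.

Lemma cdiff_opp (f : C -> C) (z l : C) : cdiff f z l -> cdiff (fun x => - f x)%C z (- l)%C.
Proof.
  intros H eps Heps. destruct (H eps Heps) as [d [Hd Hk]]. exists d. split; auto.
  intros k Hkd. rewrite <- Cmod_opp.
  replace (- (- f (z + k) - - f z - k * - l))%C with (f (z + k) - f z - k * l)%C by ring. auto.
Qed.

Lemma cdiff_minus (f g : C -> C) (z l m : C) :
  cdiff f z l -> cdiff g z m -> cdiff (fun x => f x - g x)%C z (l - m)%C.
Proof. intros Hf Hg. apply cdiff_plus; auto. now apply cdiff_opp. Qed.

Lemma cdiff_eq (f : C -> C) (z l m : C) : cdiff f z l -> l = m -> cdiff f z m.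
Proof. now intros H <-. Qed.

Lemma cdiff_pow (f : C -> C) (z l : C) (n : nat) :
  cdiff f z l -> cdiff (fun x => f x ^ n)%C z (RtoC (INR n) * f z ^ (n - 1) * l)%C.
Proof.
  intros H. induction n as [|n IH].
  - eapply cdiff_eq. { apply (cdiff_const (RtoC 1)). } simpl. ring.
  - eapply cdiff_eq. { apply (cdiff_mult f (fun x => f x ^ n)%C); eassumption. }
    rewrite S_INR, RtoC_plus. destruct n as [|n].
    + simpl. ring.
    + simpl. rewrite Nat.sub_0_r. ring.
Qed.

(** * The complex exponential *)

Lemma Cexp_add (z w : C) : Cexp (z + w)%C = (Cexp z * Cexp w)%C.
Proof.
  destruct z as [a b], w as [c d]. unfold Cexp, Cplus, Cmult; simpl.
  rewrite exp_plus, cos_plus, sin_plus. f_equal; ring.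
Qed.

Lemma Cmod_Cexp (z : C) : Cmod (Cexp z) = exp (Re z).
Proof.
  replace (Cexp z) with (RtoC (exp (Re z)) * cis (Im z))%C.
  - apply Cmod_scal_cis. left. apply exp_pos.
  - unfold Cexp, cis, RtoC, Cmult; simpl. f_equal; ring.
Qed.

Lemma Cexp_0 : Cexp (RtoC 0) = RtoC 1.
Proof. unfold Cexp, RtoC; simpl. rewrite exp_0, cos_0, sin_0. f_equal; ring. Qed.

(** Both sides come from 1 + x <= exp x, used at [x] and at [- x]; the second use gives exp x <= 1 /
    (1 - x). *)
Lemma exp_remainder_bound (x : R) : Rabs x <= / 2 -> Rabs (exp x - 1 - x) <= 2 * x ^ 2.
Proof.
  intros H. apply Rabs_le_between in H.
  assert (H1 := exp_ineq1_le x). assert (H2 := exp_ineq1_le (- x)).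
  rewrite Rabs_pos_eq by lra.
  assert (H3 : exp x * exp (- x) = 1) by (rewrite <- exp_plus, Rplus_opp_r; apply exp_0).
  assert (H4 := exp_pos x). nra.
Qed.

Lemma sin_bound_abs (y : R) : Rabs (sin y) <= Rabs y.
Proof.
  generalize (bounded_variation sin cos 1 0 y). intros H.
  rewrite sin_0, !Rminus_0_r, Rmult_1_l in H. apply H.
  intros t _. split. { apply is_derive_sin. }
  apply Rabs_le. generalize (COS_bound t). lra.
Qed.

Lemma cos_bound_sqr (y : R) : Rabs (cos y - 1) <= y ^ 2.
Proof.
  replace (cos y) with (1 - 2 * sin (y / 2) ^ 2).
  - generalize (sin_bound_abs (y / 2)). intros H.
    apply (Rsqr_le_abs_1 (sin (y/2)) (y/2)) in H. unfold Rsqr in H.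
    rewrite Rabs_left1; simpl; nra.
  - replace y with (2 * (y / 2)) at 2 by field. rewrite cos_2a_sin. simpl. ring.
Qed.

Lemma sin_remainder_bound (y : R) : Rabs y <= 1 -> Rabs (sin y - y) <= y ^ 2.
Proof.
  intros Hy.
  generalize (bounded_variation (fun t => sin t - t) (fun t => cos t - 1) (y ^ 2) 0 y).
  intros H. rewrite sin_0, !Rminus_0_r in H.
  eapply Rle_trans. { apply H.
    intros t Ht. rewrite Rminus_0_r in Ht. split.
    - auto_derive; auto. ring.
    - eapply Rle_trans. { apply cos_bound_sqr. }
      apply Rsqr_le_abs_1 in Ht. unfold Rsqr in Ht. simpl. lra. }
  assert (0 <= y ^ 2) by (simpl; nra). nra.
Qed.

Lemma Cexp_remainder_bound (k : C) :
  Cmod k <= / 2 -> Cmod (Cexp k - RtoC 1 - k)%C <= 10 * Cmod k ^ 2.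
Proof.
  intros Hk. destruct k as [x y].
  assert (Hx : Rabs x <= / 2) by (generalize (re_le_Cmod (x, y)); simpl; lra).
  assert (Hy : Rabs y <= / 2) by (generalize (im_le_Cmod (x, y)); simpl; lra).
  rewrite Cmod2_alt. simpl Re; simpl Im.
  eapply Rle_trans. { apply Cmod_le_Re_Im. }
  unfold Cexp, Cminus, Cplus, Copp, RtoC; simpl.
  assert (E1 := exp_remainder_bound x Hx).
  assert (E2 := cos_bound_sqr y). assert (E3 := sin_bound_abs y).
  assert (E4 := sin_remainder_bound y ltac:(lra)).
  assert (E5 : Rabs (exp x - 1) <= 2 * Rabs x).
  { replace (exp x - 1) with ((exp x - 1 - x) + x) by ring.
    eapply Rle_trans. { apply Rabs_triang. }
    assert (x ^ 2 = Rabs x * Rabs x) by (rewrite <- Rabs_mult, Rabs_pos_eq; simpl; nra).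
    generalize (Rabs_pos x). nra. }
  assert (E6 : exp x <= 2).
  { generalize (Rle_abs (exp x - 1)). lra. }
  assert (E7 := exp_pos x).
  assert (F1 : Rabs (exp x * cos y + -(1) + - x) <= 2 * x ^ 2 + 2 * y ^ 2).
  { replace (exp x * cos y + -(1) + - x) with ((exp x - 1 - x) + exp x * (cos y - 1)) by ring.
    eapply Rle_trans. { apply Rabs_triang. }
    rewrite Rabs_mult, (Rabs_pos_eq (exp x)) by lra.
    generalize (Rabs_pos (cos y - 1)). nra. }
  assert (F2 : Rabs (exp x * sin y + - 0 + - y) <= 2 * Rabs x * Rabs y + y ^ 2).
  { replace (exp x * sin y + - 0 + - y) with ((exp x - 1) * sin y + (sin y - y)) by ring.
    eapply Rle_trans. { apply Rabs_triang. }
    rewrite Rabs_mult. generalize (Rabs_pos (sin y)) (Rabs_pos (exp x - 1)) (Rabs_pos x). nra. }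
  assert (x ^ 2 = Rabs x * Rabs x) by (rewrite <- Rabs_mult, Rabs_pos_eq; simpl; nra).
  assert (y ^ 2 = Rabs y * Rabs y) by (rewrite <- Rabs_mult, Rabs_pos_eq; simpl; nra).
  simpl in *. generalize (Rabs_pos x) (Rabs_pos y). nra.
Qed.

Lemma cdiff_Cexp (z : C) : cdiff Cexp z (Cexp z).
Proof.
  intros eps Heps.
  assert (Hp : 0 < Cmod (Cexp z)) by (rewrite Cmod_Cexp; apply exp_pos).
  exists (Rmin (/ 2) (eps / (10 * Cmod (Cexp z)))). split.
  { apply Rmin_case. lra. apply Rdiv_lt_0_compat; lra. }
  intros k Hk.
  destruct (Rmin_Rgt_l _ _ _ Hk) as [K1 K2].
  rewrite Cexp_add.
  replace (Cexp z * Cexp k - Cexp z - k * Cexp z)%C with (Cexp z * (Cexp k - RtoC 1 - k))%C by ring.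
  rewrite Cmod_mult.
  assert (H := Cexp_remainder_bound k ltac:(lra)).
  apply (Rmult_lt_compat_r (10 * Cmod (Cexp z))) in K2; [|lra].
  replace (eps / (10 * Cmod (Cexp z)) * (10 * Cmod (Cexp z))) with eps in K2 by (field; lra).
  generalize (Cmod_ge_0 k). simpl in H. nra.
Qed.

(** * Integrals of complex-valued functions of a real variable *)

Definition rcont (g : R -> C) (x : R) : Prop :=
  forall eps : R, 0 < eps -> exists d : R, 0 < d /\
    forall y : R, Rabs (y - x) < d -> Cmod (g y - g x)%C <= eps.

Definition rdiff (g : R -> C) (x : R) (l : C) : Prop :=
  forall eps : R, 0 < eps -> exists d : R, 0 < d /\
    forall y : R, Rabs (y - x) < d -> Cmod (g y - g x - RtoC (y - x) * l)%C <= eps * Rabs (y - x).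

Definition is_CInt (f : R -> C) (a b : R) (l : C) : Prop :=
  is_RInt (V := C_R_NormedModule) f a b l.

Definition CInt (f : R -> C) (a b : R) : C := RInt (V := C_R_CompleteNormedModule) f a b.

Lemma norm_C_R (z : C) : norm (V := C_R_NormedModule) z = Cmod z.
Proof.
  change (sqrt (Rabs (fst z) ^ 2 + Rabs (snd z) ^ 2) = Cmod z).
  unfold Cmod. now rewrite !pow2_abs.
Qed.

Lemma rcont_continuous (g : R -> C) (x : R) :
  rcont g x -> continuous (U := C_UniformSpace) g x.
Proof.
  intros H P [eps HP]. destruct (H (eps / 2)) as [d [Hd Hk]].
  { generalize (cond_pos eps); lra. }
  exists (mkposreal d Hd). intros y Hy. apply HP.
  apply C_NormedModule_mixin_compat1.
  assert (Hy' : Rabs (y - x) < d) by exact Hy.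
  specialize (Hk y Hy').
  change (Cmod (g y - g x)%C < eps). generalize (cond_pos eps). lra.
Qed.

(** Composition with [Re] reduces continuity on the line to continuity on the plane, so that the
    rules for [ccont] carry over. *)
Lemma rcont_ccont (g : R -> C) (x : R) : rcont g x <-> ccont (fun z => g (Re z)) (RtoC x).
Proof.
  split; intros H eps Heps; destruct (H eps Heps) as [d [Hd Hk]]; exists d; split; auto.
  - intros k Hkd. apply Hk. change (Rabs (x + Re k - x) < d).
    replace (x + Re k - x) with (Re k) by ring. eapply Rle_lt_trans; [apply re_le_Cmod|exact Hkd].
  - intros y Hy. specialize (Hk (RtoC (y - x))). rewrite Cmod_R in Hk. specialize (Hk Hy).
    change (Cmod (g (x + (y - x))%R - g x)%C <= eps) in Hk. replace (x + (y - x)) with y in Hk by ring. exact Hk.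
Qed.

Lemma rcont_plus (f g : R -> C) (x : R) :
  rcont f x -> rcont g x -> rcont (fun x => f x + g x)%C x.
Proof. rewrite !rcont_ccont. apply ccont_plus. Qed.

Lemma rcont_mult (f g : R -> C) (x : R) :
  rcont f x -> rcont g x -> rcont (fun x => f x * g x)%C x.
Proof. rewrite !rcont_ccont. apply ccont_mult. Qed.

Lemma rcont_comp (f : C -> C) (g : R -> C) (x : R) :
  rcont g x -> ccont f (g x) -> rcont (fun x => f (g x)) x.
Proof. rewrite !rcont_ccont. apply (ccont_comp f (fun z => g (Re z))). Qed.

Lemma rcont_const (c : C) (x : R) : rcont (fun _ => c) x.
Proof. apply rcont_ccont, ccont_const. Qed.

Lemma rcont_ext_eq (f g : R -> C) (x : R) : (forall y, f y = g y) -> rcont f x -> rcont g x.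
Proof.
  intros E H. replace g with f; auto. now apply functional_extensionality.
Qed.

Lemma rdiff_rcont (g : R -> C) (x : R) (l : C) : rdiff g x l -> rcont g x.
Proof.
  intros H eps Heps.
  destruct (H 1 Rlt_0_1) as [d [Hd Hk]].
  assert (Hp : 0 < 1 + Cmod l) by (generalize (Cmod_ge_0 l); lra).
  exists (Rmin d (eps / (1 + Cmod l))). split.
  { apply Rmin_case; auto. apply Rdiv_lt_0_compat; auto. }
  intros y Hy.
  destruct (Rmin_Rgt_l _ _ _ Hy) as [Ha Hb].
  replace (g y - g x)%C with ((g y - g x - RtoC (y - x) * l) + RtoC (y - x) * l)%C by ring.
  eapply Rle_trans. { apply Cmod_triangle. }
  specialize (Hk y Ha). rewrite Cmod_mult, Cmod_R.
  apply (Rmult_lt_compat_r (1 + Cmod l)) in Hb; auto.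
  replace (eps / (1 + Cmod l) * (1 + Cmod l)) with eps in Hb by (field; lra).
  lra.
Qed.

Lemma rdiff_comp (f : C -> C) (g : R -> C) (x : R) (l m : C) :
  cdiff f (g x) l -> rdiff g x m -> rdiff (fun x => f (g x)) x (m * l)%C.
Proof.
  intros Hf Hg.
  assert (Hc := rdiff_rcont _ _ _ Hg).
  apply cdiff_caratheodory in Hf. destruct Hf as [p [Hp [Hp0 Hpc]]].
  assert (Hq : rcont (fun y => p (g y - g x)%C) x).
  { apply (rcont_comp p (fun y => g y - g x)%C).
    - apply (rcont_plus g (fun _ => - g x)%C); auto. apply rcont_const.
    - replace (g x - g x)%C with (RtoC 0) by ring. auto. }
  intros eps Heps.
  set (B := 1 + Cmod l). assert (HB : 1 <= B) by (unfold B; generalize (Cmod_ge_0 l); lra).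
  set (A := 1 + Cmod m). assert (HA : 1 <= A) by (unfold A; generalize (Cmod_ge_0 m); lra).
  set (e := Rmin 1 (eps / (A + B))).
  assert (He : 0 < e).
  { unfold e. apply Rmin_case. lra. apply Rdiv_lt_0_compat; lra. }
  assert (He1 : e <= 1) by apply Rmin_l.
  assert (He2 : e * (A + B) <= eps).
  { apply Rle_div_r. lra. apply Rmin_r. }
  destruct (Hq e He) as [d1 [Hd1 H1]].
  destruct (Hg e He) as [d2 [Hd2 H2]].
  exists (Rmin d1 d2). split. { apply Rmin_case; auto. }
  intros y Hy.
  destruct (Rmin_Rgt_l _ _ _ Hy) as [K1 K2].
  specialize (H1 y K1). specialize (H2 y K2). simpl in H1.
  replace (g x - g x)%C with (RtoC 0) in H1 by ring. rewrite Hp0 in H1.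
  replace (f (g y)) with (f (g x + (g y - g x)))%C by (f_equal; ring).
  rewrite Hp.
  set (t := RtoC (y - x)) in *. set (P := p (g y - g x)%C) in *.
  replace (f (g x) + (g y - g x) * P - f (g x) - t * (m * l))%C
    with ((g y - g x - t * m) * (P - l) + ((g y - g x - t * m) * l + t * m * (P - l)))%C by ring.
  eapply Rle_trans. { apply Cmod_triangle. }
  eapply Rle_trans. { apply Rplus_le_compat_l. apply Cmod_triangle. }
  rewrite !Cmod_mult. unfold t at 3. rewrite Cmod_R.
  generalize (Cmod_ge_0 (g y - g x - t * m)%C) (Cmod_ge_0 (P - l)%C) (Cmod_ge_0 l) (Cmod_ge_0 m)
    (Rabs_pos (y - x)).
  set (X := Cmod (g y - g x - t * m)%C) in *. set (Y := Cmod (P - l)%C) in *.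
  intros. unfold A, B in *.
  assert (X * Y <= (e * Rabs (y - x)) * 1) by (apply Rmult_le_compat; lra).
  assert (X * Cmod l <= (e * Rabs (y - x)) * Cmod l) by (apply Rmult_le_compat_r; lra).
  assert (Rabs (y - x) * Cmod m * Y <= Rabs (y - x) * Cmod m * e) by (apply Rmult_le_compat_l; nra).
  nra.
Qed.

Lemma rdiff_is_derive (g : R -> C) (x : R) (l : C) :
  rdiff g x l -> is_derive (V := C_R_NormedModule) g x l.
Proof.
  intros H. split.
  - apply (is_linear_scal_l (K := R_AbsRing) (V := C_R_NormedModule)).
  - intros x' Hx eps.
    apply (is_filter_lim_locally_unique (V := R_NormedModule)) in Hx. subst x'.
    destruct (H eps (cond_pos eps)) as [d [Hd Hk]].
    exists (mkposreal d Hd). intros y Hy.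
    rewrite norm_C_R.
    refine (Rle_trans _ _ _ (Req_le _ _ _) (Hk y Hy)).
    apply f_equal.
    unfold minus, plus, opp, scal; simpl. unfold prod_plus, prod_opp, prod_scal; simpl.
    unfold plus, opp, scal; simpl. unfold mult; simpl.
    unfold Cminus, Cplus, Copp, Cmult, RtoC; simpl. f_equal; ring.
Qed.

Lemma rdiff_line (c : C) (x : R) : rdiff (fun x => RtoC x * c)%C x c.
Proof.
  intros eps Heps. exists 1. split. lra. intros y _.
  replace (RtoC y * c - RtoC x * c - RtoC (y - x) * c)%C with (RtoC 0).
  - rewrite Cmod_0. generalize (Rabs_pos (y - x)). nra.
  - rewrite RtoC_minus. ring.
Qed.

Lemma cis_Cexp (y : R) : cis y = Cexp (RtoC y * Ci)%C.
Proof.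
  unfold cis, Cexp, Cmult, Ci, RtoC; simpl.
  replace (y * 0 - 0 * 1) with 0 by ring. replace (y * 1 + 0 * 0) with y by ring.
  rewrite exp_0. f_equal; ring.
Qed.

Lemma rdiff_cis (y : R) : rdiff cis y (Ci * cis y)%C.
Proof.
  replace cis with (fun y => Cexp (RtoC y * Ci)%C)
    by (apply functional_extensionality; intros; now rewrite cis_Cexp).
  apply (rdiff_comp Cexp (fun y => RtoC y * Ci)%C). { apply cdiff_Cexp. } apply rdiff_line.
Qed.

Lemma rcont_line (c : C) (x : R) : rcont (fun x => RtoC x * c)%C x.
Proof. eapply rdiff_rcont. apply rdiff_line. Qed.

Lemma is_CInt_unique (f : R -> C) (a b : R) (l : C) : is_CInt f a b l -> CInt f a b = l.
Proof. intros H. apply (is_RInt_unique (V := C_R_CompleteNormedModule)). exact H. Qed.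

Lemma CInt_correct (f : R -> C) (a b : R) :
  a <= b -> (forall x, a <= x <= b -> rcont f x) -> is_CInt f a b (CInt f a b).
Proof.
  intros Hab H. apply (RInt_correct (V := C_R_CompleteNormedModule)).
  apply (ex_RInt_continuous (V := C_R_CompleteNormedModule)).
  rewrite Rmin_left, Rmax_right by assumption.
  intros z Hz. apply rcont_continuous. auto.
Qed.

Lemma is_CInt_plus (f g : R -> C) (a b : R) (l m : C) :
  is_CInt f a b l -> is_CInt g a b m -> is_CInt (fun x => f x + g x)%C a b (l + m)%C.
Proof. intros. apply (is_RInt_plus (V := C_R_NormedModule)); auto. Qed.

Lemma is_CInt_minus (f g : R -> C) (a b : R) (l m : C) :
  is_CInt f a b l -> is_CInt g a b m -> is_CInt (fun x => f x - g x)%C a b (l - m)%C.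
Proof. intros. apply (is_RInt_minus (V := C_R_NormedModule)); auto. Qed.

Lemma is_CInt_ext (f g : R -> C) (a b : R) (l : C) :
  a <= b -> (forall x, a < x < b -> f x = g x) -> is_CInt f a b l -> is_CInt g a b l.
Proof.
  intros Hab H. apply (is_RInt_ext (V := C_R_NormedModule)).
  rewrite Rmin_left, Rmax_right by assumption. exact H.
Qed.

Lemma is_CInt_Chasles (f : R -> C) (a b c : R) (l m : C) :
  is_CInt f a b l -> is_CInt f b c m -> is_CInt f a c (l + m)%C.
Proof. intros. eapply (is_RInt_Chasles (V := C_R_NormedModule)); eauto. Qed.

Lemma is_CInt_pair (f : R -> C) (a b : R) (l : C) :
  is_CInt f a b l <->
  is_RInt (fun x => Re (f x)) a b (Re l) /\ is_RInt (fun x => Im (f x)) a b (Im l).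
Proof.
  split.
  - intros H. split.
    + apply (is_RInt_fct_extend_fst (U := R_NormedModule) (V := R_NormedModule)). exact H.
    + apply (is_RInt_fct_extend_snd (U := R_NormedModule) (V := R_NormedModule)). exact H.
  - intros [H1 H2]. destruct l as [lu lv].
    apply (is_RInt_fct_extend_pair (U := R_NormedModule) (V := R_NormedModule)); auto.
Qed.

(** The integral takes values in a real normed module, so a complex factor is pulled out through
    real and imaginary parts. *)
Lemma is_CInt_cmult (c : C) (f : R -> C) (a b : R) (l : C) :
  is_CInt f a b l -> is_CInt (fun x => c * f x)%C a b (c * l)%C.
Proof.
  intros H. apply is_CInt_pair in H. destruct H as [H1 H2]. apply is_CInt_pair.
  destruct c as [u v]. unfold Cmult; simpl. split.
  - apply (is_RInt_minus (V := R_NormedModule)); apply (is_RInt_scal (V := R_NormedModule)); auto.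
  - apply (is_RInt_plus (V := R_NormedModule)); apply (is_RInt_scal (V := R_NormedModule)); auto.
Qed.

Lemma is_CInt_bound (f : R -> C) (g : R -> R) (a b : R) (l : C) (m : R) :
  a <= b -> (forall x, a <= x <= b -> Cmod (f x) <= g x) ->
  is_CInt f a b l -> is_RInt g a b m -> Cmod l <= m.
Proof.
  intros Hab H H1 H2. rewrite <- norm_C_R.
  eapply (norm_RInt_le (V := C_R_NormedModule)); eauto.
  intros x Hx. rewrite norm_C_R. auto.
Qed.

Lemma is_CInt_bound_const (f : R -> C) (a b : R) (l : C) (M : R) :
  a <= b -> (forall x, a <= x <= b -> Cmod (f x) <= M) -> is_CInt f a b l -> Cmod l <= (b - a) * M.
Proof.
  intros Hab H H1. rewrite <- norm_C_R.
  eapply (norm_RInt_le_const (V := C_R_NormedModule)); eauto.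
  intros x Hx. rewrite norm_C_R. auto.
Qed.

Lemma is_CInt_derive (f df : R -> C) (a b : R) :
  a <= b -> (forall x, a <= x <= b -> rdiff f x (df x)) ->
  (forall x, a <= x <= b -> rcont df x) -> is_CInt df a b (f b - f a)%C.
Proof.
  intros Hab H1 H2. apply (is_RInt_derive (V := C_R_CompleteNormedModule));
  rewrite Rmin_left, Rmax_right by assumption; intros x Hx.
  - apply rdiff_is_derive. auto.
  - apply rcont_continuous. auto.
Qed.

Lemma is_CInt_const (c : C) (a b : R) : is_CInt (fun _ => c) a b (RtoC (b - a) * c)%C.
Proof.
  replace (RtoC (b - a) * c)%C with (scal (V := C_R_NormedModule) (b - a) c).
  - apply (is_RInt_const (V := C_R_NormedModule)).
  - unfold scal; simpl. unfold prod_scal; simpl. unfold scal; simpl. unfold mult; simpl.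
    unfold Cmult, RtoC; simpl. f_equal; ring.
Qed.

(** * Goursat's theorem on polar rectangles *)

(** Polar rectangles serve both uses of Goursat's theorem: with angles from 0 to [2 * PI] they
    compare two concentric circles, and with inner radius 0 they are the sectors between two
    rays. *)
Definition polar (x y : R) : C := (RtoC x * cis y)%C.

Definition ray_int (f : C -> C) (y a b : R) : C := CInt (fun x => f (polar x y) * cis y)%C a b.

Definition arc_int (f : C -> C) (x c d : R) : C :=
  CInt (fun y => f (polar x y) * (Ci * polar x y))%C c d.

Definition bdry_int (f : C -> C) (a b c d : R) : C :=
  (ray_int f c a b + arc_int f b c d - ray_int f d a b - arc_int f a c d)%C.

Lemma rdiff_ray (x y : R) : rdiff (fun x => polar x y) x (cis y).
Proof. apply rdiff_line. Qed.

Lemma rdiff_arc (x y : R) : rdiff (fun y => polar x y) y (Ci * polar x y)%C.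
Proof.
  intros eps Heps.
  assert (H : rdiff (fun y => RtoC x * cis y)%C y (Ci * cis y * (RtoC x))%C).
  { apply (rdiff_comp (fun z => RtoC x * z)%C cis y (RtoC x) (Ci * cis y)%C).
    - eapply cdiff_eq. { apply (cdiff_mult (fun _ => RtoC x) (fun z => z)). apply cdiff_const. apply cdiff_id. }
      ring.
    - apply rdiff_cis. }
  destruct (H eps Heps) as [d [Hd Hk]]. exists d. split; auto. intros z Hz.
  unfold polar. replace (Ci * (RtoC x * cis y))%C with (Ci * cis y * RtoC x)%C by ring. auto.
Qed.

Lemma rcont_ray_integrand (f : C -> C) (x y : R) :
  ccont f (polar x y) -> rcont (fun x => f (polar x y) * cis y)%C x.
Proof.
  intros H. apply rcont_mult; [|apply rcont_const].
  apply (rcont_comp f (fun x => polar x y)); auto. eapply rdiff_rcont. apply rdiff_ray.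
Qed.

Lemma rcont_arc_integrand (f : C -> C) (x y : R) :
  ccont f (polar x y) -> rcont (fun y => f (polar x y) * (Ci * polar x y))%C y.
Proof.
  intros H.
  assert (H0 : rcont (fun y => polar x y) y) by (eapply rdiff_rcont; apply rdiff_arc).
  apply rcont_mult.
  - apply (rcont_comp f (fun y => polar x y)); auto.
  - apply rcont_mult; auto. apply rcont_const.
Qed.

Lemma ray_int_correct (f : C -> C) (y a b : R) :
  a <= b -> (forall x, a <= x <= b -> ccont f (polar x y)) ->
  is_CInt (fun x => f (polar x y) * cis y)%C a b (ray_int f y a b).
Proof. intros Hab H. apply CInt_correct; auto. intros x Hx. apply rcont_ray_integrand. auto. Qed.

Lemma arc_int_correct (f : C -> C) (x c d : R) :
  c <= d -> (forall y, c <= y <= d -> ccont f (polar x y)) ->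
  is_CInt (fun y => f (polar x y) * (Ci * polar x y))%C c d (arc_int f x c d).
Proof. intros Hab H. apply CInt_correct; auto. intros y Hy. apply rcont_arc_integrand. auto. Qed.

Definition cont_on_rect (f : C -> C) (a b c d : R) : Prop :=
  forall x y, a <= x <= b -> c <= y <= d -> ccont f (polar x y).

Lemma bdry_int_split_ray (f : C -> C) (a m b c d : R) :
  a <= m <= b -> c <= d -> cont_on_rect f a b c d ->
  bdry_int f a b c d = (bdry_int f a m c d + bdry_int f m b c d)%C.
Proof.
  intros Hm Hcd H. unfold bdry_int.
  assert (E : forall y, c <= y <= d -> ray_int f y a b = (ray_int f y a m + ray_int f y m b)%C).
  { intros y Hy. apply is_CInt_unique. apply is_CInt_Chasles with m;
    apply ray_int_correct; try lra; intros; apply H; lra. }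
  rewrite (E c), (E d) by lra. ring.
Qed.

Lemma bdry_int_split_arc (f : C -> C) (a b c m d : R) :
  a <= b -> c <= m <= d -> cont_on_rect f a b c d ->
  bdry_int f a b c d = (bdry_int f a b c m + bdry_int f a b m d)%C.
Proof.
  intros Hab Hm H. unfold bdry_int.
  assert (E : forall x, a <= x <= b -> arc_int f x c d = (arc_int f x c m + arc_int f x m d)%C).
  { intros x Hx. apply is_CInt_unique. apply is_CInt_Chasles with m;
    apply arc_int_correct; try lra; intros; apply H; lra. }
  rewrite (E a), (E b) by lra. ring.
Qed.

Lemma bdry_int_minus (f g : C -> C) (a b c d : R) :
  a <= b -> c <= d -> cont_on_rect f a b c d -> cont_on_rect g a b c d ->
  bdry_int (fun z => f z - g z)%C a b c d = (bdry_int f a b c d - bdry_int g a b c d)%C.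
Proof.
  intros Hab Hcd Hf Hg. unfold bdry_int.
  assert (E : forall y, c <= y <= d ->
    ray_int (fun z => f z - g z)%C y a b = (ray_int f y a b - ray_int g y a b)%C).
  { intros y Hy. apply is_CInt_unique.
    eapply is_CInt_ext; [exact Hab| |apply is_CInt_minus; apply ray_int_correct].
    - intros; simpl; ring.
    - exact Hab.
    - intros; apply Hf; auto.
    - exact Hab.
    - intros; apply Hg; auto. }
  assert (E' : forall x, a <= x <= b ->
    arc_int (fun z => f z - g z)%C x c d = (arc_int f x c d - arc_int g x c d)%C).
  { intros x Hx. apply is_CInt_unique.
    eapply is_CInt_ext; [exact Hcd| |apply is_CInt_minus; apply arc_int_correct].
    - intros; simpl; ring.
    - exact Hcd.
    - intros; apply Hf; auto.
    - exact Hcd.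
    - intros; apply Hg; auto. }
  rewrite (E c), (E d), (E' a), (E' b) by lra. ring.
Qed.

Lemma Cmod_polar (x y : R) : 0 <= x -> Cmod (polar x y) = x.
Proof. apply Cmod_scal_cis. Qed.

Lemma bdry_int_bound (f : C -> C) (a b c d M : R) :
  0 <= a <= b -> c <= d -> cont_on_rect f a b c d ->
  (forall x y, a <= x <= b -> c <= y <= d -> Cmod (f (polar x y)) <= M) ->
  Cmod (bdry_int f a b c d) <= M * (2 * (b - a) + 2 * b * (d - c)).
Proof.
  intros Hab Hcd H HM.
  assert (HM0 : 0 <= M).
  { eapply Rle_trans; [|apply (HM a c); lra]. apply Cmod_ge_0. }
  assert (E : forall y, c <= y <= d -> Cmod (ray_int f y a b) <= (b - a) * M).
  { intros y Hy. eapply is_CInt_bound_const; [| |apply ray_int_correct]; try lra.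
    - intros x Hx. simpl. rewrite Cmod_mult, Cmod_cis, Rmult_1_r. auto.
    - intros; apply H; auto. }
  assert (E' : forall x, a <= x <= b -> Cmod (arc_int f x c d) <= (d - c) * (M * b)).
  { intros x Hx. eapply is_CInt_bound_const; [| |apply arc_int_correct]; try lra.
    - intros y Hy. simpl. rewrite !Cmod_mult, Cmod_Ci, Rmult_1_l, Cmod_polar by lra.
      apply Rmult_le_compat; auto; try lra. apply Cmod_ge_0.
    - intros; apply H; auto. }
  unfold bdry_int.
  eapply Rle_trans. { apply Cmod_sub_le. }
  eapply Rle_trans. { apply Rplus_le_compat_r. apply Cmod_sub_le. }
  eapply Rle_trans. { apply Rplus_le_compat_r. apply Rplus_le_compat_r. apply Cmod_triangle. }
  generalize (E c ltac:(lra)) (E d ltac:(lra)) (E' a ltac:(lra)) (E' b ltac:(lra)). lra.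
Qed.

Lemma bdry_int_primitive (F f : C -> C) (a b c d : R) :
  a <= b -> c <= d -> cont_on_rect f a b c d ->
  (forall x y, a <= x <= b -> c <= y <= d -> cdiff F (polar x y) (f (polar x y))) ->
  bdry_int f a b c d = RtoC 0.
Proof.
  intros Hab Hcd H HF. unfold bdry_int.
  assert (E : forall y, c <= y <= d -> ray_int f y a b = (F (polar b y) - F (polar a y))%C).
  { intros y Hy. apply is_CInt_unique.
    apply (is_CInt_derive (fun x => F (polar x y))); auto.
    - intros x Hx. rewrite Cmult_comm.
      apply (rdiff_comp F (fun x => polar x y)); auto. apply rdiff_ray.
    - intros x Hx. apply rcont_ray_integrand. auto. }
  assert (E' : forall x, a <= x <= b -> arc_int f x c d = (F (polar x d) - F (polar x c))%C).
  { intros x Hx. apply is_CInt_unique.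
    apply (is_CInt_derive (fun y => F (polar x y))); auto.
    - intros y Hy. rewrite Cmult_comm.
      apply (rdiff_comp F (fun y => polar x y)); auto. apply rdiff_arc.
    - intros y Hy. apply rcont_arc_integrand. auto. }
  rewrite (E c), (E d), (E' a), (E' b) by lra. ring.
Qed.

Lemma bdry_int_affine (p l q : C) (a b c d : R) :
  a <= b -> c <= d -> bdry_int (fun z => p + (z - q) * l)%C a b c d = RtoC 0.
Proof.
  intros Hab Hcd.
  assert (H : forall z, cdiff (fun z => p * z + (z - q) * (z - q) * (l / RtoC 2))%C z (p + (z - q) * l)%C).
  { intros z. eapply cdiff_eq.
    { apply cdiff_plus. { apply cdiff_mult. apply cdiff_const. apply cdiff_id. }
      apply cdiff_mult; [|apply cdiff_const].
      apply cdiff_mult; apply cdiff_minus; try apply cdiff_const; apply cdiff_id. }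
    replace (RtoC 2) with (RtoC 1 + RtoC 1)%C by (rewrite <- RtoC_plus; f_equal; ring).
    field. }
  apply (bdry_int_primitive (fun z => p * z + (z - q) * (z - q) * (l / RtoC 2))%C); auto.
  intros x y _ _. apply (cdiff_ccont _ _ l).
  eapply cdiff_eq. { apply cdiff_plus. apply cdiff_const. apply cdiff_mult; [|apply cdiff_const].
    apply cdiff_minus. apply cdiff_id. apply cdiff_const. }
  cbv beta. ring.
Qed.

Lemma cis_lipschitz (y y' : R) : Cmod (cis y - cis y')%C <= 2 * Rabs (y - y').
Proof.
  eapply Rle_trans. { apply Cmod_le_Re_Im. }
  unfold cis; simpl.
  assert (H1 : Rabs (cos y - cos y') <= 1 * Rabs (y - y')).
  { apply (bounded_variation cos (fun t => - sin t)). intros t _. split.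
    apply is_derive_cos. rewrite Rabs_Ropp. apply Rabs_le. generalize (SIN_bound t). lra. }
  assert (H2 : Rabs (sin y - sin y') <= 1 * Rabs (y - y')).
  { apply (bounded_variation sin cos). intros t _. split.
    apply is_derive_sin. apply Rabs_le. generalize (COS_bound t). lra. }
  unfold Rminus in *. lra.
Qed.

Lemma polar_lipschitz (x y x' y' b : R) :
  0 <= x' <= b -> Cmod (polar x y - polar x' y')%C <= Rabs (x - x') + 2 * b * Rabs (y - y').
Proof.
  intros Hb. unfold polar.
  replace (RtoC x * cis y - RtoC x' * cis y')%C
    with (RtoC (x - x') * cis y + RtoC x' * (cis y - cis y'))%C by (rewrite RtoC_minus; ring).
  eapply Rle_trans. { apply Cmod_triangle. }
  rewrite !Cmod_mult, Cmod_cis, !Cmod_R, (Rabs_pos_eq x') by lra.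
  generalize (cis_lipschitz y y') (Cmod_ge_0 (cis y - cis y')%C). nra.
Qed.

Lemma nested_intervals (u v : nat -> R) :
  (forall n, u n <= u (S n)) -> (forall n, v (S n) <= v n) -> (forall n, u n <= v n) ->
  exists x, forall n, u n <= x <= v n.
Proof.
  intros Hu Hv Huv.
  assert (Mu : forall n k, u n <= u (n + k)%nat).
  { intros n k. induction k; [rewrite Nat.add_0_r; lra|]. rewrite Nat.add_succ_r.
    specialize (Hu (n + k)%nat). lra. }
  assert (Mv : forall n k, v (n + k)%nat <= v n).
  { intros n k. induction k; [rewrite Nat.add_0_r; lra|]. rewrite Nat.add_succ_r.
    specialize (Hv (n + k)%nat). lra. }
  assert (Hc : forall n m, u n <= v m).
  { intros n m. specialize (Mu n m). specialize (Mv m n). rewrite Nat.add_comm in Mv.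
    specialize (Huv (n + m)%nat). lra. }
  destruct (completeness (fun r => exists n, r = u n)) as [x [H1 H2]].
  - exists (v O). intros r [n ->]. auto.
  - exists (u O). now exists O.
  - exists x. intros n. split.
    + apply H1. now exists n.
    + apply H2. intros r [m ->]. auto.
Qed.

Record rect := Rect { rx0 : R; rx1 : R; ry0 : R; ry1 : R }.

Definition rect_int (f : C -> C) (r : rect) : C := bdry_int f (rx0 r) (rx1 r) (ry0 r) (ry1 r).

Definition rect_wf (r : rect) : Prop := 0 <= rx0 r <= rx1 r /\ ry0 r <= ry1 r.

Definition rect_sub (r s : rect) : Prop :=
  rx0 s <= rx0 r /\ rx1 r <= rx1 s /\ ry0 s <= ry0 r /\ ry1 r <= ry1 s.

Definition rect_half (r s : rect) : Prop :=
  rx1 r - rx0 r = (rx1 s - rx0 s) / 2 /\ ry1 r - ry0 r = (ry1 s - ry0 s) / 2.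

Lemma goursat_step (f : C -> C) (s : rect) :
  rect_wf s -> cont_on_rect f (rx0 s) (rx1 s) (ry0 s) (ry1 s) ->
  exists r, rect_wf r /\ rect_sub r s /\ rect_half r s /\
    Cmod (rect_int f s) / 4 <= Cmod (rect_int f r).
Proof.
  destruct s as [a b c d]. unfold rect_wf, rect_int; simpl. intros [Hab Hcd] H.
  set (m := (a + b) / 2). set (n := (c + d) / 2).
  assert (Hm : a <= m <= b) by (unfold m; lra). assert (Hn : c <= n <= d) by (unfold n; lra).
  assert (E : bdry_int f a b c d = (bdry_int f a m c n + bdry_int f a m n d +
     (bdry_int f m b c n + bdry_int f m b n d))%C).
  { rewrite (bdry_int_split_ray f a m b c d) by auto.
    rewrite (bdry_int_split_arc f a m c n d), (bdry_int_split_arc f m b c n d); auto; try lra;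
    intros x y Hx Hy; apply H; lra. }
  assert (T : Cmod (bdry_int f a b c d) <= Cmod (bdry_int f a m c n) + Cmod (bdry_int f a m n d) +
     (Cmod (bdry_int f m b c n) + Cmod (bdry_int f m b n d))).
  { rewrite E. eapply Rle_trans. { apply Cmod_triangle. } apply Rplus_le_compat; apply Cmod_triangle. }
  unfold rect_sub, rect_half.
  destruct (Rle_dec (Cmod (bdry_int f a b c d) / 4) (Cmod (bdry_int f a m c n))).
  { exists (Rect a m c n). simpl. unfold m, n in *. repeat split; auto; lra. }
  destruct (Rle_dec (Cmod (bdry_int f a b c d) / 4) (Cmod (bdry_int f a m n d))).
  { exists (Rect a m n d). simpl. unfold m, n in *. repeat split; auto; lra. }
  destruct (Rle_dec (Cmod (bdry_int f a b c d) / 4) (Cmod (bdry_int f m b c n))).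
  { exists (Rect m b c n). simpl. unfold m, n in *. repeat split; auto; lra. }
  exists (Rect m b n d). simpl. unfold m, n in *. repeat split; auto; lra.
Qed.

Lemma rect_sub_refl (r : rect) : rect_sub r r.
Proof. unfold rect_sub. lra. Qed.

(** Bisection takes place in the parameters (radius, angle); [polar_lipschitz] transfers the
    shrinking to the plane. An affine approximation has integral 0, and the error, of order diameter
    times perimeter, is 4^-n times an arbitrarily small factor, against the 4^-n lost by passing to
    quarters. *)
Lemma goursat (f : C -> C) (a b c d : R) :
  0 <= a <= b -> c <= d ->
  (forall x y, a <= x <= b -> c <= y <= d -> exists l, cdiff f (polar x y) l) ->
  bdry_int f a b c d = RtoC 0.
Proof.
  intros Hab Hcd Hf.
  set (s0 := Rect a b c d).
  assert (Hc : forall r, rect_sub r s0 -> cont_on_rect f (rx0 r) (rx1 r) (ry0 r) (ry1 r)).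
  { intros r Hr x y Hx Hy. unfold rect_sub, s0 in Hr; simpl in Hr.
    destruct (Hf x y) as [l Hl]; try lra. eapply cdiff_ccont; eauto. }
  set (next := fun s => epsilon (inhabits s0) (fun r => rect_wf r /\ rect_sub r s /\ rect_half r s /\
    Cmod (rect_int f s) / 4 <= Cmod (rect_int f r))).
  set (seq := fix seq n := match n with O => s0 | S n => next (seq n) end).
  assert (Hnext : forall s, rect_wf s -> rect_sub s s0 ->
    rect_wf (next s) /\ rect_sub (next s) s /\ rect_half (next s) s /\
    Cmod (rect_int f s) / 4 <= Cmod (rect_int f (next s))).
  { intros s Hs Hs0. apply epsilon_spec. apply goursat_step; auto. }
  assert (Hseq : forall n, rect_wf (seq n) /\ rect_sub (seq n) s0).
  { induction n as [|n [IH1 IH2]].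
    - split. { unfold rect_wf, s0; simpl; split; [exact Hab|exact Hcd]. } apply rect_sub_refl.
    - destruct (Hnext _ IH1 IH2) as [H1 [H2 _]]. split; auto.
      unfold rect_sub in *. change (seq (S n)) with (next (seq n)). lra. }
  assert (Hstep : forall n, rect_sub (seq (S n)) (seq n) /\ rect_half (seq (S n)) (seq n) /\
    Cmod (rect_int f (seq n)) / 4 <= Cmod (rect_int f (seq (S n)))).
  { intros n. destruct (Hseq n) as [H1 H2]. apply Hnext; auto. }
  destruct (nested_intervals (fun n => rx0 (seq n)) (fun n => rx1 (seq n))) as [x Hx].
  { intros n. apply Hstep. } { intros n. apply Hstep. } { intros n. apply Hseq. }
  destruct (nested_intervals (fun n => ry0 (seq n)) (fun n => ry1 (seq n))) as [y Hy].
  { intros n. apply Hstep. } { intros n. apply Hstep. } { intros n. apply Hseq. }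
  assert (Hsize : forall n, rx1 (seq n) - rx0 (seq n) = (b - a) / 2 ^ n /\
     ry1 (seq n) - ry0 (seq n) = (d - c) / 2 ^ n).
  { induction n as [|n [IH1 IH2]].
    - unfold seq, s0; simpl. split; field.
    - destruct (Hstep n) as [_ [[H1 H2] _]]. rewrite H1, H2, IH1, IH2. simpl.
      assert (2 ^ n <> 0) by (apply pow_nonzero; lra). split; field; auto. }
  assert (Hint : forall n, Cmod (bdry_int f a b c d) / 4 ^ n <= Cmod (rect_int f (seq n))).
  { induction n as [|n IH].
    - unfold seq, rect_int, s0; simpl. lra.
    - destruct (Hstep n) as [_ [_ H]]. simpl in *.
      assert (0 < 4 ^ n) by (apply pow_lt; lra).
      replace (Cmod (bdry_int f a b c d) / (4 * 4 ^ n))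
        with (Cmod (bdry_int f a b c d) / 4 ^ n / 4) by (field; lra). lra. }
  (* After [n] bisections [D / 2 ^ n] bounds the distance to the limit point and [2 * D / 2 ^ n] the
     perimeter term of [bdry_int_bound]. *)
  set (D := (b - a) + 2 * b * (d - c)).
  assert (HD : 0 <= D) by (unfold D; nra).
  assert (Hmain : forall eps, 0 < eps -> Cmod (bdry_int f a b c d) <= eps * (2 * D * D)).
  { intros eps Heps.
    assert (Hx0 := Hx O). assert (Hy0 := Hy O). unfold seq, s0 in Hx0, Hy0; simpl in Hx0, Hy0.
    destruct (Hf x y Hx0 Hy0) as [l Hl].
    destruct (Hl eps Heps) as [del [Hdel Hk]].
    set (p := polar x y) in *.
    assert (Hsmall : exists n, D / 2 ^ n < del).
    { destruct (Pow_x_infinity 2) with (b := D / del + 1) as [n Hn].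
      { rewrite Rabs_pos_eq; lra. }
      exists n. specialize (Hn n (le_n n)). rewrite Rabs_pos_eq in Hn by (apply pow_le; lra).
      assert (0 < 2 ^ n) by (apply pow_lt; lra).
      apply Rlt_div_l; auto. assert (D / del < 2 ^ n) by lra.
      apply Rlt_div_l in H0; auto. lra. }
    destruct Hsmall as [n Hn].
    destruct (Hseq n) as [Hwf Hsub]. destruct (Hsize n) as [S1 S2].
    specialize (Hx n). specialize (Hy n). specialize (Hint n).
    assert (Hcn := Hc _ Hsub).
    assert (P2 : 0 < 2 ^ n) by (apply pow_lt; lra).
    set (r := seq n) in *.
    assert (Hb : 0 <= rx0 r /\ rx1 r <= b).
    { unfold rect_wf, rect_sub, s0 in *; simpl in *; lra. }
    set (g := (fun z => f p + (z - p) * l)%C).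
    assert (Hg : forall z, ccont g z).
    { intros z. unfold g. apply ccont_plus. apply ccont_const. apply ccont_mult; [|apply ccont_const].
      apply (ccont_plus (fun z => z) (fun _ => - p)%C). apply ccont_id. apply ccont_const. }
    assert (E : rect_int f r = bdry_int (fun z => f z - g z)%C (rx0 r) (rx1 r) (ry0 r) (ry1 r)).
    { rewrite bdry_int_minus.
      - unfold g. rewrite bdry_int_affine; try apply Hwf. unfold rect_int. ring.
      - apply Hwf. - apply Hwf. - apply Hcn. - intros ? ? _ _; apply Hg. }
    rewrite E in Hint. clear E.
    assert (B : Cmod (bdry_int (fun z => f z - g z)%C (rx0 r) (rx1 r) (ry0 r) (ry1 r))
      <= (eps * (D / 2 ^ n)) * (2 * (rx1 r - rx0 r) + 2 * rx1 r * (ry1 r - ry0 r))).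
    { apply bdry_int_bound; try apply Hwf.
      - intros u v Hu Hv. apply (ccont_plus f (fun z => - g z)%C). { apply Hcn; auto. }
        intros e He. destruct (Hg (polar u v) e He) as [dd [Hdd Hkk]]. exists dd. split; auto.
        intros k Hk'. rewrite <- Cmod_opp.
        replace (- (- g (polar u v + k) - - g (polar u v)))%C
          with (g (polar u v + k) - g (polar u v))%C by ring. auto.
      - intros u v Hu Hv.
        assert (Hdist : Cmod (polar u v - p)%C <= D / 2 ^ n).
        { unfold p. eapply Rle_trans. { apply (polar_lipschitz u v x y b). lra. }
          unfold D.
          assert (Rabs (u - x) <= (b - a) / 2 ^ n) by (apply Rabs_le; lra).
          assert (Rabs (v - y) <= (d - c) / 2 ^ n) by (apply Rabs_le; lra).
          replace ((b - a + 2 * b * (d - c)) / 2 ^ n) with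
            ((b - a) / 2 ^ n + 2 * b * ((d - c) / 2 ^ n)) by (field; lra).
          nra. }
        specialize (Hk (polar u v - p)%C ltac:(lra)).
        replace (p + (polar u v - p))%C with (polar u v) in Hk by ring.
        unfold g. replace (f (polar u v) - (f p + (polar u v - p) * l))%C
          with (f (polar u v) - f p - (polar u v - p) * l)%C by ring.
        eapply Rle_trans; [exact Hk|]. apply Rmult_le_compat_l; lra. }
    assert (B2 : 2 * (rx1 r - rx0 r) + 2 * rx1 r * (ry1 r - ry0 r) <= 2 * D / 2 ^ n).
    { rewrite S1, S2. unfold D.
      replace (2 * (b - a + 2 * b * (d - c)) / 2 ^ n) with
            (2 * ((b - a) / 2 ^ n) + 4 * b * ((d - c) / 2 ^ n)) by (field; lra).
      assert (0 <= (d - c) / 2 ^ n). { apply Rle_mult_inv_pos; lra. }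
      destruct Hb. nra. }
    assert (P4 : 4 ^ n = 2 ^ n * 2 ^ n) by (rewrite <- Rpow_mult_distr; f_equal; lra).
    assert (B3 : Cmod (bdry_int f a b c d) / 4 ^ n <= (eps * (D / 2 ^ n)) * (2 * D / 2 ^ n)).
    { eapply Rle_trans; [exact Hint|]. eapply Rle_trans; [exact B|].
      apply Rmult_le_compat_l; auto. apply Rmult_le_pos; [lra|]. apply Rle_mult_inv_pos; auto. }
    assert (P4' : 0 < 4 ^ n) by (apply pow_lt; lra).
    apply (Rmult_le_compat_r (4 ^ n)) in B3; [|lra].
    replace (Cmod (bdry_int f a b c d) / 4 ^ n * 4 ^ n) with (Cmod (bdry_int f a b c d)) in B3
      by (field; lra).
    replace (eps * (D / 2 ^ n) * (2 * D / 2 ^ n) * 4 ^ n) with (eps * (2 * D * D)) in B3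
      by (rewrite P4; field; lra). exact B3. }
  apply Cmod_eq_0. apply Rle_antisym; [|apply Cmod_ge_0].
  destruct (Req_dec D 0) as [E|E].
  - specialize (Hmain 1 Rlt_0_1). rewrite E in Hmain. lra.
  - apply le_epsilon. intros eps Heps.
    assert (0 < 2 * D * D) by nra.
    specialize (Hmain (eps / (2 * D * D))). 
    replace (eps / (2 * D * D) * (2 * D * D)) with eps in Hmain by (field; auto).
    rewrite Rplus_0_l. apply Hmain. apply Rdiv_lt_0_compat; auto.
Qed.

(** * Cauchy estimates *)

Definition hol (f : C -> C) (z : C) : Prop := exists l, cdiff f z l.

Lemma hol_ccont (f : C -> C) (z : C) : hol f z -> ccont f z.
Proof. intros [l H]. eapply cdiff_ccont; eauto. Qed.

Lemma hol_const (c z : C) : hol (fun _ => c) z.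
Proof. eexists; apply cdiff_const. Qed.

Lemma hol_id (z : C) : hol (fun z => z) z.
Proof. eexists; apply cdiff_id. Qed.

Lemma hol_plus (f g : C -> C) (z : C) : hol f z -> hol g z -> hol (fun z => f z + g z)%C z.
Proof. intros [l H] [m H']. eexists; apply cdiff_plus; eauto. Qed.

Lemma hol_minus (f g : C -> C) (z : C) : hol f z -> hol g z -> hol (fun z => f z - g z)%C z.
Proof. intros [l H] [m H']. eexists; apply cdiff_minus; eauto. Qed.

Lemma hol_opp (f : C -> C) (z : C) : hol f z -> hol (fun z => - f z)%C z.
Proof. intros [l H]. eexists; apply cdiff_opp; eauto. Qed.

Lemma hol_mult (f g : C -> C) (z : C) : hol f z -> hol g z -> hol (fun z => f z * g z)%C z.
Proof. intros [l H] [m H']. eexists; apply cdiff_mult; eauto. Qed.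

Lemma hol_inv (f : C -> C) (z : C) : hol f z -> f z <> RtoC 0 -> hol (fun z => / f z)%C z.
Proof. intros [l H] Hn. eexists; apply cdiff_inv; eauto. Qed.

Lemma hol_div (f g : C -> C) (z : C) :
  hol f z -> hol g z -> g z <> RtoC 0 -> hol (fun z => f z / g z)%C z.
Proof. intros. apply hol_mult; auto. apply hol_inv; auto. Qed.

Lemma hol_comp (f g : C -> C) (z : C) : hol g z -> hol f (g z) -> hol (fun z => f (g z)) z.
Proof. intros [l H] [m H']. eexists; apply cdiff_comp; eauto. Qed.

Lemma hol_pow (f : C -> C) (z : C) (n : nat) : hol f z -> hol (fun z => f z ^ n)%C z.
Proof. intros [l H]. eexists; apply cdiff_pow; eauto. Qed.

Lemma hol_Cexp (z : C) : hol Cexp z.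
Proof. eexists; apply cdiff_Cexp. Qed.

Lemma hol_ext_loc (f g : C -> C) (z : C) (r : R) :
  0 < r -> (forall k, Cmod k < r -> f (z + k)%C = g (z + k)%C) -> hol f z -> hol g z.
Proof. intros Hr He [l H]. exists l. eapply cdiff_ext_loc; eauto. Qed.

Lemma polar_neq_0 (x y : R) : 0 < x -> polar x y <> RtoC 0.
Proof. intros H. apply Cmod_gt_0. rewrite Cmod_polar; lra. Qed.

Lemma polar_2PI (x : R) : polar x (2 * PI) = polar x 0.
Proof. unfold polar, cis. rewrite cos_2PI, sin_2PI, cos_0, sin_0. auto. Qed.

(* The integral of [G z / z] over a circle centred at 0 does not depend on the radius. *)
Lemma circle_limit_bound (G : C -> C) (L : C) (rad rho M : R) :
  0 < rho < rad ->
  (forall z, 0 < Cmod z < rad -> hol G z) ->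
  (forall e, 0 < e -> exists d, 0 < d /\ forall z, 0 < Cmod z < d -> Cmod (G z - L)%C <= e) ->
  (forall y, Cmod (G (polar rho y)) <= M) -> Cmod L <= M.
Proof.
  intros Hrho HG HL HM.
  apply le_epsilon. intros e He.
  destruct (HL e He) as [d [Hd Hk]].
  set (r := Rmin (d / 2) rho).
  assert (Hr : 0 < r <= rho) by (unfold r; split; [apply Rmin_case; lra|apply Rmin_r]).
  assert (Hrd : r < d) by (generalize (Rmin_l (d / 2) rho); fold r; lra).
  set (g := fun z => (G z / z)%C).
  assert (Hpi := PI_RGT_0).
  assert (Hg : forall z, 0 < Cmod z < rad -> hol g z).
  { intros z Hz. apply hol_div; auto. apply hol_id. apply Cmod_gt_0; lra. }
  assert (H0 : bdry_int g r rho 0 (2 * PI) = RtoC 0).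
  { apply goursat; try lra. intros x y Hx Hy. apply Hg. rewrite Cmod_polar; lra. }
  unfold bdry_int in H0.
  assert (E : ray_int g (2 * PI) r rho = ray_int g 0 r rho).
  { unfold ray_int. f_equal. apply functional_extensionality. intros x.
    rewrite polar_2PI. f_equal. unfold cis. rewrite cos_2PI, sin_2PI, cos_0, sin_0. auto. }
  rewrite E in H0.
  assert (EJ : arc_int g rho 0 (2 * PI) = arc_int g r 0 (2 * PI)).
  { replace (arc_int g rho 0 (2 * PI)) with
      (ray_int g 0 r rho + arc_int g rho 0 (2 * PI) - ray_int g 0 r rho - arc_int g r 0 (2 * PI)
       + arc_int g r 0 (2 * PI))%C by ring. rewrite H0. ring. }
  assert (Hcont : forall x y, 0 < x < rad -> ccont g (polar x y)).
  { intros x y Hx. apply hol_ccont. apply Hg. rewrite Cmod_polar; lra. }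
  assert (Hval : forall x y, 0 < x -> (g (polar x y) * (Ci * polar x y) = Ci * G (polar x y))%C).
  { intros x y Hx. unfold g. field. apply polar_neq_0; auto. }
  assert (J1 : is_CInt (fun y => Ci * G (polar rho y))%C 0 (2 * PI) (arc_int g rho 0 (2 * PI))).
  { eapply is_CInt_ext; [lra| |apply arc_int_correct; [lra|]].
    - intros y _. apply Hval. lra.
    - intros y _. apply Hcont. lra. }
  assert (J2 : is_CInt (fun y => Ci * G (polar r y))%C 0 (2 * PI) (arc_int g r 0 (2 * PI))).
  { eapply is_CInt_ext; [lra| |apply arc_int_correct; [lra|]].
    - intros y _. apply Hval. lra.
    - intros y _. apply Hcont. lra. }
  rewrite EJ in J1. set (J := arc_int g r 0 (2 * PI)) in *.
  assert (B1 : Cmod J <= (2 * PI - 0) * M).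
  { eapply is_CInt_bound_const; [| |exact J1]. lra.
    intros y _. simpl. rewrite Cmod_mult, Cmod_Ci, Rmult_1_l. auto. }
  assert (J3 : is_CInt (fun y => Ci * G (polar r y) - Ci * L)%C 0 (2 * PI)
     (J - RtoC (2 * PI - 0) * (Ci * L))%C).
  { apply is_CInt_minus; auto. apply is_CInt_const. }
  assert (B3 : Cmod (J - RtoC (2 * PI - 0) * (Ci * L))%C <= (2 * PI - 0) * e).
  { eapply is_CInt_bound_const; [| |exact J3]. lra.
    intros y _. simpl. replace (Ci * G (polar r y) - Ci * L)%C with (Ci * (G (polar r y) - L))%C by ring.
    rewrite Cmod_mult, Cmod_Ci, Rmult_1_l. apply Hk. rewrite Cmod_polar; lra. }
  rewrite Cmod_sub_sym in B3.
  assert (B4 := Cmod_sub_ge (RtoC (2 * PI - 0) * (Ci * L))%C J).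
  rewrite !Cmod_mult, Cmod_Ci, Cmod_RtoC_pos in B4 by lra.
  apply (Rmult_le_reg_l (2 * PI)). lra. lra.
Qed.

Lemma cauchy_max (f : C -> C) (a : C) (rad rho M : R) :
  0 < rho < rad -> (forall z, Cmod (z - a)%C < rad -> hol f z) ->
  (forall y, Cmod (f (a + polar rho y)%C) <= M) -> Cmod (f a) <= M.
Proof.
  intros Hr Hf HM.
  apply (circle_limit_bound (fun z => f (a + z)%C) (f a) rad rho M); auto.
  - intros z Hz. apply (hol_comp f (fun z => a + z)%C).
    + apply hol_plus. apply hol_const. apply hol_id.
    + apply Hf. replace (a + z - a)%C with z by ring. lra.
  - intros e He. destruct (hol_ccont f a) with (eps := e) as [d [Hd Hk]]; auto.
    { apply Hf. replace (a - a)%C with (RtoC 0) by ring. rewrite Cmod_0. lra. }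
    exists d. split; auto. intros z Hz. apply Hk. lra.
Qed.

(** This is [circle_limit_bound] for the difference quotient, whose limit at 0 is [l]. The factor 2
    pays for subtracting [f a]; no integral formula for the derivative is involved. *)
Lemma cauchy_deriv (f : C -> C) (a l : C) (rad M : R) :
  0 < rad -> (forall z, Cmod (z - a)%C < rad -> hol f z) ->
  (forall z, Cmod (z - a)%C < rad -> Cmod (f z) <= M) -> cdiff f a l -> Cmod l <= 2 * M / rad.
Proof.
  intros Hr Hf HM Hl.
  assert (M0 : 0 <= M).
  { eapply Rle_trans; [|apply (HM a)]. apply Cmod_ge_0.
    replace (a - a)%C with (RtoC 0) by ring. rewrite Cmod_0. lra. }
  assert (H : forall rho, 0 < rho < rad -> Cmod l <= 2 * M / rho).
  { intros rho Hrho.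
    apply (circle_limit_bound (fun z => (f (a + z) - f a) / z)%C l rad rho); auto.
    - intros z Hz. apply hol_div; [|apply hol_id|apply Cmod_gt_0; lra].
      apply hol_minus; [|apply hol_const].
      apply (hol_comp f (fun z => a + z)%C).
      + apply hol_plus. apply hol_const. apply hol_id.
      + apply Hf. replace (a + z - a)%C with z by ring. lra.
    - intros e He. destruct (Hl e He) as [d [Hd Hk]]. exists d. split; auto.
      intros z Hz. assert (Hz0 : z <> RtoC 0) by (apply Cmod_gt_0; lra).
      replace ((f (a + z) - f a) / z - l)%C with ((f (a + z) - f a - z * l) / z)%C by (field; auto).
      rewrite Cmod_div by auto. apply Rle_div_l. lra. apply Hk. lra.
    - intros y. rewrite Cmod_div by (apply polar_neq_0; lra).
      rewrite Cmod_polar by lra. apply Rmult_le_compat_r.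
      + left. apply Rinv_0_lt_compat. lra.
      + eapply Rle_trans. { apply Cmod_sub_le. }
        assert (Cmod (f (a + polar rho y)%C) <= M).
        { apply HM. replace (a + polar rho y - a)%C with (polar rho y) by ring.
          rewrite Cmod_polar; lra. }
        assert (Cmod (f a) <= M).
        { apply HM. replace (a - a)%C with (RtoC 0) by ring. rewrite Cmod_0. lra. }
        lra. }
  apply Rle_div_r; auto.
  apply le_epsilon. intros e He.
  (* The circles have to stay inside the open disc, so [rho] approaches [rad] closely enough that
     [Cmod l * (rad - rho) <= e]. *)
  set (rho := Rmax (rad / 2) (rad - e / (1 + Cmod l))).
  assert (Hl0 := Cmod_ge_0 l).
  assert (He' : 0 < e / (1 + Cmod l)) by (apply Rdiv_lt_0_compat; lra).
  assert (H1 : 0 < rho < rad).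
  { unfold rho. split. eapply Rlt_le_trans; [|apply Rmax_l]. lra. apply Rmax_lub_lt; lra. }
  specialize (H rho H1). apply Rle_div_r in H; [|lra].
  assert (H2 : rad - e / (1 + Cmod l) <= rho) by apply Rmax_r.
  assert (Cmod l * (e / (1 + Cmod l)) <= e).
  { replace (Cmod l * (e / (1 + Cmod l))) with (e * (Cmod l / (1 + Cmod l))) by (field; lra).
    rewrite <- (Rmult_1_r e) at 2. apply Rmult_le_compat_l; [lra|].
    apply Rle_div_l; lra. }
  nra.
Qed.

Lemma rdiff_Re (g : R -> C) (x : R) (l : C) : rdiff g x l -> is_derive (fun t => Re (g t)) x (Re l).
Proof.
  intros H. split.
  - apply (is_linear_scal_l (K := R_AbsRing) (V := R_NormedModule)).
  - intros x' Hx eps.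
    apply (is_filter_lim_locally_unique (V := R_NormedModule)) in Hx. subst x'.
    destruct (H eps (cond_pos eps)) as [d [Hd Hk]].
    assert (Hy : forall y : R, Rabs (y - x) < d ->
      Rabs (Re (g y) - Re (g x) - (y - x) * Re l) <= eps * Rabs (y - x)).
    { intros y Hy. refine (Rle_trans _ _ _ _ (Hk y Hy)).
      refine (Rle_trans _ _ _ _ (re_le_Cmod _)). right.
      f_equal. unfold Re, Cminus, Cplus, Copp, Cmult, RtoC; simpl. ring. }
    exists (mkposreal d Hd). exact Hy.
Qed.

(** The real mean value theorem is applied to the component of [F] along its own increment [u], that
    is to the real part of [Cconj u * F]; dividing by [Cmod u] gives the complex inequality. *)
Lemma mvt_segment (F : C -> C) (x y : C) (D : R) :
  (forall t, 0 <= t <= 1 -> exists l, cdiff F (x + RtoC t * (y - x))%C l /\ Cmod l <= D) ->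
  Cmod (F y - F x)%C <= D * Cmod (y - x)%C.
Proof.
  intros H.
  set (u := (F y - F x)%C).
  set (path := fun t => (RtoC t * (y - x) + x)%C).
  assert (Hpath : forall t, rdiff path t (y - x)%C).
  { intros t. unfold path.
    assert (Hp := rdiff_comp (fun z => z + x)%C (fun t => RtoC t * (y - x))%C t (RtoC 1 + RtoC 0)%C (y - x)%C).
    replace ((y - x) * (RtoC 1 + RtoC 0))%C with (y - x)%C in Hp by ring.
    apply Hp. apply cdiff_plus. apply cdiff_id. apply cdiff_const. apply rdiff_line. }
  set (dF := fun t => epsilon (inhabits (RtoC 0)) (fun l => cdiff F (path t) l /\ Cmod l <= D)).
  assert (HdF : forall t, 0 <= t <= 1 -> cdiff F (path t) (dF t) /\ Cmod (dF t) <= D).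
  { intros t Ht. apply epsilon_spec. destruct (H t Ht) as [l Hl]. exists l.
    unfold path. rewrite Cplus_comm. auto. }
  assert (Hd : forall t, 0 <= t <= 1 ->
    is_derive (fun t => Re (Cconj u * F (path t))%C) t (Re (((y - x) * dF t) * Cconj u)%C)).
  { intros t Ht. apply rdiff_Re.
    apply (rdiff_comp (fun z => Cconj u * z)%C (fun t => F (path t)) t (Cconj u) ((y - x) * dF t)%C).
    - eapply cdiff_eq. apply cdiff_mult. apply cdiff_const. apply cdiff_id. cbv beta. ring.
    - apply rdiff_comp. apply HdF; auto. apply Hpath. }
  destruct (MVT_gen (fun t => Re (Cconj u * F (path t))%C) 0 1
     (fun t => Re (((y - x) * dF t) * Cconj u)%C)) as [c [Hc E]].
  - rewrite Rmin_left, Rmax_right by lra. intros t Ht. apply Hd. lra.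
  - rewrite Rmin_left, Rmax_right by lra. intros t Ht.
    apply continuity_pt_filterlim. apply (ex_derive_continuous (V := R_NormedModule)).
    eexists. apply Hd. lra.
  - rewrite Rmin_left, Rmax_right in Hc by lra.
    assert (E2 : Cmod u ^ 2 = Re (((y - x) * dF c) * Cconj u)%C).
    { rewrite Cmod2_alt. rewrite Rminus_0_r, Rmult_1_r in E. rewrite <- E.
      unfold path. replace (RtoC 1 * (y - x) + x)%C with y by ring.
      replace (RtoC 0 * (y - x) + x)%C with x by ring.
      replace (Re (Cconj u * F y) - Re (Cconj u * F x)) with (Re (Cconj u * u)%C).
      - unfold Cconj, Cmult; simpl. ring.
      - unfold u. unfold Cminus, Cplus, Copp, Cmult; simpl. ring. }
    assert (B : Cmod u ^ 2 <= Cmod (y - x)%C * D * Cmod u).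
    { rewrite E2. eapply Rle_trans. { apply Re_le_Cmod. }
      rewrite !Cmod_mult, Cmod_conj. apply Rmult_le_compat_r. apply Cmod_ge_0.
      apply Rmult_le_compat_l. apply Cmod_ge_0. apply HdF; auto. }
    destruct (Rle_lt_or_eq_dec 0 (Cmod u) (Cmod_ge_0 u)) as [Hu|Hu].
    + apply (Rmult_le_reg_r (Cmod u)); auto. simpl in B. lra.
    + rewrite <- Hu. apply Rmult_le_pos; [|apply Cmod_ge_0].
      eapply Rle_trans; [apply Cmod_ge_0|apply (HdF 0); lra].
Qed.

(** The first Cauchy estimate bounds the derivative by 4 M / rad on the half disc. The second, for
    the translate difference f (x + k') - f x on a disc of radius rad / 4, makes the derivative
    Lipschitz at [a], whence 32 = 2 * 4 * 4. A last mean value inequality integrates this. *)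
Lemma cauchy_second_order (f : C -> C) (a l k : C) (rad M : R) :
  0 < rad -> (forall z, Cmod (z - a)%C < rad -> hol f z) ->
  (forall z, Cmod (z - a)%C < rad -> Cmod (f z) <= M) -> cdiff f a l -> Cmod k < rad / 4 ->
  Cmod (f (a + k) - f a - k * l)%C <= 32 * M / rad ^ 2 * Cmod k ^ 2.
Proof.
  intros Hr Hf HM Hl Hk.
  assert (Hd : forall x m, Cmod (x - a)%C < rad / 2 -> cdiff f x m -> Cmod m <= 4 * M / rad).
  { intros x m Hx Hm. replace (4 * M / rad) with (2 * M / (rad / 2)) by (field; lra).
    apply (cauchy_deriv f x m); auto; try lra.
    - intros z Hz. apply Hf. generalize (Cmod_triangle (z - x) (x - a)).
      replace (z - x + (x - a))%C with (z - a)%C by ring. lra.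
    - intros z Hz. apply HM. generalize (Cmod_triangle (z - x) (x - a)).
      replace (z - x + (x - a))%C with (z - a)%C by ring. lra. }
  assert (Hd2 : forall k' m, Cmod k' < rad / 4 -> cdiff f (a + k')%C m ->
     Cmod (m - l)%C <= 32 * M / rad ^ 2 * Cmod k').
  { intros k' m Hk' Hm.
    replace (32 * M / rad ^ 2 * Cmod k') with (2 * (4 * M / rad * Cmod k') / (rad / 4)) by (field; lra).
    apply (cauchy_deriv (fun x => f (x + k') - f x)%C a).
    - lra.
    - intros z Hz. apply hol_minus; [|apply Hf; lra].
      apply (hol_comp f (fun z => z + k')%C).
      + apply hol_plus. apply hol_id. apply hol_const.
      + apply Hf. replace (z + k' - a)%C with (z - a + k')%C by ring.
        eapply Rle_lt_trans. apply Cmod_triangle. lra.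
    - intros z Hz.
      replace k' with (z + k' - z)%C at 2 by ring.
      apply mvt_segment. intros t Ht.
      assert (Hin : Cmod (z + RtoC t * (z + k' - z) - a)%C < rad / 2).
      { replace (z + RtoC t * (z + k' - z) - a)%C with (z - a + RtoC t * k')%C by ring.
        eapply Rle_lt_trans. apply Cmod_triangle. rewrite Cmod_mult, Cmod_RtoC_pos by lra.
        generalize (Cmod_ge_0 k'). nra. }
      destruct (Hf (z + RtoC t * (z + k' - z))%C) as [m' Hm']. lra.
      exists m'. split; auto. eapply Hd; eauto.
    - apply cdiff_minus; auto.
      eapply cdiff_eq. apply (cdiff_comp f (fun z => z + k')%C); eauto.
      apply cdiff_plus. apply cdiff_id. apply cdiff_const. ring. }
  assert (M0 : 0 <= M).
  { eapply Rle_trans; [|apply (HM a)]. apply Cmod_ge_0.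
    replace (a - a)%C with (RtoC 0) by ring. rewrite Cmod_0. lra. }
  assert (B := mvt_segment (fun z => f z - z * l)%C a (a + k)%C (32 * M / rad ^ 2 * Cmod k)).
  replace (a + k - a)%C with k in B by ring.
  replace (f (a + k) - f a - k * l)%C with (f (a + k) - (a + k) * l - (f a - a * l))%C by ring.
  replace (32 * M / rad ^ 2 * Cmod k ^ 2) with (32 * M / rad ^ 2 * Cmod k * Cmod k) by (simpl; field; lra).
  apply B. intros t Ht.
  assert (Htk : Cmod (RtoC t * k)%C <= Cmod k).
  { rewrite Cmod_mult, Cmod_RtoC_pos by lra. generalize (Cmod_ge_0 k). nra. }
  destruct (Hf (a + RtoC t * k)%C) as [m Hm].
  { replace (a + RtoC t * k - a)%C with (RtoC t * k)%C by ring. lra. }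
  exists (m - l)%C. split.
  - eapply cdiff_eq. { apply cdiff_minus; eauto. apply cdiff_mult. apply cdiff_id. apply cdiff_const. }
    cbv beta. ring.
  - eapply Rle_trans. { apply (Hd2 (RtoC t * k)%C m); [lra|exact Hm]. }
    apply Rmult_le_compat_l; auto.
    apply Rle_mult_inv_pos; [lra|apply pow_lt; lra].
Qed.

(** * Limits of holomorphic functions *)

Definition cseq_lim (u : nat -> C) (l : C) : Prop :=
  forall eps, 0 < eps -> exists N, forall n, (N <= n)%nat -> Cmod (u n - l)%C <= eps.

Lemma cseq_cauchy (u : nat -> C) :
  (forall eps, 0 < eps -> exists N, forall n m, (N <= n)%nat -> (N <= m)%nat -> Cmod (u n - u m)%C <= eps) ->
  exists l, cseq_lim u l.
Proof.
  intros H.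
  assert (HR : forall p : C -> R, (forall z w, Rabs (p z - p w) <= Cmod (z - w)%C) ->
    exists l, is_lim_seq (fun n => p (u n)) (Finite l)).
  { intros p Hp. apply ex_lim_seq_cauchy_corr. intros eps.
    destruct (H (eps / 2)) as [N HN]. { generalize (cond_pos eps); lra. }
    exists N. intros n m Hn Hm. eapply Rle_lt_trans; [apply Hp|].
    specialize (HN n m Hn Hm). generalize (cond_pos eps). lra. }
  destruct (HR Re) as [a Ha].
  { intros z w. replace (Re z - Re w) with (Re (z - w)%C) by reflexivity. apply re_le_Cmod. }
  destruct (HR Im) as [b Hb].
  { intros z w. replace (Im z - Im w) with (Im (z - w)%C) by reflexivity. apply im_le_Cmod. }
  apply is_lim_seq_spec in Ha. apply is_lim_seq_spec in Hb.
  exists (a, b). intros eps Heps.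
  assert (He2 : 0 < eps / 2) by lra.
  destruct (Ha (mkposreal _ He2)) as [N1 H1]. destruct (Hb (mkposreal _ He2)) as [N2 H2].
  simpl in H1, H2. exists (N1 + N2)%nat. intros n Hn.
  eapply Rle_trans. { apply Cmod_le_Re_Im. }
  specialize (H1 n ltac:(lia)). specialize (H2 n ltac:(lia)).
  change (Rabs (Re (u n) - a) + Rabs (Im (u n) - b) <= eps). lra.
Qed.

Lemma cseq_lim_unique (u : nat -> C) (l m : C) : cseq_lim u l -> cseq_lim u m -> l = m.
Proof.
  intros H1 H2.
  assert (E : (l - m)%C = RtoC 0).
  { apply Cmod_eq_0. apply Rle_antisym; [|apply Cmod_ge_0]. apply le_epsilon. intros e He.
    destruct (H1 (e / 2)) as [N1 HN1]. lra. destruct (H2 (e / 2)) as [N2 HN2]. lra.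
    specialize (HN1 (N1 + N2)%nat ltac:(lia)). specialize (HN2 (N1 + N2)%nat ltac:(lia)).
    replace (l - m)%C with ((u (N1 + N2)%nat - m) - (u (N1 + N2)%nat - l))%C by ring.
    eapply Rle_trans. apply Cmod_sub_le. lra. }
  replace l with (l - m + m)%C by ring. rewrite E. ring.
Qed.

Lemma cseq_lim_bound (u : nat -> C) (l : C) (M : R) :
  cseq_lim u l -> (forall n, Cmod (u n) <= M) -> Cmod l <= M.
Proof.
  intros H HM. apply le_epsilon. intros e He. destruct (H e He) as [N HN].
  specialize (HN N (le_n N)). specialize (HM N).
  replace l with (u N - (u N - l))%C by ring. eapply Rle_trans. apply Cmod_sub_le. lra.
Qed.

Lemma cseq_lim_const (c : C) : cseq_lim (fun _ => c) c.
Proof.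
  intros e He. exists O. intros n _. replace (c - c)%C with (RtoC 0) by ring. rewrite Cmod_0. lra.
Qed.

Lemma cseq_lim_plus (u v : nat -> C) (l m : C) :
  cseq_lim u l -> cseq_lim v m -> cseq_lim (fun n => u n + v n)%C (l + m)%C.
Proof.
  intros H1 H2 e He.
  destruct (H1 (e / 2)) as [N1 HN1]. lra. destruct (H2 (e / 2)) as [N2 HN2]. lra.
  exists (N1 + N2)%nat. intros n Hn.
  specialize (HN1 n ltac:(lia)). specialize (HN2 n ltac:(lia)).
  replace (u n + v n - (l + m))%C with ((u n - l) + (v n - m))%C by ring.
  eapply Rle_trans. apply Cmod_triangle. lra.
Qed.

Lemma cseq_lim_cmult (c : C) (u : nat -> C) (l : C) :
  cseq_lim u l -> cseq_lim (fun n => c * u n)%C (c * l)%C.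
Proof.
  intros H e He.
  assert (Hc := Cmod_ge_0 c).
  destruct (H (e / (1 + Cmod c))) as [N HN]. { apply Rdiv_lt_0_compat; lra. }
  exists N. intros n Hn. specialize (HN n Hn).
  replace (c * u n - c * l)%C with (c * (u n - l))%C by ring. rewrite Cmod_mult.
  apply Rle_div_r in HN; [|lra]. generalize (Cmod_ge_0 (u n - l)%C). nra.
Qed.

Lemma cseq_lim_minus (u v : nat -> C) (l m : C) :
  cseq_lim u l -> cseq_lim v m -> cseq_lim (fun n => u n - v n)%C (l - m)%C.
Proof.
  intros H1 H2. apply (cseq_lim_cmult (- RtoC 1)%C) in H2.
  assert (H := cseq_lim_plus _ _ _ _ H1 H2).
  replace (l - m)%C with (l + - RtoC 1 * m)%C by ring.
  intros e He. destruct (H e He) as [N HN]. exists N. intros n Hn.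
  replace (u n - v n)%C with (u n + - RtoC 1 * v n)%C by ring. auto.
Qed.

(* A derivative-free form of the second-order Taylor estimate: it passes to pointwise limits and to
   integrals with respect to a parameter, and it implies differentiability. *)
Definition quadratic_at (f : C -> C) (a : C) (K r : R) : Prop :=
  forall k k', Cmod k < r -> Cmod k' < r ->
    Cmod (k' * (f (a + k) - f a) - k * (f (a + k') - f a))%C
    <= K * (Cmod k * Cmod k' * (Cmod k + Cmod k')).

Lemma hol_quadratic_at (f : C -> C) (a : C) (rad M : R) :
  0 < rad -> (forall z, Cmod (z - a)%C < rad -> hol f z) ->
  (forall z, Cmod (z - a)%C < rad -> Cmod (f z) <= M) ->
  quadratic_at f a (32 * M / rad ^ 2) (rad / 4).
Proof.
  intros Hr Hf HM k k' Hk Hk'.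
  destruct (Hf a) as [l Hl].
  { replace (a - a)%C with (RtoC 0) by ring. rewrite Cmod_0. lra. }
  assert (B1 := cauchy_second_order f a l k rad M Hr Hf HM Hl Hk).
  assert (B2 := cauchy_second_order f a l k' rad M Hr Hf HM Hl Hk').
  replace (k' * (f (a + k) - f a) - k * (f (a + k') - f a))%C
    with (k' * (f (a + k) - f a - k * l) - k * (f (a + k') - f a - k' * l))%C by ring.
  eapply Rle_trans. apply Cmod_sub_le. rewrite !Cmod_mult.
  generalize (Cmod_ge_0 k) (Cmod_ge_0 k'). intros.
  apply (Rmult_le_compat_l (Cmod k')) in B1; auto. apply (Rmult_le_compat_l (Cmod k)) in B2; auto.
  simpl in *. lra.
Qed.

Lemma vanishing_sequence (r : R) : 0 < r ->
  exists k : nat -> C, (forall n, 0 < Cmod (k n) < r) /\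
    forall e, 0 < e -> exists N, forall n, (N <= n)%nat -> Cmod (k n) < e.
Proof.
  intros Hr. exists (fun n => RtoC (r / INR (n + 2))).
  assert (Hn : forall n, 2 <= INR (n + 2)).
  { intros n. rewrite plus_INR. simpl. generalize (pos_INR n). lra. }
  assert (Hk : forall n, Cmod (RtoC (r / INR (n + 2))) = r / INR (n + 2)).
  { intros n. apply Cmod_RtoC_pos. specialize (Hn n). apply Rle_mult_inv_pos; lra. }
  split.
  - intros n. rewrite Hk. specialize (Hn n). split. apply Rdiv_lt_0_compat; lra.
    apply Rlt_div_l; nra.
  - intros e He. destruct (nfloor_ex (r / e)) as [N HN]. { apply Rle_mult_inv_pos; lra. }
    exists N. intros n HNn. rewrite Hk. specialize (Hn n). apply Rlt_div_l. lra.
    assert (H : r / e < INR (n + 2)).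
    { eapply Rlt_le_trans. apply HN. rewrite plus_INR. simpl. apply le_INR in HNn. lra. }
    apply Rlt_div_l in H; auto. lra.
Qed.

(** Divided by k k', the hypothesis says that two difference quotients differ by at most K (|k| +
    |k'|). They are thus Cauchy along one vanishing sequence, and its limit is the derivative along
    every increment. *)
Lemma quadratic_at_hol (f : C -> C) (a : C) (K r : R) :
  0 < r -> quadratic_at f a K r -> hol f a.
Proof.
  intros Hr H.
  destruct (vanishing_sequence r Hr) as [k [Hkr Hsmall]].
  (* The sign of [K] is not known, and the radii chosen below need a nonnegative constant. *)
  set (K' := Rabs K).
  assert (HK' : 0 <= K') by apply Rabs_pos.
  assert (HQ : forall k k', 0 < Cmod k < r -> 0 < Cmod k' < r ->
    Cmod ((f (a + k) - f a) / k - (f (a + k') - f a) / k')%C <= K' * (Cmod k + Cmod k')).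
  { intros h h' Hh Hh'.
    assert (h <> RtoC 0) by (apply Cmod_gt_0; lra). assert (h' <> RtoC 0) by (apply Cmod_gt_0; lra).
    replace ((f (a + h) - f a) / h - (f (a + h') - f a) / h')%C with
      ((h' * (f (a + h) - f a) - h * (f (a + h') - f a)) / (h * h'))%C by (field; auto).
    rewrite Cmod_div by (apply Cmult_neq_0; auto). rewrite Cmod_mult.
    apply Rle_div_l. nra.
    eapply Rle_trans. apply H; lra.
    replace (K' * (Cmod h + Cmod h') * (Cmod h * Cmod h')) with
      (K' * (Cmod h * Cmod h' * (Cmod h + Cmod h'))) by ring.
    apply Rmult_le_compat_r. { assert (0 < Cmod h * Cmod h') by nra. nra. } apply Rle_abs. }
  destruct (cseq_cauchy (fun n => (f (a + k n) - f a) / k n)%C) as [l Hl].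
  { intros e He. destruct (Hsmall (e / (2 * (1 + K')))) as [N HN].
    { apply Rdiv_lt_0_compat; lra. }
    exists N. intros n m Hn Hm. eapply Rle_trans. { apply HQ; auto. }
    assert (A := HN n Hn). assert (B := HN m Hm).
    apply Rlt_div_r in A; [|lra]. apply Rlt_div_r in B; [|lra].
    generalize (Cmod_ge_0 (k n)) (Cmod_ge_0 (k m)). nra. }
  exists l.
  intros e He. exists (Rmin r (e / (1 + K'))). split.
  { apply Rmin_case; auto. apply Rdiv_lt_0_compat; lra. }
  intros h Hh.
  destruct (Rmin_Rgt_l _ _ _ Hh) as [Hh1 Hh2].
  destruct (Ceq_dec h (RtoC 0)) as [->|Hh0].
  { replace (f (a + RtoC 0) - f a - RtoC 0 * l)%C with (RtoC 0).
    - rewrite Cmod_0. lra.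
    - replace (a + RtoC 0)%C with a by ring. ring. }
  assert (Hhp : 0 < Cmod h) by (apply Cmod_gt_0; auto).
  assert (B : Cmod ((f (a + h) - f a) / h - l)%C <= K' * Cmod h).
  { apply le_epsilon. intros e' He'.
    destruct (Hl (e' / 2)) as [N1 HN1]. lra.
    destruct (Hsmall (e' / (2 * (1 + K')))) as [N2 HN2]. { apply Rdiv_lt_0_compat; lra. }
    set (n := (N1 + N2)%nat).
    specialize (HN1 n ltac:(unfold n; lia)). specialize (HN2 n ltac:(unfold n; lia)).
    assert (Q := HQ h (k n) ltac:(lra) (Hkr n)).
    replace ((f (a + h) - f a) / h - l)%C with
      (((f (a + h) - f a) / h - (f (a + k n) - f a) / k n) + ((f (a + k n) - f a) / k n - l))%C by ring.
    eapply Rle_trans. apply Cmod_triangle.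
    apply Rlt_div_r in HN2; [|lra]. generalize (Cmod_ge_0 (k n)). nra. }
  replace (f (a + h) - f a - h * l)%C with (h * ((f (a + h) - f a) / h - l))%C by (field; auto).
  rewrite Cmod_mult.
  apply (Rmult_lt_compat_r (1 + K')) in Hh2; [|lra].
  replace (e / (1 + K') * (1 + K')) with e in Hh2 by (field; lra).
  nra.
Qed.

(** Pointwise convergence and a common bound suffice: all the [F n] satisfy [quadratic_at] with the
    same constant, and that inequality survives a pointwise limit. *)
Lemma hol_limit (F : nat -> C -> C) (f : C -> C) (a : C) (rad M : R) :
  0 < rad -> (forall n z, Cmod (z - a)%C < rad -> hol (F n) z) ->
  (forall n z, Cmod (z - a)%C < rad -> Cmod (F n z) <= M) ->
  (forall z, Cmod (z - a)%C < rad -> cseq_lim (fun n => F n z) (f z)) -> hol f a.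
Proof.
  intros Hr HF HM Hlim.
  apply (quadratic_at_hol f a (32 * M / rad ^ 2) (rad / 4)). lra.
  intros k k' Hk Hk'.
  assert (L : forall h, Cmod h < rad / 4 -> cseq_lim (fun n => F n (a + h)%C) (f (a + h)%C)).
  { intros h Hh. apply Hlim. replace (a + h - a)%C with h by ring. lra. }
  assert (L0 : cseq_lim (fun n => F n a) (f a)).
  { apply Hlim. replace (a - a)%C with (RtoC 0) by ring. rewrite Cmod_0. lra. }
  apply (cseq_lim_bound (fun n => k' * (F n (a + k) - F n a) - k * (F n (a + k') - F n a))%C).
  - apply cseq_lim_minus; apply cseq_lim_cmult; apply cseq_lim_minus; auto.
  - intros n. apply hol_quadratic_at; auto.
Qed.

(** The conclusion is [quadratic_at] rather than [hol], with a constant that involves only the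
    integral [m] of the dominating function. In [Lap_hol] the upper end of the integral can
    therefore still tend to infinity. *)
Lemma hol_integral (Phi : C -> R -> C) (I : C -> C) (g : R -> R) (a : C) (u v m rad : R) :
  0 < rad -> u <= v ->
  (forall z s, Cmod (z - a)%C < rad -> u <= s <= v -> hol (fun z => Phi z s) z) ->
  (forall z s, Cmod (z - a)%C < rad -> u <= s <= v -> Cmod (Phi z s) <= g s) ->
  is_RInt g u v m ->
  (forall z, Cmod (z - a)%C < rad -> is_CInt (Phi z) u v (I z)) ->
  quadratic_at I a (32 * m / rad ^ 2) (rad / 4).
Proof.
  intros Hr Huv Hh Hb Hg HI k k' Hk Hk'.
  assert (L : forall h, Cmod h < rad / 4 -> is_CInt (Phi (a + h)%C) u v (I (a + h)%C)).
  { intros h Hhr. apply HI. replace (a + h - a)%C with h by ring. lra. }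
  assert (L0 : is_CInt (Phi a) u v (I a)).
  { apply HI. replace (a - a)%C with (RtoC 0) by ring. rewrite Cmod_0. lra. }
  set (X := Cmod k * Cmod k' * (Cmod k + Cmod k')).
  apply (is_CInt_bound
    (fun s => k' * (Phi (a + k)%C s - Phi a s) - k * (Phi (a + k')%C s - Phi a s))%C
    (fun s => (32 / rad ^ 2 * X) * g s) u v); auto.
  - intros s Hs.
    assert (Q := hol_quadratic_at (fun z => Phi z s) a rad (g s) Hr
      (fun z Hz => Hh z s Hz Hs) (fun z Hz => Hb z s Hz Hs) k k' Hk Hk').
    fold X in Q. simpl in Q. eapply Rle_trans; [exact Q|]. right. field. lra.
  - apply is_CInt_minus; apply is_CInt_cmult; apply is_CInt_minus; auto.
  - replace (32 * m / rad ^ 2 * X) with ((32 / rad ^ 2 * X) * m) by (field; lra).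
    apply (is_RInt_scal (V := R_NormedModule)). exact Hg.
Qed.

Lemma geometric_squeeze (x M q : R) : 0 <= q < 1 -> (forall N, x <= M * q ^ N) -> x <= 0.
Proof.
  intros Hq H.
  assert (L := is_lim_seq_scal_l _ M _ (is_lim_seq_geom q ltac:(rewrite Rabs_pos_eq; lra))).
  simpl in L. rewrite Rmult_0_r in L.
  apply (is_lim_seq_le _ _ x 0 H); auto. apply is_lim_seq_const.
Qed.

(** * Taylor expansion *)

(** The derivative is the pointwise limit of difference quotients with increments [k n], which are
    holomorphic and, by the mean value inequality, uniformly bounded; so [hol_limit] applies. *)
Lemma deriv_hol (f df : C -> C) (a : C) (rad M : R) :
  0 < rad -> (forall z, Cmod (z - a)%C < rad -> cdiff f z (df z)) ->
  (forall z, Cmod (z - a)%C < rad -> Cmod (f z) <= M) -> hol df a.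
Proof.
  intros Hr Hf HM.
  destruct (vanishing_sequence (rad / 8)) as [k [Hkr Hsmall]]. { lra. }
  assert (Hd : forall x, Cmod (x - a)%C < rad / 2 -> Cmod (df x) <= 4 * M / rad).
  { intros x Hx. replace (4 * M / rad) with (2 * M / (rad / 2)) by (field; lra).
    assert (Hin : forall z, Cmod (z - x)%C < rad / 2 -> Cmod (z - a)%C < rad).
    { intros z Hz. generalize (Cmod_triangle (z - x) (x - a)).
      replace (z - x + (x - a))%C with (z - a)%C by ring. lra. }
    apply (cauchy_deriv f x); try lra.
    - intros z Hz. eexists. apply Hf. auto.
    - intros z Hz. apply HM. auto.
    - apply Hf. lra. }
  apply (hol_limit (fun n x => (f (x + k n) - f x) / k n)%C df a (rad / 4) (4 * M / rad)).
  - lra.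
  - intros n z Hz. specialize (Hkr n).
    apply hol_div; [|apply hol_const|apply Cmod_gt_0; lra].
    apply hol_minus; [|eexists; apply Hf; lra].
    apply (hol_comp f (fun z => z + k n)%C).
    + apply hol_plus. apply hol_id. apply hol_const.
    + eexists. apply Hf. replace (z + k n - a)%C with (z - a + k n)%C by ring.
      eapply Rle_lt_trans. apply Cmod_triangle. lra.
  - intros n z Hz. specialize (Hkr n).
    rewrite Cmod_div by (apply Cmod_gt_0; lra). apply Rle_div_l. lra.
    replace (k n) with (z + k n - z)%C at 2 by ring.
    apply mvt_segment. intros t Ht.
    assert (Hin : Cmod (z + RtoC t * (z + k n - z) - a)%C < rad / 2).
    { replace (z + RtoC t * (z + k n - z) - a)%C with (z - a + RtoC t * k n)%C by ring.
      eapply Rle_lt_trans. apply Cmod_triangle. rewrite Cmod_mult, (Cmod_RtoC_pos t) by lra.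
      nra. }
    eexists. split. { apply Hf. lra. } apply Hd. auto.
  - intros z Hz e He.
    destruct (Hf z ltac:(lra) e He) as [d [Hdp Hdk]].
    destruct (Hsmall d Hdp) as [N HN]. exists N. intros n Hn.
    specialize (Hdk _ (HN n Hn)). specialize (Hkr n).
    assert (k n <> RtoC 0) by (apply Cmod_gt_0; lra).
    replace ((f (z + k n) - f z) / k n - df z)%C
      with ((f (z + k n) - f z - k n * df z) / k n)%C by (field; auto).
    rewrite Cmod_div by auto. apply Rle_div_l; lra.
Qed.

Definition diffquot (f : C -> C) (l z : C) : C :=
  if Ceq_dec z (RtoC 0) then l else ((f z - f (RtoC 0)) / z)%C.

Lemma diffquot_eq (f : C -> C) (l z : C) : f z = (f (RtoC 0) + z * diffquot f l z)%C.
Proof.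
  unfold diffquot. destruct (Ceq_dec z (RtoC 0)) as [->|H]. ring. field. auto.
Qed.

Lemma diffquot_hol_away (f : C -> C) (l z : C) : z <> RtoC 0 -> hol f z -> hol (diffquot f l) z.
Proof.
  intros Hz Hf.
  apply (hol_ext_loc (fun z => (f z - f (RtoC 0)) / z)%C _ z (Cmod z)).
  - apply Cmod_gt_0; auto.
  - intros k Hk. unfold diffquot. destruct (Ceq_dec (z + k) (RtoC 0)) as [E|E]; auto.
    exfalso. assert (k = - z)%C by (replace k with (z + k - z)%C by ring; rewrite E; ring).
    subst k. rewrite Cmod_opp in Hk. lra.
  - apply hol_div; auto. apply hol_minus; auto. apply hol_const. apply hol_id.
Qed.

(** Only the point 0 needs an argument; there the derivative of the quotient is half the second
    derivative of [f]. Subtracting the candidate Taylor polynomial leaves [phi], whose derivative is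
    o(|z|), and the mean value inequality makes [phi] itself o(|z|^2) up to a constant. *)
Lemma diffquot_hol (f : C -> C) (l : C) (rad M : R) :
  0 < rad -> (forall z, Cmod z < rad -> hol f z) ->
  (forall z, Cmod z < rad -> Cmod (f z) <= M) -> cdiff f (RtoC 0) l ->
  forall z, Cmod z < rad -> hol (diffquot f l) z.
Proof.
  intros Hr Hf HM Hl z Hz.
  destruct (Ceq_dec z (RtoC 0)) as [->|Hz0]; [|apply diffquot_hol_away; auto].
  set (df := fun z => epsilon (inhabits (RtoC 0)) (fun l => cdiff f z l)).
  assert (Hdf : forall z, Cmod z < rad -> cdiff f z (df z)).
  { intros w Hw. apply epsilon_spec. apply Hf; auto. }
  assert (Hdl : df (RtoC 0) = l). { eapply cdiff_unique; eauto. }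
  destruct (deriv_hol f df (RtoC 0) rad M) as [d2 Hd2]; auto.
  { intros w Hw. apply Hdf. replace (w - RtoC 0)%C with w in Hw by ring. auto. }
  { intros w Hw. apply HM. replace (w - RtoC 0)%C with w in Hw by ring. auto. }
  exists (d2 / RtoC 2)%C. intros e He.
  destruct (Hd2 e He) as [d [Hd Hdk]].
  exists (Rmin d rad). split. { apply Rmin_case; auto. }
  intros k Hk.
  destruct (Rmin_Rgt_l _ _ _ Hk) as [K1 K2].
  rewrite !Cplus_0_l.
  destruct (Ceq_dec k (RtoC 0)) as [->|Hk0].
  { replace (diffquot f l (RtoC 0) - diffquot f l (RtoC 0) - RtoC 0 * (d2 / RtoC 2))%C with (RtoC 0) by ring.
    rewrite Cmod_0. lra. }
  unfold diffquot at 1. destruct (Ceq_dec k (RtoC 0)) as [|_]; [contradiction|].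
  unfold diffquot. destruct (Ceq_dec (RtoC 0) (RtoC 0)) as [_|]; [|contradiction].
  set (phi := fun z => (f z - (z * l + z * z * (d2 / RtoC 2)))%C).
  assert (T2 : (RtoC 2 <> RtoC 0)) by (apply RtoC_neq; lra).
  replace ((f k - f (RtoC 0)) / k - l - k * (d2 / RtoC 2))%C with ((phi k - phi (RtoC 0)) / k)%C
    by (unfold phi; field; auto).
  rewrite Cmod_div by auto.
  assert (Hkp : 0 < Cmod k) by (apply Cmod_gt_0; auto).
  apply Rle_div_l; auto.
  replace k with (k - RtoC 0)%C at 3 by ring.
  apply mvt_segment. intros t Ht.
  replace (RtoC 0 + RtoC t * (k - RtoC 0))%C with (RtoC t * k)%C by ring.
  assert (Htk : Cmod (RtoC t * k)%C <= Cmod k).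
  { rewrite Cmod_mult, Cmod_RtoC_pos by lra. nra. }
  exists (df (RtoC t * k)%C - df (RtoC 0) - (RtoC t * k) * d2)%C. split.
  - unfold phi. eapply cdiff_eq.
    { apply cdiff_minus. { apply Hdf. lra. }
      apply cdiff_plus. { apply cdiff_mult. apply cdiff_id. apply cdiff_const. }
      apply cdiff_mult; [|apply cdiff_const]. apply cdiff_mult; apply cdiff_id. }
    cbv beta. rewrite Hdl.
    replace (RtoC 2) with (RtoC 1 + RtoC 1)%C by (rewrite <- RtoC_plus; f_equal; ring). field.
  - specialize (Hdk (RtoC t * k)%C ltac:(lra)). rewrite Cplus_0_l in Hdk.
    eapply Rle_trans; [exact Hdk|]. nra.
Qed.

(** Away from 0 the numerator is at most 2 M and the denominator at least rad / 4, whence 8 / rad.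
    Near 0 the division is out of control, and the maximum principle imports the bound from the
    outer ring. *)
Lemma diffquot_bound (f : C -> C) (l : C) (rad M : R) :
  0 < rad -> (forall z, Cmod z < rad -> hol f z) ->
  (forall z, Cmod z < rad -> Cmod (f z) <= M) -> cdiff f (RtoC 0) l ->
  forall z, Cmod z < rad -> Cmod (diffquot f l z) <= M * (8 / rad).
Proof.
  intros Hr Hf HM Hl.
  assert (M0 : 0 <= M).
  { eapply Rle_trans; [|apply (HM (RtoC 0))]. apply Cmod_ge_0. rewrite Cmod_0. lra. }
  assert (Hfar : forall z, rad / 4 <= Cmod z < rad -> Cmod (diffquot f l z) <= M * (8 / rad)).
  { intros z Hz. assert (Hz0 : z <> RtoC 0) by (apply Cmod_gt_0; lra).
    unfold diffquot. destruct (Ceq_dec z (RtoC 0)); [contradiction|].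
    rewrite Cmod_div by auto. apply Rle_div_l. lra.
    eapply Rle_trans. { apply Cmod_sub_le. }
    assert (Cmod (f z) <= M) by (apply HM; lra).
    assert (Cmod (f (RtoC 0)) <= M) by (apply HM; rewrite Cmod_0; lra).
    apply Rle_trans with (M * (8 / rad) * (rad / 4)).
    - replace (M * (8 / rad) * (rad / 4)) with (2 * M) by (field; lra). lra.
    - apply Rmult_le_compat_l; [|lra]. apply Rmult_le_pos; auto. apply Rle_mult_inv_pos; lra. }
  intros z Hz. destruct (Rle_dec (rad / 4) (Cmod z)) as [H|H]. { apply Hfar. lra. }
  (* Since |z| < rad / 4, the circle of radius 5 rad / 8 about [z] lies between the radii 3 rad / 8
     and 7 rad / 8, hence in the ring. *)
  apply (cauchy_max (diffquot f l) z (3 * rad / 4) (5 * rad / 8)). lra.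
  - intros w Hw. apply (diffquot_hol f l rad M); auto.
    replace w with (w - z + z)%C by ring. eapply Rle_lt_trans. apply Cmod_triangle. lra.
  - intros y.
    assert (Hp : Cmod (polar (5 * rad / 8) y) = 5 * rad / 8) by (apply Cmod_polar; lra).
    apply Hfar. split.
    + rewrite Cplus_comm. eapply Rle_trans; [|apply Cmod_plus_ge]. rewrite Hp. lra.
    + eapply Rle_lt_trans. apply Cmod_triangle. rewrite Hp. lra.
Qed.

Fixpoint tpoly (a : nat -> C) (z : C) (N : nat) : C :=
  match N with O => RtoC 0 | S N => (tpoly a z N + a N * z ^ N)%C end.

(** Iterated difference quotients: f = polynomial + z^N times the N-th quotient, and each quotient
    costs a factor 8 / rad. This rate is worse than Cauchy's, but only geometric growth of the
    coefficients is wanted. *)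
Lemma taylor (f : C -> C) (rad M : R) :
  0 < rad -> (forall z, Cmod z < rad -> hol f z) ->
  (forall z, Cmod z < rad -> Cmod (f z) <= M) ->
  exists a : nat -> C,
    (forall k, Cmod (a k) <= M * (8 / rad) ^ k) /\
    (forall N z, Cmod z < rad -> Cmod (f z - tpoly a z N)%C <= M * (8 / rad * Cmod z) ^ N).
Proof.
  intros Hr Hf HM.
  set (der0 := fun g => epsilon (inhabits (RtoC 0)) (fun l => cdiff g (RtoC 0) l)).
  set (it := fix it n := match n with O => f | S n => diffquot (it n) (der0 (it n)) end).
  assert (Hit : forall n, (forall z, Cmod z < rad -> hol (it n) z) /\
    (forall z, Cmod z < rad -> Cmod (it n z) <= M * (8 / rad) ^ n)).
  { induction n as [|n [IH1 IH2]].
    - split; auto. intros z Hz. simpl. rewrite Rmult_1_r. auto.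
    - assert (Hd : cdiff (it n) (RtoC 0) (der0 (it n))).
      { apply epsilon_spec. apply IH1. rewrite Cmod_0. auto. }
      split; simpl.
      + apply (diffquot_hol (it n) _ rad (M * (8 / rad) ^ n)); auto.
      + intros z Hz. replace (M * (8 / rad * (8 / rad) ^ n)) with (M * (8 / rad) ^ n * (8 / rad)) by ring.
        apply (diffquot_bound (it n) _ rad (M * (8 / rad) ^ n)); auto. }
  exists (fun k => it k (RtoC 0)). split.
  - intros k. apply Hit. rewrite Cmod_0. auto.
  - intros N z Hz.
    assert (E : forall N, f z = (tpoly (fun k => it k (RtoC 0)) z N + z ^ N * it N z)%C).
    { clear N. induction N as [|N IH]. { simpl. ring. }
      rewrite IH at 1. simpl tpoly.
      replace (it N z) with (it N (RtoC 0) + z * it (S N) z)%C.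
      - change (z ^ S N)%C with (z * z ^ N)%C. ring.
      - symmetry. apply diffquot_eq. }
    replace (f z - tpoly (fun k => it k (RtoC 0)) z N)%C with (z ^ N * it N z)%C
      by (rewrite (E N); ring).
    rewrite Cmod_mult, Cmod_pow, Rpow_mult_distr.
    destruct (Hit N) as [_ HB]. specialize (HB z Hz).
    apply (Rmult_le_compat_l (Cmod z ^ N)) in HB. lra. apply pow_le. apply Cmod_ge_0.
Qed.

(** Smallness is asked along one ray only, because the lemma also serves the identity theorem, where
    a function is known to vanish merely on a segment. *)
Lemma jet_unique (a : nat -> C) (c : C) :
  c <> RtoC 0 ->
  (forall N, exists K d, 0 < d /\ forall e, 0 < e < d -> Cmod (tpoly a (RtoC e * c) N) <= K * e ^ N) ->
  forall k, a k = RtoC 0.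
Proof.
  intros Hc H k.
  induction k as [k IH] using (well_founded_induction Nat.lt_wf_0).
  assert (E : forall z n, (n <= k)%nat -> tpoly a z n = RtoC 0).
  { intros z n. induction n as [|n IHn]; intros Hn; auto.
    simpl. rewrite IHn, (IH n) by lia. ring. }
  destruct (H (S k)) as [K [d [Hd HK]]].
  assert (Hcp : 0 < Cmod c ^ k) by (apply pow_lt; apply Cmod_gt_0; auto).
  assert (B : forall e, 0 < e < d -> Cmod (a k) * Cmod c ^ k <= K * e).
  { intros e He. specialize (HK e He). simpl in HK. rewrite E in HK by lia.
    rewrite Cplus_0_l, Cmod_mult, Cmod_pow, Cmod_mult, Cmod_RtoC_pos, Rpow_mult_distr in HK by lra.
    assert (0 < e ^ k) by (apply pow_lt; lra).
    apply (Rmult_le_reg_r (e ^ k)); auto. lra. }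
  assert (Z : Cmod (a k) * Cmod c ^ k <= 0).
  { apply le_epsilon. intros e He. rewrite Rplus_0_l.
    set (t := Rmin (d / 2) (e / (1 + Rabs K))).
    assert (HKp := Rabs_pos K).
    assert (0 < t) by (unfold t; apply Rmin_case; [lra|apply Rdiv_lt_0_compat; lra]).
    assert (t <= d / 2) by apply Rmin_l.
    assert (t <= e / (1 + Rabs K)) by apply Rmin_r.
    eapply Rle_trans; [apply (B t); lra|].
    apply Rle_div_r in H2; [|lra]. generalize (Rle_abs K). nra. }
  apply Cmod_eq_0. generalize (Cmod_ge_0 (a k)). nra.
Qed.

Lemma tpoly_minus (a b : nat -> C) (z : C) (N : nat) :
  tpoly (fun k => a k - b k)%C z N = (tpoly a z N - tpoly b z N)%C.
Proof. induction N as [|N IH]; simpl; [|rewrite IH]; ring. Qed.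

Lemma tpoly_ext (a b : nat -> C) (z : C) (N : nat) :
  (forall k, (k < N)%nat -> a k = b k) -> tpoly a z N = tpoly b z N.
Proof.
  induction N as [|N IH]; intros H; simpl; auto. rewrite IH, H; auto.
Qed.

Lemma tpoly_sum_n (a : nat -> C) (z : C) (N : nat) :
  sum_n (fun k => a k * z ^ k)%C N = tpoly a z (S N).
Proof.
  induction N as [|N IH].
  - rewrite sum_O. simpl. ring.
  - rewrite sum_Sn, IH; reflexivity.
Qed.

Lemma partial_sum_tpoly (a : nat -> C) (z : C) (N : nat) : partial_sum a z N = tpoly a z N.
Proof. destruct N; auto. apply tpoly_sum_n. Qed.

Lemma tpoly_is_pseries (a : nat -> C) (z l : C) (M q : R) :
  0 <= q < 1 -> (forall N, Cmod (l - tpoly a z N)%C <= M * q ^ N) ->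
  is_pseries (K := C_AbsRing) (V := C_NormedModule) a z l.
Proof.
  intros Hq H. unfold is_pseries, is_series.
  apply filterlim_locally. intros eps.
  assert (HM : 0 <= M).
  { specialize (H O). simpl in H. generalize (Cmod_ge_0 (l - RtoC 0)%C). lra. }
  assert (L := is_lim_seq_geom q ltac:(rewrite Rabs_pos_eq; lra)).
  apply is_lim_seq_spec in L.
  assert (He : 0 < eps / (1 + M)). { apply Rdiv_lt_0_compat. apply cond_pos. lra. }
  destruct (L (mkposreal _ He)) as [N HN].
  exists N. intros n Hn.
  apply (norm_compat1 (V := C_NormedModule)).
  change (Cmod (sum_n (fun k => (pow_n (K := C_Ring) z k * a k)%C) n - l)%C < eps).
  replace (sum_n (fun k => (pow_n (K := C_Ring) z k * a k)%C) n) with (tpoly a z (S n)).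
  - rewrite Cmod_sub_sym. eapply Rle_lt_trans; [apply H|].
    specialize (HN (S n) ltac:(lia)). simpl pos in HN. rewrite Rminus_0_r in HN.
    rewrite Rabs_pos_eq in HN by (apply pow_le; lra).
    apply (Rmult_lt_compat_r (1 + M)) in HN; [|lra].
    replace (eps / (1 + M) * (1 + M)) with (pos eps) in HN by (field; lra).
    assert (0 <= q ^ S n) by (apply pow_le; lra). nra.
  - rewrite <- tpoly_sum_n. apply sum_n_ext. intros k. apply Cmult_comm.
Qed.

(** * Laplace integrals *)

Lemma is_RInt_exp_decay (A mu u v : R) : 0 < mu ->
  is_RInt (fun x => A * exp (- mu * x)) u v (A / mu * exp (- mu * u) - A / mu * exp (- mu * v)).
Proof.
  intros Hmu.
  replace (A / mu * exp (- mu * u) - A / mu * exp (- mu * v)) with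
    (minus (- (A / mu) * exp (- mu * v)) (- (A / mu) * exp (- mu * u)))
    by (unfold minus, plus, opp; simpl; ring).
  apply (is_RInt_derive (V := R_CompleteNormedModule) (fun x => - (A / mu) * exp (- mu * x))).
  - intros x _. auto_derive; auto. field. lra.
  - intros x _. apply (ex_derive_continuous (V := R_NormedModule)). auto_derive. auto.
Qed.

Lemma pow_exp_bound (n : nat) (x : R) : 0 <= x -> x ^ n <= INR (fact n) * exp x.
Proof.
  intros Hx. assert (H := exp_ge_taylor x n Hx).
  assert (Hf : 0 < INR (fact n)) by (apply INR_fact_lt_0).
  assert (T : x ^ n / INR (fact n) <= exp x).
  { eapply Rle_trans; [|exact H]. destruct n as [|n]; [simpl; lra|]. rewrite tech5.
    assert (0 <= sum_f_R0 (fun k => x ^ k / INR (fact k)) n).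
    { apply cond_pos_sum. intros k. apply Rle_mult_inv_pos. apply pow_le; auto. apply INR_fact_lt_0. }
    lra. }
  apply Rle_div_l in T; auto. lra.
Qed.

(** Integration by parts: the boundary term at [b] is negative, so every truncated Gamma integral
    already obeys the bound for the full one. *)
Lemma pow_exp_integral (n : nat) (mu b : R) : 0 < mu -> 0 <= b ->
  exists J, is_RInt (fun x => x ^ n * exp (- mu * x)) 0 b J /\ J <= INR (fact n) / mu ^ (n + 1).
Proof.
  intros Hmu Hb. induction n as [|n [J [IH1 IH2]]].
  - exists (1 / mu * exp (- mu * 0) - 1 / mu * exp (- mu * b)). split.
    + eapply is_RInt_ext; [|apply is_RInt_exp_decay; auto]. intros x _. simpl. ring.
    + rewrite Rmult_0_r, exp_0. simpl.
      assert (0 < 1 / mu * exp (- mu * b)).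
      { apply Rmult_lt_0_compat. apply Rdiv_lt_0_compat; lra. apply exp_pos. }
      rewrite !Rmult_1_r. lra.
  - exists (INR (S n) / mu * J + (0 - b ^ S n / mu * exp (- mu * b))). split.
    + assert (D : is_RInt (fun x => x ^ S n * exp (- mu * x) - INR (S n) / mu * (x ^ n * exp (- mu * x))) 0 b
        (minus (- (b ^ S n / mu * exp (- mu * b))) (- (0 ^ S n / mu * exp (- mu * 0))))).
      { apply (is_RInt_derive (V := R_CompleteNormedModule) (fun x => - (x ^ S n / mu * exp (- mu * x)))).
        - intros x _. auto_derive; auto.
          change (match n with O => 1 | S _ => INR n + 1 end) with (INR (S n)).
          change (x ^ S n) with (x * x ^ n). field. lra.
        - intros x _. apply (ex_derive_continuous (V := R_NormedModule)). auto_derive. auto. }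
      apply (is_RInt_scal (V := R_NormedModule) _ _ _ (INR (S n) / mu)) in IH1.
      assert (HS := is_RInt_plus (V := R_NormedModule) _ _ _ _ _ _ IH1 D).
      match type of HS with is_RInt _ _ _ ?l =>
        replace (INR (S n) / mu * J + (0 - b ^ S n / mu * exp (- mu * b))) with l end.
      * eapply is_RInt_ext; [|exact HS]. intros x _.
        change (INR (S n) / mu * (x ^ n * exp (- mu * x)) +
          (x ^ S n * exp (- mu * x) - INR (S n) / mu * (x ^ n * exp (- mu * x))) = x ^ S n * exp (- mu * x)).
        ring.
      * change (INR (S n) / mu * J + (- (b ^ S n / mu * exp (- mu * b)) - - (0 ^ S n / mu * exp (- mu * 0))) =
          INR (S n) / mu * J + (0 - b ^ S n / mu * exp (- mu * b))).
        rewrite pow_i by lia. field. lra.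
    + assert (0 <= b ^ S n / mu * exp (- mu * b)).
      { apply Rmult_le_pos. apply Rle_mult_inv_pos; auto. apply pow_le; auto. left; apply exp_pos. }
      assert (INR (S n) / mu * J <= INR (S n) / mu * (INR (fact n) / mu ^ (n + 1))).
      { apply Rmult_le_compat_l; auto. apply Rle_mult_inv_pos; auto. apply pos_INR. }
      replace (INR (fact (S n)) / mu ^ (S n + 1)) with (INR (S n) / mu * (INR (fact n) / mu ^ (n + 1))).
      * lra.
      * rewrite fact_simpl, mult_INR. simpl (mu ^ (S n + 1)). field.
        split; [|lra]. apply pow_nonzero. lra.
Qed.

(** * Improper integrals on the half-line *)

Definition improper (f : R -> C) (l : C) : Prop :=
  (forall x, 0 <= x -> rcont f x) /\ cseq_lim (fun n => CInt f 0 (INR n)) l.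

Lemma improper_minus (f g : R -> C) (l m : C) :
  improper f l -> improper g m -> improper (fun x => f x - g x)%C (l - m)%C.
Proof.
  intros [Cf Hf] [Cg Hg]. split.
  - intros x Hx. apply (rcont_ext_eq (fun x => f x + (- (1)) * g x)%C). intros; ring.
    apply rcont_plus; auto. apply rcont_mult; auto. apply rcont_const.
  - assert (H := cseq_lim_minus _ _ _ _ Hf Hg). intros e He. destruct (H e He) as [N HN].
    exists N. intros n Hn. specialize (HN n Hn).
    replace (CInt (fun x => f x - g x)%C 0 (INR n)) with (CInt f 0 (INR n) - CInt g 0 (INR n))%C; auto.
    symmetry. apply is_CInt_unique. apply is_CInt_minus; apply CInt_correct; try apply pos_INR;
    intros x Hx; [apply Cf|apply Cg]; lra.
Qed.

Lemma improper_cmult (c : C) (f : R -> C) (l : C) :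
  improper f l -> improper (fun x => c * f x)%C (c * l)%C.
Proof.
  intros [Cf Hf]. split.
  - intros x Hx. apply rcont_mult; auto. apply rcont_const.
  - assert (H := cseq_lim_cmult c _ _ Hf). intros e He. destruct (H e He) as [N HN].
    exists N. intros n Hn. specialize (HN n Hn).
    replace (CInt (fun x => c * f x)%C 0 (INR n)) with (c * CInt f 0 (INR n))%C; auto.
    symmetry. apply is_CInt_unique. apply is_CInt_cmult; apply CInt_correct; try apply pos_INR.
    intros x Hx. apply Cf; lra.
Qed.

Lemma improper_ext (f g : R -> C) (l : C) : (forall x, f x = g x) -> improper f l -> improper g l.
Proof. intros E. replace g with f; auto. apply functional_extensionality; auto. Qed.

Lemma improper_tail (f : R -> C) (A mu : R) (l : C) : 0 < mu ->
  (forall x, 0 <= x -> Cmod (f x) <= A * exp (- mu * x)) -> improper f l ->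
  forall b, 0 <= b -> Cmod (CInt f 0 b - l)%C <= A / mu * exp (- mu * b).
Proof.
  intros Hmu HA [Cf Hl] b Hb.
  assert (HA0 : 0 <= A).
  { specialize (HA 0 (Rle_refl 0)). rewrite Rmult_0_r, exp_0 in HA. generalize (Cmod_ge_0 (f 0)). lra. }
  apply le_epsilon. intros e He. destruct (Hl e He) as [N HN].
  destruct (nfloor_ex b Hb) as [p Hp].
  set (n := (N + S p)%nat). specialize (HN n ltac:(unfold n; lia)).
  assert (Hbn : b <= INR n). { unfold n. rewrite plus_INR, S_INR. generalize (pos_INR N). lra. }
  assert (Hsplit : CInt f 0 (INR n) = (CInt f 0 b + CInt f b (INR n))%C).
  { apply is_CInt_unique. apply is_CInt_Chasles with b; apply CInt_correct; auto; intros x Hx; apply Cf; lra. }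
  assert (B : Cmod (CInt f b (INR n)) <= A / mu * exp (- mu * b) - A / mu * exp (- mu * INR n)).
  { eapply is_CInt_bound; [exact Hbn| |apply CInt_correct; auto|apply is_RInt_exp_decay; auto].
    - intros x Hx. apply HA. lra.
    - intros x Hx; apply Cf; lra. }
  assert (0 <= A / mu * exp (- mu * INR n)).
  { apply Rmult_le_pos. apply Rle_mult_inv_pos; auto. left; apply exp_pos. }
  replace (CInt f 0 b - l)%C with ((CInt f 0 (INR n) - l) - CInt f b (INR n))%C by (rewrite Hsplit; ring).
  eapply Rle_trans. apply Cmod_sub_le. lra.
Qed.

Lemma exp_decay_small (mu e : R) (C0 : R) : 0 < mu -> 0 < e -> 0 <= C0 ->
  exists b0, 0 <= b0 /\ forall b, b0 <= b -> C0 * exp (- mu * b) <= e.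
Proof.
  intros Hmu He HC. exists (C0 / (mu * e)). split. { apply Rle_mult_inv_pos; auto. nra. }
  intros b Hb. apply Rle_div_l in Hb; [|nra].
  replace (- mu * b) with (- (mu * b)) by ring. rewrite exp_Ropp.
  assert (H := exp_ineq1_le (mu * b)). assert (P := exp_pos (mu * b)).
  apply Rle_div_l; auto. nra.
Qed.

Lemma improper_exists (f : R -> C) (A mu : R) : 0 < mu ->
  (forall x, 0 <= x -> rcont f x) -> (forall x, 0 <= x -> Cmod (f x) <= A * exp (- mu * x)) ->
  exists l, improper f l.
Proof.
  intros Hmu Cf HA.
  assert (HA0 : 0 <= A).
  { specialize (HA 0 (Rle_refl 0)). rewrite Rmult_0_r, exp_0 in HA. generalize (Cmod_ge_0 (f 0)). lra. }
  assert (T : forall u v, 0 <= u <= v -> Cmod (CInt f 0 v - CInt f 0 u)%C <= A / mu * exp (- mu * u)).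
  { intros u v Huv.
    assert (Hsplit : CInt f 0 v = (CInt f 0 u + CInt f u v)%C).
    { apply is_CInt_unique. apply is_CInt_Chasles with u; apply CInt_correct; try lra; intros x Hx; apply Cf; lra. }
    replace (CInt f 0 v - CInt f 0 u)%C with (CInt f u v) by (rewrite Hsplit; ring).
    assert (0 <= A / mu * exp (- mu * v)).
    { apply Rmult_le_pos. apply Rle_mult_inv_pos; auto. left; apply exp_pos. }
    apply Rle_trans with (A / mu * exp (- mu * u) - A / mu * exp (- mu * v)); [|lra].
    eapply is_CInt_bound; [| |apply CInt_correct|apply is_RInt_exp_decay; auto]; try lra.
    - intros x Hx. apply HA. lra.
    - intros x Hx; apply Cf; lra. }
  destruct (cseq_cauchy (fun n => CInt f 0 (INR n))) as [l Hl].
  - intros e He. destruct (exp_decay_small mu e (A / mu)) as [b0 [Hb0 Hb]]; auto.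
    { apply Rle_mult_inv_pos; auto. }
    destruct (nfloor_ex b0 Hb0) as [N HN]. exists (S N).
    assert (HN' : forall n, (S N <= n)%nat -> b0 <= INR n).
    { intros n Hn. apply le_INR in Hn. rewrite S_INR in Hn. lra. }
    intros n m Hn Hm. destruct (Rle_dec (INR n) (INR m)) as [H|H].
    + rewrite Cmod_sub_sym. eapply Rle_trans. apply T. split; auto; apply pos_INR. auto.
    + eapply Rle_trans. apply T. split. apply pos_INR. lra. auto.
  - exists l. split; auto.
Qed.

(** [improper] tests integer upper bounds only; the exponentially small tails extend the limit to
    all real bounds, as the filter [Rbar_locally p_infty] requires. *)
Lemma improper_is_RInt_gen (f : R -> C) (A mu : R) (l : C) : 0 < mu ->
  (forall x, 0 <= x -> Cmod (f x) <= A * exp (- mu * x)) -> improper f l ->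
  is_RInt_gen (V := C_R_NormedModule) f (at_point 0) (Rbar_locally p_infty) l.
Proof.
  intros Hmu HA Hl.
  assert (HA0 : 0 <= A).
  { specialize (HA 0 (Rle_refl 0)). rewrite Rmult_0_r, exp_0 in HA. generalize (Cmod_ge_0 (f 0)). lra. }
  assert (T := improper_tail f A mu l Hmu HA Hl). destruct Hl as [Cf _].
  intros P [e He].
  destruct (exp_decay_small mu (e / 2) (A / mu)) as [b0 [Hb0 Hb]]; auto.
  { generalize (cond_pos e); lra. }
  { apply Rle_mult_inv_pos; auto. }
  apply (Filter_prod _ _ _ (fun a => a = 0) (fun b => b0 < b)).
  - reflexivity.
  - exists b0. auto.
  - intros a b -> Hbb. exists (CInt f 0 b). split.
    + simpl. apply CInt_correct. lra. intros x Hx. apply Cf. lra.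
    + apply He. apply (C_NormedModule_mixin_compat1 l (CInt f 0 b) e).
      change (Cmod (CInt f 0 b - l)%C < e).
      eapply Rle_lt_trans. apply T. lra. specialize (Hb b ltac:(lra)). generalize (cond_pos e). lra.
Qed.

Lemma improper_pow_bound (f : R -> C) (A mu : R) (n : nat) (l : C) : 0 < mu -> 0 <= A ->
  (forall x, 0 <= x -> Cmod (f x) <= A * (x ^ n * exp (- mu * x))) -> improper f l ->
  Cmod l <= A * (INR (fact n) / mu ^ (n + 1)).
Proof.
  intros Hmu HA0 HA [Cf Hl]. apply (cseq_lim_bound _ _ _ Hl). intros p.
  destruct (pow_exp_integral n mu (INR p) Hmu (pos_INR p)) as [J [HJ1 HJ2]].
  apply Rle_trans with (A * J).
  - eapply is_CInt_bound; [apply pos_INR| |apply CInt_correct; [apply pos_INR|]|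
      exact (is_RInt_scal (V := R_NormedModule) _ 0 (INR p) A _ HJ1)].
    + intros x Hx. apply HA. lra.
    + intros x Hx. apply Cf. lra.
  - apply Rmult_le_compat_l; auto.
Qed.

(** * Laplace transforms along rays *)

Definition laplace_kernel (omega : C -> C) (h xi : C) : C := (Cexp (- (xi / h)) * omega xi)%C.

Definition laplace_integrand (omega : C -> C) (theta : R) (h : C) (x : R) : C :=
  (laplace_kernel omega h (polar x theta) * cis theta)%C.

Lemma Re_polar_div (x theta : R) (h : C) : Re (polar x theta / h)%C = x * Re (cis theta / h)%C.
Proof.
  unfold polar, Cdiv. rewrite <- Cmult_assoc. unfold Re at 1. unfold Cmult at 1. simpl. ring.
Qed.

Lemma Cmod_laplace_kernel (omega : C -> C) (theta : R) (h : C) (x : R) :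
  Cmod (laplace_kernel omega h (polar x theta)) =
  exp (- (x * Re (cis theta / h)%C)) * Cmod (omega (polar x theta)).
Proof.
  unfold laplace_kernel. rewrite Cmod_mult, Cmod_Cexp. f_equal. f_equal.
  rewrite <- Re_polar_div. reflexivity.
Qed.

Lemma hol_laplace_kernel (omega : C -> C) (h xi : C) : h <> RtoC 0 ->
  hol omega xi -> hol (laplace_kernel omega h) xi.
Proof.
  intros Hh Ho. apply hol_mult; auto. apply (hol_comp Cexp (fun xi => - (xi / h))%C); [|apply hol_Cexp].
  apply hol_opp. apply hol_div; auto. apply hol_id. apply hol_const.
Qed.

Definition sectorial (alpha eta A K : R) (omega : C -> C) : Prop :=
  forall x theta, 0 <= x -> Rabs (theta - alpha) <= eta ->
    hol omega (polar x theta) /\ Cmod (omega (polar x theta)) <= A * exp (K * x).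

Lemma laplace_integrand_bound (alpha eta A K : R) (omega : C -> C) (theta : R) (h : C) (x : R) :
  sectorial alpha eta A K omega -> Rabs (theta - alpha) <= eta -> 0 <= x ->
  Cmod (laplace_integrand omega theta h x) <= A * exp (- (Re (cis theta / h)%C - K) * x).
Proof.
  intros Ho Ht Hx. unfold laplace_integrand. rewrite Cmod_mult, Cmod_cis, Rmult_1_r, Cmod_laplace_kernel.
  destruct (Ho x theta Hx Ht) as [_ B].
  replace (A * exp (- (Re (cis theta / h)%C - K) * x)) with
    (exp (- (x * Re (cis theta / h)%C)) * (A * exp (K * x))).
  - apply Rmult_le_compat_l; auto. left; apply exp_pos.
  - replace (- (Re (cis theta / h)%C - K) * x) with (- (x * Re (cis theta / h)%C) + K * x) by ring.
    rewrite exp_plus. ring.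
Qed.

(** The inverse of 0 is 0 here, so at [h = 0] the real part is 0 and cannot exceed a nonnegative
    [K]. *)
Lemma Re_div_pos_neq_0 (theta K : R) (h : C) : 0 <= K -> K < Re (cis theta / h)%C -> h <> RtoC 0.
Proof.
  intros HK H E. subst h.
  assert (X : (/ RtoC 0)%C = RtoC 0).
  { unfold Cinv, RtoC; simpl. unfold Rdiv. f_equal; ring. }
  unfold Cdiv in H. rewrite X in H. replace (cis theta * RtoC 0)%C with (RtoC 0) in H by ring.
  change (K < 0) in H. lra.
Qed.

Lemma rcont_laplace_integrand (alpha eta A K : R) (omega : C -> C) (theta : R) (h : C) (x : R) :
  sectorial alpha eta A K omega -> Rabs (theta - alpha) <= eta -> h <> RtoC 0 -> 0 <= x ->
  rcont (laplace_integrand omega theta h) x.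
Proof.
  intros Ho Ht Hh Hx. unfold laplace_integrand. apply (rcont_ray_integrand (laplace_kernel omega h)).
  apply hol_ccont. apply hol_laplace_kernel; auto. apply Ho; auto.
Qed.

Definition Lap (omega : C -> C) (theta : R) (h : C) : C :=
  epsilon (inhabits (RtoC 0)) (improper (laplace_integrand omega theta h)).

Lemma Lap_spec (alpha eta A K : R) (omega : C -> C) (theta : R) (h : C) :
  sectorial alpha eta A K omega -> Rabs (theta - alpha) <= eta -> 0 <= K -> K < Re (cis theta / h)%C ->
  improper (laplace_integrand omega theta h) (Lap omega theta h).
Proof.
  intros Ho Ht HK Hh. unfold Lap. apply epsilon_spec.
  apply (improper_exists _ A (Re (cis theta / h)%C - K)). lra.
  - intros x Hx. eapply rcont_laplace_integrand; eauto. apply (Re_div_pos_neq_0 theta K); auto.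
  - intros x Hx. eapply laplace_integrand_bound; eauto.
Qed.

Lemma Lap_is_Laplace (alpha eta A K : R) (omega : C -> C) (theta : R) (h : C) :
  sectorial alpha eta A K omega -> Rabs (theta - alpha) <= eta -> 0 <= K -> K < Re (cis theta / h)%C ->
  is_Laplace omega theta h (Lap omega theta h).
Proof.
  intros Ho Ht HK Hh.
  apply (improper_is_RInt_gen _ A (Re (cis theta / h)%C - K)). lra.
  - intros x Hx. eapply laplace_integrand_bound; eauto.
  - eapply Lap_spec; eauto.
Qed.

Lemma cis_between (t1 t2 t : R) :
  (RtoC (sin (t2 - t1)) * cis t)%C = (RtoC (sin (t2 - t)) * cis t1 + RtoC (sin (t - t1)) * cis t2)%C.
Proof.
  unfold cis, Cmult, Cplus, RtoC; simpl. rewrite !sin_minus. f_equal; ring.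
Qed.

(* [cis t] is a combination of [cis t1] and [cis t2] with nonnegative coefficients of sum at least 1. *)
Lemma Re_cis_div_between (t1 t2 t m : R) (h : C) :
  t1 <= t <= t2 -> t2 - t1 < PI -> 0 <= m ->
  m <= Re (cis t1 / h)%C -> m <= Re (cis t2 / h)%C -> m <= Re (cis t / h)%C.
Proof.
  intros Ht Hd Hm H1 H2.
  destruct (Req_dec t1 t2) as [E|E]. { replace t with t1 by lra. auto. }
  assert (Hs : 0 < sin (t2 - t1)) by (apply sin_gt_0; lra).
  assert (Sa : 0 <= sin (t2 - t)) by (apply sin_ge_0; lra).
  assert (Sb : 0 <= sin (t - t1)) by (apply sin_ge_0; lra).
  assert (Sum : sin (t2 - t1) <= sin (t2 - t) + sin (t - t1)).
  { replace (t2 - t1) with ((t2 - t) + (t - t1)) by ring. rewrite sin_plus.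
    generalize (COS_bound (t2 - t)) (COS_bound (t - t1)). nra. }
  assert (Eq : sin (t2 - t1) * Re (cis t / h)%C =
    sin (t2 - t) * Re (cis t1 / h)%C + sin (t - t1) * Re (cis t2 / h)%C).
  { rewrite <- !Re_RtoC_mult.
    change (Re (RtoC (sin (t2 - t1)) * (cis t / h))%C =
      Re (RtoC (sin (t2 - t)) * (cis t1 / h) + RtoC (sin (t - t1)) * (cis t2 / h))%C).
    f_equal. unfold Cdiv. rewrite !Cmult_assoc, cis_between. ring. }
  apply (Rmult_le_reg_l (sin (t2 - t1))); auto. rewrite Eq. nra.
Qed.

(** Goursat's theorem on the sector of radius n between the two rays: the inner arc degenerates at
    0, and the outer one is O(n exp (- (m - K) n)). As the two rays are less than [PI] apart, all
    directions in between keep a real part of at least [m]. *)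
Lemma Lap_rotate_lt (alpha eta A K : R) (omega : C -> C) (t1 t2 : R) (h : C) :
  sectorial alpha eta A K omega -> Rabs (t1 - alpha) <= eta -> Rabs (t2 - alpha) <= eta -> eta < PI / 2 ->
  0 <= K -> K < Re (cis t1 / h)%C -> K < Re (cis t2 / h)%C -> t1 <= t2 ->
  Lap omega t1 h = Lap omega t2 h.
Proof.
  intros Ho Ht1 Ht2 Heta HK H1 H2 Hlt.
  assert (Hh : h <> RtoC 0) by (apply (Re_div_pos_neq_0 t1 K); auto).
  assert (Hd : t2 - t1 < PI).
  { apply Rabs_le_between in Ht1. apply Rabs_le_between in Ht2. lra. }
  set (m := Rmin (Re (cis t1 / h)%C) (Re (cis t2 / h)%C)).
  assert (Hm : K < m) by (unfold m; apply Rmin_case; auto).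
  assert (HmB : forall t, t1 <= t <= t2 -> m <= Re (cis t / h)%C).
  { intros t Ht. apply (Re_cis_div_between t1 t2); auto. lra. apply Rmin_l. apply Rmin_r. }
  assert (Hin : forall t, t1 <= t <= t2 -> Rabs (t - alpha) <= eta).
  { intros t Ht. apply Rabs_le_between in Ht1. apply Rabs_le_between in Ht2. apply Rabs_le. lra. }
  assert (HA0 : 0 <= A).
  { destruct (Ho 0 t1 (Rle_refl 0) Ht1) as [_ B]. rewrite Rmult_0_r, exp_0 in B.
    generalize (Cmod_ge_0 (omega (polar 0 t1))). lra. }
  set (f := laplace_kernel omega h).
  assert (Hf : forall x t, 0 <= x -> t1 <= t <= t2 -> hol f (polar x t)).
  { intros x t Hx Ht. apply hol_laplace_kernel; auto. apply Ho; auto. }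
  assert (HfB : forall x t, 0 <= x -> t1 <= t <= t2 -> Cmod (f (polar x t)) <= A * exp (- (m - K) * x)).
  { intros x t Hx Ht. assert (B := laplace_integrand_bound alpha eta A K omega t h x Ho (Hin t Ht) Hx).
    unfold laplace_integrand in B. rewrite Cmod_mult, Cmod_cis, Rmult_1_r in B. fold f in B.
    eapply Rle_trans; [exact B|]. apply Rmult_le_compat_l; auto.
    specialize (HmB t Ht).
    destruct (Rle_lt_or_eq_dec (- (Re (cis t / h) - K) * x) (- (m - K) * x)) as [L|L]. nra.
    left; apply exp_increasing; auto. right; rewrite L; auto. }
  assert (P1 := Lap_spec alpha eta A K omega t1 h Ho Ht1 HK H1).
  assert (P2 := Lap_spec alpha eta A K omega t2 h Ho Ht2 HK H2).
  assert (Hdiff : forall n, Cmod (CInt (laplace_integrand omega t1 h) 0 (INR n)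
     - CInt (laplace_integrand omega t2 h) 0 (INR n))%C <= (t2 - t1) * (A * (exp (- (m - K) * INR n) * INR n))).
  { intros n. assert (Hn := pos_INR n).
    assert (G : bdry_int f 0 (INR n) t1 t2 = RtoC 0).
    { apply goursat; try lra. intros x t Hx Ht. apply Hf; lra. }
    unfold bdry_int in G.
    assert (Z : arc_int f 0 t1 t2 = RtoC 0).
    { unfold arc_int. apply is_CInt_unique. apply is_CInt_ext with (fun _ => RtoC 0); auto.
      - intros y _. unfold polar. ring.
      - assert (X := is_CInt_const (RtoC 0) t1 t2).
        replace (RtoC (t2 - t1) * RtoC 0)%C with (RtoC 0) in X by ring. exact X. }
    rewrite Z in G.
    change (CInt (laplace_integrand omega t1 h) 0 (INR n)) with (ray_int f t1 0 (INR n)).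
    change (CInt (laplace_integrand omega t2 h) 0 (INR n)) with (ray_int f t2 0 (INR n)).
    replace (ray_int f t1 0 (INR n) - ray_int f t2 0 (INR n))%C with (- arc_int f (INR n) t1 t2)%C.
    - rewrite Cmod_opp. eapply is_CInt_bound_const; [auto| |apply arc_int_correct; auto].
      + intros t Ht. cbv beta. rewrite !Cmod_mult, Cmod_Ci, Cmod_polar, Rmult_1_l by auto.
        rewrite <- Rmult_assoc. apply Rmult_le_compat_r; auto.
      + intros t Ht. apply hol_ccont. apply Hf; auto.
    - transitivity (- arc_int f (INR n) t1 t2 + (ray_int f t1 0 (INR n) + arc_int f (INR n) t1 t2 -
         ray_int f t2 0 (INR n) - RtoC 0))%C. rewrite G; ring. ring. }
  assert (D := improper_minus _ _ _ _ P1 P2).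
  assert (E : (Lap omega t1 h - Lap omega t2 h)%C = RtoC 0).
  { apply (cseq_lim_unique (fun n => CInt (laplace_integrand omega t1 h) 0 (INR n)
     - CInt (laplace_integrand omega t2 h) 0 (INR n))%C).
    - apply cseq_lim_minus. apply P1. apply P2.
    - intros e He.
      (* Half of the decay rate absorbs the length factor n of the outer arc; the other half tends
         to 0. *)
      set (mu := (m - K) / 2). assert (Hmu : 0 < mu) by (unfold mu; lra).
      destruct (exp_decay_small mu e ((t2 - t1) * (A / mu))) as [b0 [Hb0 Hb]]; auto.
      { apply Rmult_le_pos. lra. apply Rle_mult_inv_pos; auto. }
      destruct (nfloor_ex b0 Hb0) as [N HN]. exists (S N). intros n Hn.
      replace (CInt (laplace_integrand omega t1 h) 0 (INR n)
         - CInt (laplace_integrand omega t2 h) 0 (INR n) - RtoC 0)%C with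
        (CInt (laplace_integrand omega t1 h) 0 (INR n)
         - CInt (laplace_integrand omega t2 h) 0 (INR n))%C by ring.
      eapply Rle_trans. apply Hdiff.
      apply le_INR in Hn. rewrite S_INR in Hn. specialize (Hb (INR n) ltac:(lra)).
      eapply Rle_trans; [|exact Hb]. rewrite Rmult_assoc. apply Rmult_le_compat_l. lra.
      unfold Rdiv. rewrite Rmult_assoc. apply Rmult_le_compat_l; auto.
      replace (- (m - K) * INR n) with (- mu * INR n + - mu * INR n) by (unfold mu; field).
      rewrite exp_plus.
      assert (X := exp_ineq1_le (mu * INR n)). assert (Hn0 := pos_INR n).
      assert (Y : exp (- mu * INR n) * exp (mu * INR n) = 1).
      { rewrite <- exp_plus. replace (- mu * INR n + mu * INR n) with 0 by ring. apply exp_0. }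
      assert (W := exp_pos (- mu * INR n)).
      assert (exp (- mu * INR n) * INR n <= / mu).
      { apply (Rmult_le_reg_r mu); auto. rewrite Rinv_l by lra. nra. }
      nra. }
  replace (Lap omega t1 h) with (Lap omega t1 h - Lap omega t2 h + Lap omega t2 h)%C by ring.
  rewrite E. ring.
Qed.

Lemma Lap_rotate (alpha eta A K : R) (omega : C -> C) (t1 t2 : R) (h : C) :
  sectorial alpha eta A K omega -> Rabs (t1 - alpha) <= eta -> Rabs (t2 - alpha) <= eta -> eta < PI / 2 ->
  0 <= K -> K < Re (cis t1 / h)%C -> K < Re (cis t2 / h)%C ->
  Lap omega t1 h = Lap omega t2 h.
Proof.
  intros. destruct (Rle_dec t1 t2).
  - eapply Lap_rotate_lt; eauto.
  - symmetry. eapply Lap_rotate_lt; eauto. lra.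
Qed.

Lemma Re_cis_div_cont (theta : R) (h : C) (e : R) : h <> RtoC 0 -> 0 < e ->
  exists d, 0 < d /\ forall k, Cmod (k - h)%C < d ->
    k <> RtoC 0 /\ Re (cis theta / h)%C - e <= Re (cis theta / k)%C.
Proof.
  intros Hh He.
  assert (Hc : ccont (fun k => cis theta / k)%C h).
  { apply ccont_mult. apply ccont_const. apply ccont_inv; auto. apply ccont_id. }
  destruct (Hc e He) as [d [Hd Hk]].
  apply Cmod_gt_0 in Hh.
  exists (Rmin d (Cmod h)). split. { apply Rmin_case; auto. }
  intros k Hkd.
  destruct (Rmin_Rgt_l _ _ _ Hkd) as [K1 K2].
  split.
  - intros ->. replace (RtoC 0 - h)%C with (- h)%C in K2 by ring. rewrite Cmod_opp in K2. lra.
  - specialize (Hk (k - h)%C K1). replace (h + (k - h))%C with k in Hk by ring.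
    assert (X := re_le_Cmod (cis theta / k - cis theta / h)%C).
    change (Re (cis theta / k - cis theta / h)%C) with (Re (cis theta / k)%C - Re (cis theta / h)%C) in X.
    apply Rabs_le_between in X. 
    assert (Hr : Rabs (Re (cis theta / k)%C - Re (cis theta / h)%C) <= e).
    { eapply Rle_trans; [|exact Hk]. apply Rabs_le. lra. }
    apply Rabs_le_between in Hr. lra.
Qed.

(** On a disc about [h] where half of the margin over [K] survives, the truncated integrals satisfy
    [quadratic_at] with one constant, and the inequality passes to the improper integral. *)
Lemma Lap_hol (alpha eta A K : R) (omega : C -> C) (theta : R) (h : C) :
  sectorial alpha eta A K omega -> Rabs (theta - alpha) <= eta -> 0 <= K -> K < Re (cis theta / h)%C ->
  hol (Lap omega theta) h.
Proof.
  intros Ho Ht HK Hh.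
  assert (Hh0 : h <> RtoC 0) by (apply (Re_div_pos_neq_0 theta K); auto).
  set (mu := (Re (cis theta / h)%C - K) / 2). assert (Hmu : 0 < mu) by (unfold mu; lra).
  destruct (Re_cis_div_cont theta h mu Hh0 Hmu) as [r [Hr Hk]].
  assert (HA0 : 0 <= A).
  { destruct (Ho 0 theta (Rle_refl 0) Ht) as [_ B]. rewrite Rmult_0_r, exp_0 in B.
    generalize (Cmod_ge_0 (omega (polar 0 theta))). lra. }
  assert (Hk2 : forall k, Cmod (k - h)%C < r -> K + mu <= Re (cis theta / k)%C).
  { intros k Hkr. destruct (Hk k Hkr) as [_ B]. unfold mu in *. lra. }
  apply (quadratic_at_hol _ h (32 * (A / mu) / r ^ 2) (r / 4)). lra.
  intros k k' Hk1 Hk1'.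
  assert (L : forall x, Cmod x < r / 4 \/ x = RtoC 0 ->
    cseq_lim (fun n => CInt (laplace_integrand omega theta (h + x)%C) 0 (INR n)) (Lap omega theta (h + x)%C)).
  { intros x Hx. eapply Lap_spec; eauto.
    assert (X : Cmod (h + x - h)%C < r).
    { replace (h + x - h)%C with x by ring. destruct Hx as [Hx| ->]. lra. rewrite Cmod_0. auto. }
    specialize (Hk2 _ X). lra. }
  assert (L0 : cseq_lim (fun n => CInt (laplace_integrand omega theta h) 0 (INR n)) (Lap omega theta h)).
  { specialize (L (RtoC 0) (or_intror eq_refl)). replace (h + RtoC 0)%C with h in L by ring. exact L. }
  apply (cseq_lim_bound (fun n =>
    k' * (CInt (laplace_integrand omega theta (h + k)%C) 0 (INR n) - CInt (laplace_integrand omega theta h) 0 (INR n))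
    - k * (CInt (laplace_integrand omega theta (h + k')%C) 0 (INR n) - CInt (laplace_integrand omega theta h) 0 (INR n)))%C).
  - apply cseq_lim_minus; apply cseq_lim_cmult; (apply cseq_lim_minus; [apply L; left; assumption|exact L0]).
  - intros n. assert (Hn := pos_INR n).
    assert (Q := hol_integral (laplace_integrand omega theta)
      (fun h => CInt (laplace_integrand omega theta h) 0 (INR n)) (fun x => A * exp (- mu * x)) h 0 (INR n)
      (A / mu * exp (- mu * 0) - A / mu * exp (- mu * INR n)) r Hr Hn).
    eapply Rle_trans. { apply Q; auto.
      - intros z s Hz Hs. unfold laplace_integrand, laplace_kernel.
        apply hol_mult; [|apply hol_const]. apply hol_mult; [|apply hol_const].
        apply (hol_comp Cexp (fun z => - (polar s theta / z))%C); [|apply hol_Cexp].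
        apply hol_opp. apply hol_div. apply hol_const. apply hol_id. apply Hk; auto.
      - intros z s Hz Hs. eapply Rle_trans. { eapply laplace_integrand_bound; eauto. lra. }
        apply Rmult_le_compat_l; auto. specialize (Hk2 z Hz).
        destruct (Rle_lt_or_eq_dec (- (Re (cis theta / z) - K) * s) (- mu * s)) as [X|X]. nra.
        left; apply exp_increasing; auto. right; rewrite X; auto.
      - apply is_RInt_exp_decay; auto.
      - intros z Hz. apply CInt_correct; auto. intros x Hx.
        eapply rcont_laplace_integrand; eauto. apply Hk; auto. lra. }
    apply Rmult_le_compat_r.
    { generalize (Cmod_ge_0 k) (Cmod_ge_0 k'). intros. apply Rmult_le_pos; nra. }
    apply Rmult_le_compat_r. { left. apply Rinv_0_lt_compat. apply pow_lt; auto. }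
    apply Rmult_le_compat_l. lra.
    rewrite Rmult_0_r, exp_0, Rmult_1_r.
    assert (0 <= A / mu * exp (- mu * INR n)).
    { apply Rmult_le_pos. apply Rle_mult_inv_pos; auto. left; apply exp_pos. }
    lra.
Qed.

(** * Laplace transforms of polynomials and asymptotic expansions *)

Definition monomial_integrand (theta : R) (h : C) (k : nat) (x : R) : C :=
  (Cexp (- (polar x theta / h)) * polar x theta ^ k * cis theta)%C.

(** The primitive carries two free constants so that one formula serves twice: [c = 0], [d = - h]
    integrates the pure exponential, and [c = 1], [d = 0] is the integration by parts that raises
    the power. *)
Lemma rdiff_monomial (theta : R) (h : C) (k : nat) (x : R) (c d : C) : h <> RtoC 0 ->
  rdiff (fun x => Cexp (- (polar x theta / h)) * (c * polar x theta ^ S k + d))%C x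
    (RtoC (INR (S k)) * c * monomial_integrand theta h k x
       - (c * monomial_integrand theta h (S k) x + d * monomial_integrand theta h 0 x) / h)%C.
Proof.
  intros Hh.
  assert (H : cdiff (fun xi => Cexp (- (xi / h)) * (c * xi ^ S k + d))%C (polar x theta)
    (Cexp (- (polar x theta / h)) * (- / h) * (c * polar x theta ^ S k + d)
      + Cexp (- (polar x theta / h)) * (c * (RtoC (INR (S k)) * polar x theta ^ k)))%C).
  { eapply cdiff_eq.
    { apply cdiff_mult.
      { apply (cdiff_comp Cexp (fun xi => - (xi / h))%C). apply cdiff_Cexp.
        apply cdiff_opp. apply cdiff_mult. apply cdiff_id. apply cdiff_const. }
      apply cdiff_plus; [|apply cdiff_const]. apply cdiff_mult. apply cdiff_const.
      apply (cdiff_pow (fun xi => xi)). apply cdiff_id. }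
    cbv beta. replace (S k - 1)%nat with k by lia. ring. }
  assert (D := rdiff_comp _ (fun x => polar x theta) x _ _ H (rdiff_ray x theta)).
  intros e He. destruct (D e He) as [dl [Hdl Hk]]. exists dl. split; auto. intros y Hy.
  specialize (Hk y Hy).
  replace (RtoC (INR (S k)) * c * monomial_integrand theta h k x
       - (c * monomial_integrand theta h (S k) x + d * monomial_integrand theta h 0 x) / h)%C
    with (cis theta * (Cexp (- (polar x theta / h)) * (- / h) * (c * polar x theta ^ S k + d)
      + Cexp (- (polar x theta / h)) * (c * (RtoC (INR (S k)) * polar x theta ^ k))))%C.
  - exact Hk.
  - unfold monomial_integrand. rewrite Cpow_S. simpl ((polar x theta) ^ 0)%C. field. auto.
Qed.

Lemma rcont_monomial (theta : R) (h : C) (k : nat) (x : R) : h <> RtoC 0 ->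
  rcont (monomial_integrand theta h k) x.
Proof.
  intros Hh. apply (rcont_ray_integrand (fun xi => Cexp (- (xi / h)) * xi ^ k)%C).
  apply hol_ccont. apply hol_mult.
  - apply (hol_comp Cexp (fun xi => - (xi / h))%C); [|apply hol_Cexp].
    apply hol_opp. apply hol_div; auto. apply hol_id. apply hol_const.
  - apply (hol_pow (fun x => x)). apply hol_id.
Qed.

(** Half of the exponential pays for the power through [pow_exp_bound]; the other half tends to
    0. *)
Lemma boundary_term_lim (theta : R) (h : C) (k : nat) : 0 < Re (cis theta / h)%C ->
  cseq_lim (fun n => Cexp (- (polar (INR n) theta / h)) * polar (INR n) theta ^ k)%C (RtoC 0).
Proof.
  intros Hs. set (mu := Re (cis theta / h)%C) in *.
  intros e He.
  assert (Hf : 0 < INR (fact k)) by apply INR_fact_lt_0.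
  assert (Hp : 0 < (2 / mu) ^ k). { apply pow_lt. apply Rdiv_lt_0_compat; lra. }
  destruct (exp_decay_small (mu / 2) e ((2 / mu) ^ k * INR (fact k))) as [b0 [Hb0 Hb]]; try lra.
  { apply Rmult_le_pos; lra. }
  destruct (nfloor_ex b0 Hb0) as [N HN]. exists (S N). intros n Hn.
  apply le_INR in Hn. rewrite S_INR in Hn. specialize (Hb (INR n) ltac:(lra)).
  eapply Rle_trans; [|exact Hb]. set (x := INR n) in *. assert (Hx : 0 <= x) by apply pos_INR.
  replace (Cexp (- (polar x theta / h)) * polar x theta ^ k - RtoC 0)%C with
    (Cexp (- (polar x theta / h)) * polar x theta ^ k)%C by ring.
  rewrite Cmod_mult, Cmod_Cexp, Cmod_pow, Cmod_polar by auto.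
  change (Re (- (polar x theta / h))%C) with (- Re (polar x theta / h)%C).
  rewrite Re_polar_div. fold mu.
  assert (B := pow_exp_bound k (mu / 2 * x) ltac:(nra)).
  replace (x ^ k) with ((2 / mu) ^ k * (mu / 2 * x) ^ k).
  - replace (- (x * mu)) with (- (mu / 2) * x + - (mu / 2) * x) by field. rewrite exp_plus.
    set (E := exp (- (mu / 2) * x)) in *. assert (HE : 0 < E) by apply exp_pos.
    assert (Y : E * exp (mu / 2 * x) = 1).
    { unfold E. rewrite <- exp_plus. replace (- (mu / 2) * x + mu / 2 * x) with 0 by ring. apply exp_0. }
    apply Rle_trans with (E * ((2 / mu) ^ k * (E * (INR (fact k) * exp (mu / 2 * x))))).
    + replace (E * E * ((2 / mu) ^ k * (mu / 2 * x) ^ k)) with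
        (E * ((2 / mu) ^ k * (E * (mu / 2 * x) ^ k))) by ring.
      repeat (apply Rmult_le_compat_l; [lra|]). auto.
    + right. transitivity ((2 / mu) ^ k * INR (fact k) * E * (E * exp (mu / 2 * x))). ring.
      rewrite Y. ring.
  - rewrite <- Rpow_mult_distr. f_equal. field. lra.
Qed.

Lemma improper_monomial (theta : R) (h : C) (k : nat) : 0 < Re (cis theta / h)%C ->
  improper (monomial_integrand theta h k) (RtoC (INR (fact k)) * h ^ S k)%C.
Proof.
  intros Hs.
  assert (Hh : h <> RtoC 0) by (apply (Re_div_pos_neq_0 theta 0); lra).
  induction k as [|k [_ IH]].
  - split. { intros; apply rcont_monomial; auto. }
    assert (L := boundary_term_lim theta h 0 Hs).
    assert (L2 := cseq_lim_minus _ _ _ _ (cseq_lim_const h) (cseq_lim_cmult h _ _ L)).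
    intros e He. destruct (L2 e He) as [N HN]. exists N. intros n Hn. specialize (HN n Hn).
    replace (RtoC (INR (fact 0)) * h ^ 1)%C with (h - h * RtoC 0)%C by (simpl; ring).
    replace (CInt (monomial_integrand theta h 0) 0 (INR n)) with
      (h - h * (Cexp (- (polar (INR n) theta / h)) * polar (INR n) theta ^ 0))%C; auto.
    symmetry. apply is_CInt_unique.
    assert (D := is_CInt_derive _ _ 0 (INR n) (pos_INR n)
      (fun x _ => rdiff_monomial theta h 0 x (RtoC 0) (- h)%C Hh)).
    eapply is_CInt_ext; [apply pos_INR| |
      match goal with |- is_CInt _ _ _ ?l => replace l with
        (Cexp (- (polar (INR n) theta / h)) * (RtoC 0 * polar (INR n) theta ^ 1 + - h) -
         Cexp (- (polar 0 theta / h)) * (RtoC 0 * polar 0 theta ^ 1 + - h))%C end; [apply D|]].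
    + intros x _. cbv beta. field. auto.
    + intros x _. apply (rcont_ext_eq (monomial_integrand theta h 0)).
      * intros y. field. auto.
      * apply rcont_monomial; auto.
    + replace (polar 0 theta) with (RtoC 0) by (unfold polar; ring).
      replace (- (RtoC 0 / h))%C with (RtoC 0) by (field; auto). rewrite Cexp_0. simpl. ring.
  - split. { intros; apply rcont_monomial; auto. }
    assert (L := boundary_term_lim theta h (S k) Hs).
    assert (L2 := cseq_lim_minus _ _ _ _ (cseq_lim_cmult (RtoC (INR (S k)) * h)%C _ _ IH) (cseq_lim_cmult h _ _ L)).
    intros e He. destruct (L2 e He) as [N HN]. exists N. intros n Hn. specialize (HN n Hn).
    replace (RtoC (INR (fact (S k))) * h ^ S (S k))%C with
      (RtoC (INR (S k)) * h * (RtoC (INR (fact k)) * h ^ S k) - h * RtoC 0)%C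
      by (rewrite fact_simpl, mult_INR, RtoC_mult, (Cpow_S h (S k)); ring).
    set (F := (Cexp (- (polar (INR n) theta / h)) * polar (INR n) theta ^ S k)%C) in *.
    set (G := CInt (monomial_integrand theta h k) 0 (INR n)) in *.
    replace (CInt (monomial_integrand theta h (S k)) 0 (INR n)) with
      (RtoC (INR (S k)) * h * G - h * F)%C; auto.
    symmetry. apply is_CInt_unique.
    assert (D := is_CInt_derive _ _ 0 (INR n) (pos_INR n)
      (fun x _ => rdiff_monomial theta h k x (RtoC 1) (RtoC 0) Hh)).
    assert (Gi : is_CInt (monomial_integrand theta h k) 0 (INR n) G).
    { apply CInt_correct. apply pos_INR. intros; apply rcont_monomial; auto. }
    apply (is_CInt_cmult (RtoC (INR (S k)) * h)%C) in Gi.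
    assert (D' := fun H => is_CInt_cmult h _ _ _ _ (D H)). clear D.
    assert (S' := fun H => is_CInt_minus _ _ _ _ _ _ Gi (D' H)). clear D'.
    match type of S' with _ -> is_CInt _ _ _ ?l =>
      replace (RtoC (INR (S k)) * h * G - h * F)%C with l end.
    + eapply is_CInt_ext; [apply pos_INR| |apply S'].
      * intros x _. cbv beta. field. auto.
      * intros x _. apply (rcont_ext_eq (fun x => RtoC (INR (S k)) * monomial_integrand theta h k x
          + - / h * monomial_integrand theta h (S k) x)%C).
        -- intros y. field. auto.
        -- apply rcont_plus; apply rcont_mult; try apply rcont_const; apply rcont_monomial; auto.
    + replace (polar 0 theta) with (RtoC 0) by (unfold polar; ring).
      rewrite (Cpow_S (RtoC 0)). unfold F. ring.
Qed.

Lemma tpoly_head (a : nat -> C) (z : C) (N : nat) :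
  tpoly a z (S N) = (a O + z * tpoly (fun k => a (S k)) z N)%C.
Proof.
  induction N as [|N IH]. { simpl. ring. }
  change (tpoly a z (S (S N))) with (tpoly a z (S N) + a (S N) * z ^ S N)%C. rewrite IH.
  simpl. ring.
Qed.

(** The Laplace transform undoes [borel_coef] term by term. The first [n] Borel coefficients
    correspond to the coefficients 1 to n of the series, whence [S n] and the removal of [a O]. *)
Lemma improper_tpoly (a : nat -> C) (theta : R) (h : C) (n : nat) : 0 < Re (cis theta / h)%C ->
  improper (fun x => Cexp (- (polar x theta / h)) * tpoly (borel_coef a) (polar x theta) n * cis theta)%C
    (tpoly a h (S n) - a O)%C.
Proof.
  intros Hs. rewrite tpoly_head.
  replace (a O + h * tpoly (fun k => a (S k)) h n - a O)%C with (h * tpoly (fun k => a (S k)) h n)%C by ring.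
  induction n as [|n IH].
  - simpl. apply (improper_ext (fun x => RtoC 0 * monomial_integrand theta h 0 x)%C).
    + intros x. ring.
    + replace (h * RtoC 0)%C with (RtoC 0 * (RtoC (INR (fact 0)) * h ^ 1))%C by ring.
      apply improper_cmult. apply improper_monomial. auto.
  - simpl. assert (M := improper_cmult (- borel_coef a n)%C _ _ (improper_monomial theta h n Hs)).
    assert (D := improper_minus _ _ _ _ IH M).
    replace (h * (tpoly (fun k => a (S k)) h n + a (S n) * h ^ n))%C with
      (h * tpoly (fun k => a (S k)) h n - - borel_coef a n * (RtoC (INR (fact n)) * h ^ S n))%C.
    + eapply improper_ext; [|exact D]. intros x. unfold monomial_integrand. cbv beta. ring.
    + unfold borel_coef. rewrite Cpow_S. field. apply RtoC_neq. apply INR_fact_neq_0.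
Qed.

(* Inside the disc of convergence the remainder is the one of the Taylor expansion; outside, both
   [omega] and the Taylor polynomial are dominated by the next monomial. *)
Definition borel_germ (a : nat -> C) (r0 B L : R) (omega : C -> C) : Prop :=
  0 < r0 /\ 0 <= B /\ 1 <= L * r0 /\ (forall k, Cmod (borel_coef a k) <= B * L ^ k) /\
  forall N z, Cmod z < r0 -> Cmod (omega z - tpoly (borel_coef a) z N)%C <= B * (L * Cmod z) ^ N.

(** Doubling the ratio absorbs the number of terms: for x >= 1 one has x^N + (2 x)^N <= (2
    x)^(N+1). *)
Lemma tpoly_outer_bound (b : nat -> C) (z : C) (B L : R) (N : nat) :
  0 <= B -> (forall k, Cmod (b k) <= B * L ^ k) -> 1 <= L * Cmod z ->
  Cmod (tpoly b z N) <= B * (2 * (L * Cmod z)) ^ N.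
Proof.
  intros HB Hb Hz. induction N as [|N IH].
  - simpl. rewrite Cmod_0. lra.
  - simpl. eapply Rle_trans. apply Cmod_triangle. rewrite Cmod_mult, Cmod_pow.
    assert (X : Cmod (b N) * Cmod z ^ N <= B * (L * Cmod z) ^ N).
    { rewrite Rpow_mult_distr, <- Rmult_assoc. apply Rmult_le_compat_r; auto. apply pow_le, Cmod_ge_0. }
    assert (Y : (L * Cmod z) ^ N <= (2 * (L * Cmod z)) ^ N) by (apply pow_incr; lra).
    assert (W : 0 <= (L * Cmod z) ^ N) by (apply pow_le; lra).
    assert (V : 0 <= B * (2 * (L * Cmod z)) ^ N) by (apply Rmult_le_pos; auto; apply pow_le; lra).
    assert (U : B * (L * Cmod z) ^ N <= B * (2 * (L * Cmod z)) ^ N) by (apply Rmult_le_compat_l; auto).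
    nra.
Qed.

Lemma borel_remainder_bound (alpha eta A K r0 B L : R) (a : nat -> C) (omega : C -> C) (theta x : R) (N : nat) :
  sectorial alpha eta A K omega -> Rabs (theta - alpha) <= eta -> 0 <= K -> 0 <= A ->
  borel_germ a r0 B L omega -> 0 <= x ->
  Cmod (omega (polar x theta) - tpoly (borel_coef a) (polar x theta) N)%C
    <= (A + B) * (2 * L) ^ N * (x ^ N * exp (K * x)).
Proof.
  intros Ho Ht HK HA [Hr0 [HB [HL [Hb Hg]]]] Hx.
  assert (HLp : 0 < L) by nra.
  assert (HE : 1 <= exp (K * x)). { generalize (exp_ineq1_le (K * x)). nra. }
  assert (Hm := Cmod_polar x theta Hx).
  assert (Hpow : 0 <= (L * x) ^ N) by (apply pow_le; nra).
  assert (E2 : (2 * L) ^ N * x ^ N = (2 * (L * x)) ^ N) by (rewrite <- Rpow_mult_distr; f_equal; ring).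
  replace ((A + B) * (2 * L) ^ N * (x ^ N * exp (K * x))) with ((A + B) * ((2 * L) ^ N * x ^ N) * exp (K * x)) by ring.
  rewrite E2.
  assert (Hpp : (L * x) ^ N <= (2 * (L * x)) ^ N) by (apply pow_incr; nra).
  destruct (Rlt_dec x r0) as [Hlt|Hge].
  - eapply Rle_trans. { apply Hg. rewrite Hm. auto. } rewrite Hm.
    apply Rle_trans with ((A + B) * (2 * (L * x)) ^ N * 1).
    + assert (B * (L * x) ^ N <= (A + B) * (2 * (L * x)) ^ N) by (apply Rmult_le_compat; lra). lra.
    + apply Rmult_le_compat_l; auto. apply Rmult_le_pos; lra.
  - assert (H1 : 1 <= L * x) by nra.
    eapply Rle_trans. apply Cmod_sub_le.
    assert (T := tpoly_outer_bound (borel_coef a) (polar x theta) B L N HB Hb). rewrite Hm in T.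
    specialize (T H1).
    destruct (Ho x theta Hx Ht) as [_ W].
    assert (P1 : 1 <= (2 * (L * x)) ^ N). { apply pow_R1_Rle. lra. }
    set (P := (2 * (L * x)) ^ N) in *. set (E := exp (K * x)) in *.
    assert (A * E <= A * P * E). { apply Rmult_le_compat_r; [lra|]. rewrite <- (Rmult_1_r A) at 1. apply Rmult_le_compat_l; auto. }
    assert (B * P <= B * P * E). { rewrite <- (Rmult_1_r (B * P)) at 1. apply Rmult_le_compat_l; auto. apply Rmult_le_pos; lra. }
    replace ((A + B) * P * E) with (A * P * E + B * P * E) by ring. lra.
Qed.

(** The Laplace transform of the Borel remainder is estimated by a Gamma integral. The margin over
    [K] stays explicit, because uniformity up to the edge of the sector depends on its being of
    order 1 / |h|. *)
Lemma Lap_asymptotic (alpha eta A K r0 B L : R) (a : nat -> C) (omega : C -> C) (theta : R) (h : C) (N : nat) :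
  sectorial alpha eta A K omega -> Rabs (theta - alpha) <= eta -> 0 <= K -> 0 <= A ->
  borel_germ a r0 B L omega -> K < Re (cis theta / h)%C ->
  Cmod (a O + Lap omega theta h - tpoly a h (S N))%C
   <= (A + B) * (2 * L) ^ N * (INR (fact N) / (Re (cis theta / h)%C - K) ^ (N + 1)).
Proof.
  intros Ho Ht HK HA Hg Hh.
  assert (P := Lap_spec alpha eta A K omega theta h Ho Ht HK Hh).
  assert (T := improper_tpoly a theta h N ltac:(lra)).
  assert (D := improper_minus _ _ _ _ P T).
  replace (a O + Lap omega theta h - tpoly a h (S N))%C with (Lap omega theta h - (tpoly a h (S N) - a O))%C by ring.
  assert (HL : 0 < L) by (destruct Hg as [? [? [? _]]]; nra).
  eapply improper_pow_bound; [| | |exact D]; try lra.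
  - destruct Hg as [? [? _]]. apply Rmult_le_pos. lra. apply pow_le. lra.
  - intros x Hx. cbv beta. unfold laplace_integrand, laplace_kernel.
    replace (Cexp (- (polar x theta / h)) * omega (polar x theta) * cis theta -
     Cexp (- (polar x theta / h)) * tpoly (borel_coef a) (polar x theta) N * cis theta)%C with
     (Cexp (- (polar x theta / h)) * (omega (polar x theta) - tpoly (borel_coef a) (polar x theta) N) * cis theta)%C by ring.
    rewrite !Cmod_mult, Cmod_cis, Rmult_1_r, Cmod_Cexp.
    change (Re (- (polar x theta / h))%C) with (- Re (polar x theta / h)%C). rewrite Re_polar_div.
    assert (R := borel_remainder_bound alpha eta A K r0 B L a omega theta x N Ho Ht HK HA Hg Hx).
    set (mu := Re (cis theta / h)%C) in *.
    replace ((A + B) * (2 * L) ^ N * (x ^ N * exp (- (mu - K) * x))) with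
      (exp (- (x * mu)) * ((A + B) * (2 * L) ^ N * (x ^ N * exp (K * x)))).
    + apply Rmult_le_compat_l; auto. left; apply exp_pos.
    + replace (- (mu - K) * x) with (- (x * mu) + K * x) by ring. rewrite exp_plus. ring.
Qed.

(** * The convolution equation *)

(** The double sector carries the rays of integration; the disc joins its halves at 0 and supplies
    the Taylor expansion there. *)
Definition borel_domain (c : R) (z : C) : Prop := Cmod z < 1 \/ c * Rabs (Re z) < Rabs (Im z).

Lemma borel_domain_star (c s : R) (z : C) :
  0 <= s <= 1 -> borel_domain c z -> borel_domain c (RtoC s * z)%C.
Proof.
  intros Hs [H|H].
  - left. rewrite Cmod_mult, Cmod_RtoC_pos by lra. generalize (Cmod_ge_0 z). nra.
  - destruct (Req_dec s 0) as [->|Hs0].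
    + left. rewrite Cmod_mult, Cmod_0. lra.
    + right. replace (Re (RtoC s * z)) with (s * Re z) by (unfold Re, Cmult, RtoC; simpl; ring).
      replace (Im (RtoC s * z)) with (s * Im z) by (unfold Im, Cmult, RtoC; simpl; ring).
      rewrite !Rabs_mult, (Rabs_pos_eq s) by lra. nra.
Qed.

Lemma borel_domain_open (c : R) (z : C) : 0 < c -> borel_domain c z ->
  exists r, 0 < r <= 1 /\ forall y, Cmod (y - z)%C < r -> borel_domain c y.
Proof.
  intros Hc [H|H].
  - exists (1 - Cmod z). split. { generalize (Cmod_ge_0 z). lra. }
    intros y Hy. left. replace y with (y - z + z)%C by ring.
    eapply Rle_lt_trans. apply Cmod_triangle. lra.
  - set (g := Rabs (Im z) - c * Rabs (Re z)). assert (Hg : 0 < g) by (unfold g; lra).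
    exists (Rmin 1 (g / (1 + c))). split.
    { split. apply Rmin_case; [lra|]. apply Rdiv_lt_0_compat; lra. apply Rmin_l. }
    intros y Hy. right.
    assert (Hy' : Cmod (y - z)%C < g / (1 + c)) by (eapply Rlt_le_trans; [exact Hy|apply Rmin_r]).
    apply (Rmult_lt_compat_r (1 + c)) in Hy'; [|lra].
    replace (g / (1 + c) * (1 + c)) with g in Hy' by (field; lra).
    assert (A := re_le_Cmod (y - z)%C). assert (B := im_le_Cmod (y - z)%C).
    change (Re (y - z)) with (Re y - Re z) in A. change (Im (y - z)) with (Im y - Im z) in B.
    assert (Rabs (Re y) <= Rabs (Re z) + Rabs (Re y - Re z)).
    { replace (Re y) with (Re z + (Re y - Re z)) at 1 by ring. apply Rabs_triang. }
    assert (Rabs (Im z) <= Rabs (Im y) + Rabs (Im y - Im z)).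
    { replace (Im z) with (Im y + - (Im y - Im z)) at 1 by ring.
      eapply Rle_trans. apply Rabs_triang. rewrite Rabs_Ropp. lra. }
    unfold g in Hy'. nra.
Qed.

(** The zeros are real with z^2 = 6912 / 25, of modulus about 16.6 and hence far outside the unit
    disc. The constant 6912 = 2 * 3456 comes from the two extreme terms of the square, in which one
    factor is the leading coefficient 1. *)
Definition borel_symbol (z : C) : C := (RtoC 25 * (z * z) - RtoC 6912)%C.

(** With phi = arg z and u = 25 |z|^2, the squared modulus is cos^2 phi (u - 6912)^2 + sin^2 phi (u
    + 6912)^2. On the double sector sin^2 phi is at least [m0], which leaves m0 (u + 6912)^2. *)
Lemma borel_symbol_lower_bound (c : R) : 0 < c <= 1 ->
  exists m, 0 < m /\ forall z, borel_domain c z -> m * (1 + Cmod z ^ 2) <= Cmod (borel_symbol z).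
Proof.
  intros Hc. set (m0 := c ^ 2 / (1 + c ^ 2)).
  assert (Hm0 : 0 < m0 < 1).
  { unfold m0. split. apply Rdiv_lt_0_compat; nra. apply Rlt_div_l; nra. }
  exists (25 * m0). split. lra.
  intros z [Hz|Hz].
  - apply Rle_trans with (6912 - 25 * Cmod z ^ 2).
    + assert (0 <= Cmod z ^ 2 < 1). { generalize (Cmod_ge_0 z). simpl. nra. } nra.
    + unfold borel_symbol. rewrite Cmod_sub_sym. eapply Rle_trans; [|apply Cmod_sub_ge].
      rewrite !Cmod_mult, !Cmod_RtoC_pos by lra. simpl. lra.
  - assert (Hn : 0 <= Cmod z ^ 2) by (apply pow_le; apply Cmod_ge_0).
    set (u := 25 * Cmod z ^ 2) in *. 
    apply Rle_trans with (m0 * (u + 6912)). { unfold u. nra. }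
    apply Rsqr_incr_0_var; [|apply Cmod_ge_0].
    rewrite !Rsqr_pow2, Cmod2_alt.
    assert (E : Re (borel_symbol z) ^ 2 + Im (borel_symbol z) ^ 2 =
      u ^ 2 + 6912 ^ 2 - 2 * 25 * 6912 * (Re z ^ 2 - Im z ^ 2)).
    { unfold u. rewrite Cmod2_alt. destruct z as [x y].
      unfold borel_symbol, Re, Im, Cminus, Cplus, Copp, Cmult, RtoC; simpl. ring. }
    rewrite E.
    assert (Hq : c ^ 2 * Re z ^ 2 <= Im z ^ 2).
    { rewrite <- (pow2_abs (Re z)), <- (pow2_abs (Im z)), <- Rpow_mult_distr.
      apply pow_incr. generalize (Rabs_pos (Re z)). nra. }
    assert (Em : m0 * (1 + c ^ 2) = c ^ 2) by (unfold m0; field; nra).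
    assert (Hd : Re z ^ 2 - Im z ^ 2 <= (1 - 2 * m0) * Cmod z ^ 2).
    { rewrite Cmod2_alt.
      assert (0 < 1 + c ^ 2) by nra.
      apply (Rmult_le_reg_l (1 + c ^ 2)); auto.
      replace ((1 + c ^ 2) * ((1 - 2 * m0) * (Re z ^ 2 + Im z ^ 2))) with
        ((1 + c ^ 2 - 2 * (m0 * (1 + c ^ 2))) * (Re z ^ 2 + Im z ^ 2)) by ring.
      rewrite Em. nra. }
    assert (F : u ^ 2 + 6912 ^ 2 - 2 * 25 * 6912 * ((1 - 2 * m0) * Cmod z ^ 2) =
      u ^ 2 + 6912 ^ 2 - 2 * 6912 * (1 - 2 * m0) * u) by (unfold u; ring).
    apply Rle_trans with (u ^ 2 + 6912 ^ 2 - 2 * 6912 * (1 - 2 * m0) * u).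
    + assert (0 <= u) by (unfold u; lra).
      replace (u ^ 2 + 6912 ^ 2 - 2 * 6912 * (1 - 2 * m0) * u) with
        ((1 - m0) * (u - 6912) ^ 2 + m0 * (u + 6912) ^ 2) by ring.
      assert (0 <= (u - 6912) ^ 2) by apply pow2_ge_0.
      assert (0 <= (u + 6912) ^ 2) by apply pow2_ge_0.
      rewrite Rpow_mult_distr.
      apply Rle_trans with (m0 * (u + 6912) ^ 2).
      * apply Rmult_le_compat_r; auto. simpl. nra.
      * assert (0 <= (1 - m0) * (u - 6912) ^ 2) by (apply Rmult_le_pos; lra). lra.
    + rewrite <- F. apply Rplus_le_compat_l. apply Ropp_le_contravar.
      apply Rmult_le_compat_l; lra.
Qed.

(** The convolution int_0^z f(x) g(z - x) dx along the segment, with x = s z; the leading [z] is the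
    Jacobian. *)
Definition conv_integrand (f g : C -> C) (z : C) (s : R) : C :=
  (z * (f (RtoC s * z) * g (RtoC (1 - s) * z)))%C.

Definition conv (f g : C -> C) (z : C) : C := CInt (conv_integrand f g z) 0 1.

Lemma rcont_conv_integrand (f g : C -> C) (z : C) (s : R) :
  ccont f (RtoC s * z)%C -> ccont g (RtoC (1 - s) * z)%C -> rcont (conv_integrand f g z) s.
Proof.
  intros Hf Hg. unfold conv_integrand.
  apply rcont_mult. apply rcont_const. apply rcont_mult.
  - apply (rcont_comp f (fun s => RtoC s * z)%C); auto. apply rcont_line.
  - apply (rcont_comp g (fun s => RtoC (1 - s) * z)%C); auto.
    apply (rcont_ext_eq (fun s => z + RtoC s * (- z))%C).
    { intros y. rewrite RtoC_minus. ring. }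
    apply rcont_plus. apply rcont_const. apply rcont_line.
Qed.

Lemma conv_correct (f g : C -> C) (z : C) :
  (forall s, 0 <= s <= 1 -> ccont f (RtoC s * z)%C) ->
  (forall s, 0 <= s <= 1 -> ccont g (RtoC s * z)%C) ->
  is_CInt (conv_integrand f g z) 0 1 (conv f g z).
Proof.
  intros Hf Hg. apply CInt_correct. lra. intros s Hs.
  apply rcont_conv_integrand; [apply Hf|apply Hg]; lra.
Qed.

(** Monotone majorants in |z| bound the integrand uniformly near [a]: each point of a segment from 0
    has modulus at most that of its end. *)
Lemma conv_hol (c : R) (f g : C -> C) (F G : R -> R) (a : C) : 0 < c ->
  (forall z, borel_domain c z -> hol f z) -> (forall z, borel_domain c z -> hol g z) ->
  (forall x y, 0 <= x <= y -> F x <= F y) -> (forall x y, 0 <= x <= y -> G x <= G y) ->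
  (forall z, borel_domain c z -> Cmod (f z) <= F (Cmod z)) ->
  (forall z, borel_domain c z -> Cmod (g z) <= G (Cmod z)) ->
  borel_domain c a -> hol (conv f g) a.
Proof.
  intros Hc Hf Hg MF MG BF BG Ha.
  destruct (borel_domain_open c a Hc Ha) as [r [Hr Hin]].
  set (R0 := Cmod a + 1).
  assert (HR0 : forall z, Cmod (z - a)%C < r -> Cmod z <= R0).
  { intros z Hz. replace z with (z - a + a)%C by ring.
    eapply Rle_trans. apply Cmod_triangle. unfold R0. lra. }
  assert (Hs : forall (z : C) s, 0 <= s <= 1 -> Cmod (RtoC s * z)%C <= Cmod z).
  { intros z s Hs. rewrite Cmod_mult, Cmod_RtoC_pos by lra. generalize (Cmod_ge_0 z). nra. }
  apply (quadratic_at_hol _ a (32 * ((1 - 0) * (R0 * (F R0 * G R0))) / r ^ 2) (r / 4)). lra.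
  apply (hol_integral (conv_integrand f g) (conv f g) (fun _ => R0 * (F R0 * G R0)) a 0 1); try lra.
  - intros z s Hz Hs'. unfold conv_integrand.
    apply hol_mult. apply hol_id. apply hol_mult.
    + apply (hol_comp f (fun z => RtoC s * z)%C).
      * apply hol_mult. apply hol_const. apply hol_id.
      * apply Hf. apply borel_domain_star; auto.
    + apply (hol_comp g (fun z => RtoC (1 - s) * z)%C).
      * apply hol_mult. apply hol_const. apply hol_id.
      * apply Hg. apply borel_domain_star; auto. lra.
  - intros z s Hz Hs'. unfold conv_integrand. rewrite !Cmod_mult.
    assert (D1 : borel_domain c (RtoC s * z)%C) by (apply borel_domain_star; auto).
    assert (D2 : borel_domain c (RtoC (1 - s) * z)%C) by (apply borel_domain_star; auto; lra).
    assert (F1 : F (Cmod (RtoC s * z)%C) <= F R0).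
    { apply MF. split. apply Cmod_ge_0. eapply Rle_trans. apply Hs; auto. auto. }
    assert (G1 : G (Cmod (RtoC (1 - s) * z)%C) <= G R0).
    { apply MG. split. apply Cmod_ge_0. eapply Rle_trans. apply Hs; lra. auto. }
    specialize (BF _ D1). specialize (BG _ D2).
    apply Rmult_le_compat; auto; try apply Cmod_ge_0.
    { apply Rmult_le_pos; apply Cmod_ge_0. }
    apply Rmult_le_compat; try apply Cmod_ge_0; lra.
  - apply (is_RInt_const (V := R_NormedModule) 0 1 (R0 * (F R0 * G R0))).
  - intros z Hz. apply conv_correct; intros s Hs'; apply hol_ccont; [apply Hf|apply Hg];
    apply borel_domain_star; auto.
Qed.

(** The simple integral of s w(s) is a convolution with 1 and that of (z - s) w(s) a convolution
    with the identity, so one set of lemmas covers all terms. *)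
Definition borel_rhs (f : C -> C) (z : C) : C :=
  (RtoC 4 * z + RtoC 25 * conv (fun x => x * f x)%C (fun _ => RtoC 1) z
   + RtoC 4 * conv f (fun x => x) z + RtoC 3456 * conv f f z)%C.

Definition borel_map (f : C -> C) (z : C) : C := (borel_rhs f z / borel_symbol z)%C.

Definition exp_bounded (c A nu : R) (f : C -> C) : Prop :=
  (forall z, borel_domain c z -> hol f z) /\
  (forall z, borel_domain c z -> Cmod (f z) <= A * exp (nu * Cmod z)).

Lemma is_RInt_exp_line (x nu : R) : 0 < nu ->
  is_RInt (fun s => x * exp (nu * (s * x))) 0 1 ((exp (nu * x) - 1) / nu).
Proof.
  intros Hnu.
  replace ((exp (nu * x) - 1) / nu) with (minus (exp (nu * (1 * x)) / nu) (exp (nu * (0 * x)) / nu)).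
  - apply (is_RInt_derive (V := R_CompleteNormedModule) (fun s => exp (nu * (s * x)) / nu)).
    + intros s _. auto_derive; auto. field. lra.
    + intros s _. apply (ex_derive_continuous (V := R_NormedModule)). auto_derive. auto.
  - unfold minus, plus, opp; simpl. rewrite Rmult_0_l, Rmult_0_r, exp_0, Rmult_1_l. field. lra.
Qed.

Lemma exp_line_split (nu s x : R) : exp (nu * (s * x)) * exp (nu * ((1 - s) * x)) = exp (nu * x).
Proof. rewrite <- exp_plus. f_equal. ring. Qed.

Lemma exp_bounded_cont (c A nu s : R) (f : C -> C) (z : C) :
  exp_bounded c A nu f -> borel_domain c z -> 0 <= s <= 1 -> ccont f (RtoC s * z)%C.
Proof. intros [Hf _] Hz Hs. apply hol_ccont. apply Hf. apply borel_domain_star; auto. Qed.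

Lemma exp_bounded_scaled (c A nu s : R) (f : C -> C) (z : C) :
  exp_bounded c A nu f -> borel_domain c z -> 0 <= s <= 1 ->
  Cmod (f (RtoC s * z)%C) <= A * exp (nu * (s * Cmod z)).
Proof.
  intros [_ Hf] Hz Hs. specialize (Hf _ (borel_domain_star c s z Hs Hz)).
  now rewrite Cmod_mult, Cmod_RtoC_pos in Hf by lra.
Qed.

(** In the linear terms only one factor grows exponentially, and integrating it gains 1 / nu. In the
    quadratic term the two exponentials multiply to the full one, by [exp_line_split], so nothing is
    gained there and the size [A] of the functions must do the work. *)
Lemma conv_linear_bounds (c A nu D : R) (f g : C -> C) (z : C) :
  0 < nu -> 0 <= D -> exp_bounded c A nu f -> exp_bounded c A nu g -> borel_domain c z ->
  (forall y, borel_domain c y -> Cmod (f y - g y)%C <= D * exp (nu * Cmod y)) ->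
  Cmod (conv (fun x => x * f x)%C (fun _ => RtoC 1) z - conv (fun x => x * g x)%C (fun _ => RtoC 1) z)%C
    <= Cmod z * (D * exp (nu * Cmod z) / nu) /\
  Cmod (conv f (fun x => x) z - conv g (fun x => x) z)%C <= Cmod z * (D * exp (nu * Cmod z) / nu) /\
  Cmod (conv f f z - conv g g z)%C <= Cmod z * (2 * A * D * exp (nu * Cmod z)).
Proof.
  intros Hnu HD Hf Hg Hz Hfg.
  set (x := Cmod z). assert (Hx : 0 <= x) by apply Cmod_ge_0.
  assert (Hfg' : forall s, 0 <= s <= 1 ->
    Cmod (f (RtoC s * z) - g (RtoC s * z))%C <= D * exp (nu * (s * x))).
  { intros s Hs. specialize (Hfg _ (borel_domain_star c s z Hs Hz)).
    now rewrite Cmod_mult, Cmod_RtoC_pos in Hfg by lra. }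
  assert (Hcid : forall h s, exp_bounded c A nu h -> 0 <= s <= 1 -> ccont (fun x => x * h x)%C (RtoC s * z)%C).
  { intros h s Hh Hs. apply ccont_mult. apply ccont_id. eapply exp_bounded_cont; eauto. }
  assert (HI := is_RInt_exp_line x nu Hnu).
  assert (HI2 := is_RInt_scal (V := R_NormedModule) _ 0 1 (x * D) _ HI).
  assert (HE : x * D * ((exp (nu * x) - 1) / nu) <= x * (D * exp (nu * x) / nu)).
  { rewrite Rmult_assoc. apply Rmult_le_compat_l; auto.
    replace (D * exp (nu * x) / nu) with (D * (exp (nu * x) / nu)) by (field; lra).
    apply Rmult_le_compat_l; auto. apply Rmult_le_compat_r. left. apply Rinv_0_lt_compat; auto. lra. }
  split; [|split].
  - eapply Rle_trans; [|exact HE].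
    eapply is_CInt_bound; [| |apply is_CInt_minus; apply conv_correct|exact HI2]; try lra.
    + intros s Hs. cbv beta. unfold conv_integrand.
      replace (z * (RtoC s * z * f (RtoC s * z) * RtoC 1) - z * (RtoC s * z * g (RtoC s * z) * RtoC 1))%C
        with (z * (RtoC s * z * (f (RtoC s * z) - g (RtoC s * z))))%C by ring.
      rewrite !Cmod_mult, Cmod_RtoC_pos by lra. fold x.
      change (scal (x * D) (x * exp (nu * (s * x)))) with (x * D * (x * exp (nu * (s * x)))).
      specialize (Hfg' s Hs). assert (0 < exp (nu * (s * x))) by apply exp_pos.
      replace (x * D * (x * exp (nu * (s * x)))) with (x * (1 * x * (D * exp (nu * (s * x))))) by ring.
      apply Rmult_le_compat_l; auto. apply Rmult_le_compat; auto.
      * nra. * apply Cmod_ge_0. * nra.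
    + intros; apply Hcid; auto.
    + intros; apply ccont_const.
    + intros; apply Hcid; auto.
    + intros; apply ccont_const.
  - eapply Rle_trans; [|exact HE].
    eapply is_CInt_bound; [| |apply is_CInt_minus; apply conv_correct|exact HI2]; try lra.
    + intros s Hs. cbv beta. unfold conv_integrand.
      replace (z * (f (RtoC s * z) * (RtoC (1 - s) * z)) - z * (g (RtoC s * z) * (RtoC (1 - s) * z)))%C
        with (z * (RtoC (1 - s) * z * (f (RtoC s * z) - g (RtoC s * z))))%C by ring.
      rewrite !Cmod_mult, Cmod_RtoC_pos by lra. fold x.
      change (scal (x * D) (x * exp (nu * (s * x)))) with (x * D * (x * exp (nu * (s * x)))).
      specialize (Hfg' s Hs). assert (0 < exp (nu * (s * x))) by apply exp_pos.
      replace (x * D * (x * exp (nu * (s * x)))) with (x * (1 * x * (D * exp (nu * (s * x))))) by ring.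
      apply Rmult_le_compat_l; auto. apply Rmult_le_compat; auto.
      * nra. * apply Cmod_ge_0. * nra.
    + intros; eapply exp_bounded_cont; eauto.
    + intros; apply ccont_id.
    + intros; eapply exp_bounded_cont; eauto.
    + intros; apply ccont_id.
  - replace (x * (2 * A * D * exp (nu * x))) with ((1 - 0) * (x * (2 * A * D * exp (nu * x)))) by ring.
    eapply is_CInt_bound_const; [| |apply is_CInt_minus; apply conv_correct]; try lra.
    + intros s Hs. cbv beta. unfold conv_integrand.
      set (fs := f (RtoC s * z)%C). set (gs := g (RtoC s * z)%C).
      set (ft := f (RtoC (1 - s) * z)%C). set (gt := g (RtoC (1 - s) * z)%C).
      replace (z * (fs * ft) - z * (gs * gt))%C with (z * ((fs - gs) * ft + gs * (ft - gt)))%C by ring.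
      rewrite Cmod_mult. fold x. apply Rmult_le_compat_l; auto.
      eapply Rle_trans. apply Cmod_triangle. rewrite !Cmod_mult.
      assert (B1 : Cmod (fs - gs)%C <= D * exp (nu * (s * x))) by (apply Hfg'; auto).
      assert (B2 : Cmod (ft - gt)%C <= D * exp (nu * ((1 - s) * x))) by (apply Hfg'; lra).
      assert (B3 : Cmod ft <= A * exp (nu * ((1 - s) * x))).
      { eapply exp_bounded_scaled; eauto. lra. }
      assert (B4 : Cmod gs <= A * exp (nu * (s * x))).
      { eapply exp_bounded_scaled; eauto. }
      rewrite <- (exp_line_split nu s x).
      set (E1 := exp (nu * (s * x))) in *. set (E2 := exp (nu * ((1 - s) * x))) in *.
      replace (2 * A * D * (E1 * E2)) with ((D * E1) * (A * E2) + (A * E1) * (D * E2)) by ring.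
      apply Rplus_le_compat; apply Rmult_le_compat; auto; apply Cmod_ge_0.
    + intros; eapply exp_bounded_cont; eauto.
    + intros; eapply exp_bounded_cont; eauto.
    + intros; eapply exp_bounded_cont; eauto.
    + intros; eapply exp_bounded_cont; eauto.
Qed.

Lemma exp_bounded_zero (c A nu : R) : 0 <= A -> exp_bounded c A nu (fun _ => RtoC 0).
Proof.
  intros HA. split.
  - intros. apply hol_const.
  - intros z _. rewrite Cmod_0. apply Rmult_le_pos; auto. left. apply exp_pos.
Qed.

Lemma conv_zero_l (g : C -> C) (z : C) : conv (fun _ => RtoC 0) g z = RtoC 0.
Proof.
  unfold conv. apply is_CInt_unique.
  apply is_CInt_ext with (fun _ => RtoC 0). lra.
  - intros s _. unfold conv_integrand. ring.
  - assert (H := is_CInt_const (RtoC 0) 0 1). replace (RtoC (1 - 0) * RtoC 0)%C with (RtoC 0) in H by ring.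
    exact H.
Qed.

Lemma borel_rhs_zero (z : C) : borel_rhs (fun _ => RtoC 0) z = (RtoC 4 * z)%C.
Proof.
  unfold borel_rhs.
  replace (fun x : C => (x * RtoC 0)%C) with (fun _ : C => RtoC 0)
    by (apply functional_extensionality; intros; ring).
  rewrite !conv_zero_l. ring.
Qed.

Lemma borel_rhs_diff (c A nu D : R) (f g : C -> C) (z : C) :
  0 < nu -> 0 <= D -> exp_bounded c A nu f -> exp_bounded c A nu g -> borel_domain c z ->
  (forall y, borel_domain c y -> Cmod (f y - g y)%C <= D * exp (nu * Cmod y)) ->
  Cmod (borel_rhs f z - borel_rhs g z)%C
    <= Cmod z * (D * exp (nu * Cmod z)) * (29 / nu + 6912 * A).
Proof.
  intros Hnu HD Hf Hg Hz Hfg.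
  destruct (conv_linear_bounds c A nu D f g z Hnu HD Hf Hg Hz Hfg) as [B1 [B2 B3]].
  unfold borel_rhs.
  set (u1 := conv (fun x => x * f x)%C (fun _ => RtoC 1) z) in *.
  set (u2 := conv (fun x => x * g x)%C (fun _ => RtoC 1) z) in *.
  set (v1 := conv f (fun x => x) z) in *. set (v2 := conv g (fun x => x) z) in *.
  replace (RtoC 4 * z + RtoC 25 * u1 + RtoC 4 * v1 + RtoC 3456 * conv f f z -
    (RtoC 4 * z + RtoC 25 * u2 + RtoC 4 * v2 + RtoC 3456 * conv g g z))%C with
    (RtoC 25 * (u1 - u2) + RtoC 4 * (v1 - v2) + RtoC 3456 * (conv f f z - conv g g z))%C by ring.
  eapply Rle_trans. apply Cmod_triangle.
  eapply Rle_trans. apply Rplus_le_compat_r. apply Cmod_triangle.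
  rewrite !Cmod_mult, !Cmod_RtoC_pos by lra.
  replace (Cmod z * (D * exp (nu * Cmod z)) * (29 / nu + 6912 * A)) with
    (25 * (Cmod z * (D * exp (nu * Cmod z) / nu)) + 4 * (Cmod z * (D * exp (nu * Cmod z) / nu))
     + 3456 * (Cmod z * (2 * A * D * exp (nu * Cmod z)))) by (field; lra).
  lra.
Qed.

Lemma borel_rhs_hol (c A nu : R) (f : C -> C) (z : C) :
  0 < c -> 0 <= A -> 0 < nu -> exp_bounded c A nu f -> borel_domain c z -> hol (borel_rhs f) z.
Proof.
  intros Hc HA Hnu [Hf Hb] Hz.
  assert (ME : forall x y, 0 <= x <= y -> A * exp (nu * x) <= A * exp (nu * y)).
  { intros x y Hxy. apply Rmult_le_compat_l; auto.
    destruct (Req_dec x y) as [->|]; [lra|]. left. apply exp_increasing. nra. }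
  unfold borel_rhs.
  apply hol_plus; [apply hol_plus; [apply hol_plus|]|].
  - apply hol_mult. apply hol_const. apply hol_id.
  - apply hol_mult. apply hol_const.
    apply (conv_hol c _ _ (fun x => x * (A * exp (nu * x))) (fun _ => 1)); auto.
    + intros y Hy. apply hol_mult. apply hol_id. auto.
    + intros y Hy. apply hol_const.
    + intros x y Hxy. apply Rmult_le_compat; try lra; auto.
      apply Rmult_le_pos; auto. left; apply exp_pos.
    + intros x y _. lra.
    + intros y Hy. rewrite Cmod_mult. apply Rmult_le_compat_l; auto. apply Cmod_ge_0.
    + intros y Hy. rewrite Cmod_1. lra.
  - apply hol_mult. apply hol_const.
    apply (conv_hol c _ _ (fun x => A * exp (nu * x)) (fun x => x)); auto.
    + intros y Hy. apply hol_id.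
    + intros x y Hxy. lra.
    + intros y Hy. lra.
  - apply hol_mult. apply hol_const.
    apply (conv_hol c _ _ (fun x => A * exp (nu * x)) (fun x => A * exp (nu * x))); auto.
Qed.

Lemma geometric_limit (u : nat -> C) (K : R) :
  (forall n, Cmod (u (S n) - u n)%C <= K * (/ 2) ^ n) ->
  exists l, cseq_lim u l /\ forall n, Cmod (u n - l)%C <= 2 * K * (/ 2) ^ n.
Proof.
  intros H.
  assert (HK : 0 <= K). { specialize (H O). simpl in H. generalize (Cmod_ge_0 (u 1%nat - u 0%nat)%C). lra. }
  assert (T : forall n p, Cmod (u (n + p)%nat - u n)%C <= 2 * K * (/ 2) ^ n - 2 * K * (/ 2) ^ (n + p)).
  { intros n p. induction p as [|p IH].
    - rewrite Nat.add_0_r. replace (u n - u n)%C with (RtoC 0) by ring. rewrite Cmod_0. lra.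
    - rewrite Nat.add_succ_r. specialize (H (n + p)%nat).
      replace (u (S (n + p)) - u n)%C with ((u (S (n + p)) - u (n + p)%nat) + (u (n + p)%nat - u n))%C by ring.
      eapply Rle_trans. apply Cmod_triangle. simpl. lra. }
  assert (Hp : forall n, 0 < (/ 2) ^ n) by (intros; apply pow_lt; lra).
  assert (T' : forall n m, (n <= m)%nat -> Cmod (u m - u n)%C <= 2 * K * (/ 2) ^ n).
  { intros n m Hnm. replace m with (n + (m - n))%nat by lia.
    eapply Rle_trans. apply T. generalize (Hp (n + (m - n))%nat). nra. }
  assert (L := is_lim_seq_geom (/ 2) ltac:(rewrite Rabs_pos_eq; lra)).
  apply is_lim_seq_spec in L.
  assert (S : forall e, 0 < e -> exists N, forall n, (N <= n)%nat -> 2 * K * (/ 2) ^ n <= e).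
  { intros e He. assert (He' : 0 < e / (1 + 2 * K)) by (apply Rdiv_lt_0_compat; lra).
    destruct (L (mkposreal _ He')) as [N HN]. exists N. intros n Hn. specialize (HN n Hn).
    simpl in HN. rewrite Rminus_0_r, Rabs_pos_eq in HN by (left; apply Hp).
    apply (Rmult_lt_compat_r (1 + 2 * K)) in HN; [|lra].
    replace (e / (1 + 2 * K) * (1 + 2 * K)) with e in HN by (field; lra).
    generalize (Hp n). nra. }
  destruct (cseq_cauchy u) as [l Hl].
  { intros e He. destruct (S (e / 2)) as [N HN]. lra. exists N. intros n m Hn Hm.
    replace (u n - u m)%C with ((u n - u N) - (u m - u N))%C by ring.
    eapply Rle_trans. apply Cmod_sub_le.
    generalize (T' N n Hn) (T' N m Hm) (HN N (le_n N)). lra. }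
  exists l. split; auto.
  intros n. apply le_epsilon. intros e He. destruct (Hl e He) as [N HN].
  specialize (HN (n + N)%nat ltac:(lia)). specialize (T' n (n + N)%nat ltac:(lia)).
  replace (u n - l)%C with ((u (n + N)%nat - l) - (u (n + N)%nat - u n))%C by ring.
  eapply Rle_trans. apply Cmod_sub_le. lra.
Qed.

(** Picard iteration from 0 in the ball of radius [A] for the weighted norm; the differences halve
    at each step, so the iterates converge geometrically at every point. *)
Lemma borel_equation_solution (c : R) : 0 < c <= 1 ->
  exists (w : C -> C) (A nu : R), 0 < nu /\ 0 <= A /\ exp_bounded c A nu w /\
    forall z, borel_domain c z -> (borel_symbol z * w z)%C = borel_rhs w z.
Proof.
  intros Hc.
  destruct (borel_symbol_lower_bound c Hc) as [m [Hm Hsym]].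
  (* [A] makes the quadratic share 6912 A less than m / 4. The summand 64 / m of [nu] brings the
     linear share 29 / nu below m / 2, and 64 / (m A) brings the source 4 z below a small multiple
     of m A exp (nu |z|). *)
  set (A := m / 32000). set (nu := 64 / (m * A) + 64 / m + 64).
  assert (HA : 0 < A) by (unfold A; lra).
  assert (HmA : 0 < m * A) by nra.
  assert (N1 : 0 < 64 / (m * A)) by (apply Rdiv_lt_0_compat; lra).
  assert (N2 : 0 < 64 / m) by (apply Rdiv_lt_0_compat; lra).
  assert (Hnu : 0 < nu) by (unfold nu; lra).
  assert (K1 : 4 / nu <= m * A / 16).
  { apply Rle_div_l; auto. apply Rle_trans with (m * A / 16 * (64 / (m * A))).
    right; field; lra. apply Rmult_le_compat_l; unfold nu; lra. }
  assert (K2 : 29 / nu + 6912 * A <= m).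
  { assert (29 / nu <= m / 2).
    { apply Rle_div_l; auto. apply Rle_trans with (m / 2 * (64 / m)).
      replace (m / 2 * (64 / m)) with 32 by (field; lra). lra.
      apply Rmult_le_compat_l; unfold nu; lra. }
    unfold A. lra. }
  assert (Hsp : forall z, borel_domain c z -> 0 < Cmod (borel_symbol z)).
  { intros z Hz. specialize (Hsym z Hz). assert (0 <= Cmod z ^ 2) by (apply pow_le; apply Cmod_ge_0). nra. }
  assert (Hs0 : forall z, borel_domain c z -> borel_symbol z <> RtoC 0).
  { intros z Hz. apply Cmod_gt_0. auto. }
  (* From 2 |z| <= 1 + |z|^2: the growth of the symbol absorbs the factor |z| of each convolution,
     and the 2 becomes the contraction factor. *)
  assert (Hhalf : forall z, borel_domain c z -> Cmod z * m <= Cmod (borel_symbol z) / 2).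
  { intros z Hz. specialize (Hsym z Hz).
    assert (0 <= (Cmod z - 1) ^ 2) by apply pow2_ge_0. simpl in *. nra. }
  assert (Contr : forall D f g, 0 <= D -> exp_bounded c A nu f -> exp_bounded c A nu g ->
    (forall y, borel_domain c y -> Cmod (f y - g y)%C <= D * exp (nu * Cmod y)) ->
    forall z, borel_domain c z -> Cmod (borel_map f z - borel_map g z)%C <= D / 2 * exp (nu * Cmod z)).
  { intros D f g HD Hf Hg Hfg z Hz.
    assert (B := borel_rhs_diff c A nu D f g z Hnu HD Hf Hg Hz Hfg).
    unfold borel_map.
    replace (borel_rhs f z / borel_symbol z - borel_rhs g z / borel_symbol z)%C with
      ((borel_rhs f z - borel_rhs g z) / borel_symbol z)%C by (field; auto).
    rewrite Cmod_div by auto. apply Rle_div_l. { apply Hsp; auto. }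
    assert (P := exp_pos (nu * Cmod z)). assert (Q := Cmod_ge_0 z). specialize (Hhalf z Hz).
    eapply Rle_trans; [exact B|].
    apply Rle_trans with (Cmod z * (D * exp (nu * Cmod z)) * m).
    - apply Rmult_le_compat_l; auto. apply Rmult_le_pos; auto. nra.
    - replace (Cmod z * (D * exp (nu * Cmod z)) * m) with ((D * exp (nu * Cmod z)) * (Cmod z * m)) by ring.
      replace (D / 2 * exp (nu * Cmod z) * Cmod (borel_symbol z)) with
        ((D * exp (nu * Cmod z)) * (Cmod (borel_symbol z) / 2)) by field.
      apply Rmult_le_compat_l; auto. nra. }
  assert (Stab : forall f, exp_bounded c A nu f -> exp_bounded c A nu (borel_map f)).
  { intros f Hf. split.
    - intros z Hz. apply hol_div; auto.
      + apply (borel_rhs_hol c A nu); auto; lra.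
      + unfold borel_symbol. apply hol_minus; [|apply hol_const].
        apply hol_mult. apply hol_const. apply hol_mult; apply hol_id.
    - intros z Hz.
      (* Comparison with the zero function: half of the ball's radius is spent on the contraction,
         the other half on the source term. *)
      assert (B := Contr A f (fun _ => RtoC 0) ltac:(lra) Hf (exp_bounded_zero c A nu ltac:(lra))).
      assert (B0 : forall y, borel_domain c y -> Cmod (f y - RtoC 0)%C <= A * exp (nu * Cmod y)).
      { intros y Hy. replace (f y - RtoC 0)%C with (f y) by ring. apply Hf; auto. }
      specialize (B B0 z Hz). clear B0.
      replace (borel_map f z) with ((borel_map f z - borel_map (fun _ => RtoC 0) z) + borel_map (fun _ => RtoC 0) z)%C by ring.
      eapply Rle_trans. apply Cmod_triangle.
      assert (B0 : Cmod (borel_map (fun _ => RtoC 0) z) <= A / 2 * exp (nu * Cmod z)); [|lra].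
      unfold borel_map. rewrite borel_rhs_zero, Cmod_div, Cmod_mult, Cmod_RtoC_pos by (auto; lra).
      apply Rle_div_l. { apply Hsp; auto. }
      assert (E := exp_ineq1_le (nu * Cmod z)). assert (Q := Cmod_ge_0 z).
      assert (E2 : Cmod z <= exp (nu * Cmod z) / nu) by (apply Rle_div_r; lra).
      assert (E3 : 4 * Cmod z <= m * A / 16 * exp (nu * Cmod z)).
      { apply Rle_trans with (4 * (exp (nu * Cmod z) / nu)). lra.
        replace (4 * (exp (nu * Cmod z) / nu)) with (4 / nu * exp (nu * Cmod z)) by (field; lra).
        apply Rmult_le_compat_r; auto. left; apply exp_pos. }
      specialize (Hsym z Hz). assert (Z2 : 0 <= Cmod z ^ 2) by (apply pow_le; auto).
      assert (X := exp_pos (nu * Cmod z)).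
      assert (m <= Cmod (borel_symbol z)) by nra.
      apply Rle_trans with (A / 2 * exp (nu * Cmod z) * m). nra.
      apply Rmult_le_compat_l; auto. nra. }
  set (it := fix it n := match n with O => (fun _ => RtoC 0) | S n => borel_map (it n) end).
  assert (Hit : forall n, exp_bounded c A nu (it n)).
  { induction n; simpl. apply exp_bounded_zero; lra. apply Stab; auto. }
  assert (Hstep : forall n z, borel_domain c z ->
    Cmod (it (S n) z - it n z)%C <= A * (/ 2) ^ n * exp (nu * Cmod z)).
  { induction n as [|n IH].
    - intros z Hz. simpl (it 0%nat z). rewrite pow_O, Rmult_1_r.
      replace (it 1%nat z - RtoC 0)%C with (it 1%nat z) by ring. apply (Hit 1%nat); auto.
    - intros z Hz. replace (A * (/ 2) ^ S n) with (A * (/ 2) ^ n / 2) by (simpl; field).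
      apply Contr; auto. apply Rmult_le_pos; [lra|]. apply pow_le; lra. }
  set (w := fun z => epsilon (inhabits (RtoC 0)) (fun l => cseq_lim (fun n => it n z) l /\
     forall n, Cmod (it n z - l)%C <= 2 * (A * exp (nu * Cmod z)) * (/ 2) ^ n)).
  assert (Hw : forall z, borel_domain c z -> cseq_lim (fun n => it n z) (w z) /\
     forall n, Cmod (it n z - w z)%C <= 2 * (A * exp (nu * Cmod z)) * (/ 2) ^ n).
  { intros z Hz. apply epsilon_spec. apply geometric_limit.
    intros n. specialize (Hstep n z Hz). lra. }
  assert (Hwb : exp_bounded c A nu w).
  { split.
    - intros a Ha. destruct (borel_domain_open c a ltac:(lra) Ha) as [r [Hr Hin]].
      apply (hol_limit it w a r (A * exp (nu * (Cmod a + 1)))).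
      + lra.
      + intros n z Hz. apply Hit. auto.
      + intros n z Hz. eapply Rle_trans. apply Hit; auto.
        apply Rmult_le_compat_l. lra. 
        assert (Cmod z < Cmod a + 1).
        { replace z with (z - a + a)%C by ring. eapply Rle_lt_trans. apply Cmod_triangle. lra. }
        left. apply exp_increasing. nra.
      + intros z Hz. apply Hw. auto.
    - intros z Hz. apply (cseq_lim_bound (fun n => it n z)). apply Hw; auto.
      intros n. apply Hit; auto. }
  exists w, A, nu. split; auto. split. lra. split; auto.
  intros z Hz.
  assert (E : borel_map w z = w z).
  { assert (E0 : (borel_map w z - w z)%C = RtoC 0).
    { apply Cmod_eq_0. apply Rle_antisym; [|apply Cmod_ge_0].
      assert (B : forall n, Cmod (borel_map w z - w z)%C <= 2 * A * exp (nu * Cmod z) * (/ 2) ^ n).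
      { intros n.
        assert (P2 : 0 < (/ 2) ^ n) by (apply pow_lt; lra).
        assert (C1 := Contr (2 * A * (/ 2) ^ n) w (it n) ltac:(nra) Hwb (Hit n)).
        specialize (C1 ltac:(intros y Hy; destruct (Hw y Hy) as [_ Hy2]; specialize (Hy2 n);
          rewrite Cmod_sub_sym; lra) z Hz).
        destruct (Hw z Hz) as [_ C2]. specialize (C2 (S n)). change (it (S n) z) with (borel_map (it n) z) in C2.
        replace (borel_map w z - w z)%C with ((borel_map w z - borel_map (it n) z) + (borel_map (it n) z - w z))%C by ring.
        eapply Rle_trans. apply Cmod_triangle. simpl in C2. lra. }
      apply (geometric_squeeze _ _ (/ 2)) in B; lra. }
    replace (borel_map w z) with (borel_map w z - w z + w z)%C by ring. rewrite E0. ring. }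
  rewrite <- E at 1. unfold borel_map. field. auto.
Qed.

(** * Taylor coefficients of convolutions *)

Fixpoint csum (F : nat -> C) (n : nat) : C :=
  match n with O => RtoC 0 | S n => (csum F n + F n)%C end.

Lemma csum_ext (F G : nat -> C) (n : nat) : (forall k, (k < n)%nat -> F k = G k) -> csum F n = csum G n.
Proof. induction n as [|n IH]; intros H; simpl; auto. rewrite IH, H; auto. Qed.

Lemma csum_cmult (c : C) (F : nat -> C) (n : nat) : csum (fun k => c * F k)%C n = (c * csum F n)%C.
Proof. induction n as [|n IH]; simpl; [|rewrite IH]; ring. Qed.

(** Euler's Beta function at (i + 1, j + 1). *)
Definition beta (i j : nat) : R := INR (fact i) * INR (fact j) / INR (fact (i + j + 1)).

Lemma is_RInt_beta (i j : nat) : is_RInt (fun s => s ^ i * (1 - s) ^ j) 0 1 (beta i j).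
Proof.
  revert i. induction j as [|j IH]; intros i.
  - replace (beta i 0) with (minus (1 ^ (i + 1) / INR (i + 1)) (0 ^ (i + 1) / INR (i + 1))).
    + apply (is_RInt_derive (V := R_CompleteNormedModule) (fun s => s ^ (i + 1) / INR (i + 1))).
      * intros s _. auto_derive; auto. replace (Init.Nat.pred (i + 1)) with i by lia.
        field. apply not_0_INR. lia.
      * intros s _. apply (ex_derive_continuous (V := R_NormedModule)). auto_derive. auto.
    + unfold minus, plus, opp; simpl. rewrite pow1, pow_i by lia. unfold beta.
      replace (i + 0 + 1)%nat with (S i) by lia. rewrite fact_simpl, mult_INR.
      replace (i + 1)%nat with (S i) by lia. simpl (fact 0). simpl (INR 1).
      field. split. apply INR_fact_neq_0. apply not_0_INR. lia.
  - assert (H := IH (S i)).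
    assert (Hi : INR (S i) <> 0) by (apply not_0_INR; lia).
    apply (is_RInt_scal (V := R_NormedModule) _ _ _ (INR (S j) / INR (S i))) in H.
    assert (D : is_RInt (fun s => s ^ i * (1 - s) ^ S j - INR (S j) / INR (S i) * (s ^ S i * (1 - s) ^ j)) 0 1
      (minus (1 ^ S i * (1 - 1) ^ S j / INR (S i)) (0 ^ S i * (1 - 0) ^ S j / INR (S i)))).
    { apply (is_RInt_derive (V := R_CompleteNormedModule) (fun s => s ^ S i * (1 - s) ^ S j / INR (S i))).
      - intros s _. auto_derive; auto.
        change (match i with O => 1 | S _ => INR i + 1 end) with (INR (S i)).
        change (match j with O => 1 | S _ => INR j + 1 end) with (INR (S j)).
        change ((1 - s) ^ S j) with ((1 - s) * (1 - s) ^ j). unfold Rminus.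
        change (s ^ S i) with (s * s ^ i). field. auto.
      - intros s _. apply (ex_derive_continuous (V := R_NormedModule)). auto_derive. auto. }
    assert (HS := is_RInt_plus (V := R_NormedModule) _ _ _ _ _ _ D H).
    assert (E : plus (minus (1 ^ S i * (1 - 1) ^ S j / INR (S i)) (0 ^ S i * (1 - 0) ^ S j / INR (S i)))
        (scal (INR (S j) / INR (S i)) (beta (S i) j)) = beta i (S j)).
    { change (1 ^ S i * (1 - 1) ^ S j / INR (S i) - 0 ^ S i * (1 - 0) ^ S j / INR (S i)
        + INR (S j) / INR (S i) * beta (S i) j = beta i (S j)).
      rewrite !Rminus_diag, !pow_i by lia. unfold beta.
      replace (S i + j + 1)%nat with (i + S j + 1)%nat by lia.
      rewrite (fact_simpl i), (fact_simpl j), !mult_INR. field.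
      split; auto. apply INR_fact_neq_0. }
    rewrite <- E. eapply is_RInt_ext; [|exact HS].
    intros s _.
    change (s ^ i * (1 - s) ^ S j - INR (S j) / INR (S i) * (s ^ S i * (1 - s) ^ j)
      + INR (S j) / INR (S i) * (s ^ S i * (1 - s) ^ j) = s ^ i * (1 - s) ^ S j). ring.
Qed.

Lemma conv_monomials (i j : nat) (z : C) :
  conv (fun x => x ^ i)%C (fun x => x ^ j)%C z = (RtoC (beta i j) * z ^ (i + j + 1))%C.
Proof.
  unfold conv. apply is_CInt_unique.
  assert (H : is_CInt (fun s => z ^ (i + j + 1) * RtoC (s ^ i * (1 - s) ^ j))%C 0 1
     (z ^ (i + j + 1) * RtoC (beta i j))%C).
  { apply is_CInt_cmult. apply is_CInt_pair. split.
    - apply is_RInt_beta.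
    - unfold RtoC; simpl. assert (H := is_RInt_const (V := R_NormedModule) 0 1 0).
      change (is_RInt (fun _ : R => 0) 0 1 ((1 - 0) * 0)) in H. rewrite Rmult_0_r in H. exact H. }
  rewrite Cmult_comm. eapply is_CInt_ext; [lra| |exact H].
  intros s _. unfold conv_integrand. cbv beta.
  rewrite RtoC_mult, !RtoC_pow, !Cpow_mult_l.
  replace (i + j + 1)%nat with (S (i + j)) by lia. rewrite Cpow_S, Cpow_add_r. ring.
Qed.

(** The remainder has order [N] because [tpoly a z N] stops at degree N - 1. One constant serves on
    the whole unit disc, which keeps products and integrals along segments simple. *)
Definition jet (f : C -> C) (a : nat -> C) (N : nat) : Prop :=
  exists K, forall z, Cmod z < 1 -> Cmod (f z - tpoly a z N)%C <= K * Cmod z ^ N.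

Lemma jet_nonneg (f : C -> C) (a : nat -> C) (N : nat) :
  jet f a N -> exists K, 0 <= K /\ forall z, Cmod z < 1 -> Cmod (f z - tpoly a z N)%C <= K * Cmod z ^ N.
Proof.
  intros [K H]. exists (Rabs K). split. apply Rabs_pos.
  intros z Hz. eapply Rle_trans. apply H; auto. apply Rmult_le_compat_r.
  apply pow_le. apply Cmod_ge_0. apply Rle_abs.
Qed.

Lemma jet_le (f : C -> C) (a : nat -> C) (N M : nat) : (M <= N)%nat -> jet f a N -> jet f a M.
Proof.
  intros HMN. replace N with (M + (N - M))%nat by lia. generalize (N - M)%nat. clear. intros k.
  induction k as [|k IH]. { now rewrite Nat.add_0_r. }
  rewrite Nat.add_succ_r. intros H. apply IH. clear IH.
  apply jet_nonneg in H. destruct H as [K [HK H]].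
  exists (K + Cmod (a (M + k)%nat)). intros z Hz. specialize (H z Hz). simpl in H.
  replace (f z - tpoly a z (M + k))%C with
    ((f z - (tpoly a z (M + k) + a (M + k)%nat * z ^ (M + k))) + a (M + k)%nat * z ^ (M + k))%C by ring.
  eapply Rle_trans. apply Cmod_triangle. rewrite Cmod_mult, Cmod_pow.
  assert (0 <= Cmod z ^ (M + k)) by (apply pow_le; apply Cmod_ge_0).
  assert (Cmod z * Cmod z ^ (M + k) <= Cmod z ^ (M + k)) by (generalize (Cmod_ge_0 z); nra).
  nra.
Qed.

Lemma jet_plus (f g : C -> C) (a b : nat -> C) (N : nat) :
  jet f a N -> jet g b N -> jet (fun z => f z + g z)%C (fun k => a k + b k)%C N.
Proof.
  intros [K H] [L H']. exists (K + L). intros z Hz.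
  assert (E : tpoly (fun k => a k + b k)%C z N = (tpoly a z N + tpoly b z N)%C).
  { clear. induction N as [|N IH]; simpl; [|rewrite IH]; ring. }
  rewrite E. replace (f z + g z - (tpoly a z N + tpoly b z N))%C with
    ((f z - tpoly a z N) + (g z - tpoly b z N))%C by ring.
  eapply Rle_trans. apply Cmod_triangle. specialize (H z Hz). specialize (H' z Hz). lra.
Qed.

Lemma tpoly_cmult (c : C) (a : nat -> C) (z : C) (N : nat) :
  tpoly (fun k => c * a k)%C z N = (c * tpoly a z N)%C.
Proof. induction N as [|N IH]; simpl; [|rewrite IH]; ring. Qed.

Lemma jet_cmult (c : C) (f : C -> C) (a : nat -> C) (N : nat) :
  jet f a N -> jet (fun z => c * f z)%C (fun k => c * a k)%C N.
Proof.
  intros [K H]. exists (Cmod c * K). intros z Hz. rewrite tpoly_cmult.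
  replace (c * f z - c * tpoly a z N)%C with (c * (f z - tpoly a z N))%C by ring.
  rewrite Cmod_mult, Rmult_assoc. apply Rmult_le_compat_l. apply Cmod_ge_0. auto.
Qed.

Lemma jet_ext (f g : C -> C) (a b : nat -> C) (N : nat) :
  (forall z, Cmod z < 1 -> f z = g z) -> (forall k, (k < N)%nat -> a k = b k) -> jet f a N -> jet g b N.
Proof.
  intros Hf Ha [K H]. exists K. intros z Hz. rewrite <- Hf by auto.
  rewrite <- (tpoly_ext a b z N Ha). auto.
Qed.

Definition shift (k : nat) (a : nat -> C) (n : nat) : C := if (k <=? n)%nat then a (n - k)%nat else RtoC 0.

Lemma tpoly_shift (k : nat) (a : nat -> C) (z : C) (N : nat) :
  tpoly (shift k a) z (k + N) = (z ^ k * tpoly a z N)%C.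
Proof.
  induction N as [|N IH].
  - rewrite Nat.add_0_r. simpl. replace (z ^ k * 0)%C with (RtoC 0) by ring.
    assert (H : forall j, (j <= k)%nat -> tpoly (shift k a) z j = RtoC 0).
    { induction j as [|j IHj]; intros Hj; auto. simpl. rewrite IHj by lia.
      unfold shift. rewrite (proj2 (Nat.leb_gt k j)) by lia. ring. }
    apply H. lia.
  - rewrite Nat.add_succ_r. simpl. rewrite IH. unfold shift.
    rewrite (proj2 (Nat.leb_le k (k + N))) by lia.
    replace (k + N - k)%nat with N by lia. rewrite Cpow_add_r. ring.
Qed.

Lemma jet_shift (k : nat) (f : C -> C) (a : nat -> C) (N : nat) :
  jet f a N -> jet (fun z => z ^ k * f z)%C (shift k a) (k + N).
Proof.
  intros [K H]. exists K. intros z Hz. rewrite tpoly_shift.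
  replace (z ^ k * f z - z ^ k * tpoly a z N)%C with (z ^ k * (f z - tpoly a z N))%C by ring.
  rewrite Cmod_mult, Cmod_pow, pow_add. specialize (H z Hz).
  assert (0 <= Cmod z ^ k) by (apply pow_le; apply Cmod_ge_0). nra.
Qed.

Lemma jet_tpoly (a : nat -> C) (N : nat) : jet (fun z => tpoly a z N) a N.
Proof.
  exists 0. intros z _. replace (tpoly a z N - tpoly a z N)%C with (RtoC 0) by ring.
  rewrite Cmod_0. lra.
Qed.

Lemma jet_csum (f : nat -> C -> C) (a : nat -> nat -> C) (N n : nat) :
  (forall i, (i < n)%nat -> jet (f i) (a i) N) ->
  jet (fun z => csum (fun i => f i z) n) (fun k => csum (fun i => a i k) n) N.
Proof.
  induction n as [|n IH]; intros H.
  - exists 0. intros z _. simpl.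
    assert (E : tpoly (fun _ => RtoC 0) z N = RtoC 0).
    { clear. induction N as [|N IH]; simpl; [|rewrite IH]; ring. }
    rewrite E. replace (RtoC 0 - RtoC 0)%C with (RtoC 0) by ring. rewrite Cmod_0. lra.
  - simpl. apply (jet_plus (fun z => csum (fun i => f i z) n) (f n)). apply IH. auto. auto.
Qed.

Lemma jet_coef_unique (f : C -> C) (a b : nat -> C) :
  (forall N, jet f a N) -> (forall N, jet f b N) -> forall k, a k = b k.
Proof.
  intros Ha Hb k.
  assert (E : (a k - b k)%C = RtoC 0).
  { apply (jet_unique (fun k => a k - b k)%C (RtoC 1)). apply RtoC_neq; lra.
    intros N. destruct (Ha N) as [K HK]. destruct (Hb N) as [L HL].
    exists (K + L), 1. split. lra. intros e He.
    rewrite Cmult_1_r, tpoly_minus.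
    assert (M : Cmod (RtoC e) = e) by (apply Cmod_RtoC_pos; lra).
    specialize (HK (RtoC e) ltac:(lra)). specialize (HL (RtoC e) ltac:(lra)). rewrite M in *.
    replace (tpoly a (RtoC e) N - tpoly b (RtoC e) N)%C with
      ((f (RtoC e) - tpoly b (RtoC e) N) - (f (RtoC e) - tpoly a (RtoC e) N))%C by ring.
    eapply Rle_trans. apply Cmod_sub_le. lra. }
  replace (a k) with (a k - b k + b k)%C by ring. rewrite E. ring.
Qed.

(** Collects the pairs with i + j + 1 = n. For [n = 0] the sum is empty, so the truncated
    subtraction does no harm. *)
Definition conv_coef (a b : nat -> C) (n : nat) : C :=
  csum (fun i => RtoC (beta i (n - 1 - i)) * (a i * b (n - 1 - i)%nat))%C n.

Lemma ccont_tpoly (a : nat -> C) (N : nat) (z : C) : ccont (fun z => tpoly a z N) z.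
Proof.
  induction N as [|N IH]; simpl. apply ccont_const.
  apply ccont_plus; auto. apply ccont_mult. apply ccont_const.
  apply hol_ccont. apply (hol_pow (fun z => z)). apply hol_id.
Qed.

Lemma conv_plus_l (f f' g : C -> C) (z : C) :
  (forall x, ccont f x) -> (forall x, ccont f' x) -> (forall x, ccont g x) ->
  conv (fun x => f x + f' x)%C g z = (conv f g z + conv f' g z)%C.
Proof.
  intros Hf Hf' Hg. apply is_CInt_unique.
  eapply is_CInt_ext; [lra| |apply is_CInt_plus; apply conv_correct; intros; auto].
  intros s _. unfold conv_integrand. cbv beta. ring.
Qed.

Lemma conv_cmult_l (c : C) (f g : C -> C) (z : C) :
  (forall x, ccont f x) -> (forall x, ccont g x) ->
  conv (fun x => c * f x)%C g z = (c * conv f g z)%C.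
Proof.
  intros Hf Hg. apply is_CInt_unique.
  eapply is_CInt_ext; [lra| |apply is_CInt_cmult; apply conv_correct; intros; auto].
  intros s _. unfold conv_integrand. cbv beta. ring.
Qed.

Lemma conv_sym (f g : C -> C) (z : C) :
  (forall x, ccont f x) -> (forall x, ccont g x) -> conv f g z = conv g f z.
Proof.
  intros Hf Hg. symmetry. apply is_CInt_unique.
  (* The bounds are written as images of 1 and 0 under s -> -1 * s + 1, the form that
     [is_RInt_comp_lin] expects; the swap and the opposite restore the orientation. *)
  assert (H : is_CInt (conv_integrand f g z) (-1 * 1 + 1) (-1 * 0 + 1) (conv f g z)).
  { replace (-1 * 1 + 1) with 0 by ring. replace (-1 * 0 + 1) with 1 by ring. apply conv_correct; auto. }
  apply (is_RInt_swap (V := C_R_NormedModule)) in H.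
  apply (is_RInt_comp_lin (V := C_R_NormedModule)) in H.
  apply (is_RInt_opp (V := C_R_NormedModule)) in H.
  rewrite opp_opp in H.
  eapply is_CInt_ext; [lra| |exact H].
  intros s _. unfold conv_integrand.
  transitivity ((z * (f (RtoC (-1 * s + 1) * z) * g (RtoC (1 - (-1 * s + 1)) * z)))%C).
  - set (X := (z * (f (RtoC (-1 * s + 1) * z) * g (RtoC (1 - (-1 * s + 1)) * z)))%C).
    change ((- (-1 * fst X), - (-1 * snd X)) = X). destruct X as [x y]. simpl. f_equal; ring.
  - replace (-1 * s + 1) with (1 - s) by ring. replace (1 - (1 - s)) with s by ring. ring.
Qed.

Lemma hol_monomial (i : nat) (z : C) : hol (fun x => x ^ i)%C z.
Proof. apply (hol_pow (fun z => z)). apply hol_id. Qed.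

Lemma conv_tpoly_r (i : nat) (b : nat -> C) (N : nat) (z : C) :
  conv (fun x => x ^ i)%C (fun x => tpoly b x N) z =
  (z ^ (i + 1) * tpoly (fun j => RtoC (beta i j) * b j)%C z N)%C.
Proof.
  assert (Hm : forall k x, ccont (fun x => x ^ k)%C x) by (intros; apply hol_ccont; apply hol_monomial).
  assert (Ht : forall n x, ccont (fun x => tpoly b x n) x) by (intros; apply ccont_tpoly).
  rewrite conv_sym by auto.
  induction N as [|N IH]; simpl.
  - rewrite conv_zero_l. ring.
  - rewrite conv_plus_l; auto.
    + rewrite IH, conv_cmult_l; auto. rewrite conv_sym by auto. rewrite conv_monomials.
      replace (i + N + 1)%nat with ((i + 1) + N)%nat by lia. rewrite (Cpow_add_r z (i + 1) N). ring.
    + intros x. apply ccont_mult. apply ccont_const. apply Hm.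
Qed.

Lemma conv_tpoly (a b : nat -> C) (N M : nat) (z : C) :
  conv (fun x => tpoly a x N) (fun x => tpoly b x M) z =
  csum (fun i => a i * (z ^ (i + 1) * tpoly (fun j => RtoC (beta i j) * b j)%C z M))%C N.
Proof.
  assert (Hm : forall k x, ccont (fun x => x ^ k)%C x) by (intros; apply hol_ccont; apply hol_monomial).
  assert (Ht : forall a n x, ccont (fun x => tpoly a x n) x) by (intros; apply ccont_tpoly).
  induction N as [|N IH]; simpl.
  - apply conv_zero_l.
  - rewrite conv_plus_l; auto.
    + rewrite IH, conv_cmult_l, conv_tpoly_r; auto.
    + intros x. apply ccont_mult. apply ccont_const. apply Hm.
Qed.

Lemma jet_conv_tpoly (a b : nat -> C) (N : nat) :
  jet (conv (fun x => tpoly a x N) (fun x => tpoly b x N)) (conv_coef a b) (S N).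
Proof.
  apply (jet_ext (fun z => csum (fun i => a i * (z ^ (i + 1) * tpoly (fun j => RtoC (beta i j) * b j)%C z N))%C N) _
    (fun k => csum (fun i => a i * shift (i + 1) (fun j => RtoC (beta i j) * b j) k)%C N)).
  - intros z _. symmetry. apply conv_tpoly.
  - intros k Hk. unfold conv_coef.
    (* For i >= k the shifted coefficient vanishes, so the sum up to [n] shrinks to the one in
       [conv_coef]. *)
    assert (H : forall n, (k <= n)%nat ->
      csum (fun i => a i * shift (i + 1) (fun j => RtoC (beta i j) * b j) k)%C n =
      csum (fun i => RtoC (beta i (k - 1 - i)) * (a i * b (k - 1 - i)%nat))%C k).
    { intros n Hn. replace n with (k + (n - k))%nat by lia. generalize (n - k)%nat. intros p.
      induction p as [|p IH].
      - rewrite Nat.add_0_r. apply csum_ext. intros i Hi. unfold shift.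
        rewrite (proj2 (Nat.leb_le (i + 1) k)) by lia.
        replace (k - (i + 1))%nat with (k - 1 - i)%nat by lia. ring.
      - rewrite Nat.add_succ_r. simpl. rewrite IH. unfold shift.
        rewrite (proj2 (Nat.leb_gt (k + p + 1) k)) by lia. ring. }
    apply H. lia.
  - apply jet_csum. intros i Hi. apply jet_cmult.
    apply (jet_le _ _ (i + 1 + N)). lia. apply jet_shift. apply jet_tpoly.
Qed.

(** Both factors are replaced by their Taylor polynomials, through f (g - r) + r (f - p). The factor
    [z] in front of the convolution supplies the additional order. *)
Lemma jet_conv (f g : C -> C) (a b : nat -> C) (N : nat) (F : R) :
  (forall z, Cmod z < 1 -> ccont f z) -> (forall z, Cmod z < 1 -> ccont g z) ->
  (forall z, Cmod z < 1 -> Cmod (f z) <= F) ->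
  jet f a N -> jet g b N -> jet (conv f g) (conv_coef a b) (S N).
Proof.
  intros Hf Hg HF Ja Jb.
  destruct (jet_conv_tpoly a b N) as [K0 H0].
  apply jet_nonneg in Ja. destruct Ja as [K [HK Ja]].
  apply jet_nonneg in Jb. destruct Jb as [L [HL Jb]].
  set (G := csum (fun k => RtoC (Cmod (b k))) N).
  assert (HG : forall z, Cmod z < 1 -> Cmod (tpoly b z N) <= Cmod G).
  { intros z Hz. 
    assert (X : forall n, 0 <= Re (csum (fun k => RtoC (Cmod (b k))) n) /\ Cmod (tpoly b z n) <= Re (csum (fun k => RtoC (Cmod (b k))) n)).
    { induction n as [|n [IH1 IH2]].
      - simpl. rewrite Cmod_0. unfold Re, RtoC; simpl. lra.
      - cbn [csum tpoly]. change (Re (csum (fun k => RtoC (Cmod (b k))) n + RtoC (Cmod (b n)))) with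
          (Re (csum (fun k => RtoC (Cmod (b k))) n) + Cmod (b n)).
        split. { generalize (Cmod_ge_0 (b n)). lra. }
        eapply Rle_trans. apply Cmod_triangle. rewrite Cmod_mult, Cmod_pow.
        assert (0 <= Cmod z ^ n <= 1).
        { split. apply pow_le, Cmod_ge_0. rewrite <- (pow1 n). apply pow_incr. generalize (Cmod_ge_0 z). lra. }
        generalize (Cmod_ge_0 (b n)). nra. }
    eapply Rle_trans. apply X. apply Re_le_Cmod. }
  exists (K0 + (F * L + Cmod G * K)). intros z Hz. specialize (H0 z Hz).
  set (p := fun x => tpoly a x N) in *. set (r := fun x => tpoly b x N) in *.
  replace (conv f g z - tpoly (conv_coef a b) z (S N))%C with
    ((conv p r z - tpoly (conv_coef a b) z (S N)) + (conv f g z - conv p r z))%C by ring.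
  eapply Rle_trans. apply Cmod_triangle. rewrite Rmult_plus_distr_r. apply Rplus_le_compat; auto.
  assert (Hs : forall s, 0 <= s <= 1 -> Cmod (RtoC s * z)%C <= Cmod z).
  { intros s Hs. rewrite Cmod_mult, Cmod_RtoC_pos by lra. generalize (Cmod_ge_0 z). nra. }
  replace ((F * L + Cmod G * K) * Cmod z ^ S N) with
    ((1 - 0) * (Cmod z * ((F * L + Cmod G * K) * Cmod z ^ N))) by (simpl; ring).
  assert (Hsp : forall s h k, 0 <= s <= 1 -> 0 <= k -> Cmod h <= k * Cmod (RtoC s * z)%C ^ N -> Cmod h <= k * Cmod z ^ N).
  { intros s h k Hs' Hk Hh. eapply Rle_trans; [exact Hh|]. apply Rmult_le_compat_l; auto.
    apply pow_incr. split. apply Cmod_ge_0. auto. }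
  eapply is_CInt_bound_const; [| |apply is_CInt_minus; apply conv_correct]; try lra.
  - intros s Hs'. cbv beta. unfold conv_integrand.
    set (u := (RtoC s * z)%C). set (v := (RtoC (1 - s) * z)%C).
    replace (z * (f u * g v) - z * (p u * r v))%C with (z * (f u * (g v - r v) + r v * (f u - p u)))%C by ring.
    rewrite Cmod_mult. apply Rmult_le_compat_l. apply Cmod_ge_0.
    assert (Hu : Cmod u < 1) by (eapply Rle_lt_trans; [apply Hs; lra|auto]).
    assert (Hv : Cmod v < 1) by (eapply Rle_lt_trans; [apply Hs; lra|auto]).
    eapply Rle_trans. apply Cmod_triangle. rewrite !Cmod_mult.
    assert (B1 : Cmod (g v - r v)%C <= L * Cmod z ^ N) by (apply (Hsp (1 - s)); [lra|auto|apply Jb; auto]).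
    assert (B2 : Cmod (f u - p u)%C <= K * Cmod z ^ N) by (apply (Hsp s); [lra|auto|apply Ja; auto]).
    rewrite Rmult_plus_distr_r, !Rmult_assoc.
    apply Rplus_le_compat; apply Rmult_le_compat; auto; try apply Cmod_ge_0. apply HG; auto.
  - intros s Hs'. apply Hf. eapply Rle_lt_trans; [apply Hs; lra|auto].
  - intros s Hs'. apply Hg. eapply Rle_lt_trans; [apply Hs; lra|auto].
  - intros s Hs'. apply ccont_tpoly.
  - intros s Hs'. apply ccont_tpoly.
Qed.

Lemma csum_zero (F : nat -> C) (n : nat) : (forall i, (i < n)%nat -> F i = RtoC 0) -> csum F n = RtoC 0.
Proof. induction n as [|n IH]; intros H; simpl; auto. rewrite IH, H; auto. ring. Qed.

Lemma csum_last (F : nat -> C) (n : nat) :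
  (forall i, (i < n)%nat -> F i = RtoC 0) -> csum F (S n) = F n.
Proof. intros H. simpl. rewrite csum_zero by auto. ring. Qed.

Lemma csum_head (F : nat -> C) (n : nat) : csum F (S n) = (F O + csum (fun i => F (S i)) n)%C.
Proof. induction n as [|n IH]. simpl; ring. simpl csum in *. rewrite IH. ring. Qed.

(** The factorial cancels the denominator of [beta]: in terms of the coefficients before Borel
    transformation, convolution is the Cauchy product. *)
Lemma conv_coef_fact (a b : nat -> C) (n : nat) :
  (RtoC (INR (fact n)) * conv_coef a b n)%C =
  csum (fun i => RtoC (INR (fact i)) * a i * (RtoC (INR (fact (n - 1 - i))) * b (n - 1 - i)%nat))%C n.
Proof.
  unfold conv_coef. rewrite <- csum_cmult. apply csum_ext. intros i Hi. unfold beta.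
  replace (i + (n - 1 - i) + 1)%nat with n by lia.
  unfold Rdiv. rewrite !RtoC_mult, RtoC_inv by apply INR_fact_neq_0.
  field. apply RtoC_neq. apply INR_fact_neq_0.
Qed.

Definition delta (k n : nat) : C := if (n =? k)%nat then RtoC 1 else RtoC 0.

Lemma jet_monomial (k N : nat) : jet (fun z => z ^ k)%C (delta k) N.
Proof.
  apply (jet_le _ _ (k + S N)). lia.
  apply (jet_ext (fun z => z ^ k * RtoC 1)%C _ (shift k (delta 0))).
  - intros z _. ring.
  - intros n _. unfold shift, delta.
    destruct (Nat.leb_spec k n); destruct (Nat.eqb_spec (n - k) 0);
    destruct (Nat.eqb_spec n k); auto; lia.
  - apply jet_shift. exists 0. intros z _.
    assert (E : forall n, tpoly (delta 0) z (S n) = RtoC 1).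
    { induction n as [|n IH]. { unfold delta; simpl; ring. }
      change (tpoly (delta 0) z (S n) + delta 0 (S n) * z ^ S n = RtoC 1)%C. rewrite IH. unfold delta. simpl. ring. }
    rewrite E. replace (RtoC 1 - RtoC 1)%C with (RtoC 0) by ring. rewrite Cmod_0. lra.
Qed.

(* The recursion of the Taylor coefficients in terms of the coefficients of the formal
   series [1 + sum_n n! a_n z^(n+1)], whose Borel transform is [w]. *)
Definition series_of (a : nat -> C) (n : nat) : C :=
  match n with O => RtoC 1 | S m => (RtoC (INR (fact m)) * a m)%C end.

Lemma borel_coefficient_recursion (c A nu : R) (w : C -> C) :
  exp_bounded c A nu w -> 0 <= A -> 0 < nu ->
  (forall z, borel_domain c z -> (borel_symbol z * w z)%C = borel_rhs w z) ->
  exists a : nat -> C,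
    (forall k, Cmod (a k) <= A * exp nu * 8 ^ k) /\
    (forall N z, Cmod z < 1 -> Cmod (w z - tpoly a z N)%C <= A * exp nu * (8 * Cmod z) ^ N) /\
    forall n, (RtoC (25 * (INR n - 1) ^ 2 - 4) * match n with O => RtoC 0 | S m => series_of a m end)%C =
      (RtoC 3456 * csum (fun i => series_of a i * series_of a (S n - i)) (S (S n)))%C.
Proof.
  intros [Hw Hb] HA Hnu Heq.
  assert (Hin : forall z, Cmod z < 1 -> borel_domain c z) by (intros; left; auto).
  assert (HM : forall z, Cmod z < 1 -> Cmod (w z) <= A * exp nu).
  { intros z Hz. eapply Rle_trans. apply Hb; auto. apply Rmult_le_compat_l; auto.
    left. apply exp_increasing. nra. }
  destruct (taylor w 1 (A * exp nu) Rlt_0_1 (fun z Hz => Hw z (Hin z Hz)) HM) as [a [Hak Ha]].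
  exists a. split.
  { intros k. specialize (Hak k). replace (8 / 1) with 8 in Hak by field. auto. }
  split.
  { intros N z Hz. specialize (Ha N z Hz). replace (8 / 1) with 8 in Ha by field. auto. }
  assert (Ja : forall N, jet w a N).
  { intros N. exists (A * exp nu * 8 ^ N). intros z Hz. specialize (Ha N z Hz).
    replace (8 / 1) with 8 in Ha by field. rewrite Rpow_mult_distr in Ha. lra. }
  assert (Cw : forall z, Cmod z < 1 -> ccont w z) by (intros; apply hol_ccont; auto).
  assert (JL : forall N, jet (fun z => borel_symbol z * w z)%C
    (fun n => RtoC 25 * shift 2 a n + - RtoC 6912 * a n)%C N).
  { intros N. apply (jet_ext (fun z => RtoC 25 * (z ^ 2 * w z) + - RtoC 6912 * w z)%C _
      (fun n => RtoC 25 * shift 2 a n + - RtoC 6912 * a n)%C); auto.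
    - intros z _. unfold borel_symbol. simpl. ring.
    - apply jet_plus; apply jet_cmult; auto. apply (jet_le _ _ (2 + N)). lia. apply jet_shift. auto. }
  assert (JR : forall N, jet (borel_rhs w)
    (fun n => RtoC 4 * delta 1 n + RtoC 25 * conv_coef (shift 1 a) (delta 0) n
      + RtoC 4 * conv_coef a (delta 1) n + RtoC 3456 * conv_coef a a n)%C N).
  { intros N. unfold borel_rhs. apply (jet_le _ _ (S N)). lia.
    assert (J1 : jet (fun x => x) (delta 1) (S N)).
    { eapply jet_ext; [| |apply (jet_monomial 1)]; auto. intros; simpl; ring. }
    assert (J0 : jet (fun _ => RtoC 1) (delta 0) (S N)).
    { eapply jet_ext; [| |apply (jet_monomial 0)]; auto. }
    assert (JS : jet (fun z => z * w z)%C (shift 1 a) (S N)).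
    { eapply jet_ext; [| |apply (jet_shift 1 w a N)]; auto. intros; simpl; ring. }
    apply (jet_plus (fun z => RtoC 4 * z + RtoC 25 * conv (fun x => x * w x)%C (fun _ => RtoC 1) z
       + RtoC 4 * conv w (fun x => x) z)%C).
    apply (jet_plus (fun z => RtoC 4 * z + RtoC 25 * conv (fun x => x * w x)%C (fun _ => RtoC 1) z)%C).
    apply jet_plus.
    - apply (jet_cmult (RtoC 4) (fun z => z)). auto.
    - apply jet_cmult. apply (jet_conv _ _ _ _ N (A * exp nu)).
      + intros z Hz. apply ccont_mult. apply ccont_id. auto.
      + intros; apply ccont_const.
      + intros z Hz. rewrite Cmod_mult. specialize (HM z Hz).
        generalize (Cmod_ge_0 z) (Cmod_ge_0 (w z)). nra.
      + apply (jet_le _ _ (S N)); auto.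
      + apply (jet_le _ _ (S N)); auto.
    - apply jet_cmult. apply (jet_conv _ _ _ _ N (A * exp nu)); auto.
      + intros; apply ccont_id.
      + apply (jet_le _ _ (S N)); auto.
    - apply jet_cmult. apply (jet_conv _ _ _ _ N (A * exp nu)); auto. }
  assert (E := jet_coef_unique (borel_rhs w) _ _
    (fun N => jet_ext _ _ _ _ N (fun z Hz => Heq z (Hin z Hz)) (fun k _ => eq_refl) (JL N)) JR).
  intros n. specialize (E n). cbv beta in E.
  assert (Ef := f_equal (fun x => RtoC (INR (fact n)) * x)%C E). cbv beta in Ef. clear E.
  assert (R1 : (RtoC (INR (fact n)) * (RtoC 4 * delta 1 n + RtoC 25 * conv_coef (shift 1 a) (delta 0) n
      + RtoC 4 * conv_coef a (delta 1) n + RtoC 3456 * conv_coef a a n) =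
      RtoC 4 * (RtoC (INR (fact n)) * delta 1 n)
      + RtoC 25 * (RtoC (INR (fact n)) * conv_coef (shift 1 a) (delta 0) n)
      + RtoC 4 * (RtoC (INR (fact n)) * conv_coef a (delta 1) n)
      + RtoC 3456 * (RtoC (INR (fact n)) * conv_coef a a n))%C) by ring.
  rewrite R1, !conv_coef_fact in Ef. clear R1.
  rewrite csum_head. cbn [csum]. replace (S n - S n)%nat with O by lia.
  replace (S n - 0)%nat with (S n) by lia.
  assert (Ec : csum (fun i => series_of a (S i) * series_of a (S n - S i))%C n =
    csum (fun i => RtoC (INR (fact i)) * a i * (RtoC (INR (fact (n - 1 - i))) * a (n - 1 - i)%nat))%C n).
  { apply csum_ext. intros i Hi. replace (S n - S i)%nat with (S (n - 1 - i)) by lia. reflexivity. }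
  rewrite Ec.
  set (Q := csum (fun i => RtoC (INR (fact i)) * a i * (RtoC (INR (fact (n - 1 - i))) * a (n - 1 - i)%nat))%C n) in *.
  (* Degree 0 forces [a 0 = 0]. In degree 1 the source 4 z accounts for the leading coefficient 1.
     From degree 2 on, each convolution with a [delta] reduces to a single term. *)
  destruct n as [|[|n]].
  - simpl in Ef |- *. unfold shift, delta, Q in *. simpl in *.
    assert (E : a O = RtoC 0).
    { assert (X : (RtoC 6912 * a O = RtoC 0)%C).
      { transitivity (- (1 * (RtoC 25 * RtoC 0 + - RtoC 6912 * a O)))%C. ring. rewrite Ef. ring. }
      replace (a O) with (/ RtoC 6912 * (RtoC 6912 * a O))%C by (field; apply RtoC_neq; lra).
      rewrite X. ring. }
    rewrite E. ring.
  - unfold Q in *. simpl in Ef |- *. unfold shift, delta in *. simpl in *.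
    replace (25 * ((1 - 1) * ((1 - 1) * 1)) - 4) with (- (4)) by ring. rewrite RtoC_opp.
    replace (RtoC 6912) with (RtoC 3456 + RtoC 3456)%C in Ef by (rewrite <- RtoC_plus; f_equal; lra).
    transitivity (- (1 * (RtoC 25 * RtoC 0 + - (RtoC 3456 + RtoC 3456) * a 1%nat)) +
      (1 * (RtoC 25 * RtoC 0 + - (RtoC 3456 + RtoC 3456) * a 1%nat) - RtoC 4))%C. ring.
    rewrite Ef at 2. ring.
  - assert (X0 : csum (fun i => RtoC (INR (fact i)) * shift 1 a i *
      (RtoC (INR (fact (S (S n) - 1 - i))) * delta 0 (S (S n) - 1 - i)))%C (S (S n)) =
      (RtoC (INR (fact (S n))) * a n)%C).
    { rewrite csum_last.
      - replace (S (S n) - 1 - S n)%nat with O by lia.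
        replace (shift 1 a (S n)) with (a n) by (unfold shift; simpl; f_equal; lia).
        change (delta 0 0) with (RtoC 1). simpl (fact 0). simpl (INR 1). ring.
      - intros i Hi. unfold delta. destruct (Nat.eqb_spec (S (S n) - 1 - i) 0). lia. ring. }
    assert (X1 : csum (fun i => RtoC (INR (fact i)) * a i *
      (RtoC (INR (fact (S (S n) - 1 - i))) * delta 1 (S (S n) - 1 - i)))%C (S (S n)) =
      (RtoC (INR (fact n)) * a n)%C).
    { cbn [csum]. rewrite csum_zero.
      - replace (S (S n) - 1 - S n)%nat with O by lia. replace (S (S n) - 1 - n)%nat with 1%nat by lia.
        change (delta 1 1) with (RtoC 1). change (delta 1 0) with (RtoC 0). simpl (fact 1). simpl (INR 1). ring.
      - intros i Hi. unfold delta. destruct (Nat.eqb_spec (S (S n) - 1 - i) 1). lia. ring. }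
    rewrite X0, X1 in Ef.
    replace (delta 1 (S (S n))) with (RtoC 0) in Ef by reflexivity.
    replace (shift 2 a (S (S n))) with (a n) in Ef by (unfold shift; simpl; f_equal; lia).
    cbn [series_of].
    rewrite !fact_simpl, !mult_INR in Ef. rewrite fact_simpl, mult_INR.
    rewrite fact_simpl, mult_INR.
    set (fn := INR (fact n)) in *. rewrite !S_INR in *. set (x := INR n) in *.
    replace (RtoC 6912) with (RtoC 3456 + RtoC 3456)%C in Ef by (rewrite <- RtoC_plus; f_equal; lra).
    repeat rewrite ?RtoC_mult, ?RtoC_plus in Ef.
    replace (25 * (x + 1 + 1 - 1) ^ 2 - 4) with (25 * ((x + 1) * (x + 1)) + - (4)) by ring.
    repeat rewrite ?RtoC_mult, ?RtoC_plus, ?RtoC_opp.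
    match type of Ef with (?L = ?Rr)%C =>
      transitivity (L - Rr + (RtoC 3456 * (RtoC 1 * ((RtoC x + RtoC 1 + RtoC 1) * ((RtoC x + RtoC 1) * RtoC fn) * a (S (S n))) + (Q + (RtoC x + RtoC 1 + RtoC 1) * ((RtoC x + RtoC 1) * RtoC fn) * a (S (S n)) * RtoC 1))))%C
    end.
    + ring.
    + rewrite Ef. ring.
Qed.

(** * The formal solution *)

Lemma open_Cmod (U : C -> Prop) (z : C) :
  open (T := C_UniformSpace) U -> U z -> exists r, 0 < r /\ forall y, Cmod (y - z)%C < r -> U y.
Proof.
  intros HU Hz. destruct (HU z Hz) as [e He]. exists e. split. apply cond_pos.
  intros y Hy. apply He. apply C_NormedModule_mixin_compat1. exact Hy.
Qed.

Lemma Cmod_open (U : C -> Prop) :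
  (forall z, U z -> exists r, 0 < r /\ forall y, Cmod (y - z)%C < r -> U y) ->
  open (T := C_UniformSpace) U.
Proof.
  intros H z Hz. destruct (H z Hz) as [r [Hr Hy]].
  assert (Hs := sqrt2_bounds).
  assert (Hr2 : 0 < r / 2) by lra.
  exists (mkposreal _ Hr2). intros y By. apply Hy.
  apply C_NormedModule_mixin_compat2 in By. simpl in By.
  change (Cmod (y - z)%C < sqrt 2 * (r / 2)) in By. nra.
Qed.

Lemma sum_n_csum (F : nat -> C) (n : nat) : sum_n F n = csum F (S n).
Proof.
  induction n as [|n IH].
  - rewrite sum_O. simpl. ring.
  - rewrite sum_Sn, IH. reflexivity.
Qed.

(** The power u^(1 - 5 n / 2), the only one compatible with homogeneity. For odd [n] it would need a
    square root of [u], but the odd coefficients vanish, so 0 is a safe value. *)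
Definition formal_term (u : C) (n : nat) : C :=
  if Nat.even n then (u * (/ u) ^ (5 * Nat.div2 n))%C else RtoC 0.

Lemma formal_term_mul (u : C) (i j : nat) : u <> RtoC 0 ->
  Nat.even i = true -> Nat.even j = true ->
  (formal_term u i * formal_term u j = u * formal_term u (i + j))%C.
Proof.
  intros Hu Hi Hj. unfold formal_term.
  apply Nat.even_spec in Hi. apply Nat.even_spec in Hj.
  destruct Hi as [p ->]. destruct Hj as [r ->].
  replace (2 * p + 2 * r)%nat with (2 * (p + r))%nat by lia.
  rewrite !Nat.even_mul. simpl (Nat.even 2). simpl orb.
  rewrite !Nat.div2_double.
  replace (5 * (p + r))%nat with (5 * p + 5 * r)%nat by lia. rewrite Cpow_add_r. ring.
Qed.

Lemma cdiff_recip_pow (f : C -> C) (z : C) (n : nat) :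
  cdiff f z (- / (RtoC 12 * f z))%C -> f z <> RtoC 0 ->
  cdiff (fun x => (/ f x) ^ n)%C z (RtoC (INR n) / RtoC 12 * (/ f z) ^ (n + 2))%C.
Proof.
  intros H Hn. eapply cdiff_eq.
  { apply (cdiff_pow (fun x => / f x)%C). apply cdiff_inv; eauto. }
  cbv beta. destruct n as [|n].
  - simpl. unfold Cdiv. ring.
  - replace (S n - 1)%nat with n by lia. replace (S n + 2)%nat with (n + 3)%nat by lia.
    rewrite Cpow_add_r. simpl ((/ f z) ^ 3)%C. field; repeat split; auto; apply RtoC_neq; lra.
Qed.

(** The assumed derivative is that of a root of 6 u^2 + t = 0. With k = 5 n / 2, differentiating
    u^(1 - k) twice gives (k^2 - 1) / 144 times u^(- k - 3), and (k^2 - 1) / 144 = (25 n^2 - 4) /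
    576. *)
Lemma formal_term_second_derivative (f : C -> C) (U : C -> Prop) (n : nat) :
  (forall z, U z -> exists r, 0 < r /\ forall y, Cmod (y - z)%C < r -> U y) ->
  (forall z, U z -> f z <> RtoC 0 /\ cdiff f z (- / (RtoC 12 * f z))%C) ->
  exists d1 : C -> C, (forall z, U z -> cdiff (fun x => formal_term (f x) n) z (d1 z)) /\
    forall z, U z -> cdiff d1 z (RtoC (25 * INR n ^ 2 - 4) / RtoC 576 * (f z * formal_term (f z) (S (S n))))%C.
Proof.
  intros HU Hf. unfold formal_term. cbn [Nat.even Nat.div2].
  destruct (Nat.even n) eqn:En.
  2: { exists (fun _ => RtoC 0). split.
       - intros z _. apply cdiff_const.
       - intros z _. eapply cdiff_eq. apply cdiff_const. ring. }
  apply Nat.even_spec in En. destruct En as [p ->]. rewrite Nat.div2_double.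
  set (k := (5 * p)%nat).
  exists (fun z => RtoC (INR k - 1) / RtoC 12 * (/ f z) ^ (k + 1))%C. split.
  - intros z Hz. destruct (Hf z Hz) as [Hn Hd]. eapply cdiff_eq.
    { apply cdiff_mult; [exact Hd|]. apply cdiff_recip_pow; auto. }
    cbv beta. rewrite !Cpow_add_r, RtoC_minus. simpl ((/ f z) ^ 2)%C. simpl ((/ f z) ^ 1)%C.
    field; repeat split; auto; apply RtoC_neq; lra.
  - intros z Hz. destruct (Hf z Hz) as [Hn Hd]. eapply cdiff_eq.
    { apply cdiff_mult; [apply cdiff_const|]. apply cdiff_recip_pow; auto. }
    cbv beta. replace (5 * S p)%nat with (k + 5)%nat by (unfold k; lia).
    replace (k + 1 + 2)%nat with (k + 3)%nat by lia.
    rewrite !Cpow_add_r. simpl ((/ f z) ^ 3)%C. simpl ((/ f z) ^ 5)%C.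
    replace (25 * INR (2 * p) ^ 2 - 4) with (4 * ((INR k - 1) * INR (k + 1))).
    + rewrite !RtoC_mult, RtoC_minus.
      replace (RtoC 576) with (RtoC 4 * RtoC 12 * RtoC 12)%C by (rewrite <- !RtoC_mult; f_equal; lra).
      field; repeat split; auto; apply RtoC_neq; lra.
    + unfold k. rewrite plus_INR, !mult_INR. simpl (INR 1). simpl (INR 2). simpl (INR 5). ring.
Qed.

(** The coefficient of hbar^(n+1) in the equation, freed of its power of q_0; 3456 is 6 * 576. The
    second derivative shifts the order by two, so the left side involves b_(n-1) and is empty for
    [n = 0]. *)
Definition pi_recursion (b : nat -> C) : Prop :=
  b O = RtoC 1 /\
  forall n, (RtoC (25 * (INR n - 1) ^ 2 - 4) * match n with O => RtoC 0 | S m => b m end)%C =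
      (RtoC 3456 * csum (fun i => b i * b (S n - i)%nat) (S (S n)))%C.

Lemma pi_recursion_split (b : nat -> C) (n : nat) :
  csum (fun i => b i * b (S n - i)%nat)%C (S (S n)) =
  (RtoC 2 * b O * b (S n) + csum (fun i => b (S i) * b (n - i)%nat) n)%C.
Proof.
  rewrite csum_head. cbn [csum]. replace (S n - S n)%nat with O by lia. replace (S n - 0)%nat with (S n) by lia.
  replace (csum (fun i => b (S i) * b (S n - S i)%nat)%C n) with (csum (fun i => b (S i) * b (n - i)%nat)%C n)
    by (apply csum_ext; intros; f_equal; f_equal; lia).
  replace (RtoC 2) with (RtoC 1 + RtoC 1)%C by (rewrite <- RtoC_plus; f_equal; ring). ring.
Qed.

(** Strong induction: at order n + 1 the unknown enters the square only through 2 u q_(n+1), and u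
    does not vanish away from t = 0. Parity is proved along with the formula, since
    [formal_term_mul] holds for even indices only. *)
Lemma formal_solution_coefficients (t0 : C) (q : nat -> C -> C) (b : nat -> C) :
  pi_recursion b -> formal_solution_near t0 q ->
  (forall n, Nat.even n = false -> b n = RtoC 0) /\
  q O t0 <> RtoC 0 /\ forall n, q n t0 = (b n * formal_term (q O t0) n)%C.
Proof.
  intros [Hb0 Hb] [U [HU [Ht0 [Hnz [Hhol Heq]]]]].
  assert (HUo : forall z, U z -> exists r, 0 < r /\ forall y, Cmod (y - z)%C < r -> U y).
  { intros z Hz. apply open_Cmod; auto. }
  set (u := q O).
  assert (Hu : forall z, U z -> (RtoC 6 * (u z * u z) + z = RtoC 0)%C).
  { intros z Hz. specialize (Heq O z Hz). unfold fps_hbar2_dt2, fps_mul, fps_const in Heq.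
    rewrite sum_O in Heq. symmetry. exact Heq. }
  assert (Hu0 : forall z, U z -> u z <> RtoC 0).
  { intros z Hz E. specialize (Hu z Hz). rewrite E in Hu. apply (Hnz z Hz).
    replace z with (RtoC 6 * (RtoC 0 * RtoC 0) + z)%C by ring. exact Hu. }
  assert (Hud : forall z, U z -> u z <> RtoC 0 /\ cdiff u z (- / (RtoC 12 * u z))%C).
  { intros z Hz. split; auto.
    destruct (proj1 (ex_derive_cdiff u z) (Hhol O z Hz)) as [l Hl].
    destruct (HUo z Hz) as [r [Hr Hin]].
    assert (D : cdiff (fun z => RtoC 6 * (u z * u z) + z)%C z (RtoC 6 * (l * u z + u z * l) + RtoC 1)%C).
    { eapply cdiff_eq.
      { apply cdiff_plus; [|apply cdiff_id]. apply cdiff_mult; [apply cdiff_const|].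
        apply cdiff_mult; eassumption. }
      cbv beta. ring. }
    assert (D0 : cdiff (fun z => RtoC 6 * (u z * u z) + z)%C z (RtoC 0)).
    { apply (cdiff_ext_loc (fun _ => RtoC 0) _ z _ (RtoC 0) r); auto; [|apply cdiff_const].
      intros k Hk. symmetry. apply Hu. apply Hin. replace (z + k - z)%C with k by ring. auto. }
    assert (E := cdiff_unique _ _ _ _ D D0).
    assert (T6 : RtoC 12 = (RtoC 6 + RtoC 6)%C) by (rewrite <- RtoC_plus; f_equal; lra).
    assert (T12 : RtoC 12 <> RtoC 0) by (apply RtoC_neq; lra).
    replace (- / (RtoC 12 * u z))%C with l; auto.
    replace l with ((RtoC 6 * (l * u z + u z * l) + RtoC 1 - RtoC 1) / (RtoC 12 * u z))%C.
    - rewrite E. field. auto.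
    - replace (RtoC 6 * (l * u z + u z * l) + RtoC 1 - RtoC 1)%C with ((RtoC 6 + RtoC 6) * u z * l)%C by ring.
      rewrite <- T6. field. auto. }
  assert (Main : forall n, (Nat.even n = false -> b n = RtoC 0) /\
     forall z, U z -> q n z = (b n * formal_term (u z) n)%C).
  { intros n. induction n as [n IH] using (well_founded_induction Nat.lt_wf_0).
    destruct n as [|n].
    { split. discriminate. intros z Hz. unfold formal_term. simpl. rewrite Hb0. unfold u. ring. }
    assert (Hprod : forall z i j, U z -> (i < S n)%nat -> (j < S n)%nat ->
      (q i z * q j z = b i * b j * (u z * formal_term (u z) (i + j)))%C).
    { intros z i j Hz Hi Hj. destruct (IH i Hi) as [Oi Qi]. destruct (IH j Hj) as [Oj Qj].
      rewrite Qi, Qj by auto.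
      destruct (Nat.even i) eqn:Ei. 2: { rewrite Oi by auto. ring. }
      destruct (Nat.even j) eqn:Ej. 2: { rewrite Oj by auto. ring. }
      rewrite <- formal_term_mul by auto. ring. }
    assert (Hrhs : forall z, U z -> fps_mul q q (S n) z =
      (RtoC 2 * u z * q (S n) z + (u z * formal_term (u z) (S n)) * csum (fun i => b (S i) * b (n - i)%nat) n)%C).
    { intros z Hz. unfold fps_mul. rewrite sum_n_csum.
      rewrite (pi_recursion_split (fun i => q i z) n). f_equal.
      rewrite <- csum_cmult. apply csum_ext. intros i Hi. rewrite Hprod by (auto; lia).
      replace (S i + (n - i))%nat with (S n) by lia. ring. }
    assert (Hlhs : forall z, U z -> fps_hbar2_dt2 q (S n) z =
      (RtoC (25 * (INR n - 1) ^ 2 - 4) / RtoC 576 * (u z * formal_term (u z) (S n)) *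
        match n with O => RtoC 0 | S m => b m end)%C).
    { intros z Hz. destruct n as [|m]; unfold fps_hbar2_dt2; [ring|].
      destruct (formal_term_second_derivative u U m HUo Hud) as [d1 [Hd1 Hd2]].
      destruct (IH m ltac:(lia)) as [_ Qm].
      assert (E1 : forall y, U y -> C_derive (q m) y = (b m * d1 y)%C).
      { intros y Hy. apply is_C_derive_unique. apply is_derive_cdiff.
        destruct (HUo y Hy) as [r [Hr Hin]].
        apply (cdiff_ext_loc (fun x => b m * formal_term (u x) m)%C _ y _ (RtoC 0) r); auto.
        - intros k Hk. symmetry. apply Qm. apply Hin. replace (y + k - y)%C with k by ring. auto.
        - eapply cdiff_eq. { apply cdiff_mult. apply cdiff_const. apply Hd1; auto. } cbv beta. ring. }
      apply is_C_derive_unique. apply is_derive_cdiff.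
      destruct (HUo z Hz) as [r [Hr Hin]].
      apply (cdiff_ext_loc (fun y => b m * d1 y)%C _ z _ (RtoC 0) r); auto.
      - intros k Hk. symmetry. apply E1. apply Hin. replace (z + k - z)%C with k by ring. auto.
      - eapply cdiff_eq. { apply cdiff_mult. apply cdiff_const. apply Hd2; auto. } cbv beta.
        rewrite S_INR. replace (INR m + 1 - 1) with (INR m) by ring. ring. }
    specialize (Hb n). rewrite pi_recursion_split, Hb0 in Hb.
    set (X := csum (fun i => b (S i) * b (n - i)%nat)%C n) in *.
    set (Y := (match n with O => RtoC 0 | S m => b m end)) in *.
    set (c := RtoC (25 * (INR n - 1) ^ 2 - 4)) in *.
    assert (T2 : RtoC 2 <> RtoC 0) by (apply RtoC_neq; lra).
    assert (T6 : RtoC 6 <> RtoC 0) by (apply RtoC_neq; lra).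
    assert (T576 : RtoC 576 <> RtoC 0) by (apply RtoC_neq; lra).
    assert (T3456 : RtoC 3456 = (RtoC 6 * RtoC 576)%C) by (rewrite <- RtoC_mult; f_equal; lra).
    split.
    (* Two indices with an odd sum are not both even, so every product in the sum has a vanishing
       factor. *)
    - intros On.
      assert (HX : X = RtoC 0).
      { unfold X. apply csum_zero. intros i Hi.
        destruct (IH (S i) ltac:(lia)) as [Oi _]. destruct (IH (n - i)%nat ltac:(lia)) as [Oj _].
        destruct (Nat.even (S i)) eqn:Ei. 2: { rewrite Oi by auto. ring. }
        destruct (Nat.even (n - i)) eqn:Ej. 2: { rewrite Oj by auto. ring. }
        exfalso. replace (S n) with (S i + (n - i))%nat in On by lia.
        rewrite Nat.even_add, Ei, Ej in On. discriminate. }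
      assert (HY : Y = RtoC 0).
      { unfold Y. destruct n as [|m]; auto. destruct (IH m ltac:(lia)) as [Om _]. apply Om. exact On. }
      rewrite HX, HY, T3456 in Hb.
      replace (b (S n)) with ((RtoC 6 * RtoC 576 * (RtoC 2 * RtoC 1 * b (S n) + RtoC 0)) / (RtoC 6 * RtoC 576 * RtoC 2))%C
        by (field; auto).
      rewrite <- Hb. unfold Cdiv. ring.
    - intros z Hz. specialize (Heq (S n) z Hz). rewrite Hlhs, Hrhs in Heq by auto.
      unfold fps_const in Heq.
      assert (Hz0 := Hu0 z Hz). set (w := u z) in *. set (h := formal_term w (S n)) in *.
      assert (E : (RtoC 6 * (RtoC 2 * w * q (S n) z) = RtoC 6 * (RtoC 2 * w * (b (S n) * h)))%C).
      { transitivity (RtoC 6 * (RtoC 2 * w * q (S n) z + w * h * X) + RtoC 0 - RtoC 6 * (w * h * X))%C. ring.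
        rewrite <- Heq.
        transitivity ((c * Y) * (w * h) / RtoC 576 - RtoC 6 * (w * h * X))%C. field; auto.
        rewrite Hb, T3456. field; auto. }
      replace (q (S n) z) with ((RtoC 6 * (RtoC 2 * w * q (S n) z)) / (RtoC 6 * (RtoC 2 * w)))%C by (field; auto).
      rewrite E. field; auto. }
  split; [|split].
  - intros n. apply Main.
  - apply Hu0; auto.
  - intros n. apply Main; auto.
Qed.

(** * Uniqueness *)

(** Vanishing on a short segment from [c] makes all Taylor coefficients vanish by [jet_unique]; the
    remainder estimate of [taylor] then tends to 0 on an eighth of the disc. *)
Lemma hol_zero_ball (D : C -> C) (c v : C) (rad M d : R) :
  0 < rad -> 0 < d -> v <> RtoC 0 -> (forall z, Cmod (z - c)%C < rad -> hol D z) ->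
  (forall z, Cmod (z - c)%C < rad -> Cmod (D z) <= M) ->
  (forall e, 0 < e < d -> D (c + RtoC e * v)%C = RtoC 0) ->
  forall z, Cmod (z - c)%C < rad / 8 -> D z = RtoC 0.
Proof.
  intros Hr Hd Hv HD HM Hz z Hzr.
  set (f := fun z => D (c + z)%C).
  assert (Hsh : forall z, (c + z - c)%C = z) by (intros; ring).
  destruct (taylor f rad M Hr) as [a [_ Ha]].
  { intros w Hw. apply (hol_comp D (fun z => c + z)%C).
    - apply hol_plus. apply hol_const. apply hol_id.
    - apply HD. now rewrite Hsh. }
  { intros w Hw. apply HM. now rewrite Hsh. }
  assert (Hvp : 0 < Cmod v) by (apply Cmod_gt_0; auto).
  assert (Ha0 : forall k, a k = RtoC 0).
  { apply (jet_unique a v Hv). intros N. exists (M * (8 / rad * Cmod v) ^ N), (Rmin d (rad / Cmod v)).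
    split. { apply Rmin_case; auto. apply Rdiv_lt_0_compat; auto. }
    intros e [He1 He2].
    destruct (Rmin_Rgt_l _ _ _ He2) as [E1 E2].
    assert (E3 : Cmod (RtoC e * v)%C = e * Cmod v) by (rewrite Cmod_mult, Cmod_RtoC_pos; lra).
    assert (E4 : e * Cmod v < rad).
    { apply (Rmult_lt_compat_r (Cmod v)) in E2; auto. replace (rad / Cmod v * Cmod v) with rad in E2 by (field; lra). auto. }
    specialize (Ha N (RtoC e * v)%C). rewrite E3 in Ha. specialize (Ha E4).
    unfold f in Ha. rewrite Hz in Ha by lra.
    replace (RtoC 0 - tpoly a (RtoC e * v) N)%C with (- tpoly a (RtoC e * v) N)%C in Ha by ring.
    rewrite Cmod_opp in Ha. rewrite Rmult_assoc, <- Rpow_mult_distr.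
    replace (8 / rad * Cmod v * e) with (8 / rad * (e * Cmod v)) by ring. exact Ha. }
  assert (T : forall N, tpoly a (z - c)%C N = RtoC 0).
  { induction N as [|N IH]; simpl; auto. rewrite IH, Ha0. ring. }
  apply Cmod_eq_0. apply Rle_antisym; [|apply Cmod_ge_0].
  set (q := 8 / rad * Cmod (z - c)%C).
  assert (Hq : 0 <= q < 1).
  { unfold q. split. apply Rmult_le_pos. apply Rle_mult_inv_pos; lra. apply Cmod_ge_0.
    replace 1 with (8 / rad * (rad / 8)) by (field; lra). apply Rmult_lt_compat_l; auto.
    apply Rdiv_lt_0_compat; lra. }
  assert (B : forall N, Cmod (D z) <= M * q ^ N).
  { intros N. specialize (Ha N (z - c)%C ltac:(lra)). rewrite T in Ha. unfold f in Ha.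
    replace (c + (z - c))%C with z in Ha by ring.
    replace (D z - RtoC 0)%C with (D z) in Ha by ring. exact Ha. }
  apply (geometric_squeeze _ M q); auto.
Qed.

Lemma hol_locally_bounded (D : C -> C) (c : C) (rad : R) :
  0 < rad -> hol D c -> exists r M, 0 < r <= rad /\ forall z, Cmod (z - c)%C < r -> Cmod (D z) <= M.
Proof.
  intros Hr HD. destruct (hol_ccont D c HD 1 Rlt_0_1) as [d [Hd Hk]].
  exists (Rmin d rad), (Cmod (D c) + 1). split. { split. apply Rmin_case; auto. apply Rmin_r. }
  intros z Hz. assert (Hzd : Cmod (z - c)%C < d) by (eapply Rlt_le_trans; [exact Hz|apply Rmin_l]).
  specialize (Hk _ Hzd). replace (c + (z - c))%C with z in Hk by ring.
  replace (D z) with (D z - D c + D c)%C by ring. eapply Rle_trans. apply Cmod_triangle. lra.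
Qed.

(** Continuation along the segment from [x] to [y]: at the supremum [T] of the parameters reached, a
    radius uniform near [T] lets the vanishing cross [T], so [T] is 1. *)
Lemma identity_convex (S : C -> Prop) (D : C -> C) (x y : C) (r0 : R) :
  (forall z, S z -> exists r, 0 < r /\ forall w, Cmod (w - z)%C < r -> S w) ->
  (forall t, 0 <= t <= 1 -> S (x + RtoC t * (y - x))%C) ->
  (forall z, S z -> hol D z) -> 0 < r0 -> (forall z, Cmod (z - x)%C < r0 -> D z = RtoC 0) ->
  D y = RtoC 0.
Proof.
  intros HS Hseg HD Hr0 Hx0.
  set (g := fun t => (x + RtoC t * (y - x))%C).
  set (L := Cmod (y - x)%C). assert (HL : 0 <= L) by apply Cmod_ge_0.
  assert (Hg : forall t u, Cmod (g t - g u)%C = Rabs (t - u) * L).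
  { intros t u. unfold g.
    replace (x + RtoC t * (y - x) - (x + RtoC u * (y - x)))%C with (RtoC (t - u) * (y - x))%C
      by (rewrite RtoC_minus; ring).
    now rewrite Cmod_mult, Cmod_R. }
  set (P := fun t => exists r, 0 < r /\ forall z, Cmod (z - g t)%C < r -> D z = RtoC 0).
  set (E := fun t => 0 <= t <= 1 /\ forall u, 0 <= u <= t -> P u).
  assert (E0 : E 0).
  { split. lra. intros u Hu. replace u with 0 by lra. exists r0. split; auto. intros z Hz. apply Hx0.
    unfold g in Hz. replace (x + RtoC 0 * (y - x))%C with x in Hz by ring. auto. }
  destruct (completeness E) as [T [HT1 HT2]].
  { exists 1. intros t [Ht _]. lra. }
  { exists 0. auto. }
  assert (HT : 0 <= T <= 1).
  { split. apply HT1; auto. apply HT2. intros t [Ht _]. lra. }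
  destruct (HS (g T) (Hseg T HT)) as [ra [Hra Hin]].
  destruct (hol_locally_bounded D (g T) ra Hra (HD _ (Hseg T HT))) as [r1 [M [Hr1 HM]]].
  set (r := r1 / 2).
  (* Parameters within [d] of [T] move points by at most r / 32. A disc of radius r / 16 about any
     of them lies in the zero disc of radius r / 8 about [g t]. *)
  set (d := r / (32 * (1 + L))). assert (Hd : 0 < d) by (unfold d, r; apply Rdiv_lt_0_compat; lra).
  assert (HdL : d * L <= r / 32).
  { unfold d. replace (r / (32 * (1 + L)) * L) with (r / 32 * (L / (1 + L))) by (field; lra).
    rewrite <- (Rmult_1_r (r / 32)) at 2. apply Rmult_le_compat_l. unfold r; lra. apply Rle_div_l; lra. }
  assert (Hex : exists t, E t /\ T - d < t).
  { apply NNPP. intros N. assert (Hub : is_upper_bound E (T - d)).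
    { intros t Ht. destruct (Rle_dec t (T - d)); auto. exfalso. apply N. exists t. split; auto. lra. }
    specialize (HT2 _ Hub). lra. }
  destruct Hex as [t [[Ht HPt] HtT]].
  assert (HtT2 : t <= T) by (apply HT1; split; auto).
  assert (Hdist : Cmod (g t - g T)%C <= r / 32).
  { rewrite Hg. rewrite Rabs_left1 by lra. nra. }
  destruct (HPt t) as [r2 [Hr2 Hz2]]. { lra. }
  assert (Hzero : forall z, Cmod (z - g t)%C < r / 8 -> D z = RtoC 0).
  { assert (Hsub : forall z, Cmod (z - g t)%C < r -> Cmod (z - g T)%C < r1).
    { intros z Hz. replace (z - g T)%C with (z - g t + (g t - g T))%C by ring.
      eapply Rle_lt_trans. apply Cmod_triangle. unfold r in *. lra. }
    apply (hol_zero_ball D (g t) (RtoC 1) r M r2); auto.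
    - unfold r; lra.
    - apply RtoC_neq; lra.
    - intros z Hz. apply HD. apply Hin. specialize (Hsub z Hz). lra.
    - intros e He. apply Hz2. replace (g t + RtoC e * RtoC 1 - g t)%C with (RtoC e) by ring.
      rewrite Cmod_RtoC_pos; lra. }
  assert (HPu : forall u, Rabs (u - T) < d -> P u).
  { intros u Hu. exists (r / 16). split. { unfold r; lra. }
    intros z Hz. apply Hzero.
    replace (z - g t)%C with ((z - g u) + ((g u - g T) - (g t - g T)))%C by ring.
    eapply Rle_lt_trans. apply Cmod_triangle.
    assert (X := Cmod_sub_le (g u - g T)%C (g t - g T)%C).
    assert (Y : Cmod (g u - g T)%C <= r / 32).
    { rewrite Hg. apply Rle_trans with (d * L); auto. apply Rmult_le_compat_r; lra. }
    lra. }
  assert (HT1' : T = 1).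
  { apply NNPP. intros N. assert (T < 1) by lra.
    set (t' := Rmin 1 (T + d / 2)).
    assert (HE : E t').
    { unfold t'. split. { split. apply Rmin_case; lra. apply Rmin_l. }
      intros u Hu. destruct (Rle_dec u t) as [Hut|Hut]. { apply HPt. lra. }
      apply HPu. assert (u <= T + d / 2) by (eapply Rle_trans; [apply Hu|apply Rmin_r]).
      apply Rabs_lt_between. lra. }
    specialize (HT1 _ HE). unfold t', Rmin in HT1. destruct (Rle_dec 1 (T + d / 2)); lra. }
  destruct (HPu 1) as [r3 [Hr3 Hz3]]. { rewrite HT1', Rminus_diag, Rabs_R0. auto. }
  apply Hz3. unfold g. replace (y - (x + RtoC 1 * (y - x)))%C with (RtoC 0) by ring.
  rewrite Cmod_0. auto.
Qed.

(* A sum of Poisson-type kernels at dyadic scales: on a circle nearly touching 0 its real part is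
   [O(1 / |z|)] apart from a term [11 n / (20 s)], which is beaten by its value [4 n / (5 s)] at the
   centre. *)
Fixpoint dyadic_kernel (s : R) (n : nat) (z : C) : C :=
  match n with
  | O => RtoC 0
  | S n => (dyadic_kernel s n z + / (z + RtoC (s / 4 * (/ 2) ^ n)))%C
  end.

Lemma Re_inv_shift (z : C) (d : R) : 0 < Re z -> 0 < d ->
  Re (/ (z + RtoC d))%C <= (Re z + d) / (Cmod z ^ 2 + d ^ 2).
Proof.
  intros Hz Hd. destruct z as [x y]. rewrite Cmod2_alt.
  unfold Re, Im, Cinv, Cplus, RtoC in *; simpl in *.
  apply Rmult_le_compat_l. lra. apply Rinv_le_contravar; nra.
Qed.

(** On the circle Re z = (|z|^2 + s^2 - rho^2) / (2 s), so the part Re z / (|z|^2 + d^2) costs at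
    most 11 / (20 s) per scale, less than the 4 / (5 s) gained at the centre. The part d / (|z|^2 +
    d^2) is dominated by 4 / |z| times the increment of d / (d + |z|) between scales d / 2 and d,
    and telescopes. *)
Lemma dyadic_kernel_circle (s rho : R) (n : nat) (z : C) :
  0 < rho < s -> Cmod (z - RtoC s)%C = rho -> s ^ 2 - rho ^ 2 <= (s / 4 * (/ 2) ^ n) ^ 2 / 10 ->
  Re (dyadic_kernel s n z) <= 11 * INR n / (20 * s) + 4 / Cmod z.
Proof.
  intros Hrho Hz Hclose.
  assert (Ez : Cmod z ^ 2 = 2 * s * Re z - (s ^ 2 - rho ^ 2)).
  { rewrite <- Hz, !Cmod2_alt. destruct z as [x y]. unfold Re, Im, Cminus, Cplus, Copp, RtoC; simpl. ring. }
  assert (Hgap : 0 < s ^ 2 - rho ^ 2) by (simpl; nra).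
  assert (HRz : 0 < Re z). { assert (0 <= Cmod z ^ 2) by apply pow2_ge_0. nra. }
  set (y := Cmod z) in *.
  assert (Hy : 0 < y). { apply Rlt_le_trans with (Re z); auto. apply Re_le_Cmod. }
  set (del := fun k => s / 4 * (/ 2) ^ k).
  assert (Hdel : forall k, 0 < del k).
  { intros k. unfold del. apply Rmult_lt_0_compat. lra. apply pow_lt; lra. }
  assert (Hmono : forall k, (k <= n)%nat -> del n <= del k).
  { intros k Hk. unfold del. apply Rmult_le_compat_l. lra.
    replace n with (k + (n - k))%nat by lia. rewrite pow_add.
    assert (0 < (/ 2) ^ k) by (apply pow_lt; lra).
    assert ((/ 2) ^ (n - k) <= 1). { rewrite <- (pow1 (n - k)). apply pow_incr; lra. }
    nra. }
  assert (Main : forall m, (m <= n)%nat ->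
    Re (dyadic_kernel s m z) <= 11 * INR m / (20 * s) + 4 / y * (del 0%nat / (del 0%nat + y) - del m / (del m + y))).
  { induction m as [|m IH]; intros Hm.
    - simpl. unfold Re, RtoC; simpl. right. field. split; [|split]; try lra. specialize (Hdel 0%nat). lra.
    - specialize (IH ltac:(lia)). cbn [dyadic_kernel]. fold (del m).
      change (Re (dyadic_kernel s m z + / (z + RtoC (del m)))%C) with
        (Re (dyadic_kernel s m z) + Re (/ (z + RtoC (del m)))%C).
      assert (B := Re_inv_shift z (del m) HRz (Hdel m)). fold y in B.
      assert (Hd := Hdel m). set (d := del m) in *.
      assert (Hd' : del (S m) = d / 2). { unfold d, del. simpl. field. }
      rewrite Hd'. rewrite S_INR.
      assert (Hden : 0 < y ^ 2 + d ^ 2) by (simpl; nra).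
      assert (B1 : Re z / (y ^ 2 + d ^ 2) <= 11 / (20 * s)).
      { apply Rle_div_l; auto.
        assert (Hcl : s ^ 2 - rho ^ 2 <= d ^ 2 / 10).
        { eapply Rle_trans; [exact Hclose|]. fold (del n). apply Rmult_le_compat_r. lra.
          apply pow_incr. split. left; auto. apply Hmono. lia. }
        apply (Rmult_le_reg_l (20 * s)). lra.
        replace (20 * s * (11 / (20 * s) * (y ^ 2 + d ^ 2))) with (11 * (y ^ 2 + d ^ 2)) by (field; lra).
        replace (20 * s * Re z) with (10 * (y ^ 2 + (s ^ 2 - rho ^ 2))) by (rewrite Ez; ring).
        assert (0 <= y ^ 2) by apply pow2_ge_0. assert (0 <= d ^ 2) by apply pow2_ge_0. lra. }
      assert (B2 : d / (y ^ 2 + d ^ 2) <= 4 / y * (d / (d + y) - d / 2 / (d / 2 + y))).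
      { replace (4 / y * (d / (d + y) - d / 2 / (d / 2 + y))) with (2 * d / ((d + y) * (d / 2 + y))) by (field; lra).
        apply Rle_div_l; auto.
        replace (2 * d / ((d + y) * (d / 2 + y)) * (y ^ 2 + d ^ 2)) with
          (d * (2 * (y ^ 2 + d ^ 2) / ((d + y) * (d / 2 + y)))) by (field; lra).
        rewrite <- (Rmult_1_r d) at 1. apply Rmult_le_compat_l. lra.
        apply (proj1 (Rle_div_r 1 (2 * (y ^ 2 + d ^ 2)) ((d + y) * (d / 2 + y)) ltac:(nra))).
        rewrite Rmult_1_l.
        assert (E : 2 * (y ^ 2 + d ^ 2) - (d + y) * (d / 2 + y) =
          3 / 4 * (d - y) ^ 2 + 3 / 4 * d ^ 2 + / 4 * y ^ 2) by field.
        assert (0 <= (d - y) ^ 2) by apply pow2_ge_0.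
        assert (0 <= d ^ 2) by apply pow2_ge_0. assert (0 <= y ^ 2) by apply pow2_ge_0. lra. }
      assert (B3 : (Re z + d) / (y ^ 2 + d ^ 2) = Re z / (y ^ 2 + d ^ 2) + d / (y ^ 2 + d ^ 2)) by (field; lra).
      replace (11 * (INR m + 1) / (20 * s)) with (11 * INR m / (20 * s) + 11 / (20 * s)) by (field; lra).
      lra. }
  specialize (Main n (le_n n)).
  assert (H1 : del 0%nat / (del 0%nat + y) <= 1). { apply Rle_div_l. specialize (Hdel 0%nat). lra. lra. }
  assert (H2 : 0 <= del n / (del n + y)). { apply Rle_mult_inv_pos. left; auto. specialize (Hdel n). lra. }
  assert (0 < 4 / y) by (apply Rdiv_lt_0_compat; lra). nra.
Qed.

Lemma dyadic_kernel_centre (s : R) (n : nat) : 0 < s -> 4 * INR n / (5 * s) <= Re (dyadic_kernel s n (RtoC s)).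
Proof.
  intros Hs. induction n as [|n IH].
  - simpl. unfold Re, RtoC; simpl. right. field. lra.
  - cbn [dyadic_kernel]. set (d := s / 4 * (/ 2) ^ n).
    change (Re (dyadic_kernel s n (RtoC s) + / (RtoC s + RtoC d))%C) with
      (Re (dyadic_kernel s n (RtoC s)) + Re (/ (RtoC s + RtoC d))%C).
    assert (Hd : 0 < d <= s / 4).
    { unfold d. assert (0 < (/ 2) ^ n <= 1).
      { split. apply pow_lt; lra. rewrite <- (pow1 n). apply pow_incr; lra. }
      nra. }
    rewrite <- RtoC_plus, <- RtoC_inv by lra.
    change (Re (RtoC (/ (s + d)))) with (/ (s + d)).
    rewrite S_INR. replace (4 * (INR n + 1) / (5 * s)) with (4 * INR n / (5 * s) + / (5 * s / 4)) by (field; lra).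
    apply Rplus_le_compat; auto. apply Rinv_le_contravar; lra.
Qed.

Lemma hol_dyadic_kernel (s : R) (n : nat) (z : C) : 0 < s -> 0 < Re z -> hol (dyadic_kernel s n) z.
Proof.
  intros Hs Hz. induction n as [|n IH]; simpl. { apply hol_const. }
  apply hol_plus; auto. apply hol_inv. { apply hol_plus. apply hol_id. apply hol_const. }
  intros E. assert (X : Re (z + RtoC (s / 4 * (/ 2) ^ n))%C = 0) by (rewrite E; auto).
  change (Re z + s / 4 * (/ 2) ^ n = 0) in X.
  assert (0 < (/ 2) ^ n) by (apply pow_lt; lra). nra.
Qed.

Lemma Re_pos_in_tangent_disc (s : R) (z : C) : Cmod (z - RtoC s)%C < s -> 0 < Re z.
Proof.
  intros H. assert (X := re_le_Cmod (z - RtoC s)%C).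
  change (Re (z - RtoC s)%C) with (Re z - s) in X. apply Rabs_le_between in X. lra.
Qed.

(** With lam = kappa / 4 the term 4 lam / |z| of the multiplier is cancelled by the decay of [D].
    What remains favours the centre by a factor exp (lam n / (4 s)), and [n] is arbitrary. *)
Lemma watson_centre (D : C -> C) (s A kappa : R) :
  0 < s -> 0 < kappa -> (forall z, Cmod (z - RtoC s)%C < s -> hol D z) ->
  (forall z, Cmod (z - RtoC s)%C < s -> Cmod (D z) <= A * exp (- (kappa / Cmod z))) ->
  D (RtoC s) = RtoC 0.
Proof.
  intros Hs Hk HD HB.
  assert (HA : 0 <= A).
  { assert (X : Cmod (RtoC s - RtoC s)%C < s).
    { replace (RtoC s - RtoC s)%C with (RtoC 0) by ring. rewrite Cmod_0. auto. }
    specialize (HB _ X). assert (P := exp_pos (- (kappa / Cmod (RtoC s)))).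
    generalize (Cmod_ge_0 (D (RtoC s))). nra. }
  set (lam := kappa / 4).
  assert (Main : forall n, Cmod (D (RtoC s)) <= A * exp (- (lam / (4 * s)) * INR n)).
  { intros n.
    set (d := s / 4 * (/ 2) ^ n).
    assert (Hd : 0 < d <= s / 4).
    { unfold d. assert (0 < (/ 2) ^ n <= 1).
      { split. apply pow_lt; lra. rewrite <- (pow1 n). apply pow_incr; lra. }
      nra. }
    (* The circle comes closer to 0 as [n] grows: its gap is small against the square of the finest
       scale, so that all [n] scales are visible on it. *)
    set (rho := s - d ^ 2 / (20 * s)).
    assert (Hgap : 0 < d ^ 2 / (20 * s) < s).
    { split. apply Rdiv_lt_0_compat; [simpl; nra|lra]. apply Rlt_div_l. lra. simpl; nra. }
    assert (Hrho : 0 < rho < s) by (unfold rho; lra).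
    assert (Hclose : s ^ 2 - rho ^ 2 <= d ^ 2 / 10).
    { unfold rho. replace (s ^ 2 - (s - d ^ 2 / (20 * s)) ^ 2) with
        (2 * s * (d ^ 2 / (20 * s)) - (d ^ 2 / (20 * s)) ^ 2) by ring.
      assert (0 <= (d ^ 2 / (20 * s)) ^ 2) by apply pow2_ge_0.
      replace (2 * s * (d ^ 2 / (20 * s))) with (d ^ 2 / 10) by (field; lra). lra. }
    set (F := fun z => (D z * Cexp (RtoC lam * dyadic_kernel s n z))%C).
    assert (HF : Cmod (F (RtoC s)) <= A * exp (lam * (11 * INR n / (20 * s)))).
    { apply (cauchy_max F (RtoC s) s rho); auto.
      - intros z Hz. apply hol_mult; auto.
        apply (hol_comp Cexp (fun z => RtoC lam * dyadic_kernel s n z)%C); [|apply hol_Cexp].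
        apply hol_mult. apply hol_const. apply hol_dyadic_kernel; auto.
        eapply Re_pos_in_tangent_disc; eauto.
      - intros y. set (z := (RtoC s + polar rho y)%C).
        assert (Hz : Cmod (z - RtoC s)%C = rho).
        { unfold z. replace (RtoC s + polar rho y - RtoC s)%C with (polar rho y) by ring. apply Cmod_polar. lra. }
        assert (K := dyadic_kernel_circle s rho n z Hrho Hz Hclose).
        unfold F. rewrite Cmod_mult, Cmod_Cexp, Re_RtoC_mult.
        specialize (HB z ltac:(lra)).
        eapply Rle_trans. { apply Rmult_le_compat_r; [left; apply exp_pos|exact HB]. }
        rewrite Rmult_assoc, <- exp_plus. apply Rmult_le_compat_l; auto.
        assert (Hle : - (kappa / Cmod z) + lam * Re (dyadic_kernel s n z) <= lam * (11 * INR n / (20 * s))).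
        { assert (Hzp : 0 < Cmod z).
          { eapply Rlt_le_trans; [|apply Re_le_Cmod]. apply (Re_pos_in_tangent_disc s). lra. }
          replace (kappa / Cmod z) with (lam * (4 / Cmod z)) by (unfold lam; field; lra).
          assert (0 < lam) by (unfold lam; lra). nra. }
        destruct (Rle_lt_or_eq_dec _ _ Hle) as [X|X]. left; apply exp_increasing; auto. right; rewrite X; auto. }
    unfold F in HF. rewrite Cmod_mult, Cmod_Cexp, Re_RtoC_mult in HF.
    assert (C0 := dyadic_kernel_centre s n Hs).
    assert (Hlam : 0 < lam) by (unfold lam; lra).
    assert (E1 : exp (lam * (4 * INR n / (5 * s))) <= exp (lam * Re (dyadic_kernel s n (RtoC s)))).
    { destruct (Rle_lt_or_eq_dec _ _ C0) as [X|X]. left; apply exp_increasing; nra. right; rewrite X; auto. }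
    assert (E2 : Cmod (D (RtoC s)) * exp (lam * (4 * INR n / (5 * s))) <= A * exp (lam * (11 * INR n / (20 * s)))).
    { eapply Rle_trans; [|exact HF]. apply Rmult_le_compat_l; auto. apply Cmod_ge_0. }
    apply (Rmult_le_reg_r (exp (lam * (4 * INR n / (5 * s))))). apply exp_pos.
    rewrite Rmult_assoc, <- exp_plus.
    replace (- (lam / (4 * s)) * INR n + lam * (4 * INR n / (5 * s))) with (lam * (11 * INR n / (20 * s)))
      by (field; lra). exact E2. }
  apply Cmod_eq_0. apply Rle_antisym; [|apply Cmod_ge_0].
  apply le_epsilon. intros e He. rewrite Rplus_0_l.
  set (mu := lam / (4 * s)). assert (Hmu : 0 < mu) by (unfold mu, lam; apply Rdiv_lt_0_compat; lra).
  destruct (nfloor_ex (A / (mu * e))) as [N HN]. { apply Rle_mult_inv_pos; nra. }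
  eapply Rle_trans. apply (Main (S N)). fold mu.
  rewrite S_INR. assert (X := exp_ineq1_le (mu * (INR N + 1))).
  replace (- mu * (INR N + 1)) with (- (mu * (INR N + 1))) by ring. rewrite exp_Ropp.
  apply Rle_div_l. apply exp_pos.
  assert (A < (INR N + 1) * (mu * e)). { apply Rlt_div_l. nra. apply HN. }
  nra.
Qed.

(** Instead of choosing the best [n], all the inequalities are summed with weights u^n / n!, where u
    = 1 / (2 M x): the left side becomes d exp u and the right side a geometric series with sum 2
    A. *)
Lemma factorial_decay (A M x d : R) : 0 < A -> 0 < M -> 0 < x -> 0 <= d ->
  (forall n : nat, d <= A * M ^ n * INR (fact n) * x ^ n) -> d <= 2 * A * exp (- (/ (2 * M) / x)).
Proof.
  intros HA HM Hx Hd H.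
  set (u := / (2 * M) / x).
  assert (Hu : 0 < u). { unfold u. apply Rdiv_lt_0_compat; auto. apply Rinv_0_lt_compat. lra. }
  assert (Hterm : forall n, d * (u ^ n * / INR (fact n)) <= A * (/ 2) ^ n).
  { intros n. specialize (H n).
    assert (Hf : 0 < INR (fact n)) by apply INR_fact_lt_0.
    assert (P : 0 < u ^ n * / INR (fact n)). { apply Rmult_lt_0_compat. apply pow_lt; auto. apply Rinv_0_lt_compat; auto. }
    apply (Rmult_le_compat_r _ _ _ (Rlt_le _ _ P)) in H. eapply Rle_trans; [exact H|]. right.
    transitivity (A * (M ^ n * x ^ n * u ^ n)). field; lra.
    rewrite <- !Rpow_mult_distr. f_equal. f_equal. unfold u. field. lra. }
  assert (Hsum : forall n, d * sum_n (fun k => u ^ k * / INR (fact k)) n <= 2 * A - A * (/ 2) ^ n).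
  { induction n as [|n IH].
    - rewrite sum_O. specialize (Hterm O). simpl in *. lra.
    - rewrite sum_Sn. change (d * (sum_n (fun k => u ^ k * / INR (fact k)) n + u ^ S n * / INR (fact (S n))) <= 2 * A - A * (/ 2) ^ S n).
      specialize (Hterm (S n)). rewrite Rmult_plus_distr_l.
      assert (A * (/ 2) ^ n = 2 * (A * (/ 2) ^ S n)) by (simpl; field). lra. }
  assert (L : is_lim_seq (sum_n (fun k => u ^ k * / INR (fact k))) (exp u)).
  { assert (X := is_exp_Reals u). unfold is_pseries, is_series in X.
    eapply filterlim_ext; [|exact X]. intros n. apply sum_n_ext. intros k. now rewrite pow_n_pow. }
  apply (is_lim_seq_scal_l _ d) in L. simpl in L.
  assert (B : d * exp u <= 2 * A).
  { apply (is_lim_seq_le (fun n => d * sum_n (fun k => u ^ k * / INR (fact k)) n) (fun _ => 2 * A) (d * exp u) (2 * A)).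
    - intros n. specialize (Hsum n). assert (0 < (/ 2) ^ n) by (apply pow_lt; lra). nra.
    - exact L.
    - apply is_lim_seq_const. }
  rewrite exp_Ropp. apply (proj1 (Rle_div_r d (2 * A) (exp u) (exp_pos u))). exact B.
Qed.

(** The first condition is Re (cis alpha / h) > K cleared of denominators: a disc with 0 on its
    boundary, or a half-plane if [K = 0]. One convex family thus contains both the domain of
    convergence of the Laplace integral and the straight sector; strictness excludes 0. *)
Definition tangent_sector (alpha K r : R) (h : C) : Prop :=
  K * Cmod h ^ 2 < Re (h * cis (- alpha))%C /\ Cmod h < r.

Lemma tangent_sector_neq_0 (alpha K r : R) (h : C) : tangent_sector alpha K r h -> h <> RtoC 0.
Proof.
  intros [H _] E. subst h. rewrite Cmod_0 in H.
  replace (RtoC 0 * cis (- alpha))%C with (RtoC 0) in H by ring. change (K * 0 ^ 2 < 0) in H. simpl in H. lra.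
Qed.

Lemma tangent_sector_convex (alpha K r : R) (x y : C) (t : R) :
  0 <= K -> 0 <= t <= 1 -> tangent_sector alpha K r x -> tangent_sector alpha K r y ->
  tangent_sector alpha K r (x + RtoC t * (y - x))%C.
Proof.
  intros HK Ht [X1 X2] [Y1 Y2].
  replace (x + RtoC t * (y - x))%C with (RtoC (1 - t) * x + RtoC t * y)%C by (rewrite RtoC_minus; ring).
  assert (B : Cmod (RtoC (1 - t) * x + RtoC t * y)%C <= (1 - t) * Cmod x + t * Cmod y).
  { eapply Rle_trans. apply Cmod_triangle. rewrite !Cmod_mult, !Cmod_RtoC_pos by lra. lra. }
  assert (X0 := Cmod_ge_0 x). assert (Y0 := Cmod_ge_0 y).
  assert (Z0 := Cmod_ge_0 (RtoC (1 - t) * x + RtoC t * y)%C).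
  assert (Ht01 : t = 0 \/ t = 1 \/ 0 < t < 1) by lra.
  split.
  - replace (Re ((RtoC (1 - t) * x + RtoC t * y) * cis (- alpha))%C) with
      ((1 - t) * Re (x * cis (- alpha))%C + t * Re (y * cis (- alpha))%C).
    + apply Rle_lt_trans with ((1 - t) * (K * Cmod x ^ 2) + t * (K * Cmod y ^ 2)).
      * apply Rle_trans with (K * ((1 - t) * Cmod x + t * Cmod y) ^ 2).
        { apply Rmult_le_compat_l; auto. apply pow_incr. lra. }
        replace ((1 - t) * (K * Cmod x ^ 2) + t * (K * Cmod y ^ 2)) with
          (K * ((1 - t) * Cmod x ^ 2 + t * Cmod y ^ 2)) by ring.
        apply Rmult_le_compat_l; auto.
        assert (0 <= t * (1 - t) * (Cmod x - Cmod y) ^ 2).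
        { apply Rmult_le_pos. nra. apply pow2_ge_0. }
        simpl in *. nra.
      * destruct Ht01 as [->|[->|Ht01]]; nra.
    + unfold Re, Cmult, Cplus, RtoC; simpl. ring.
  - eapply Rle_lt_trans; [exact B|]. destruct Ht01 as [->|[->|Ht01]]; nra.
Qed.

Lemma tangent_sector_open (alpha K r : R) (z : C) : 0 <= K -> tangent_sector alpha K r z ->
  exists d, 0 < d /\ forall w, Cmod (w - z)%C < d -> tangent_sector alpha K r w.
Proof.
  intros HK [H1 H2].
  set (g := Re (z * cis (- alpha))%C - K * Cmod z ^ 2). assert (Hg : 0 < g) by (unfold g; lra).
  set (m := Cmod z) in *. assert (Hm : 0 <= m) by apply Cmod_ge_0.
  set (c := 1 + K * (2 * m + 1)). assert (Hc : 0 < c) by (unfold c; nra).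
  exists (Rmin 1 (Rmin (r - m) (g / c))). split.
  { apply Rmin_case; [lra|]. apply Rmin_case; [lra|]. apply Rdiv_lt_0_compat; auto. }
  intros w Hw.
  destruct (Rmin_Rgt_l _ _ _ Hw) as [W1 W2].
  destruct (Rmin_Rgt_l _ _ _ W2) as [W3 W4].
  apply (Rmult_lt_compat_r c) in W4; auto. replace (g / c * c) with g in W4 by (field; lra).
  set (e := Cmod (w - z)%C) in *. assert (He : 0 <= e) by apply Cmod_ge_0.
  assert (Hwm : Cmod w <= m + e).
  { replace w with (z + (w - z))%C by ring. apply Cmod_triangle. }
  split; [|lra].
  assert (HR : Re (z * cis (- alpha))%C - e <= Re (w * cis (- alpha))%C).
  { assert (X := re_le_Cmod ((w - z) * cis (- alpha))%C). rewrite Cmod_mult, Cmod_cis, Rmult_1_r in X. fold e in X.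
    replace (Re ((w - z) * cis (- alpha))%C) with (Re (w * cis (- alpha))%C - Re (z * cis (- alpha))%C) in X
      by (unfold Re, Cmult, Cminus, Cplus, Copp; simpl; ring).
    apply Rabs_le_between in X. lra. }
  assert (HQ : K * Cmod w ^ 2 <= K * (m + e) ^ 2).
  { apply Rmult_le_compat_l; auto. apply pow_incr. split; auto. apply Cmod_ge_0. }
  assert (HE : K * (e * e) <= K * (e * 1)) by (apply Rmult_le_compat_l; [auto|nra]).
  replace (K * (m + e) ^ 2) with (K * m ^ 2 + (2 * K * m * e + K * (e * e))) in HQ by ring.
  replace (e * c) with (e + (2 * K * m * e + K * (e * 1))) in W4 by (unfold c; ring).
  unfold g in W4. lra.
Qed.

(** Applied to small discs centred on the bisecting ray and touching 0, [watson_centre] makes [D]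
    vanish on a piece of that ray; convexity and the identity theorem do the rest. *)
Lemma watson_unique (alpha K r A M delta : R) (D : C -> C) :
  0 <= K -> 0 < r -> 0 < A -> 0 < M -> 0 < delta ->
  (forall h, tangent_sector alpha K r h -> hol D h) ->
  (forall (n : nat) h, tangent_sector alpha K r h -> Cmod h < delta ->
     Cmod (D h) <= A * M ^ n * INR (fact n) * Cmod h ^ n) ->
  forall h, tangent_sector alpha K r h -> D h = RtoC 0.
Proof.
  intros HK Hr HA HM Hdel HD HB.
  (* In a disc of radius s touching 0 one has |z|^2 < 2 s Re z, so 2 K s < 1 puts it inside the
     tangent region. The other two bounds keep |z| < 2 s below [r] and [delta]. *)
  set (s0 := Rmin (/ (2 * (K + 1))) (Rmin (r / 2) (delta / 2))).
  assert (HK1 : 0 < / (2 * (K + 1))) by (apply Rinv_0_lt_compat; lra).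
  assert (Hs0 : 0 < s0). { unfold s0. apply Rmin_case; auto. apply Rmin_case; lra. }
  assert (Hs0K : s0 <= / (2 * (K + 1))) by apply Rmin_l.
  assert (Hs0r : s0 <= r / 2) by (eapply Rle_trans; [apply Rmin_r|apply Rmin_l]).
  assert (Hs0d : s0 <= delta / 2) by (eapply Rle_trans; [apply Rmin_r|apply Rmin_r]).
  assert (Hin : forall s z, 0 < s <= s0 -> Cmod (z - RtoC s)%C < s ->
    tangent_sector alpha K r (z * cis alpha)%C /\ Cmod (z * cis alpha)%C < delta /\ 0 < Cmod (z * cis alpha)%C).
  { intros s z Hs Hz.
    assert (HRz := Re_pos_in_tangent_disc s z Hz).
    assert (Hsq : Cmod z ^ 2 < 2 * s * Re z).
    { assert (X : Cmod (z - RtoC s)%C ^ 2 < s ^ 2).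
      { generalize (Cmod_ge_0 (z - RtoC s)%C). simpl. nra. }
      rewrite Cmod2_alt in *. destruct z as [x y]. unfold Re, Im, Cminus, Cplus, Copp, RtoC in *; simpl in *. nra. }
    assert (Hzs : Cmod z < 2 * s).
    { replace z with (z - RtoC s + RtoC s)%C by ring. eapply Rle_lt_trans. apply Cmod_triangle.
      rewrite Cmod_RtoC_pos by lra. lra. }
    assert (Hzp : 0 < Cmod z) by (eapply Rlt_le_trans; [exact HRz|apply Re_le_Cmod]).
    unfold tangent_sector. rewrite Cmod_mult, Cmod_cis, Rmult_1_r.
    replace (z * cis alpha * cis (- alpha))%C with z by (rewrite <- Cmult_assoc, cis_opp_r; ring).
    split; [split|split]; try lra.
    assert (HKs : K * (2 * s) < 1).
    { assert (Y : s * (2 * (K + 1)) <= 1).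
      { apply Rle_trans with (/ (2 * (K + 1)) * (2 * (K + 1))). apply Rmult_le_compat_r; lra.
        rewrite Rinv_l; lra. }
      lra. }
    assert (K * Cmod z ^ 2 <= K * (2 * s * Re z)) by (apply Rmult_le_compat_l; lra). nra. }
  assert (Hray : forall s, 0 < s <= s0 -> D (RtoC s * cis alpha)%C = RtoC 0).
  { intros s Hs.
    apply (watson_centre (fun z => D (z * cis alpha)%C) s (2 * A) (/ (2 * M))).
    - lra.
    - apply Rinv_0_lt_compat. lra.
    - intros z Hz. apply (hol_comp D (fun z => z * cis alpha)%C).
      + apply hol_mult. apply hol_id. apply hol_const.
      + apply HD. apply (Hin s); auto.
    - intros z Hz. destruct (Hin s z Hs Hz) as [T1 [T2 T3]].
      assert (X := factorial_decay A M (Cmod (z * cis alpha)%C) (Cmod (D (z * cis alpha)%C)) HA HM T3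
        (Cmod_ge_0 _) (fun n => HB n _ T1 T2)).
      rewrite (Cmod_mult z), Cmod_cis, Rmult_1_r in X. exact X. }
  set (c := (RtoC (s0 / 2) * cis alpha)%C).
  assert (Hc : tangent_sector alpha K r c).
  { apply (Hin (s0 / 2)). lra. replace (RtoC (s0 / 2) - RtoC (s0 / 2))%C with (RtoC 0) by ring. rewrite Cmod_0. lra. }
  destruct (tangent_sector_open alpha K r c HK Hc) as [d1 [Hd1 Hball]].
  destruct (hol_locally_bounded D c d1 Hd1 (HD _ Hc)) as [r1 [B [Hr1 Hbd]]].
  assert (Hzero : forall z, Cmod (z - c)%C < r1 / 8 -> D z = RtoC 0).
  { apply (hol_zero_ball D c (cis alpha) r1 B (s0 / 2)); try lra.
    - apply cis_neq_0.
    - intros z Hz. apply HD. apply Hball. lra.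
    - exact Hbd.
    - intros e He. unfold c. replace (RtoC (s0 / 2) * cis alpha + RtoC e * cis alpha)%C with
        (RtoC (s0 / 2 + e) * cis alpha)%C by (rewrite RtoC_plus; ring).
      apply Hray. lra. }
  intros h Hh. apply (identity_convex (tangent_sector alpha K r) D c h (r1 / 8)); auto.
  - intros z Hz. apply tangent_sector_open; auto.
  - intros t Ht. apply tangent_sector_convex; auto.
  - lra.
Qed.

(** * Sectorial neighbourhoods *)

Lemma continuous_R_plus {U : UniformSpace} (f g : U -> R) (p : U) :
  continuous f p -> continuous g p -> continuous (fun x => f x + g x) p.
Proof. apply (continuous_plus (V := R_NormedModule)). Qed.

Lemma continuous_R_mult {U : UniformSpace} (f g : U -> R) (p : U) :
  continuous f p -> continuous g p -> continuous (fun x => f x * g x) p.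
Proof. apply (continuous_mult (K := R_AbsRing)). Qed.

Lemma continuous_R_minus {U : UniformSpace} (f g : U -> R) (p : U) :
  continuous f p -> continuous g p -> continuous (fun x => f x - g x) p.
Proof. apply (continuous_minus (V := R_NormedModule)). Qed.

Lemma continuous_R_inv {U : UniformSpace} (f : U -> R) (p : U) :
  continuous f p -> f p <> 0 -> continuous (fun x => / f x) p.
Proof. intros Hf Hn. apply (continuous_comp f Rinv); auto. apply continuous_Rinv. auto. Qed.

Lemma continuous_R_sqrt {U : UniformSpace} (f : U -> R) (p : U) : continuous f p -> continuous (fun x => sqrt (f x)) p.
Proof. intros Hf. apply (continuous_comp f sqrt); auto. apply continuous_sqrt. Qed.

Lemma continuous_R_abs {U : UniformSpace} (f : U -> R) (p : U) : continuous f p -> continuous (fun x => Rabs (f x)) p.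
Proof. intros Hf. apply (continuous_comp f Rabs); auto. apply continuous_Rabs. Qed.

Lemma continuous_pair {U V W : UniformSpace} (f : U -> V) (g : U -> W) (p : U) :
  continuous f p -> continuous g p -> continuous (fun x => (f x, g x)) p.
Proof.
  intros Hf Hg. apply filterlim_locally. intros eps.
  assert (H1 := proj1 (filterlim_locally f (f p)) Hf eps).
  assert (H2 := proj1 (filterlim_locally g (g p)) Hg eps).
  generalize (filter_and _ _ H1 H2). apply filter_imp. intros x [A B]. split; auto.
Qed.

Ltac cont_R := repeat first [ assumption | match goal with
  | |- continuous (fun _ => ?c) _ => apply continuous_const
  | |- continuous (fun x => x) _ => apply continuous_id
  | |- continuous (fun x => @?f x + @?g x) _ => apply (continuous_R_plus f g)
  | |- continuous (fun x => @?f x - @?g x) _ => apply (continuous_R_minus f g)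
  | |- continuous (fun x => @?f x * @?g x) _ => apply (continuous_R_mult f g)
  | |- continuous (fun x => Rabs (@?f x)) _ => apply (continuous_R_abs f)
  | |- continuous (fun x => sqrt (@?f x)) _ => apply (continuous_R_sqrt f)
  end ].

Lemma continuous_proj1 {U V : UniformSpace} (x : U * V) : continuous fst x.
Proof. destruct x. apply continuous_fst. Qed.

Lemma continuous_proj2 {U V : UniformSpace} (x : U * V) : continuous snd x.
Proof. destruct x. apply continuous_snd. Qed.

(** The retraction of the line onto [0,1], written with absolute values so that its continuity is
    immediate. *)
Definition clamp (t : R) : R := (1 + Rabs t - Rabs (t - 1)) / 2.

Lemma clamp_id (t : R) : 0 <= t <= 1 -> clamp t = t.
Proof. intros H. unfold clamp. rewrite Rabs_pos_eq, Rabs_left1 by lra. field. Qed.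

Lemma clamp_range (t : R) : 0 <= clamp t <= 1.
Proof.
  unfold clamp. destruct (Rle_dec t 0). { rewrite !Rabs_left1 by lra. lra. }
  destruct (Rle_dec t 1). { rewrite Rabs_pos_eq, Rabs_left1 by lra. lra. }
  rewrite !Rabs_pos_eq by lra. lra.
Qed.

Lemma continuous_clamp (t : R) : continuous clamp t.
Proof.
  unfold clamp, Rdiv. cont_R.
Qed.

(** The contraction gives the paths, and, with the start of the loop as base point, a homotopy that
    keeps the ends fixed. Continuity is asked only along paths inside [X], because [blowup_contract]
    divides by a norm that may vanish elsewhere. *)
Lemma contraction_simply_connected {T : UniformSpace} (X : T -> Prop) (Phi : T -> T -> R -> T) :
  (exists x, X x) ->
  (forall x x0 v, X x -> X x0 -> 0 <= v <= 1 -> X (Phi x x0 v)) ->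
  (forall x x0, X x -> X x0 -> Phi x x0 0 = x /\ Phi x x0 1 = x0) ->
  (forall x0 v, X x0 -> 0 <= v <= 1 -> Phi x0 x0 v = x0) ->
  (forall (g : R -> T) x0, (forall s, continuous g s) -> (forall s, X (g s)) -> X x0 ->
     forall p : R * R, continuous (fun p : R * R => Phi (g (fst p)) x0 (clamp (snd p))) p) ->
  simply_connected X.
Proof.
  intros Hne HX H01 Hfix Hcont. split.
  - split; auto. intros x y Hx Hy. exists (fun s => Phi x y (clamp s)).
    destruct (H01 x y Hx Hy) as [E0 E1].
    split; [|split; [|split]].
    + intros s.
      assert (C := Hcont (fun _ => x) y (fun _ => continuous_const _ _) (fun _ => Hx) Hy (0, s)).
      apply (continuous_comp (fun s : R => (0, s)) (fun p : R * R => Phi x y (clamp (snd p)))); auto.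
      apply continuous_pair. apply continuous_const. apply continuous_id.
    + rewrite clamp_id by lra. auto.
    + rewrite clamp_id by lra. auto.
    + intros s Hs. apply HX; auto. apply clamp_range.
  - intros g Hg Hloop Hin.
    set (g' := fun s => g (clamp s)).
    assert (Hin' : forall s, X (g' s)) by (intros s; apply Hin, clamp_range).
    assert (Hg' : forall s, continuous g' s).
    { intros s. apply (continuous_comp clamp g). apply continuous_clamp. apply Hg. }
    assert (X0 : X (g 0)) by (apply Hin; lra).
    exists (fun p => Phi (g' (fst p)) (g 0) (clamp (snd p))). simpl.
    split; [|split; [|split]].
    + apply Hcont; auto.
    + intros s u Hs Hu. apply HX; auto. apply clamp_range.
    + intros s Hs. rewrite !clamp_id by lra. unfold g'. rewrite clamp_id by auto. apply H01; auto.
    + intros u Hu. unfold g'. rewrite (clamp_id 0), (clamp_id 1) by lra. rewrite <- Hloop.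
      split; apply Hfix; auto; apply clamp_range.
Qed.

(** Linear interpolation, in real coordinates for the sake of [cont_R]. *)
Definition line_contract (x x0 : C) (v : R) : C :=
  ((1 - v) * fst x + v * fst x0, (1 - v) * snd x + v * snd x0).

Lemma line_contract_eq (x x0 : C) (v : R) : line_contract x x0 v = (x + RtoC v * (x0 - x))%C.
Proof.
  unfold line_contract, Cplus, Cmult, Cminus, Cplus, Copp, RtoC; simpl. f_equal; ring.
Qed.

Lemma line_contract_eq' (x x0 : C) (v : R) : line_contract x x0 v = (RtoC (1 - v) * x + RtoC v * x0)%C.
Proof. rewrite line_contract_eq, RtoC_minus. ring. Qed.

Lemma line_contract_ends (x x0 : C) : line_contract x x0 0 = x /\ line_contract x x0 1 = x0.
Proof. rewrite !line_contract_eq. split; ring. Qed.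

Lemma line_contract_fix (x0 : C) (v : R) : line_contract x0 x0 v = x0.
Proof. rewrite line_contract_eq. ring. Qed.

Lemma convex_simply_connected (S : C -> Prop) :
  (exists x, S x) -> (forall x y t, 0 <= t <= 1 -> S x -> S y -> S (x + RtoC t * (y - x))%C) ->
  simply_connected (T := C_UniformSpace) S.
Proof.
  intros Hne HS. apply (contraction_simply_connected (T := C_UniformSpace) S line_contract); auto.
  - intros x x0 v Hx Hx0 Hv. rewrite line_contract_eq. apply HS; auto.
  - intros x x0 _ _. apply line_contract_ends.
  - intros x0 v _ _. apply line_contract_fix.
  - intros g x0 Hg _ _ p.
    assert (G : continuous (fun p : R * R => g (fst p)) p).
    { apply (continuous_comp fst g). apply continuous_proj1. apply Hg. }
    assert (G1 : continuous (fun p : R * R => fst (g (fst p))) p).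
    { apply (continuous_comp _ (fst : C -> R) p G). apply continuous_proj1. }
    assert (G2 : continuous (fun p : R * R => snd (g (fst p))) p).
    { apply (continuous_comp _ (snd : C -> R) p G). apply continuous_proj2. }
    assert (G3 : continuous (fun p : R * R => clamp (snd p)) p).
    { apply (continuous_comp snd clamp). apply continuous_proj2. apply continuous_clamp. }
    unfold line_contract. apply continuous_pair; cont_R.
Qed.

(** Radii are interpolated linearly; directions are interpolated linearly and then normalised.
    Interpolating the points themselves would leave the blowup at radius 0. Real coordinates again
    suit [cont_R]. *)
Definition blowup_contract (p p0 : C * C) (v : R) : C * C :=
  let n1 := (1 - v) * fst (snd p) + v * fst (snd p0) in
  let n2 := (1 - v) * snd (snd p) + v * snd (snd p0) in
  let N := / sqrt (n1 * n1 + n2 * n2) in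
  let rho := (1 - v) * sqrt (fst (fst p) * fst (fst p) + snd (fst p) * snd (fst p))
     + v * sqrt (fst (fst p0) * fst (fst p0) + snd (fst p0) * snd (fst p0)) in
  ((rho * (n1 * N), rho * (n2 * N)), (n1 * N, n2 * N)).

Lemma Cmod_sqrt (z : C) : Cmod z = sqrt (fst z * fst z + snd z * snd z).
Proof. unfold Cmod. f_equal. ring. Qed.

Lemma blowup_contract_eq (p p0 : C * C) (v : R) :
  let n := (RtoC (1 - v) * snd p + RtoC v * snd p0)%C in
  let u := (RtoC (/ Cmod n) * n)%C in
  blowup_contract p p0 v = ((RtoC ((1 - v) * Cmod (fst p) + v * Cmod (fst p0)) * u)%C, u).
Proof.
  cbv zeta. rewrite <- line_contract_eq'. unfold blowup_contract. cbv zeta.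
  rewrite !Cmod_sqrt. unfold line_contract. simpl.
  unfold Cmult, RtoC; simpl. f_equal; f_equal; ring.
Qed.

(** The inequality of [tangent_sector] divided by |h|: it then makes sense on the boundary circle,
    where it cuts out the open arc. *)
Definition blowup_sector (alpha K r : R) (p : C * C) : Prop :=
  blowup p /\ (K * Cmod (fst p) < Re (snd p * cis (- alpha))%C /\ Cmod (fst p) < r).

Lemma blowup_contract_fix (p : C * C) (p0 : C * C) (v : R) (q : C * C) :
  blowup q ->
  (RtoC (1 - v) * snd p + RtoC v * snd p0)%C = snd q ->
  (1 - v) * Cmod (fst p) + v * Cmod (fst p0) = Cmod (fst q) -> blowup_contract p p0 v = q.
Proof.
  intros [B1 B2] E1 E2. rewrite blowup_contract_eq. cbv zeta. rewrite E1, E2, B1, Rinv_1.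
  destruct q as [z u]. simpl in *. f_equal.
  - replace (RtoC 1 * u)%C with u by ring. symmetry. exact B2.
  - ring.
Qed.

(** The defining inequality is affine in the pair (radius, direction), so interpolation before
    normalisation preserves it. It also keeps the interpolated direction in an open half-plane,
    hence away from 0. *)
Lemma blowup_sector_simply_connected (alpha K r : R) : 0 <= K -> 0 < r ->
  simply_connected (T := prod_UniformSpace C_UniformSpace C_UniformSpace) (blowup_sector alpha K r).
Proof.
  intros HK Hr.
  assert (Hn : forall x x0 v, blowup_sector alpha K r x -> blowup_sector alpha K r x0 -> 0 <= v <= 1 ->
    K * ((1 - v) * Cmod (fst x) + v * Cmod (fst x0)) <
      Re ((RtoC (1 - v) * snd x + RtoC v * snd x0) * cis (- alpha))%C /\
    0 < Cmod (RtoC (1 - v) * snd x + RtoC v * snd x0)%C <= 1).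
  { intros [z u] [z0 u0] v [[B1 _] [B3 _]] [[C1 _] [C3 _]] Hv. cbn [fst snd] in *.
    assert (E : Re ((RtoC (1 - v) * u + RtoC v * u0) * cis (- alpha))%C =
      (1 - v) * Re (u * cis (- alpha))%C + v * Re (u0 * cis (- alpha))%C).
    { unfold Re, Cmult, Cplus, RtoC; simpl. ring. }
    assert (Hlt : K * ((1 - v) * Cmod z + v * Cmod z0) <
      Re ((RtoC (1 - v) * u + RtoC v * u0) * cis (- alpha))%C).
    { rewrite E. destruct (Req_dec v 0) as [->|Hv0]. { lra. }
      assert (v * (K * Cmod z0) < v * Re (u0 * cis (- alpha))%C) by (apply Rmult_lt_compat_l; lra).
      assert ((1 - v) * (K * Cmod z) <= (1 - v) * Re (u * cis (- alpha))%C) by (apply Rmult_le_compat_l; lra).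
      lra. }
    split; auto. split.
    - apply Cmod_gt_0. intros E0. rewrite E0 in Hlt.
      replace (RtoC 0 * cis (- alpha))%C with (RtoC 0) in Hlt by ring.
      change (K * ((1 - v) * Cmod z + v * Cmod z0) < 0) in Hlt.
      generalize (Cmod_ge_0 z) (Cmod_ge_0 z0). intros.
      assert (0 <= (1 - v) * Cmod z + v * Cmod z0) by nra. nra.
    - eapply Rle_trans. apply Cmod_triangle. rewrite !Cmod_mult, !Cmod_RtoC_pos, B1, C1 by lra. lra. }
  assert (Hmem : forall (x x0 : C * C) v, blowup_sector alpha K r x -> blowup_sector alpha K r x0 -> 0 <= v <= 1 ->
    blowup_sector alpha K r (blowup_contract x x0 v)).
  { intros x x0 v Hx Hx0 Hv. destruct (Hn x x0 v Hx Hx0 Hv) as [H1 H2].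
    rewrite blowup_contract_eq. cbv zeta.
    set (n := (RtoC (1 - v) * snd x + RtoC v * snd x0)%C) in *.
    set (rho := (1 - v) * Cmod (fst x) + v * Cmod (fst x0)) in *.
    assert (Hrho : 0 <= rho).
    { unfold rho. generalize (Cmod_ge_0 (fst x)) (Cmod_ge_0 (fst x0)). nra. }
    (* An average of unit vectors has norm at most 1, so normalising can only enlarge the real part
       in the inequality. *)
    assert (Hinv : 1 <= / Cmod n). { apply (Rmult_le_reg_r (Cmod n)); [lra|]. rewrite Rinv_l; lra. }
    assert (Hu : Cmod (RtoC (/ Cmod n) * n)%C = 1).
    { rewrite Cmod_mult, Cmod_RtoC_pos by lra. field. lra. }
    unfold blowup_sector, blowup. cbn [fst snd].
    set (u := (RtoC (/ Cmod n) * n)%C) in *.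
    rewrite (Cmod_mult (RtoC rho)), Hu, Cmod_RtoC_pos, Rmult_1_r by auto.
    split; [split; auto|split].
    + unfold u. rewrite <- Cmult_assoc, Re_RtoC_mult. assert (0 <= K * rho) by nra. nra.
    + unfold rho. destruct Hx as [_ [_ X]]. destruct Hx0 as [_ [_ X0]].
      destruct (Req_dec v 0) as [->|Hv0]. { lra. }
      assert (v * Cmod (fst x0) < v * r) by (apply Rmult_lt_compat_l; lra).
      assert ((1 - v) * Cmod (fst x) <= (1 - v) * r) by (apply Rmult_le_compat_l; lra). lra. }
  apply (contraction_simply_connected (T := prod_UniformSpace C_UniformSpace C_UniformSpace) _ blowup_contract).
  - exists (RtoC 0, cis alpha). unfold blowup_sector, blowup; cbn [fst snd]. rewrite Cmod_cis, Cmod_0, cis_opp_r.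
    change (Re (RtoC 1)) with 1. repeat split; try lra. ring.
  - exact Hmem.
  - intros x x0 Hx Hx0. split.
    + apply blowup_contract_fix. apply Hx. rewrite Rminus_0_r. ring. ring.
    + apply blowup_contract_fix. apply Hx0. rewrite Rminus_diag. ring. ring.
  - intros x0 v Hx0 _. apply blowup_contract_fix. apply Hx0. rewrite RtoC_minus. ring. ring.
  - intros g x0 Hg HX Hx0 p.
    assert (G : continuous (fun p : R * R => g (fst p)) p).
    { apply (continuous_comp fst g). apply continuous_proj1. apply Hg. }
    assert (Ga : continuous (fun p : R * R => fst (g (fst p))) p).
    { apply (continuous_comp _ (fst : C * C -> C) p G). apply continuous_proj1. }
    assert (Gb : continuous (fun p : R * R => snd (g (fst p))) p).
    { apply (continuous_comp _ (snd : C * C -> C) p G). apply continuous_proj2. }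
    assert (G1 : continuous (fun p : R * R => fst (fst (g (fst p)))) p).
    { apply (continuous_comp _ (fst : C -> R) p Ga). apply continuous_proj1. }
    assert (G2 : continuous (fun p : R * R => snd (fst (g (fst p)))) p).
    { apply (continuous_comp _ (snd : C -> R) p Ga). apply continuous_proj2. }
    assert (G3 : continuous (fun p : R * R => fst (snd (g (fst p)))) p).
    { apply (continuous_comp _ (fst : C -> R) p Gb). apply continuous_proj1. }
    assert (G4 : continuous (fun p : R * R => snd (snd (g (fst p)))) p).
    { apply (continuous_comp _ (snd : C -> R) p Gb). apply continuous_proj2. }
    assert (G5 : continuous (fun p : R * R => clamp (snd p)) p).
    { apply (continuous_comp snd clamp). apply continuous_proj2. apply continuous_clamp. }
    destruct (Hn (g (fst p)) x0 (clamp (snd p)) (HX _) Hx0 (clamp_range _)) as [_ [Hpos _]].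
    rewrite <- line_contract_eq', Cmod_sqrt in Hpos. unfold line_contract in Hpos. cbn [fst snd] in Hpos.
    assert (GN : continuous (fun p : R * R => / sqrt (((1 - clamp (snd p)) * fst (snd (g (fst p))) + clamp (snd p) * fst (snd x0)) *
       ((1 - clamp (snd p)) * fst (snd (g (fst p))) + clamp (snd p) * fst (snd x0)) +
       ((1 - clamp (snd p)) * snd (snd (g (fst p))) + clamp (snd p) * snd (snd x0)) *
       ((1 - clamp (snd p)) * snd (snd (g (fst p))) + clamp (snd p) * snd (snd x0)))) p).
    { apply continuous_R_inv; [cont_R|]. apply Rgt_not_eq. exact Hpos. }
    unfold blowup_contract. cbv zeta.
    apply continuous_pair; apply continuous_pair; cont_R.
Qed.

(** After rotation the real part is positive, so the arcsine of the imaginary part recovers the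
    argument within half of [PI]. *)
Lemma Arc_pi_iff (alpha : R) (u : C) : Cmod u = 1 ->
  (Arc_pi alpha u <-> 0 < Re (u * cis (- alpha))%C).
Proof.
  intros Hu. split.
  - intros [t [Ht ->]]. rewrite <- cis_add. unfold cis, Re; simpl. apply cos_gt_0; lra.
  - intros H. set (w := (u * cis (- alpha))%C) in *.
    assert (Hw : Cmod w = 1) by (unfold w; rewrite Cmod_mult, Cmod_cis; lra).
    assert (Hsq : Re w ^ 2 + Im w ^ 2 = 1) by (rewrite <- Cmod2_alt, Hw; ring).
    assert (Hi : -1 < Im w < 1) by nra.
    exists (asin (Im w) + alpha). split. { generalize (asin_bound_lt _ Hi). lra. }
    rewrite cis_add. replace u with (w * cis alpha)%C.
    + f_equal. unfold cis. rewrite sin_asin, cos_asin by lra.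
      destruct w as [x y]. unfold Re, Im in *. simpl fst in *; simpl snd in *. f_equal.
      replace (1 - y²) with (x * x) by (unfold Rsqr; nra). symmetry. apply sqrt_square. lra.
    + unfold w. rewrite <- Cmult_assoc, cis_opp_l. ring.
Qed.

Lemma polar_form (z : C) : z <> RtoC 0 -> z = (RtoC (Cmod z) * (z / RtoC (Cmod z)))%C.
Proof. intros H. field. intros E. apply H. apply Cmod_eq_0. now injection E. Qed.

Lemma Cmod_unit (z : C) : z <> RtoC 0 -> Cmod (z / RtoC (Cmod z))%C = 1.
Proof.
  intros H. assert (0 < Cmod z) by (apply Cmod_gt_0; auto).
  rewrite Cmod_div, Cmod_RtoC_pos by (try apply RtoC_neq; lra). field. lra.
Qed.

Lemma Re_unit (z : C) (alpha : R) : z <> RtoC 0 ->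
  Re (z * cis (- alpha))%C = Cmod z * Re (z / RtoC (Cmod z) * cis (- alpha))%C.
Proof. intros H. rewrite <- Re_RtoC_mult, Cmult_assoc, <- polar_form; auto. Qed.

Lemma tangent_sector_blowup (alpha K r : R) (z : C) : z <> RtoC 0 ->
  (tangent_sector alpha K r z <->
   K * Cmod z < Re (z / RtoC (Cmod z) * cis (- alpha))%C /\ Cmod z < r).
Proof.
  intros Hz. assert (Hp : 0 < Cmod z) by (apply Cmod_gt_0; auto).
  unfold tangent_sector. rewrite Re_unit by auto.
  split; intros [H1 H2]; split; auto.
  - apply (Rmult_lt_reg_l (Cmod z)); auto.
    replace (Cmod z ^ 2) with (Cmod z * Cmod z) in H1 by ring. lra.
  - apply (Rmult_lt_compat_l (Cmod z)) in H1; auto.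
    replace (Cmod z ^ 2) with (Cmod z * Cmod z) by ring. lra.
Qed.

Lemma Sect_pi_tangent (alpha r : R) : Sect_pi alpha r = tangent_sector alpha 0 r.
Proof.
  apply functional_extensionality. intros z. apply propositional_extensionality.
  split.
  - intros [Hz [HA Hr]]. apply tangent_sector_blowup; auto. split; auto.
    rewrite Rmult_0_l. apply Arc_pi_iff; auto. apply Cmod_unit; auto.
  - intros H. assert (Hz := tangent_sector_neq_0 _ _ _ _ H).
    apply tangent_sector_blowup in H; auto. destruct H as [H1 H2]. rewrite Rmult_0_l in H1.
    split; auto. split; auto. apply Arc_pi_iff; auto. apply Cmod_unit; auto.
Qed.

Lemma tangent_sector_sectorial (alpha K r : R) : 0 <= K -> 0 < r ->
  sectorial_neighbourhood (Arc_pi alpha) (tangent_sector alpha K r).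
Proof.
  intros HK Hr. split; [|split; [|split]].
  - apply Cmod_open. intros z Hz. apply tangent_sector_open; auto.
  - apply convex_simply_connected.
    + set (s := Rmin (/ (2 * (K + 1))) (r / 2)).
      assert (H1 : 0 < / (2 * (K + 1))) by (apply Rinv_0_lt_compat; lra).
      assert (Hs : 0 < s) by (unfold s; apply Rmin_case; lra).
      assert (Hs1 : s <= / (2 * (K + 1))) by apply Rmin_l.
      assert (Hs2 : s <= r / 2) by apply Rmin_r.
      exists (RtoC s * cis alpha)%C. unfold tangent_sector.
      rewrite Cmod_scal_cis, <- Cmult_assoc, cis_opp_r, Re_RtoC_mult by lra.
      change (Re (RtoC 1)) with 1. split; [|lra].
      assert (Y : s * (2 * (K + 1)) <= 1).
      { apply Rle_trans with (/ (2 * (K + 1)) * (2 * (K + 1))). apply Rmult_le_compat_r; lra.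
        rewrite Rinv_l; lra. }
      assert (s * K < 1) by nra. simpl. nra.
    + intros x y t Ht Hx Hy. apply tangent_sector_convex; auto.
  - apply tangent_sector_neq_0.
  - exists (blowup_sector alpha K r). split; [|split; [|split]].
    + apply blowup_sector_simply_connected; auto.
    + exists (fun p => 0 < Re (snd p * cis (- alpha))%C - K * Cmod (fst p) /\ Cmod (fst p) < r).
      split.
      * apply (open_and (T := prod_UniformSpace C_UniformSpace C_UniformSpace)).
        -- apply (open_comp (T := prod_UniformSpace C_UniformSpace C_UniformSpace) (U := R_UniformSpace)
             (fun p : C * C => Re (snd p * cis (- alpha))%C - K * Cmod (fst p)) (fun x => 0 < x)).
           2: apply open_gt.
           intros p _. unfold Re, Cmult; simpl. unfold Cmod.
           assert (F1 : continuous (U := R_UniformSpace) (fun p : prod_UniformSpace C_UniformSpace C_UniformSpace => fst (fst p)) p).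
           { apply (continuous_comp fst (fst : C -> R)); apply continuous_proj1. }
           assert (F2 : continuous (U := R_UniformSpace) (fun p : prod_UniformSpace C_UniformSpace C_UniformSpace => snd (fst p)) p).
           { apply (continuous_comp fst (snd : C -> R)). apply continuous_proj1. apply continuous_proj2. }
           assert (F3 : continuous (U := R_UniformSpace) (fun p : prod_UniformSpace C_UniformSpace C_UniformSpace => fst (snd p)) p).
           { apply (continuous_comp snd (fst : C -> R)). apply continuous_proj2. apply continuous_proj1. }
           assert (F4 : continuous (U := R_UniformSpace) (fun p : prod_UniformSpace C_UniformSpace C_UniformSpace => snd (snd p)) p).
           { apply (continuous_comp snd (snd : C -> R)); apply continuous_proj2. }
           lazymatch goal with |- filterlim ?f (locally ?p) _ =>
             change (@continuous (prod_UniformSpace C_UniformSpace C_UniformSpace) R_UniformSpace f p) end.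
           simpl. cont_R.
        -- apply (open_comp (T := prod_UniformSpace C_UniformSpace C_UniformSpace) (U := R_UniformSpace)
             (fun p : C * C => Cmod (fst p)) (fun x => x < r)).
           2: apply open_lt.
           intros p _. unfold Cmod.
           assert (F1 : continuous (U := R_UniformSpace) (fun p : prod_UniformSpace C_UniformSpace C_UniformSpace => fst (fst p)) p).
           { apply (continuous_comp fst (fst : C -> R)); apply continuous_proj1. }
           assert (F2 : continuous (U := R_UniformSpace) (fun p : prod_UniformSpace C_UniformSpace C_UniformSpace => snd (fst p)) p).
           { apply (continuous_comp fst (snd : C -> R)). apply continuous_proj1. apply continuous_proj2. }
           lazymatch goal with |- filterlim ?f (locally ?p) _ =>
             change (@continuous (prod_UniformSpace C_UniformSpace C_UniformSpace) R_UniformSpace f p) end.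
           simpl. cont_R.
      * intros p. unfold blowup_sector. split; intros [H1 [H2 H3]]; split; auto; split; auto; lra.
    + intros z Hz. rewrite tangent_sector_blowup by auto. unfold blowup_sector, blowup. cbn [fst snd]. split.
      * intros [_ H]. exact H.
      * intros H. split; auto. split. apply Cmod_unit; auto. apply polar_form; auto.
    + intros u Hu. rewrite Arc_pi_iff by auto. unfold blowup_sector, blowup. cbn [fst snd].
      rewrite Cmod_0, Rmult_0_r. split.
      * intros [_ [H _]]. auto.
      * intros H. repeat split; auto. ring.
Qed.

(** * Borel resummation on sectors *)

Lemma holomorphic_on_hol (S : C -> Prop) (f : C -> C) :
  holomorphic_on S f <-> forall z, S z -> hol f z.
Proof. split; intros H z Hz; apply ex_derive_cdiff; apply H; auto. Qed.

Lemma factorial_asymptotics_unique (alpha K r : R) (f g : C -> C) (a : nat -> C) :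
  0 <= K -> 0 < r ->
  (forall h, tangent_sector alpha K r h -> hol f h) -> (forall h, tangent_sector alpha K r h -> hol g h) ->
  factorially_asymptotic (tangent_sector alpha K r) f a ->
  factorially_asymptotic (tangent_sector alpha K r) g a ->
  forall h, tangent_sector alpha K r h -> g h = f h.
Proof.
  intros HK Hr Hf Hg [A1 [M1 [d1 [HA1 [HM1 [Hd1 H1]]]]]] [A2 [M2 [d2 [HA2 [HM2 [Hd2 H2]]]]]] h Hh.
  assert (E : (g h - f h)%C = RtoC 0).
  { apply (watson_unique alpha K r (A1 + A2) (Rmax M1 M2) (Rmin d1 d2) (fun h => g h - f h)%C); auto.
    - lra.
    - eapply Rlt_le_trans; [exact HM1|apply Rmax_l].
    - apply Rmin_case; auto.
    - intros z Hz. apply hol_minus; auto.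
    - intros n z Hz Hzd.
      destruct (Rmin_Rgt_l _ _ _ Hzd) as [Z1 Z2].
      specialize (H1 n z Hz Z1). specialize (H2 n z Hz Z2).
      replace (g z - f z)%C with ((g z - partial_sum a z n) - (f z - partial_sum a z n))%C by ring.
      eapply Rle_trans. apply Cmod_sub_le.
      assert (P1 : M1 ^ n <= Rmax M1 M2 ^ n) by (apply pow_incr; split; [lra|apply Rmax_l]).
      assert (P2 : M2 ^ n <= Rmax M1 M2 ^ n) by (apply pow_incr; split; [lra|apply Rmax_r]).
      assert (W : 0 <= INR (fact n) * Cmod z ^ n).
      { apply Rmult_le_pos. apply pos_INR. apply pow_le, Cmod_ge_0. }
      set (X := INR (fact n) * Cmod z ^ n) in *. set (P := Rmax M1 M2 ^ n) in *.
      replace (A1 * M1 ^ n * INR (fact n) * Cmod z ^ n) with (A1 * (M1 ^ n * X)) in H1 by (unfold X; ring).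
      replace (A2 * M2 ^ n * INR (fact n) * Cmod z ^ n) with (A2 * (M2 ^ n * X)) in H2 by (unfold X; ring).
      replace ((A1 + A2) * P * INR (fact n) * Cmod z ^ n) with (A1 * (P * X) + A2 * (P * X)) by (unfold X; ring).
      assert (A1 * (M1 ^ n * X) <= A1 * (P * X)).
      { apply Rmult_le_compat_l; [lra|]. apply Rmult_le_compat_r; auto. }
      assert (A2 * (M2 ^ n * X) <= A2 * (P * X)).
      { apply Rmult_le_compat_l; [lra|]. apply Rmult_le_compat_r; auto. }
      lra. }
  replace (g h) with (g h - f h + f h)%C by ring. rewrite E. ring.
Qed.

Lemma Re_cis_div (theta : R) (h : C) : h <> RtoC 0 ->
  Re (cis theta / h)%C * Cmod h ^ 2 = Re (h * cis (- theta))%C.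
Proof.
  intros Hh. assert (Hp : 0 < Cmod h ^ 2) by (apply pow_lt; apply Cmod_gt_0; auto).
  rewrite Cmod2_alt in *. destruct h as [x y]. unfold Re, Im, cis, Cdiv, Cinv, Cmult in *; simpl in *.
  rewrite cos_neg, sin_neg. field. lra.
Qed.

Lemma tangent_sector_Re (alpha K r : R) (h : C) :
  tangent_sector alpha K r h -> K < Re (cis alpha / h)%C.
Proof.
  intros H. assert (Hh := tangent_sector_neq_0 _ _ _ _ H). destruct H as [H _].
  rewrite <- Re_cis_div in H by auto.
  apply (Rmult_lt_reg_r (Cmod h ^ 2)); auto. apply pow_lt. apply Cmod_gt_0; auto.
Qed.

(** Tilting towards the side on which [h] lies gives Re v cos eta + |Im v| sin eta. For eta <= PI /
    4 the cosine is at least the sine, so this is at least sin eta (Re v + |Im v|) >= sin eta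
    |h|. *)
Lemma tilted_direction (alpha eta : R) (h : C) : 0 < eta <= PI / 4 -> 0 < Re (h * cis (- alpha))%C ->
  sin eta / Cmod h <= Re (cis (alpha + eta) / h)%C \/ sin eta / Cmod h <= Re (cis (alpha - eta) / h)%C.
Proof.
  intros Heta H.
  assert (Hpi := PI_RGT_0).
  assert (Hh : h <> RtoC 0).
  { intros ->. replace (RtoC 0 * cis (- alpha))%C with (RtoC 0) in H by ring. change (0 < 0) in H. lra. }
  assert (Hp : 0 < Cmod h) by (apply Cmod_gt_0; auto).
  set (v := (h * cis (- alpha))%C) in *.
  assert (Hs : 0 < sin eta) by (apply sin_gt_0; lra).
  assert (Hc : sin eta <= cos eta).
  { apply Rle_trans with (sin (PI / 4)). { apply sin_incr_1; lra. }
    rewrite sin_cos_PI4. apply cos_decr_1; lra. }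
  assert (Hv : Re v ^ 2 + Im v ^ 2 = Cmod h ^ 2).
  { rewrite <- Cmod2_alt. unfold v. rewrite Cmod_mult, Cmod_cis, Rmult_1_r. auto. }
  assert (Hsum : Cmod h <= Re v + Rabs (Im v)).
  { assert (X := Cmod_le_Re_Im v). unfold v at 1 in X. rewrite Cmod_mult, Cmod_cis, Rmult_1_r in X.
    rewrite (Rabs_pos_eq (Re v)) in X by lra. auto. }
  assert (Key : forall th, Re (h * cis (- th))%C >= sin eta * Cmod h -> sin eta / Cmod h <= Re (cis th / h)%C).
  { intros th X. rewrite <- Re_cis_div in X by auto.
    apply (Rmult_le_reg_r (Cmod h ^ 2)). { apply pow_lt; auto. }
    replace (sin eta / Cmod h * Cmod h ^ 2) with (sin eta * Cmod h) by (field; lra). lra. }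
  assert (E1 : Re (h * cis (- (alpha + eta)))%C = Re v * cos eta + Im v * sin eta).
  { replace (- (alpha + eta)) with (- alpha + - eta) by ring. rewrite cis_add, Cmult_assoc. fold v.
    unfold cis, Re, Im, Cmult; simpl. rewrite (cos_neg eta), (sin_neg eta). ring. }
  assert (E2 : Re (h * cis (- (alpha - eta)))%C = Re v * cos eta - Im v * sin eta).
  { replace (- (alpha - eta)) with (- alpha + eta) by ring. rewrite cis_add, Cmult_assoc. fold v.
    unfold cis, Re, Im, Cmult; simpl. ring. }
  destruct (Rle_dec 0 (Im v)) as [Hi|Hi].
  - left. apply Key. rewrite E1. rewrite (Rabs_pos_eq (Im v)) in Hsum by auto.
    assert (Re v * sin eta <= Re v * cos eta) by (apply Rmult_le_compat_l; lra). nra.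
  - right. apply Key. rewrite E2. rewrite (Rabs_left (Im v)) in Hsum by lra.
    assert (Re v * sin eta <= Re v * cos eta) by (apply Rmult_le_compat_l; lra). nra.
Qed.

(** The condition on [r] makes [K] at most half of sin eta / |h|. So for every [h] of the straight
    sector one tilted Laplace integral converges with a margin of order 1 / |h|, right up to the
    edges. *)
Lemma borel_resummation (alpha eta A K r0 B L r : R) (a : nat -> C) (omega : C -> C) :
  0 < eta <= PI / 4 -> 0 < K -> 0 <= A -> 0 < r -> 2 * K * r <= sin eta ->
  sectorial alpha eta A K omega -> borel_germ a r0 B L omega -> Borel_continuation a alpha omega ->
  exists f : C -> C,
    (forall h, tangent_sector alpha 0 r h -> hol f h) /\
    factorially_asymptotic (tangent_sector alpha 0 r) f a /\
    forall h, tangent_sector alpha 0 r h -> K < Re (cis alpha / h)%C -> is_Borel_sum a alpha h (f h).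
Proof.
  intros Heta HK HA Hr HKr Ho Hg Hbc.
  assert (Hpi := PI_RGT_0).
  assert (Hs : 0 < sin eta) by (apply sin_gt_0; lra).
  assert (Hp : Rabs (alpha + eta - alpha) <= eta) by (apply Rabs_le; lra).
  assert (Hm : Rabs (alpha - eta - alpha) <= eta) by (apply Rabs_le; lra).
  assert (H0 : Rabs (alpha - alpha) <= eta) by (apply Rabs_le; lra).
  (* The choice matters only for the definition: wherever several directions converge, [Hf] shows
     that they give the same value. *)
  set (dir := fun h => if Rlt_dec K (Re (cis (alpha + eta) / h)%C) then alpha + eta else alpha - eta).
  set (f := fun h => (a O + Lap omega (dir h) h)%C).
  (* The direction [dir h] may converge with hardly any margin, so the estimates use this direction
     instead, which need not be the one chosen by [dir]. *)
  assert (Htilt : forall h, tangent_sector alpha 0 r h -> exists th, Rabs (th - alpha) <= eta /\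
     K < Re (cis th / h)%C /\ sin eta / (2 * Cmod h) <= Re (cis th / h)%C - K).
  { intros h Hh. assert (Hh0 := tangent_sector_neq_0 _ _ _ _ Hh). destruct Hh as [H1 H2].
    assert (Hhp : 0 < Cmod h) by (apply Cmod_gt_0; auto).
    assert (HKh : K <= sin eta / (2 * Cmod h)). { apply Rle_div_r; nra. }
    assert (Ehalf : sin eta / Cmod h = sin eta / (2 * Cmod h) + sin eta / (2 * Cmod h)) by (field; lra).
    assert (0 < sin eta / (2 * Cmod h)) by (apply Rdiv_lt_0_compat; lra).
    rewrite Rmult_0_l in H1.
    destruct (tilted_direction alpha eta h Heta H1) as [T|T].
    - exists (alpha + eta). repeat split; auto; lra.
    - exists (alpha - eta). repeat split; auto; lra. }
  assert (Hdir : forall h, tangent_sector alpha 0 r h -> Rabs (dir h - alpha) <= eta /\ K < Re (cis (dir h) / h)%C).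
  { intros h Hh. unfold dir. destruct (Rlt_dec K (Re (cis (alpha + eta) / h)%C)) as [X|X]; auto.
    split; auto.
    assert (Hh0 := tangent_sector_neq_0 _ _ _ _ Hh). destruct Hh as [H1 H2].
    assert (Hhp : 0 < Cmod h) by (apply Cmod_gt_0; auto).
    rewrite Rmult_0_l in H1.
    assert (HKh : K < sin eta / Cmod h). { apply (Rmult_lt_reg_r (Cmod h)); auto.
      replace (sin eta / Cmod h * Cmod h) with (sin eta) by (field; lra). nra. }
    destruct (tilted_direction alpha eta h Heta H1) as [T|T]; lra. }
  assert (Hf : forall h th, tangent_sector alpha 0 r h -> Rabs (th - alpha) <= eta -> K < Re (cis th / h)%C ->
    f h = (a O + Lap omega th h)%C).
  { intros h th Hh Hth HKth. destruct (Hdir h Hh) as [D1 D2]. unfold f. f_equal.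
    apply (Lap_rotate alpha eta A K); auto; lra. }
  exists f. split; [|split].
  - intros h Hh. destruct (Hdir h Hh) as [D1 D2].
    destruct (tangent_sector_open alpha 0 r h (Rle_refl 0) Hh) as [d1 [Hd1 Hin]].
    assert (Hh0 := tangent_sector_neq_0 _ _ _ _ Hh).
    set (e := (Re (cis (dir h) / h)%C - K) / 2). assert (He : 0 < e) by (unfold e; lra).
    destruct (Re_cis_div_cont (dir h) h e Hh0 He) as [d2 [Hd2 Hin2]].
    apply (hol_ext_loc (fun k => a O + Lap omega (dir h) k)%C f h (Rmin d1 d2)).
    + apply Rmin_case; auto.
    + intros k Hk. symmetry.
      destruct (Rmin_Rgt_l _ _ _ Hk) as [K1 K2].
      assert (Ek : (h + k - h)%C = k) by ring.
      apply Hf; auto.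
      * apply Hin. rewrite Ek. auto.
      * destruct (Hin2 (h + k)%C) as [_ X]. { rewrite Ek. auto. } unfold e in X. lra.
    + apply hol_plus. apply hol_const. apply (Lap_hol alpha eta A K); auto; lra.
  - assert (HLp : 0 < L). { destruct Hg as [G1 [_ [G2 _]]]. nra. }
    assert (HB : 0 <= B) by (destruct Hg as [_ [G _]]; auto).
    (* The summand 1 gives [M >= 1], so that the power [N] of the Laplace estimate can be raised to
       [S N]. *)
    set (M := 4 * L / sin eta + 1).
    assert (Hq : 0 < 4 * L / sin eta) by (apply Rdiv_lt_0_compat; lra).
    set (C1 := (A + B) * (2 / sin eta)).
    assert (H2s : 0 < 2 / sin eta) by (apply Rdiv_lt_0_compat; lra).
    assert (HC1 : 0 <= C1) by (unfold C1; apply Rmult_le_pos; lra).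
    assert (Hrem : forall N h, tangent_sector alpha 0 r h ->
      Cmod (f h - tpoly a h (S N))%C <= C1 * M ^ S N * INR (fact (S N)) * Cmod h ^ S N).
    { intros N h Hh. destruct (Htilt h Hh) as [th [T1 [T2 T3]]].
      assert (Hh0 := tangent_sector_neq_0 _ _ _ _ Hh).
      assert (Hhp : 0 < Cmod h) by (apply Cmod_gt_0; auto).
      rewrite (Hf h th) by auto.
      eapply Rle_trans. { apply (Lap_asymptotic alpha eta A K r0 B L a omega th h N); auto; lra. }
      set (g := Re (cis th / h)%C - K) in *.
      assert (Hg0 : 0 < sin eta / (2 * Cmod h)) by (apply Rdiv_lt_0_compat; lra).
      assert (P1 : / g ^ (N + 1) <= (2 * Cmod h / sin eta) ^ (N + 1)).
      { replace (2 * Cmod h / sin eta) with (/ (sin eta / (2 * Cmod h))) by (field; lra).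
        rewrite pow_inv. apply Rinv_le_contravar. apply pow_lt; auto. apply pow_incr. lra. }
      assert (P2 : INR (fact N) <= INR (fact (S N))). { apply le_INR. apply fact_le. lia. }
      assert (P3 : (4 * L / sin eta) ^ N <= M ^ S N).
      { apply Rle_trans with (M ^ N). apply pow_incr; unfold M; lra. apply Rle_pow. unfold M; lra. lia. }
      assert (F0 := pos_INR (fact N)).
      apply Rle_trans with ((A + B) * (2 * L) ^ N * (INR (fact N) * (2 * Cmod h / sin eta) ^ (N + 1))).
      - apply Rmult_le_compat_l. apply Rmult_le_pos. lra. apply pow_le. lra.
        apply Rmult_le_compat_l; auto.
      - replace ((A + B) * (2 * L) ^ N * (INR (fact N) * (2 * Cmod h / sin eta) ^ (N + 1))) with
          (C1 * (4 * L / sin eta) ^ N * INR (fact N) * Cmod h ^ S N).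
        + apply Rmult_le_compat_r. apply pow_le; lra.
          apply Rmult_le_compat; auto. apply Rmult_le_pos; auto. apply pow_le; lra.
          apply Rmult_le_compat_l; auto.
        + unfold C1. rewrite pow_add, pow_1.
          replace (4 * L / sin eta) with (2 * L * (2 / sin eta)) by (field; lra).
          replace (2 * Cmod h / sin eta) with (2 / sin eta * Cmod h) by (field; lra).
          rewrite !Rpow_mult_distr. simpl. ring. }
    assert (HM : 1 <= M) by (unfold M; lra).
    (* The Laplace estimate starts at order 1; order 0, a plain bound for [f], follows from it with
       |h| < r. *)
    set (C0 := Cmod (a O) + C1 * M * r).
    assert (HC0 : 0 <= C0). { unfold C0. generalize (Cmod_ge_0 (a O)). intros. assert (0 <= C1 * M * r) by (apply Rmult_le_pos; [apply Rmult_le_pos|]; lra). lra. }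
    exists (C0 + C1 + 1), M, r. split; [lra|]. split; [lra|]. split; auto.
    intros n h Hh _. rewrite partial_sum_tpoly. destruct n as [|N].
    + specialize (Hrem O h Hh). destruct Hh as [_ Hhr].
      simpl in *. rewrite !Rmult_1_r in *.
      replace (f h - RtoC 0)%C with ((f h - (RtoC 0 + a O * RtoC 1)) + a O)%C by ring.
      eapply Rle_trans. apply Cmod_triangle.
      assert (C1 * M * Cmod h <= C1 * M * r). { apply Rmult_le_compat_l; [apply Rmult_le_pos|]; lra. }
      unfold C0. lra.
    + eapply Rle_trans. apply Hrem; auto.
      apply Rmult_le_compat_r. apply pow_le, Cmod_ge_0. apply Rmult_le_compat_r. apply pos_INR.
      apply Rmult_le_compat_r. apply pow_le; lra. lra.
  - intros h Hh HKh. exists omega, (Lap omega alpha h). split; auto. split.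
    + apply (Lap_is_Laplace alpha eta A K); auto; lra.
    + apply Hf; auto.
Qed.

(** One function on two domains: on the straight sector it is partly an analytic continuation, while
    on the smaller tangent region every value is an actual Laplace integral in the direction
    [alpha]. *)
Lemma resummed_of_borel_data (alpha eta A K r0 B L r : R) (a : nat -> C) (omega : C -> C) :
  0 < eta <= PI / 4 -> 0 < K -> 0 <= A -> 0 < r -> 2 * K * r <= sin eta ->
  sectorial alpha eta A K omega -> borel_germ a r0 B L omega -> Borel_continuation a alpha omega ->
  resummed_on_straight_sector a alpha r /\
  exists (S : C -> Prop) (f : C -> C),
    sectorial_neighbourhood (Arc_pi alpha) S /\
    (forall h : C, S h -> is_Borel_sum a alpha h (f h)) /\ unique_factorially_asymptotic S f a.
Proof.
  intros Heta HK HA Hr HKr Ho Hg Hbc.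
  destruct (borel_resummation alpha eta A K r0 B L r a omega Heta HK HA Hr HKr Ho Hg Hbc) as [f [F1 [F2 F3]]].
  assert (Hsub : forall h, tangent_sector alpha K r h -> tangent_sector alpha 0 r h).
  { intros h [H1 H2]. split; auto. assert (0 <= Cmod h ^ 2) by apply pow2_ge_0. nra. }
  split.
  - unfold resummed_on_straight_sector. rewrite Sect_pi_tangent. split.
    { apply tangent_sector_sectorial; lra. }
    exists f. split; [split|split; [|split]].
    + apply holomorphic_on_hol. auto.
    + exists K. auto.
    + apply holomorphic_on_hol. auto.
    + auto.
    + intros g Hg1 Hg2. apply (factorial_asymptotics_unique alpha 0 r f g a); auto; try lra.
      apply holomorphic_on_hol. auto.
  - exists (tangent_sector alpha K r), f.
    assert (F2' : factorially_asymptotic (tangent_sector alpha K r) f a).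
    { destruct F2 as [A1 [M1 [d1 [X1 [X2 [X3 X4]]]]]]. exists A1, M1, d1. repeat split; auto. }
    split; [|split].
    + apply tangent_sector_sectorial; lra.
    + intros h Hh. apply F3; auto. eapply tangent_sector_Re; eauto.
    + split; [|split]; auto.
      * apply holomorphic_on_hol. auto.
      * intros g Hg1 Hg2. apply (factorial_asymptotics_unique alpha K r f g a); auto; try lra.
        apply holomorphic_on_hol. auto.
Qed.

(** * The first Painleve equation *)

(** Both families of Stokes directions together are the zeros of one sine. *)
Lemma regular_direction_sin (theta0 alpha : R) :
  regular_direction theta0 alpha -> sin (alpha - stokes_plus theta0) <> 0.
Proof.
  intros H E. apply sin_eq_0_0 in E. destruct E as [k Hk].
  destruct (Z.Even_or_Odd k) as [[m Hm]|[m Hm]]; subst k; destruct (H m) as [H1 H2].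
  - apply H1. rewrite mult_IZR in Hk. lra.
  - apply H2. unfold stokes_minus. rewrite plus_IZR, mult_IZR in Hk. lra.
Qed.

Lemma cis_pow (t : R) (n : nat) : (cis t ^ n)%C = cis (INR n * t).
Proof.
  induction n as [|n IH].
  - simpl. rewrite Rmult_0_l. symmetry. apply cis_0.
  - rewrite Cpow_S, IH, <- cis_add. f_equal. rewrite S_INR. ring.
Qed.

(** The number |u|^(-5/2), which is the modulus of kappa. *)
Definition borel_scale (u : C) : R := sqrt (/ Cmod u ^ 5).

Lemma borel_scale_pos (u : C) : u <> RtoC 0 -> 0 < borel_scale u.
Proof.
  intros H. apply sqrt_lt_R0. apply Rinv_0_lt_compat. apply pow_lt. apply Cmod_gt_0; auto.
Qed.

(** By compatibility q_0 has argument (theta0 + PI) / 2, so q_0^(-5) has argument - 2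
    [stokes_plus theta0]. Multiplication by [kappa] therefore turns the Stokes directions into the
    real axis. *)
Lemma borel_scale_sqr (t : C) (u : C) (theta0 : R) : u <> RtoC 0 ->
  u = (RtoC (sqrt (Cmod (t / RtoC 6))) * cis ((theta0 + PI) / 2))%C ->
  let kappa := (RtoC (borel_scale u) * cis (- stokes_plus theta0))%C in (kappa * kappa = (/ u) ^ 5)%C.
Proof.
  intros Hu E kappa.
  assert (Hp : 0 < Cmod u) by (apply Cmod_gt_0; auto).
  assert (Em : u = (RtoC (Cmod u) * cis ((theta0 + PI) / 2))%C).
  { rewrite E at 2. rewrite Cmod_scal_cis by apply sqrt_pos. exact E. }
  assert (Ei : (/ u)%C = (RtoC (/ Cmod u) * cis (- ((theta0 + PI) / 2)))%C).
  { rewrite Em at 1. rewrite RtoC_inv by lra.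
    assert (Hc : (RtoC (Cmod u) * cis ((theta0 + PI) / 2) * (/ RtoC (Cmod u) * cis (- ((theta0 + PI) / 2))) = RtoC 1)%C).
    { transitivity ((RtoC (Cmod u) * / RtoC (Cmod u)) * (cis ((theta0 + PI) / 2) * cis (- ((theta0 + PI) / 2))))%C. ring.
      rewrite cis_opp_r, Cinv_r. ring. apply RtoC_neq; lra. }
    rewrite <- Em in Hc |- *.
    replace (/ RtoC (Cmod u) * cis (- ((theta0 + PI) / 2)))%C with
      (/ u * (u * (/ RtoC (Cmod u) * cis (- ((theta0 + PI) / 2)))))%C by (field; split; auto; apply RtoC_neq; lra).
    rewrite Hc. ring. }
  rewrite Ei, Cpow_mult_l, cis_pow, <- RtoC_pow, pow_inv.
  unfold kappa.
  replace (RtoC (borel_scale u) * cis (- stokes_plus theta0) * (RtoC (borel_scale u) * cis (- stokes_plus theta0)))%C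
    with (RtoC (borel_scale u * borel_scale u) * (cis (- stokes_plus theta0) * cis (- stokes_plus theta0)))%C
    by (rewrite RtoC_mult; ring).
  unfold borel_scale. rewrite sqrt_sqrt.
  - f_equal. rewrite <- cis_add. f_equal. unfold stokes_plus. simpl. field.
  - left. apply Rinv_0_lt_compat. apply pow_lt; auto.
Qed.

Lemma formal_term_scale (u kappa : C) (n : nat) : (kappa * kappa = (/ u) ^ 5)%C ->
  Nat.even n = true -> formal_term u n = (u * kappa ^ n)%C.
Proof.
  intros Hk Hn. unfold formal_term. rewrite Hn. apply Nat.even_spec in Hn. destruct Hn as [p ->].
  rewrite Nat.div2_double, !Cpow_mult_r. f_equal. rewrite <- Hk. f_equal. simpl. ring.
Qed.

(** The step from s / 2 to s / 4 leaves room for the strict inequality, the cosine being at most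
    1. *)
Lemma borel_domain_rotated (s phi x : R) : 0 < s <= 1 -> s / 2 <= Rabs (sin phi) -> 0 <= x ->
  borel_domain (s / 4) (polar x phi).
Proof.
  intros Hs Hphi Hx. destruct (Req_dec x 0) as [->|Hx0].
  - left. rewrite Cmod_polar; lra.
  - right. unfold polar.
    replace (Re (RtoC x * cis phi)) with (x * cos phi) by (unfold Re, Cmult, RtoC, cis; simpl; ring).
    replace (Im (RtoC x * cis phi)) with (x * sin phi) by (unfold Im, Cmult, RtoC, cis; simpl; ring).
    rewrite !Rabs_mult, (Rabs_pos_eq x) by auto.
    assert (Rabs (cos phi) <= 1) by (apply Rabs_le; generalize (COS_bound phi); lra).
    assert (0 <= Rabs (cos phi)) by apply Rabs_pos.
    replace (s / 4 * (x * Rabs (cos phi))) with (x * (s / 4 * Rabs (cos phi))) by ring.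
    apply Rmult_lt_compat_l; nra.
Qed.

Lemma polar_mult_scale (k x phi psi : R) :
  (RtoC k * cis phi * polar x psi)%C = polar (k * x) (psi + phi).
Proof. unfold polar. rewrite RtoC_mult, cis_add. ring. Qed.

Lemma tpoly_scale (b : nat -> C) (v kappa z : C) (N : nat) :
  tpoly (fun n => v * (b n * kappa ^ n))%C z N = (v * tpoly b (kappa * z) N)%C.
Proof.
  induction N as [|N IH]; simpl. ring. rewrite IH, Cpow_mult_l. ring.
Qed.

(** [eta] and [nu] are fixed before [t], because the normalised solution depends on the opening of
    the domain only. The time enters the exponential rate through [borel_scale] alone, which is what
    makes the radius grow. *)
Lemma painleve_borel_data (theta0 alpha : R) : regular_direction theta0 alpha ->
  exists eta nu : R, 0 < eta <= PI / 4 /\ 0 < nu /\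
  forall (t : C) (q : nat -> C -> C), formal_solution_near t q -> compatible_argument t q theta0 ->
    q O t <> RtoC 0 /\
    exists (omega : C -> C) (A r0 B L : R),
      0 <= A /\ sectorial alpha eta A (nu * borel_scale (q O t)) omega /\
      borel_germ (fun n => q n t) r0 B L omega /\
      forall beta, Rabs (beta - alpha) <= eta -> Borel_continuation (fun n => q n t) beta omega.
Proof.
  intros Hreg.
  set (sp := stokes_plus theta0).
  set (s := Rabs (sin (alpha - sp))).
  assert (Hs : 0 < s <= 1).
  { unfold s. split. apply Rabs_pos_lt. apply regular_direction_sin; auto.
    apply Rabs_le. generalize (SIN_bound (alpha - sp)). lra. }
  assert (Hpi := PI2_3_2).
  set (c := s / 4).
  destruct (borel_equation_solution c) as [w [A [nu [Hnu [HA [Hw Heq]]]]]]. { unfold c; lra. }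
  destruct (borel_coefficient_recursion c A nu w Hw HA Hnu Heq) as [aw [Haw1 [Haw2 Hrec]]].
  (* The sine is 1-Lipschitz, so within s / 2 of [alpha] its modulus stays above s / 2; and s <= 1
     keeps s / 2 below PI / 4. *)
  exists (s / 2), nu. split; [lra|]. split; auto.
  intros t q Hq [_ Hcomp].
  destruct (formal_solution_coefficients t q (series_of aw) (conj eq_refl Hrec) Hq) as [Hodd [Hu Hcoef]].
  split; auto.
  set (u := q O t) in *. set (k := borel_scale u). assert (Hk : 0 < k) by (apply borel_scale_pos; auto).
  set (kappa := (RtoC k * cis (- sp))%C).
  assert (Hkk : (kappa * kappa = (/ u) ^ 5)%C) by (apply (borel_scale_sqr t u theta0 Hu Hcomp)).
  assert (Hqn : forall n, q n t = (series_of aw n * (u * kappa ^ n))%C).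
  { intros n. rewrite Hcoef. destruct (Nat.even n) eqn:En.
    - rewrite (formal_term_scale u kappa n); auto.
    - rewrite Hodd by auto. ring. }
  assert (Hmk : Cmod kappa = k) by (apply Cmod_scal_cis; lra).
  (* [borel_coef] shifts the index by one, so the Borel transform carries one [kappa] more than the
     series. *)
  set (v := (u * kappa)%C).
  set (omega := fun xi => (v * w (kappa * xi))%C).
  set (Av := Cmod v * A). assert (Hv := Cmod_ge_0 v).
  assert (HAv : 0 <= Av) by (apply Rmult_le_pos; auto).
  set (M := Cmod v * (A * exp nu)).
  assert (HM : 0 <= M). { apply Rmult_le_pos; auto. apply Rmult_le_pos; auto. left; apply exp_pos. }
  set (Om := fun xi => borel_domain c (kappa * xi)%C).
  assert (Homol : forall xi, Om xi -> hol omega xi /\ Cmod (omega xi) <= Av * exp (nu * k * Cmod xi)).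
  { intros xi Hxi. destruct Hw as [W1 W2]. unfold omega. split.
    - apply hol_mult. apply hol_const. apply (hol_comp w (fun xi => kappa * xi)%C).
      apply hol_mult. apply hol_const. apply hol_id. apply W1. exact Hxi.
    - rewrite Cmod_mult. specialize (W2 _ Hxi). rewrite Cmod_mult, Hmk in W2.
      unfold Av. rewrite !Rmult_assoc. apply Rmult_le_compat_l; auto. }
  assert (Hray : forall x beta, 0 <= x -> Rabs (beta - alpha) <= s / 2 -> Om (polar x beta)).
  { intros x beta Hx Hb. unfold Om, kappa. rewrite polar_mult_scale.
    apply borel_domain_rotated; auto; [|nra].
    assert (Hsin : Rabs (sin (alpha - sp) - sin (beta - sp)) <= 1 * Rabs (alpha - sp - (beta - sp))).
    { apply (bounded_variation sin cos). intros y _. split.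
      apply is_derive_sin. apply Rabs_le. generalize (COS_bound y). lra. }
    replace (alpha - sp - (beta - sp)) with (- (beta - alpha)) in Hsin by ring. rewrite Rabs_Ropp in Hsin.
    replace (beta + - sp) with (beta - sp) by ring.
    assert (X := Rabs_triang_inv (sin (alpha - sp)) (sin (alpha - sp) - sin (beta - sp))).
    replace (sin (alpha - sp) - (sin (alpha - sp) - sin (beta - sp))) with (sin (beta - sp)) in X by ring.
    fold s in X. lra. }
  assert (Hbc : forall n, borel_coef (fun n => q n t) n = (v * (aw n * kappa ^ n))%C).
  { intros n. unfold borel_coef. rewrite Hqn. cbn [series_of]. unfold v. rewrite Cpow_S.
    field. apply RtoC_neq. apply INR_fact_neq_0. }
  assert (Htp : forall z N, tpoly (borel_coef (fun n => q n t)) z N = (v * tpoly aw (kappa * z) N)%C).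
  { intros z N. rewrite <- tpoly_scale. apply tpoly_ext. intros; apply Hbc. }
  assert (Hgerm : forall N z, Cmod z < / k ->
    Cmod (omega z - tpoly (borel_coef (fun n => q n t)) z N)%C <= M * (8 * k * Cmod z) ^ N).
  { intros N z Hz. rewrite Htp. unfold omega.
    replace (v * w (kappa * z) - v * tpoly aw (kappa * z) N)%C with (v * (w (kappa * z) - tpoly aw (kappa * z) N))%C by ring.
    rewrite Cmod_mult. unfold M. rewrite Rmult_assoc. apply Rmult_le_compat_l; auto.
    specialize (Haw2 N (kappa * z)%C). rewrite Cmod_mult, Hmk in Haw2. rewrite (Rmult_assoc 8 k). apply Haw2.
    apply (Rmult_lt_compat_l k) in Hz; auto. rewrite Rinv_r in Hz; lra. }
  exists omega, Av, (/ k), M, (8 * k). split; auto. split; [|split].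
  - intros x beta Hx Hb. destruct (Homol (polar x beta) (Hray x beta Hx Hb)) as [X Y].
    rewrite Cmod_polar in Y by auto. auto.
  - split; [apply Rinv_0_lt_compat; auto|]. split; auto. split.
    { rewrite Rmult_assoc, Rinv_r; lra. }
    split; auto.
    intros n. rewrite Hbc, !Cmod_mult, Cmod_pow, Hmk. unfold M.
    rewrite Rpow_mult_distr, Rmult_assoc. apply Rmult_le_compat_l; auto.
    rewrite <- Rmult_assoc. apply Rmult_le_compat_r; auto. apply pow_le; lra.
  - intros beta Hb. exists Om. split; [|split; [|split; [|split]]].
    + apply Cmod_open. intros z Hz. destruct (borel_domain_open c (kappa * z)%C) as [r [Hr Hin]].
      { unfold c; lra. } { exact Hz. }
      exists (r / k). split. { apply Rdiv_lt_0_compat; lra. }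
      intros y Hy. apply Hin. replace (kappa * y - kappa * z)%C with (kappa * (y - z))%C by ring.
      rewrite Cmod_mult, Hmk. apply (Rmult_lt_compat_l k) in Hy; auto.
      replace (k * (r / k)) with r in Hy by (field; lra). auto.
    + intros rho Hrho. apply (Hray rho beta); auto.
    + apply holomorphic_on_hol. intros z Hz. apply Homol; auto.
    (* On this disc the ratio 8 k |xi| of the Taylor remainders is below 1 / 2, so the series
       converges to [omega]. *)
    + assert (Hr : 0 < / (16 * k)) by (apply Rinv_0_lt_compat; lra).
      assert (HO : open (T := C_UniformSpace) (fun xi => Cmod xi < / (16 * k))).
      { apply Cmod_open. intros z Hz. exists (/ (16 * k) - Cmod z). split. lra.
        intros y Hy. replace y with (y - z + z)%C by ring. eapply Rle_lt_trans. apply Cmod_triangle. lra. }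
      apply (filter_imp (fun xi => Cmod xi < / (16 * k))).
      * intros xi Hxi.
        assert (Hxi' : 16 * k * Cmod xi < 1).
        { apply (Rmult_lt_compat_l (16 * k)) in Hxi; [|lra]. rewrite Rinv_r in Hxi; lra. }
        assert (Hx0 := Cmod_ge_0 xi).
        apply (tpoly_is_pseries _ xi (omega xi) M (8 * k * Cmod xi)).
        -- split; nra.
        -- intros N. apply Hgerm. apply (Rmult_lt_reg_l k); auto. rewrite Rinv_r; nra.
      * apply HO. rewrite Cmod_0. auto.
    + exists Av, (nu * k). intros xi Hxi. apply Homol; auto.
Qed.

Theorem proposition2p9 :
  forall (t0 : C) (q : nat -> C -> C) (theta0 : R),
    t0 <> RtoC 0 ->
    formal_solution_near t0 q ->
    compatible_argument t0 q theta0 ->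
    forall alpha : R, regular_direction theta0 alpha ->
      stably_Borel_summable (fun n => q n t0) alpha /\
      (exists (S : C -> Prop) (f : C -> C),
         sectorial_neighbourhood (Arc_pi alpha) S /\
         (forall h : C, S h -> is_Borel_sum (fun n => q n t0) alpha h (f h)) /\
         unique_factorially_asymptotic S f (fun n => q n t0)) /\
      (exists r : R, 0 < r /\
         resummed_on_straight_sector (fun n => q n t0) alpha r) /\
      (forall r : R, 0 < r ->
         exists T : R, 0 < T /\
           forall (t1 : C) (q1 : nat -> C -> C),
             T < Cmod t1 ->
             formal_solution_near t1 q1 ->
             compatible_argument t1 q1 theta0 ->
             resummed_on_straight_sector (fun n => q1 n t1) alpha r).
Proof.
  intros t0 q theta0 _ Hq Hcomp alpha Hreg.
  destruct (painleve_borel_data theta0 alpha Hreg) as [eta [nu [Heta [Hnu Hdata]]]].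
  assert (Hpi := PI_RGT_0).
  assert (Hs : 0 < sin eta) by (apply sin_gt_0; lra).
  assert (Hres : forall (t : C) (p : nat -> C -> C) (r : R), 0 < r ->
    formal_solution_near t p -> compatible_argument t p theta0 ->
    2 * (nu * borel_scale (p O t)) * r <= sin eta ->
    resummed_on_straight_sector (fun n => p n t) alpha r /\
    exists (S : C -> Prop) (f : C -> C),
      sectorial_neighbourhood (Arc_pi alpha) S /\
      (forall h : C, S h -> is_Borel_sum (fun n => p n t) alpha h (f h)) /\
      unique_factorially_asymptotic S f (fun n => p n t)).
  { intros t p r Hr Hp Hc Hle.
    destruct (Hdata t p Hp Hc) as [Hu [omega [A [r0 [B [L [HA [Ho [Hg Hb]]]]]]]]].
    apply (resummed_of_borel_data alpha eta A (nu * borel_scale (p O t)) r0 B L r _ omega); auto.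
    - apply Rmult_lt_0_compat; auto. apply borel_scale_pos; auto.
    - apply Hb. rewrite Rminus_diag, Rabs_R0. lra. }
  destruct (Hdata t0 q Hq Hcomp) as [Hu [omega [A [r0 [B [L [HA [Ho [Hg Hb]]]]]]]]].
  assert (Hk := borel_scale_pos _ Hu). set (k := borel_scale (q O t0)) in *.
  (* The largest radius that the condition 2 K r <= sin eta allows, with K = nu k. *)
  set (r := sin eta / (2 * (nu * k))).
  assert (Hnk : 0 < nu * k) by (apply Rmult_lt_0_compat; auto).
  assert (Hr : 0 < r) by (unfold r; apply Rdiv_lt_0_compat; lra).
  destruct (Hres t0 q r Hr Hq Hcomp) as [R1 R2].
  { fold k. unfold r. right. field. lra. }
  split; [|split; [|split]].
  - exists eta. split; [lra|]. intros beta Hbeta. exists omega. apply Hb. lra.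
  - exact R2.
  - exists r. auto.
  - intros r' Hr'.
    set (e := sin eta / (2 * nu * r')).
    assert (He : 0 < e). { unfold e. apply Rdiv_lt_0_compat; auto. apply Rmult_lt_0_compat; lra. }
    assert (He2 : 0 < 6 / e ^ 2). { apply Rdiv_lt_0_compat. lra. apply pow_lt; auto. }
    (* Since |q_0|^2 = |t1| / 6, the summand 6 gives |q_0| >= 1 and hence |q_0|^-5 <= |q_0|^-2 = 6 /
       |t1|; the other summand makes this at most e^2. *)
    exists (6 + 6 / e ^ 2). split; [lra|].
    intros t1 q1 Ht1 Hq1 Hc1. apply Hres; auto.
    assert (Hscale : borel_scale (q1 O t1) <= e).
    { destruct Hc1 as [_ Hc1].
      assert (Em : Cmod (q1 O t1) = sqrt (Cmod t1 / 6)).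
      { rewrite Hc1, Cmod_scal_cis by apply sqrt_pos. f_equal.
        rewrite Cmod_div, Cmod_RtoC_pos by (try apply RtoC_neq; lra). reflexivity. }
      set (m := Cmod (q1 O t1)) in *.
      assert (Em2 : m ^ 2 = Cmod t1 / 6).
      { rewrite Em. simpl. rewrite Rmult_1_r. apply sqrt_sqrt. lra. }
      assert (Hm0 : 0 <= m) by apply Cmod_ge_0.
      assert (Hm1 : 1 <= m). { simpl in Em2. nra. }
      unfold borel_scale. fold m. rewrite <- (sqrt_square e) by lra. apply sqrt_le_1_alt.
      assert (H5 : m ^ 2 <= m ^ 5) by (apply Rle_pow; [lra|lia]).
      apply Rle_trans with (/ m ^ 2). { apply Rinv_le_contravar; auto. apply pow_lt; lra. }
      rewrite Em2. replace (e * e) with (/ (/ e ^ 2)) by (field; lra).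
      apply Rinv_le_contravar. { apply Rinv_0_lt_compat. apply pow_lt; auto. }
      replace (6 / e ^ 2) with (6 * / e ^ 2) in * by (unfold Rdiv; ring). lra. }
    apply Rle_trans with (2 * nu * r' * e).
    + replace (2 * (nu * borel_scale (q1 O t1)) * r') with (2 * nu * r' * borel_scale (q1 O t1)) by ring.
      apply Rmult_le_compat_l; auto. left. apply Rmult_lt_0_compat; lra.
    + right. unfold e. field. lra.
Qed.
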